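(* Let $I\subset\mathbb{C}[z,w]$ be a distinguished ideal, and let $\alpha\geq-1$ be such that $[I]_\alpha^\perp$ is essentially normal. Then the short exact sequence $$0\to\mathcal{K}\hookrightarrow C^*([I]_\alpha^\perp)\to C(Z(I)\cap\partial\mathbb{D}^2)\to0$$ is not splitting.
   Context: $\mathbb{D}$ is the open unit disc, $\mathbb{T}$ the unit circle, and $\partial\mathbb{D}^2$ the topological boundary of the bidisc $\mathbb{D}^2$ in $\mathbb{C}^2$. For an ideal $I\subset\mathbb{C}[z,w]$, $Z(I)\subset\mathbb{C}^2$ is its common zero set. The ideal $I$ is distinguished if $V=Z(I)\cap\mathbb{D}^2$ is a distinguished variety, i.e. $\partial V\subset\mathbb{T}^2$, where $\partial V=\overline{V}\cap\partial\mathbb{D}^2$. For real $\alpha>-1$, $\mathcal{A}_\alpha(\mathbb{D}^2)$ is the weighted Bergman space of holomorphic $f$ on $\mathbb{D}^2$ with $\|f\|_\alpha^2=c_\alpha\int_{\mathbb{D}^2}|f(z_1,z_2)|^2\prod_{i=1}^2(1-|z_i|^2)^\alpha\,dV_2<\infty$, where $dV_2$ is Lebesgue measure and $c_\alpha$ normalizes the measure; $\mathcal{A}_{-1}(\mathbb{D}^2)$ denotes the Hardy space $H^2(\mathbb{D}^2)$. $[I]_\alpha$ is the closure of $I$ in $\mathcal{A}_\alpha(\mathbb{D}^2)$, $[I]_\alpha^\perp$ is its orthogonal complement, and $S_p=P_{[I]_\alpha^\perp}M_p|_{[I]_\alpha^\perp}$ for polynomials $p$, where $M_p$ is multiplication by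 $p$ and $P_{[I]_\alpha^\perp}$ is the orthogonal projection. Distinguished ideals are assumed contracted, i.e. $[I]_\alpha\cap\mathbb{C}[z,w]=I$. $[I]_\alpha^\perp$ is essentially normal if $[S_p^*,S_q]=S_p^*S_q-S_qS_p^*$ is compact for all polynomials $p,q$. $C^*([I]_\alpha^\perp)$ is the $C^*$-algebra generated by $S_z,S_w$ and the identity on $[I]_\alpha^\perp$; it contains the ideal $\mathcal{K}$ of all compact operators on $[I]_\alpha^\perp$. When $[I]_\alpha^\perp$ is essentially normal, $C^*([I]_\alpha^\perp)/\mathcal{K}$ is commutative and is identified with $C(Z(I)\cap\partial\mathbb{D}^2)$, where $Z(I)\cap\partial\mathbb{D}^2$ is the Taylor joint essential spectrum of $(S_z,S_w)$ and $S_z,S_w$ are mapped to the coordinate functions $z,w$; this gives the exact sequence in the statement. The sequence is splitting if there is a $*$-homomorphism $C(Z(I)\cap\partial\mathbb{D}^2)\to C^*([I]_\alpha^\perp)$ which is a right inverse of the quotient map.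
   Formalization: The distinguished variety V = Z(I) ∩ D² is additionally required to be infinite (a genuine curve); for finite or empty V, e.g. I = (z,w), the set Z(I) ∩ ∂D² is empty, C(∅) = 0, and the sequence splits trivially. *)

(* Defs.v *)
From HB Require Import structures.
From mathcomp Require Import all_boot all_order all_algebra.
From mathcomp Require Import complex.
From mathcomp Require Import all_classical all_reals all_analysis.

Set Implicit Arguments.
Unset Strict Implicit.
Unset Printing Implicit Defensive.

Import Order.TTheory GRing.Theory Num.Theory.
Import numFieldNormedType.Exports.

Local Open Scope classical_set_scope.
Local Open Scope ring_scope.

(* R[i] as a normed space over itself, so that [differentiable] on R[i] * R[i]
   is complex (Frechet) differentiability. *)
HB.instance Definition _ (R : realType) := NormedModule.copy R[i] R[i]^o.

(* Operators on a Hilbert space.  The Hilbert space is a linear subspace [H] of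
   an ambient vector space [V], with norm [N] (only meaningful on the subspace
   of interest).  An operator on [H] is represented by the map V -> V extending
   it by 0 off [H], so that equality of operators is Leibniz equality. *)
Section HilbertOperators.
Variables (R : realType) (V : lmodType R[i]) (N : V -> R).

(* the inner product (linear on the left) recovered from the norm by
   polarization *)
Definition dotp (x y : V) : R[i] :=
  4^-1 * \sum_(k < 4)
    ('i%C : R[i]) ^+ k * real_complex R (N (x + ('i%C : R[i]) ^+ k *: y) ^+ 2).

Definition norm_closure (H A : set V) : set V :=
  [set x | H x /\ forall e : R, 0 < e -> exists2 y, A y & N (x - y) < e].

Definition orthocomplement (H A : set V) : set V :=
  [set x | H x /\ forall y, A y -> dotp x y = 0].

Definition orthoproj (H : set V) (x : V) : V :=
  xget 0 [set y | H y /\ forall h, H h -> dotp (x - y) h = 0].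

Variable H : set V.

Definition bounded_op : set (V -> V) :=
  [set T | [/\ forall x, H x -> H (T x),
               forall (a : R[i]) x y, H x -> H y ->
                 T (a *: x + y) = a *: T x + T y,
               exists M : R, forall x, H x -> N (T x) <= M * N x
             & forall x, ~ H x -> T x = 0]].

Definition idop : V -> V := patch (fun=> 0) H id.

Definition adjoint (T : V -> V) : V -> V :=
  xget (fun=> 0) [set S | bounded_op S /\
    forall x y, H x -> H y -> dotp (T x) y = dotp x (S y)].

Definition compact_op : set (V -> V) :=
  [set T | bounded_op T /\
    forall u : nat -> V, (forall n, H (u n) /\ N (u n) <= 1) ->
    exists k : nat -> nat, exists y : V,
      [/\ {homo k : m n / (m < n)%N}, H y
        & (fun n => N (T (u (k n)) - y)) @ \oo --> (0 : R)]].

(* norm-closed *-subalgebras of the bounded operators on H *)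
Definition cstar_subalgebra (A : set (V -> V)) : Prop :=
  [/\ A `<=` bounded_op,
      A 0 /\ (forall (a : R[i]) S T, A S -> A T -> A (a *: S + T)),
      forall S T, A S -> A T -> A (S \o T),
      forall T, A T -> A (adjoint T)
    & forall T, bounded_op T ->
      (forall e : R, 0 < e -> exists2 S, A S &
         forall x, H x -> N (T x - S x) <= e * N x) -> A T].

Definition cstar_generated (G : set (V -> V)) : set (V -> V) :=
  smallest cstar_subalgebra G.

End HilbertOperators.

(* *-homomorphisms (not necessarily unital) between two *-algebras A and B,
   each given as a subset of a vector space with a product and an involution *)
Definition star_hom (R : realType) (U W : lmodType R[i])
    (A : set U) (mulA : U -> U -> U) (starA : U -> U)
    (B : set W) (mulB : W -> W -> W) (starB : W -> W) (f : U -> W) : Prop :=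
  [/\ forall a, A a -> B (f a),
      forall (c : R[i]) a b, A a -> A b -> f (c *: a + b) = c *: f a + f b,
      forall a b, A a -> A b -> f (mulA a b) = mulB (f a) (f b)
    & forall a, A a -> f (starA a) = starB (f a)].

Section Bidisc.
Variable R : realType.
Notation C := R[i].
(* functions on the bidisc, or on a subset X of C^2, are represented by their
   extension by 0 to C^2 *)
Notation E := (C * C -> C).

Definition bidisc : set (C * C) := [set x | `|x.1| < 1 /\ `|x.2| < 1].

Definition bidisc_boundary : set (C * C) := closure bidisc `\` interior bidisc.

Definition torus : set (C * C) := [set x | `|x.1| = 1 /\ `|x.2| = 1].

(* C[z,w] is {poly {poly C}}, with z the inner and w the outer variable *)
Definition peval (p : {poly {poly C}}) : E := fun x => p.[x.2%:P].[x.1].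
Definition polyz : {poly {poly C}} := 'X%:P.
Definition polyw : {poly {poly C}} := 'X.

Definition is_ideal (I : set {poly {poly C}}) : Prop :=
  [/\ I 0, forall p q, I p -> I q -> I (p + q)
    & forall p q, I q -> I (p * q)].

Definition zero_set (I : set {poly {poly C}}) : set (C * C) :=
  [set x | forall p, I p -> peval p x = 0].

(* A distinguished variety is an algebraic curve in the bidisc: degenerate V,
   which for an algebraic set means V finite or empty, are excluded. *)
Definition distinguished (I : set {poly {poly C}}) : Prop :=
  let V := zero_set I `&` bidisc in
  [/\ is_ideal I, infinite_set V & closure V `&` bidisc_boundary `<=` torus].

Definition leb2 := (@lebesgue_measure R \x @lebesgue_measure R)%E.
Definition leb4 := (leb2 \x leb2)%E.

Definition of_real (t : (R * R) * (R * R)) : C * C :=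
  ((t.1.1 +i* t.1.2)%C, (t.2.1 +i* t.2.2)%C).

Definition bergman_weight (alpha : R) (x : C * C) : R :=
  (1 - Normc.normc x.1 ^+ 2) `^ alpha * (1 - Normc.normc x.2 ^+ 2) `^ alpha.

Definition bergman_cst (alpha : R) : R :=
  (fine (\int[leb4]_(t in of_real @^-1` bidisc)
           (bergman_weight alpha (of_real t))%:E)%E)^-1.

Definition bergman_sqnorm (alpha : R) (f : E) : \bar R :=
  ((bergman_cst alpha)%:E *
   \int[leb4]_(t in of_real @^-1` bidisc)
     (Normc.normc (f (of_real t)) ^+ 2 * bergman_weight alpha (of_real t))%:E)%E.

Definition polar (r t : R) : C := ((r * cos t) +i* (r * sin t))%C.

Definition angles : set (R * R) := `[0, 2 * pi] `*` `[0, 2 * pi].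

Definition hardy_sqnorm (f : E) : \bar R :=
  ereal_sup [set ((((2 * pi) ^- 2 : R)%:E *
    \int[leb2]_(t in angles)
      (Normc.normc (f (polar r t.1, polar r t.2)) ^+ 2)%:E)%E : \bar R)
    | r in (`]0, 1[ : set R)].

Definition sqnorm (alpha : R) (f : E) : \bar R :=
  if alpha == -1 then hardy_sqnorm f else bergman_sqnorm alpha f.

Definition norm_alpha (alpha : R) (f : E) : R := Num.sqrt (fine (sqnorm alpha f)).

Definition bergman_space (alpha : R) : set E :=
  [set f | [/\ forall x, bidisc x -> differentiable f x,
               forall x, ~ bidisc x -> f x = 0
             & (sqnorm alpha f < +oo)%E]].

Definition poly_fun (p : {poly {poly C}}) : E := patch (fun=> 0) bidisc (peval p).

Definition ideal_closure (alpha : R) (I : set {poly {poly C}}) : set E :=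
  norm_closure (norm_alpha alpha) (bergman_space alpha) (poly_fun @` I).

Definition contracted (alpha : R) (I : set {poly {poly C}}) : Prop :=
  [set p | ideal_closure alpha I (poly_fun p)] = I.

Definition quotient_module (alpha : R) (I : set {poly {poly C}}) : set E :=
  orthocomplement (norm_alpha alpha) (bergman_space alpha)
    (ideal_closure alpha I).

Definition compression (alpha : R) (I : set {poly {poly C}})
    (p : {poly {poly C}}) : E -> E :=
  patch (fun=> 0) (quotient_module alpha I)
    (fun f => orthoproj (norm_alpha alpha) (quotient_module alpha I)
                (peval p \* f)).

Definition qadjoint (alpha : R) (I : set {poly {poly C}}) : (E -> E) -> E -> E :=
  adjoint (norm_alpha alpha) (quotient_module alpha I).

Definition qcompact (alpha : R) (I : set {poly {poly C}}) : set (E -> E) :=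
  compact_op (norm_alpha alpha) (quotient_module alpha I).

Definition essentially_normal (alpha : R) (I : set {poly {poly C}}) : Prop :=
  forall p q : {poly {poly C}},
    let S := compression alpha I in let adj := qadjoint alpha I in
    qcompact alpha I ((adj (S p) \o S q) - (S q \o adj (S p))).

Definition qcstar (alpha : R) (I : set {poly {poly C}}) : set (E -> E) :=
  cstar_generated (norm_alpha alpha) (quotient_module alpha I)
    [set compression alpha I polyz; compression alpha I polyw;
         idop (quotient_module alpha I)].

Definition boundary_spectrum (I : set {poly {poly C}}) : set (C * C) :=
  zero_set I `&` bidisc_boundary.

Definition cont_fun (X : set (C * C)) : set E :=
  [set g | {within X, continuous g} /\ forall x, ~ X x -> g x = 0].

Definition fun_conj (g : E) : E := fun x => (g x)^*.

Definition op_comp (S T : E -> E) : E -> E := S \o T.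
Definition fun_mul (g h : E) : E := g \* h.

(* [quo] is the quotient map of the short exact sequence
   0 -> K -> C*([I]^perp) -> C(Z(I) `&` boundary) -> 0,
   normalized by S_z |-> z and S_w |-> w. *)
Definition exact_sequence (alpha : R) (I : set {poly {poly C}})
    (quo : (E -> E) -> E) : Prop :=
  let A := qcstar alpha I in let X := boundary_spectrum I in
  [/\ star_hom A op_comp (qadjoint alpha I) (cont_fun X) fun_mul fun_conj quo,
      [set T | A T /\ quo T = 0] = qcompact alpha I,
      quo @` A = cont_fun X,
      quo (compression alpha I polyz) = patch (fun=> 0) X fst
    & quo (compression alpha I polyw) = patch (fun=> 0) X snd].

Definition splitting (alpha : R) (I : set {poly {poly C}})
    (quo : (E -> E) -> E) : Prop :=
  exists sigma : E -> E -> E,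
    star_hom (cont_fun (boundary_spectrum I)) fun_mul fun_conj
      (qcstar alpha I) op_comp (qadjoint alpha I) sigma /\
    forall g, cont_fun (boundary_spectrum I) g -> quo (sigma g) = g.

End Bidisc.

(* Main.v *)
(* Suppose that the sequence splits. Let [l] in the open disc be such that
   [z - l] has no zero on [Z(I) ∩ ∂D^2]. The splitting then writes [S_z - l] as
   an invertible operator plus a compact one, so by the Fredholm alternative
   [S_z - l] is onto as soon as it is injective.
   Let [g] in [I] be nonzero of minimal degree in [w], and [(l, w0)] a point of
   [V] at which the leading coefficient of [g] does not vanish. The slice
   [g(l, .)] has no unimodular root [m]: either such a root is a limit of points
   of [V], against distinguishedness, or [w - m] divides [g], and then
   [g / (w - m)] lies in [I] because [w - m] is cyclic, against minimality. So
   multiplication by [g(l, .)] is bounded below, and if [(z - l) f] is a limit of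
   elements [p] of [I], dividing [p - (p(l, .) / g(l, .)) g] by [z - l] gives
   elements of [I] that tend to [f]. Hence [S_z - l] is injective; it is not onto,
   since evaluation at [(l, w0)] vanishes on [[I]] and on the range of [z - l].
   The estimates are made on Taylor coefficients: the squared norm is
   [sum |a_mn|^2 om_m om_n], by Parseval on circles for the Hardy space and by
   rotation invariance of the area for the Bergman spaces. *)

Require Import Defs.
From HB Require Import structures.
From mathcomp Require Import all_boot all_order all_algebra.
From mathcomp Require Import complex.
From mathcomp Require Import all_classical all_reals all_analysis.
From mathcomp Require Import measurable_realfun.
From mathcomp Require Import ring lra.

Set Implicit Arguments.
Unset Strict Implicit.
Unset Printing Implicit Defensive.

Import Order.TTheory GRing.Theory Num.Theory.
Import numFieldNormedType.Exports.

Local Open Scope classical_set_scope.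
Local Open Scope ring_scope.

(** Under a splitting [S_z - l] would have Fredholm index zero, whereas its kernel is trivial and
    its range is not everything. For the sum of an invertible and a compact operator, the Fredholm
    alternative expresses this without defining an index. The lift [sigma] may fail to preserve
    units: the image of the function [z - l] is then invertible only on the range of the idempotent
    [sigma e], and the complementary idempotent has to be added. The ideal may fail to be principal.
    Near a line [z = l] on which the leading coefficient of [g] does not vanish, pseudo-division
    makes [g] act as a generator, which carries an estimate on one slice over to all of [I]. The
    estimates for [z - l] rest on the backward shift. Two properties of the weights carry them:
    monotonicity makes multiplication by a coordinate a contraction, and decay slower than every
    geometric sequence bounds the powers of the backward shift. The space is defined by pointwise
    differentiability, so Taylor coefficients have to be produced by Cauchy theory, and conversely
    square-summable coefficients have to give back a differentiable function. *)

(** * The complex modulus with real values, and the topology of C and of C x C in terms of it *)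

Section ComplexModulus.
Variable R : realType.
Notation C := R[i].
Notation nc := (@Normc.normc R).
Notation Re := (@complex.Re R).
Notation Im := (@complex.Im R).
Implicit Types x y z : C.

Lemma normE_nc x : `|x| = (nc x)%:C%C. Proof. by case: x. Qed.

Lemma nc_ge0 x : 0 <= nc x. Proof. by case: x => a b; exact: sqrtr_ge0. Qed.
Lemma nc0 : nc 0 = 0. Proof. exact: Normc.normc0. Qed.
Lemma nc1 : nc 1 = 1. Proof. exact: Normc.normc1. Qed.
Lemma ncM x y : nc (x * y) = nc x * nc y. Proof. exact: Normc.normcM. Qed.
Lemma ncV x : nc x^-1 = (nc x)^-1. Proof. exact: Normc.normcV. Qed.
Lemma ncN x : nc (- x) = nc x. Proof. exact: normcN. Qed.
Lemma ncD x y : nc (x + y) <= nc x + nc y. Proof. exact: le_normcD. Qed.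
Lemma ncB x y : nc (x - y) <= nc x + nc y.
Proof. by rewrite -(ncN y) ncD. Qed.
Lemma nc_dist x y : nc (x - y) = nc (y - x). Proof. by rewrite -ncN opprB. Qed.
Lemma nc_eq0 x : (nc x == 0) = (x == 0).
Proof.
by apply/eqP/eqP => [|->]; [exact: Normc.eq0_normc|exact: nc0].
Qed.
Lemma nc_gt0 x : (0 < nc x) = (x != 0).
Proof. by rewrite lt_def nc_ge0 andbT nc_eq0. Qed.
Lemma ncX x n : nc (x ^+ n) = nc x ^+ n.
Proof. by elim: n => [|n IH]; rewrite ?expr0 ?nc1 // !exprS ncM IH. Qed.
Lemma nc_real (r : R) : nc r%:C%C = `|r|.
Proof. by rewrite /= expr0n /= addr0 sqrtr_sqr. Qed.
Lemma nc_i : nc 'i%C = 1.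
Proof. by rewrite /= expr0n expr1n /= add0r sqrtr1. Qed.
Lemma nc_sub x y z : nc (x - z) <= nc (x - y) + nc (y - z).
Proof. by rewrite (le_trans _ (ncD _ _)) // addrA subrK. Qed.
Lemma ler_ncB x y : nc x - nc y <= nc (x - y).
Proof. by rewrite lerBlDr (le_trans _ (ncD _ _)) // subrK. Qed.
Lemma nc_sum I (s : seq I) (P : pred I) (F : I -> C) :
  nc (\sum_(i <- s | P i) F i) <= \sum_(i <- s | P i) nc (F i).
Proof.
elim/big_ind2: _ => [|a b c d h1 h2|//]; first by rewrite nc0.
by rewrite (le_trans (ncD _ _)) // lerD.
Qed.
Lemma sqr_nc x : nc x ^+ 2 = Re x ^+ 2 + Im x ^+ 2.
Proof. by case: x => a b; rewrite /= sqr_sqrtr // addr_ge0 // sqr_ge0. Qed.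
Lemma Re_le_nc x : `|Re x| <= nc x.
Proof. by rewrite -ler_sqr ?nnegrE ?nc_ge0 // real_normK ?num_real // sqr_nc lerDl sqr_ge0. Qed.
Lemma Im_le_nc x : `|Im x| <= nc x.
Proof. by rewrite -ler_sqr ?nnegrE ?nc_ge0 // real_normK ?num_real // sqr_nc lerDr sqr_ge0. Qed.
Lemma nc_le_ReIm x : nc x <= `|Re x| + `|Im x|.
Proof.
rewrite -ler_sqr ?nnegrE ?nc_ge0 ?addr_ge0 // sqr_nc sqrrD !real_normK ?num_real //.
have : 0 <= `|Re x| * `|Im x| by rewrite mulr_ge0.
by rewrite -mulr_natr; lra.
Qed.
Lemma ncJ x : nc x^*%C = nc x. Proof. by case: x => a b /=; rewrite sqrrN. Qed.
Lemma mulrJ x : x * x^*%C = (nc x ^+ 2)%:C%C.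
Proof. by rewrite sqr_nc; case: x => a b; apply/eqP; rewrite eq_complex /=; apply/andP; split; apply/eqP; ring. Qed.
Lemma cReM x y : Re (x * y) = Re x * Re y - Im x * Im y.
Proof. by case: x y => [a b] [c d]. Qed.
Lemma cImM x y : Im (x * y) = Re x * Im y + Im x * Re y.
Proof. by case: x y => [a b] [c d]. Qed.
Lemma cReD x y : Re (x + y) = Re x + Re y. Proof. by case: x y => [a b] [c d]. Qed.
Lemma cImD x y : Im (x + y) = Im x + Im y. Proof. by case: x y => [a b] [c d]. Qed.
Lemma cReN x : Re (- x) = - Re x. Proof. by case: x. Qed.
Lemma cImN x : Im (- x) = - Im x. Proof. by case: x. Qed.
Lemma cReB x y : Re (x - y) = Re x - Re y. Proof. by rewrite cReD cReN. Qed.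
Lemma cImB x y : Im (x - y) = Im x - Im y. Proof. by rewrite cImD cImN. Qed.
Lemma cReJ x : Re x^*%C = Re x. Proof. by case: x. Qed.
Lemma cImJ x : Im x^*%C = - Im x. Proof. by case: x. Qed.
Lemma complex_ext x y : Re x = Re y -> Im x = Im y -> x = y.
Proof. by case: x y => [a b] [c d] /= -> ->. Qed.
Lemma cRe_sum I (s : seq I) (P : pred I) (F : I -> C) :
  Re (\sum_(i <- s | P i) F i) = \sum_(i <- s | P i) Re (F i).
Proof. by elim/big_rec2: _ => [//|i x y _ <-]; rewrite cReD. Qed.
Lemma cIm_sum I (s : seq I) (P : pred I) (F : I -> C) :
  Im (\sum_(i <- s | P i) F i) = \sum_(i <- s | P i) Im (F i).
Proof. by elim/big_rec2: _ => [//|i x y _ <-]; rewrite cImD. Qed.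
Lemma sqr_ncD x y : nc (x + y) ^+ 2 = nc x ^+ 2 + nc y ^+ 2 + 2 * Re (x * y^*%C).
Proof. by rewrite !sqr_nc !cReD !cImD cReM cReJ cImJ; ring. Qed.

Lemma normC_lt x (r : R) : (`|x| < r%:C%C) = (nc x < r).
Proof. by rewrite normE_nc ltcR. Qed.
Lemma normC_lt1 x : (`|x| < 1) = (nc x < 1).
Proof. exact: normC_lt. Qed.
Lemma normC_eq1 x : (`|x| = 1) <-> (nc x = 1).
Proof. by rewrite normE_nc; split => [[]|->]. Qed.

(** In the order of [R[i]] a positive element is real; this trades the C-valued radii of balls for
    real ones. *)
Lemma gt0C (e : C) : 0 < e -> exists2 d : R, 0 < d & e = d%:C%C.
Proof.
by case: e => a b; rewrite ltcE /= => /andP[/eqP-> ?]; exists a.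
Qed.

Lemma nbhsC x (A : set C) :
  nbhs x A <-> exists2 e : R, 0 < e & forall y, nc (y - x) < e -> A y.
Proof.
split=> [/nbhs_ballP [e e0 h]|[e e0 h]].
  have [d d0 ed] := gt0C e0; exists d => // y yx; apply: h.
  by rewrite /ball /= ed normC_lt nc_dist.
apply/nbhs_ballP; exists (e%:C)%C; first by rewrite /= ltcR.
by move=> y; rewrite /ball /= normC_lt nc_dist; exact: h.
Qed.

Lemma nbhsC2 (x : C * C) (A : set (C * C)) :
  nbhs x A <-> exists2 e : R, 0 < e &
    forall y : C * C, nc (y.1 - x.1) < e -> nc (y.2 - x.2) < e -> A y.
Proof.
split=> [/nbhs_ballP [e e0 h]|[e e0 h]].
  have [d d0 ed] := gt0C e0; exists d => // y yx1 yx2; apply: h.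
  by rewrite /ball /=; split; rewrite /ball /= ed normC_lt nc_dist.
apply/nbhs_ballP; exists (e%:C)%C; first by rewrite /= ltcR.
move=> y; rewrite /ball /= /prod_ball.
case; rewrite /ball /= !normC_lt ![nc (x.1 - _)]nc_dist ![nc (x.2 - _)]nc_dist.
exact: h.
Qed.

Lemma cvgC T (F : set_system T) {FF : Filter F} (f : T -> C) l :
  f @ F --> l <-> forall e : R, 0 < e -> \forall t \near F, nc (f t - l) < e.
Proof.
split=> [h e e0|h A /nbhsC[e e0 eA]].
  by apply: (h [set y | nc (y - l) < e]); apply/nbhsC; exists e.
by apply: filterS (h e e0) => t; exact: eA.
Qed.

Lemma cvg_ReC T (F : set_system T) {FF : Filter F} (f : T -> C) l :
  f @ F --> l -> Re (f t) @[t --> F] --> Re l.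
Proof.
move=> /cvgC h; apply/cvgrPdist_lt => e e0; apply: filterS (h e e0) => t.
by apply: le_lt_trans; rewrite -cReB nc_dist Re_le_nc.
Qed.

Lemma cvg_ImC T (F : set_system T) {FF : Filter F} (f : T -> C) l :
  f @ F --> l -> Im (f t) @[t --> F] --> Im l.
Proof.
move=> /cvgC h; apply/cvgrPdist_lt => e e0; apply: filterS (h e e0) => t.
by apply: le_lt_trans; rewrite -cImB nc_dist Im_le_nc.
Qed.

Lemma cvg_ReImC T (F : set_system T) {FF : Filter F} (f : T -> C) l :
  Re (f t) @[t --> F] --> Re l -> Im (f t) @[t --> F] --> Im l -> f @ F --> l.
Proof.
move=> /cvgrPdist_lt h1 /cvgrPdist_lt h2; apply/cvgC => e e0.
have e2 : 0 < e / 2 by rewrite divr_gt0.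
apply: filterS2 (h1 _ e2) (h2 _ e2) => t k1 k2.
rewrite nc_dist (le_lt_trans (nc_le_ReIm _)) // cReB cImB [ltRHS]splitr.
exact: ltrD.
Qed.

Lemma cvg_ncC T (F : set_system T) {FF : Filter F} (f : T -> C) l :
  f @ F --> l -> nc (f t) @[t --> F] --> nc l.
Proof.
move=> /cvgC h; apply/cvgrPdist_lt => e e0; apply: filterS (h e e0) => t.
apply: le_lt_trans; rewrite ler_norml.
have := ler_ncB (f t) l; have := ler_ncB l (f t); rewrite (nc_dist l); lra.
Qed.

Lemma continuousC (G : C -> C) z : {for z, continuous G} <->
  forall e : R, 0 < e -> exists2 d : R, 0 < d &
    forall y, nc (y - z) < d -> nc (G y - G z) < e.
Proof.
split=> [/(@cvgC _ _ (nbhs_filter z)) h e e0|h].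
  by have /nbhsC := h e e0.
by apply/(@cvgC _ _ (nbhs_filter z)) => e e0; apply/nbhsC; exact: h.
Qed.

End ComplexModulus.
#[global] Arguments Normc.normc R x : simpl never.

(** * Integrals and derivatives of complex functions of a real variable; polar coordinates *)

Section ComplexIntegral.
Variable R : realType.
Notation C := R[i].
Notation nc := (@Normc.normc R).
Notation Re := (@complex.Re R).
Notation Im := (@complex.Im R).
Notation mu := (@lebesgue_measure R).

(** Two-sided continuity at each point of the segment, stronger than continuity within it, so that
    limits compose pointwise. *)
Definition cont_on (a b : R) (F : R -> C) :=
  forall t, a <= t <= b -> {for t, continuous F}.

Definition cint (a b : R) (F : R -> C) : C :=
  ((\int[mu]_(t in `[a, b]) Re (F t)) +i* (\int[mu]_(t in `[a, b]) Im (F t)))%C.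

Lemma cont_on_Re a b F : cont_on a b F -> {within `[a, b], continuous (Re \o F)}.
Proof.
move=> h; apply: continuous_in_subspaceT => t; rewrite inE /= in_itv /= => /h.
by move=> /cvg_ReC; apply.
Qed.

Lemma cont_on_Im a b F : cont_on a b F -> {within `[a, b], continuous (Im \o F)}.
Proof.
move=> h; apply: continuous_in_subspaceT => t; rewrite inE /= in_itv /= => /h.
by move=> /cvg_ImC; apply.
Qed.

Lemma cont_on_iRe a b F : cont_on a b F ->
  mu.-integrable `[a, b] (EFin \o (Re \o F)).
Proof.
move=> h; apply: continuous_compact_integrable; first exact: segment_compact.
exact: cont_on_Re.
Qed.

Lemma cont_on_iIm a b F : cont_on a b F ->
  mu.-integrable `[a, b] (EFin \o (Im \o F)).
Proof.
move=> h; apply: continuous_compact_integrable; first exact: segment_compact.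
exact: cont_on_Im.
Qed.

Lemma cont_onD a b F G : cont_on a b F -> cont_on a b G ->
  cont_on a b (fun t => F t + G t).
Proof. by move=> hF hG t ht; apply: cvgD; [exact: hF|exact: hG]. Qed.

Lemma cont_onM a b F G : cont_on a b F -> cont_on a b G ->
  cont_on a b (fun t => F t * G t).
Proof. by move=> hF hG t ht; apply: cvgM; [exact: hF|exact: hG]. Qed.

Lemma cont_on_cst a b c : cont_on a b (fun=> c).
Proof. by move=> t ht; exact: cvg_cst. Qed.

Lemma eq_cint a b F G : (forall t, a <= t <= b -> F t = G t) ->
  cint a b F = cint a b G.
Proof.
move=> h; rewrite /cint; congr (_ +i* _)%C; apply: eq_Rintegral => t;
by rewrite inE /= in_itv /= => /h ->.
Qed.

Lemma cintD a b F G : cont_on a b F -> cont_on a b G ->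
  cint a b (fun t => F t + G t) = cint a b F + cint a b G.
Proof.
move=> hF hG; apply: complex_ext; rewrite ?cReD ?cImD /=.
  under eq_Rintegral do rewrite cReD.
  by rewrite RintegralD //; exact: cont_on_iRe.
under eq_Rintegral do rewrite cImD.
by rewrite RintegralD //; exact: cont_on_iIm.
Qed.

Lemma cintZ a b c F : cont_on a b F ->
  cint a b (fun t => c * F t) = c * cint a b F.
Proof.
move=> hF; have iR := cont_on_iRe hF; have iI := cont_on_iIm hF.
have iZ k f : mu.-integrable `[a, b] (EFin \o f) ->
  mu.-integrable `[a, b] (EFin \o (fun t => k * f t)).
  by move=> fi; apply: eq_integrable (integrableZl _ k fi).
apply: complex_ext; rewrite ?cReM ?cImM /=.
  under eq_Rintegral do rewrite cReM.
  by rewrite RintegralB ?RintegralZl //; exact: iZ.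
under eq_Rintegral do rewrite cImM.
by rewrite RintegralD ?RintegralZl //; exact: iZ.
Qed.

Lemma cintB a b F G : cont_on a b F -> cont_on a b G ->
  cint a b (fun t => F t - G t) = cint a b F - cint a b G.
Proof.
move=> hF hG; have hG' : cont_on a b (fun t => -1 * G t).
  exact: (cont_onM (@cont_on_cst a b (-1)) hG).
have -> : cint a b (fun t => F t - G t) = cint a b (fun t => F t + -1 * G t).
  by apply: eq_cint => t _; rewrite mulN1r.
by rewrite (cintD hF hG') (cintZ (-1) hG) mulN1r.
Qed.

Lemma cint_sum a b n (F : nat -> R -> C) : (forall k, (k < n)%N -> cont_on a b (F k)) ->
  cint a b (fun t => \sum_(k < n) F k t) = \sum_(k < n) cint a b (F k) /\
  cont_on a b (fun t => \sum_(k < n) F k t).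
Proof.
elim: n => [|n IH] h.
  have E : (fun t => \sum_(k < 0) F k t) = (fun=> 0).
    by apply/funext => t; rewrite big_ord0.
  rewrite E; split; last exact: cont_on_cst.
  by rewrite big_ord0 /cint /= !Rintegral_cst // !mul0r.
have [|IH1 IH2] := IH; first by move=> k kn; apply: h; exact: ltnW.
have E : (fun t => \sum_(k < n.+1) F k t) = (fun t => \sum_(k < n) F k t + F n t).
  by apply/funext => t; rewrite big_ord_recr.
have hn := h n (ltnSn n).
by rewrite E; split; [rewrite cintD // IH1 big_ord_recr|exact: cont_onD].
Qed.

Lemma Rint_cst a b k : a <= b -> \int[mu]_(t in `[a, b]) k = k * (b - a).
Proof.
move=> ab; rewrite Rintegral_cst // [X in fine X](_ : _ = mu `[a, b]%classic) //.
rewrite lebesgue_measure_itv /= lte_fin.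
by case: ltP => //= ba; rewrite (le_anti (_ : a <= b <= a)) ?ab // subrr.
Qed.

Lemma cint_cst a b c : a <= b -> cint a b (fun=> c) = (b - a)%:C%C * c.
Proof.
move=> ab; rewrite /cint !Rint_cst //; case: c => x y /=.
by apply: complex_ext; rewrite /= ?mul0r ?subr0 ?addr0 mulrC.
Qed.

(** The factor 2 comes from bounding the real and imaginary parts separately. *)
Lemma cint_le a b M F : a <= b -> cont_on a b F ->
  (forall t, a <= t <= b -> nc (F t) <= M) -> nc (cint a b F) <= 2 * M * (b - a).
Proof.
move=> ab hF h.
have iR := cont_on_iRe hF; have iI := cont_on_iIm hF.
have icst : mu.-integrable `[a, b] (EFin \o cst M).
  apply: continuous_compact_integrable; first exact: segment_compact.
  by apply: continuous_subspaceT => t; exact: cvg_cst.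
have key f : mu.-integrable `[a, b] (EFin \o f) ->
    (forall t, a <= t <= b -> `|f t| <= M) -> `|\int[mu]_(t in `[a, b]) f t| <= M * (b - a).
  move=> fi fM; rewrite -Rint_cst //; apply: le_trans (le_normr_Rintegral _ fi) _ => //.
  apply: (le_Rintegral _ (integrable_abse fi) icst) => //.
rewrite (le_trans (nc_le_ReIm _)) //= -mulrA mulr_natl mulr2n lerD //; apply: key => // t /h.
  by apply: le_trans; exact: Re_le_nc.
by apply: le_trans; exact: Im_le_nc.
Qed.

Lemma cint_split a c b F : a <= c <= b -> cont_on a b F ->
  cint a b F = cint a c F + cint c b F.
Proof.
move=> /andP[ac cb] hF; have iR := cont_on_iRe hF; have iI := cont_on_iIm hF.
have key f : mu.-integrable `[a, b] (EFin \o f) -> \int[mu]_(t in `[a, b]) f t =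
    \int[mu]_(t in `[a, c]) f t + \int[mu]_(t in `[c, b]) f t.
  move=> fi; apply/eqP; rewrite addrC -subr_eq; apply/eqP.
  rewrite (@Rintegral_itvB _ _ (BLeft a) (BRight b) c) //.
  rewrite Rintegral_itv_obnd_cbnd //; apply: integrableS fi => //.
  by apply: subset_itvr; rewrite bnd_simp.
by apply: complex_ext; rewrite ?cReD ?cImD /=; exact: key.
Qed.

Definition cder (P F : R -> C) := forall t,
  is_derive t (1 : R) (Re \o P) (Re (F t)) /\ is_derive t (1 : R) (Im \o P) (Im (F t)).

Lemma cder_cst c : cder (fun=> c) (fun=> 0).
Proof. by move=> t; split; exact: is_derive_cst. Qed.

Lemma cderD P Q F G : cder P F -> cder Q G ->
  cder (fun t => P t + Q t) (fun t => F t + G t).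
Proof.
move=> hP hQ t; have [P1 P2] := hP t; have [Q1 Q2] := hQ t; split.
  have -> : Re \o (fun t => P t + Q t) = (Re \o P) + (Re \o Q).
    by apply/funext => s /=; rewrite cReD.
  by rewrite cReD; exact: is_deriveD.
have -> : Im \o (fun t => P t + Q t) = (Im \o P) + (Im \o Q).
  by apply/funext => s /=; rewrite cImD.
by rewrite cImD; exact: is_deriveD.
Qed.

Lemma cderM P Q F G : cder P F -> cder Q G ->
  cder (fun t => P t * Q t) (fun t => F t * Q t + P t * G t).
Proof.
move=> hP hQ t; have [P1 P2] := hP t; have [Q1 Q2] := hQ t; split.
  have -> : Re \o (fun t => P t * Q t) = (Re \o P) * (Re \o Q) - (Im \o P) * (Im \o Q).
    by apply/funext => s /=; rewrite cReM.
  by apply: is_derive_eq; rewrite cReD !cReM /= /GRing.scale /=; ring.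
have -> : Im \o (fun t => P t * Q t) = (Re \o P) * (Im \o Q) + (Im \o P) * (Re \o Q).
  by apply/funext => s /=; rewrite cImM.
by apply: is_derive_eq; rewrite cImD !cImM /= /GRing.scale /=; ring.
Qed.

Lemma cder_cont P F : cder P F -> continuous P.
Proof.
move=> h t; have [h1 h2] := h t; apply: cvg_ReImC.
  by apply: (@differentiable_continuous _ _ _ t (Re \o P)); apply/derivable1_diffP.
by apply: (@differentiable_continuous _ _ _ t (Im \o P)); apply/derivable1_diffP.
Qed.

Lemma cont_onT a b F : continuous F -> cont_on a b F.
Proof. by move=> h t _; exact: h. Qed.

Lemma cint_FTC a b P F : a <= b -> cder P F -> cont_on a b F ->
  cint a b F = P b - P a.
Proof.
rewrite le_eqVlt => /predU1P[<- _ _|ab hP hF].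
  by rewrite subrr /cint set_itv1 !Rintegral_set1.
have key f p : {within `[a, b], continuous f} ->
    (forall t, is_derive t (1 : R) p (f t)) -> \int[mu]_(t in `[a, b]) f t = p b - p a.
  move=> cf df; have cp : continuous p.
    move=> t; apply: differentiable_continuous; apply/derivable1_diffP.
    by have := df t.
  rewrite /Rintegral (continuous_FTC2 ab cf (F := p)) //.
    split.
    - by move=> x _; have := df x.
    - by apply: cvg_at_right_filter; exact: cp.
    - by apply: cvg_at_left_filter; exact: cp.
  by move=> x _; rewrite derive1E; have := df x => -[].
apply: complex_ext; rewrite ?cReB ?cImB /=.
  by apply: (key (Re \o F) (Re \o P)); [exact: cont_on_Re|move=> t; have [] := hP t].
by apply: (key (Im \o F) (Im \o P)); [exact: cont_on_Im|move=> t; have [] := hP t].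
Qed.

Lemma cder_polar_t (r : R) : cder (fun t => polar r t) (fun t => 'i%C * polar r t).
Proof.
move=> t; split.
  have -> : Re \o polar r = (cst r : R -> R) * cos by apply/funext.
  by apply: is_derive_eq; rewrite /= /GRing.scale /=; ring.
have -> : Im \o polar r = (cst r : R -> R) * sin by apply/funext.
by apply: is_derive_eq; rewrite /= /GRing.scale /=; ring.
Qed.

Lemma cder_polar_r (t : R) : cder (fun r => polar r t) (fun r => polar 1 t).
Proof.
move=> r; split.
  have -> : Re \o ((@polar R) ^~ t) = (id : R -> R) * cst (cos t) by apply/funext.
  by apply: is_derive_eq; rewrite /= /GRing.scale /=; ring.
have -> : Im \o ((@polar R) ^~ t) = (id : R -> R) * cst (sin t) by apply/funext.
by apply: is_derive_eq; rewrite /= /GRing.scale /=; ring.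
Qed.

Lemma nc_polar (r t : R) : nc (polar r t) = `|r|.
Proof.
rewrite -[RHS]sqrtr_sqr /polar /=; congr Num.sqrt.
by rewrite !exprMn -mulrDr cos2Dsin2 mulr1.
Qed.

Lemma polar_mul (r s t u : R) : polar r t * polar s u = polar (r * s) (t + u).
Proof. by apply: complex_ext; rewrite /= ?cosD ?sinD; ring. Qed.

Lemma polarE (r t : R) : polar r t = r%:C%C * polar 1 t.
Proof. by apply: complex_ext; rewrite /=; ring. Qed.

Lemma polar_conj (r t : R) : (polar r t)^*%C = polar r (- t).
Proof. by apply: complex_ext; rewrite /= ?cosN ?sinN ?mulrN. Qed.

Lemma polar_neq0 (r t : R) : r != 0 -> polar r t != 0.
Proof. by move=> r0; rewrite -nc_eq0 nc_polar normr_eq0. Qed.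

Lemma polar_2pi (r : R) : polar r (2 * pi) = polar r 0.
Proof.
by rewrite mulrC mulr_natr; apply: complex_ext; rewrite /= ?cos2pi ?cos0 ?sin2pi ?sin0.
Qed.

End ComplexIntegral.

(** * Goursat's theorem on polar rectangles *)

Section Goursat.
Variable R : realType.
Notation C := R[i].
Notation nc := (@Normc.normc R).
Notation polar := (@polar R).

Definition ccont (f : C -> C) (z : C) : Prop := {for z, continuous f}.

(** The linear form of the remainder is the one that Goursat's argument consumes; [cdiffP]
    identifies the notion with [derivable]. *)
Definition cdiff (G : C -> C) (z : C) := exists d : C, forall e : R, 0 < e ->
  exists2 del : R, 0 < del & forall y, nc (y - z) < del ->
    nc (G y - G z - d * (y - z)) <= e * nc (y - z).

Lemma cdiff_cont G z : cdiff G z -> ccont G z.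
Proof.
move=> [d hd]; apply/continuousC => e e0.
have [del del0 h] := hd 1 ltr01.
have M0 : 0 < nc d + 1 by rewrite ltr_wpDl ?nc_ge0.
exists (Num.min del (e / (nc d + 1))); first by rewrite lt_min del0 divr_gt0.
move=> y; rewrite lt_min => /andP[y1 y2].
have -> : G y - G z = (G y - G z - d * (y - z)) + d * (y - z) by rewrite subrK.
rewrite (le_lt_trans (ncD _ _)) // ncM (le_lt_trans (lerD (h y y1) (lexx _))) //.
by rewrite -mulrDl addrC mulrC -ltr_pdivlMr.
Qed.

Lemma polar_cont_t r : continuous (fun t => polar r t).
Proof. exact: cder_cont (cder_polar_t r). Qed.

Lemma polar_cont_r t : continuous (fun r => polar r t).
Proof. exact: cder_cont (cder_polar_r t). Qed.

Lemma polar1_dist t u : nc (polar 1 t - polar 1 u) <= 2 * `|t - u|.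
Proof.
wlog tu : t u / t <= u.
  by move=> h; case: (leP t u) => [/h//|/ltW /h]; rewrite nc_dist distrC.
have hc : cont_on t u (fun t => 'i%C * polar 1 t).
  exact: (cont_onM (@cont_on_cst _ t u 'i%C) (@cont_onT _ _ _ _ (@polar_cont_t 1))).
rewrite nc_dist -(cint_FTC tu (cder_polar_t 1) hc).
apply: le_trans (cint_le (M := 1) tu hc _) _.
  by move=> s _; rewrite ncM nc_i nc_polar normr1 mul1r.
by rewrite mulr1 distrC ger0_norm ?subr_ge0.
Qed.

Lemma polar_dist r t s u :
  nc (polar r t - polar s u) <= `|r - s| + `|s| * (2 * `|t - u|).
Proof.
have -> : polar r t - polar s u = (r - s)%:C%C * polar 1 t + s%:C%C * (polar 1 t - polar 1 u).
  by rewrite (polarE r) (polarE s) rmorphB /=; ring.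
rewrite (le_trans (ncD _ _)) // !ncM !nc_real nc_polar normr1 mulr1 lerD2l.
by rewrite ler_wpM2l // polar1_dist.
Qed.

Lemma nested_intervals (a l : nat -> R) : (forall n, a n <= a n.+1) ->
  (forall n, a n.+1 + l n.+1 <= a n + l n) -> (forall n, 0 <= l n) ->
  exists x, forall n, a n <= x <= a n + l n.
Proof.
move=> h1 h2 l0.
have m1 : {homo a : m n / (m <= n)%N >-> m <= n} by apply/nondecreasing_seqP.
have m2 : {homo (fun n => a n + l n) : m n / (m <= n)%N >-> m >= n}.
  by apply/nonincreasing_seqP.
have ub n : ubound (range a) (a n + l n).
  move=> _ [m _ <-]; have [mn|nm] := leqP m n.
    by rewrite (le_trans (m1 _ _ mn)) // lerDl.
  by rewrite (le_trans _ (m2 _ _ (ltnW nm))) //= lerDl.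
exists (sup (range a)) => n; apply/andP; split.
  by apply: ub_le_sup; [exists (a 0%N + l 0%N); exact: ub|exists n].
by apply: ge_sup; [exists (a 0%N), 0%N|exact: ub].
Qed.

Section PolarRectangle.
Variables (ra rb : R) (ra0 : 0 <= ra) (rb1 : rb <= 1).

Definition annulus : set C := [set z | ra <= nc z <= rb].
Definition cont_ann (G : C -> C) := forall z, annulus z -> ccont G z.

Definition radf (G : C -> C) (t : R) := fun r => G (polar r t) * polar 1 t.
Definition arcf (G : C -> C) (r : R) := fun t => G (polar r t) * ('i%C * polar r t).
(** The contour integral of [G dz] around a polar rectangle, anticlockwise from the radial edge at
    [t1]. With circles as coordinate lines, the radial edges cancel over a full turn. *)
Definition pint (G : C -> C) (r1 r2 t1 t2 : R) : C :=
  cint r1 r2 (radf G t1) + cint t1 t2 (arcf G r2) -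
  cint r1 r2 (radf G t2) - cint t1 t2 (arcf G r1).

Lemma annulus_polar r t : ra <= r <= rb -> annulus (polar r t).
Proof. by move=> h; rewrite /annulus /= nc_polar ger0_norm // (le_trans ra0) //; case/andP: h. Qed.

Lemma radf_cont G t r1 r2 : cont_ann G -> ra <= r1 -> r2 <= rb ->
  cont_on r1 r2 (radf G t).
Proof.
move=> hG h1 h2; apply: (@cont_onM _ _ _ (fun r => G (polar r t)) (fun=> polar 1 t)).
  move=> r /andP[k1 k2]; apply: cvg_comp (@polar_cont_r t r) _.
  apply: hG; apply: annulus_polar.
  by rewrite (le_trans h1 k1) (le_trans k2 h2).
exact: cont_on_cst.
Qed.

Lemma arcf_cont G r t1 t2 : cont_ann G -> ra <= r <= rb ->
  cont_on t1 t2 (arcf G r).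
Proof.
move=> hG h1; apply: (@cont_onM _ _ _ (fun t => G (polar r t)) (fun t => 'i%C * polar r t)).
  move=> t _; apply: cvg_comp (@polar_cont_t r t) _.
  by apply: hG; exact: annulus_polar.
exact: (cont_onM (@cont_on_cst _ t1 t2 'i%C) (@cont_onT _ _ _ _ (@polar_cont_t r))).
Qed.

Lemma pint_split_r G r1 m r2 t1 t2 : cont_ann G -> ra <= r1 -> r1 <= m -> m <= r2 ->
  r2 <= rb -> pint G r1 r2 t1 t2 = pint G r1 m t1 t2 + pint G m r2 t1 t2.
Proof.
move=> hG h1 h2 h3 h4; have hm : r1 <= m <= r2 by rewrite h2.
rewrite /pint (cint_split hm (radf_cont (t := t1) hG h1 h4)) (cint_split hm (radf_cont (t := t2) hG h1 h4)).
ring.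
Qed.

Lemma pint_split_t G r1 r2 t1 m t2 : cont_ann G -> ra <= r1 -> r1 <= r2 ->
  r2 <= rb -> t1 <= m -> m <= t2 ->
  pint G r1 r2 t1 t2 = pint G r1 r2 t1 m + pint G r1 r2 m t2.
Proof.
move=> hG h1 h2 h3 h4 h5; have hm : t1 <= m <= t2 by rewrite h4.
have c1 : cont_on t1 t2 (arcf G r1) by apply: arcf_cont hG _; rewrite h1 (le_trans h2).
have c2 : cont_on t1 t2 (arcf G r2) by apply: arcf_cont hG _; rewrite h3 (le_trans h1).
rewrite /pint (cint_split hm c1) (cint_split hm c2); ring.
Qed.

Lemma pintB G H r1 r2 t1 t2 : cont_ann G -> cont_ann H -> ra <= r1 -> r1 <= r2 ->
  r2 <= rb -> pint (fun z => G z - H z) r1 r2 t1 t2 = pint G r1 r2 t1 t2 - pint H r1 r2 t1 t2.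
Proof.
move=> hG hH h1 h2 h3.
have k1 : ra <= r1 <= rb by rewrite h1 (le_trans h2).
have k2 : ra <= r2 <= rb by rewrite h3 (le_trans h1).
have e1 t : cint r1 r2 (radf (fun z => G z - H z) t) = cint r1 r2 (radf G t) - cint r1 r2 (radf H t).
  rewrite -(cintB (radf_cont (t := t) hG h1 h3) (radf_cont (t := t) hH h1 h3)).
  by apply: eq_cint => s _; rewrite /radf mulrBl.
have e2 r : ra <= r <= rb ->
  cint t1 t2 (arcf (fun z => G z - H z) r) = cint t1 t2 (arcf G r) - cint t1 t2 (arcf H r).
  move=> hr; rewrite -(cintB (arcf_cont hG hr) (arcf_cont hH hr)).
  by apply: eq_cint => s _; rewrite /arcf mulrBl.
rewrite /pint !e1 (e2 _ k1) (e2 _ k2); ring.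
Qed.

Lemma affine_cont (c0 c1 : C) : continuous (fun z : C => c0 + c1 * z).
Proof.
move=> z; apply: cdiff_cont; exists c1 => e e0; exists 1 => // y _.
have -> : c0 + c1 * y - (c0 + c1 * z) - c1 * (y - z) = 0 by ring.
by rewrite nc0 mulr_ge0 ?nc_ge0 // ltW.
Qed.

(** An affine function has the antiderivative [P], so that its four edge integrals telescope. *)
Lemma pint_affine c0 c1 r1 r2 t1 t2 : ra <= r1 -> r1 <= r2 -> r2 <= rb -> t1 <= t2 ->
  pint (fun z => c0 + c1 * z) r1 r2 t1 t2 = 0.
Proof.
move=> h1 h2 h3 h4; pose P := fun z : C => c0 * z + c1 / 2 * (z * z).
have hG : cont_ann (fun z => c0 + c1 * z) by move=> z _; exact: affine_cont.
have d1 t : cder (fun r => P (polar r t)) (radf (fun z => c0 + c1 * z) t).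
  have hp := cder_polar_r t.
  have := cderD (cderM (@cder_cst _ c0) hp) (cderM (@cder_cst _ (c1 / 2)) (cderM hp hp)).
  congr cder; apply/funext => r; by rewrite /radf /=; field.
have d2 r : cder (fun t => P (polar r t)) (arcf (fun z => c0 + c1 * z) r).
  have hp := cder_polar_t r.
  have := cderD (cderM (@cder_cst _ c0) hp) (cderM (@cder_cst _ (c1 / 2)) (cderM hp hp)).
  congr cder; apply/funext => t; by rewrite /arcf /=; field.
have k1 : ra <= r1 <= rb by rewrite h1 (le_trans h2).
have k2 : ra <= r2 <= rb by rewrite h3 (le_trans h1).
rewrite /pint (cint_FTC h2 (d1 t1) (radf_cont (t := t1) hG h1 h3)) (cint_FTC h2 (d1 t2) (radf_cont (t := t2) hG h1 h3)).
rewrite (cint_FTC h4 (d2 r1) (arcf_cont hG k1)) (cint_FTC h4 (d2 r2) (arcf_cont hG k2)).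
ring.
Qed.

Lemma pint_le G M r1 r2 t1 t2 : cont_ann G -> ra <= r1 -> r1 <= r2 -> r2 <= rb -> t1 <= t2 ->
  (forall r t, r1 <= r <= r2 -> t1 <= t <= t2 -> nc (G (polar r t)) <= M) ->
  nc (pint G r1 r2 t1 t2) <= 4 * M * ((r2 - r1) + (t2 - t1)).
Proof.
move=> hG h1 h2 h3 h4 hM.
have k1 : ra <= r1 <= rb by rewrite h1 (le_trans h2).
have k2 : ra <= r2 <= rb by rewrite h3 (le_trans h1).
have b1 t : t1 <= t <= t2 -> nc (cint r1 r2 (radf G t)) <= 2 * M * (r2 - r1).
  move=> ht; apply: cint_le => //; first exact: radf_cont.
  by move=> r hr; rewrite /radf ncM nc_polar normr1 mulr1 hM.
have b2 r : r1 <= r <= r2 -> nc (cint t1 t2 (arcf G r)) <= 2 * M * (t2 - t1).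
  move=> hr; have hr' : ra <= r <= rb.
    by case/andP: hr => [x1 x2]; rewrite (le_trans h1 x1) (le_trans x2 h3).
  apply: cint_le => //; first exact: arcf_cont.
  move=> t ht; rewrite /arcf !ncM nc_i nc_polar mul1r.
  have r0 : 0 <= r by rewrite (le_trans ra0) //; case/andP: hr'.
  rewrite (le_trans _ (hM r t hr ht)) // ler_piMr ?nc_ge0 // ger0_norm //.
  by case/andP: hr' => _ /le_trans ->.
have q1 : r1 <= r1 <= r2 by rewrite lexx.
have q2 : r1 <= r2 <= r2 by rewrite lexx h2.
have q3 : t1 <= t1 <= t2 by rewrite lexx.
have q4 : t1 <= t2 <= t2 by rewrite lexx h4.
rewrite /pint; have := ncB (cint r1 r2 (radf G t1) + cint t1 t2 (arcf G r2) -
  cint r1 r2 (radf G t2)) (cint t1 t2 (arcf G r1)).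
have := ncB (cint r1 r2 (radf G t1) + cint t1 t2 (arcf G r2)) (cint r1 r2 (radf G t2)).
have := ncD (cint r1 r2 (radf G t1)) (cint t1 t2 (arcf G r2)).
have := b1 _ q3; have := b1 _ q4; have := b2 _ q1; have := b2 _ q2; lra.
Qed.

(** Quadrisection: some quarter always keeps a quarter of the integral. Around the common point of
    the nested rectangles [G] is affine up to a small multiple of the diameter, and the affine part
    integrates to 0. *)
Lemma goursat G t1 t2 : ra <= rb -> t1 <= t2 -> (forall z, annulus z -> cdiff G z) ->
  pint G ra rb t1 t2 = 0.
Proof.
move=> hab h12 hG.
have cG : cont_ann G by move=> z /hG; exact: cdiff_cont.
apply/eqP; rewrite -nc_eq0 eq_le nc_ge0 andbT leNgt; apply/negP => K0.
set K := nc _ in K0.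
pose dr n := (rb - ra) / 2 ^+ n; pose dt n := (t2 - t1) / 2 ^+ n.
have drS n : dr n = dr n.+1 + dr n.+1 by rewrite /dr exprS; field; rewrite expf_neq0.
have dtS n : dt n = dt n.+1 + dt n.+1 by rewrite /dt exprS; field; rewrite expf_neq0.
have dr0 n : 0 <= dr n by rewrite /dr divr_ge0 ?subr_ge0 ?exprn_ge0.
have dt0 n : 0 <= dt n by rewrite /dt divr_ge0 ?subr_ge0 ?exprn_ge0.
(* [q] is the lower corner of a rectangle of the [n]-th generation that still carries at least
   [K / 4 ^ n]. *)
pose bad n (q : R * R) := [/\ ra <= q.1, q.1 + dr n <= rb, t1 <= q.2, q.2 + dt n <= t2 &
  K / 4 ^+ n <= nc (pint G q.1 (q.1 + dr n) q.2 (q.2 + dt n))].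
pose nxt n (q q' : R * R) := [/\ q.1 <= q'.1, q'.1 <= q.1 + dr n.+1, q.2 <= q'.2 &
  q'.2 <= q.2 + dt n.+1].
have step n q : bad n q -> exists q', bad n.+1 q' /\ nxt n q q'.
  case: q => [r t] [/= b1 b2 b3 b4 b5].
  set h := dr n.+1; set k := dt n.+1.
  have h0 : 0 <= h := dr0 _; have k0 : 0 <= k := dt0 _.
  have eh : r + dr n = (r + h) + h by rewrite drS addrA.
  have ek : t + dt n = (t + k) + k by rewrite dtS addrA.
  rewrite eh ek in b2 b4 b5.
  rewrite (@pint_split_r _ _ (r + h)) ?lerDl // in b5.
  have r1 : r + h <= rb by rewrite (le_trans _ b2) // lerDl.
  have r2 : ra <= r + h by rewrite (le_trans b1) // lerDl.
  rewrite (@pint_split_t _ _ (r + h) t (t + k)) ?lerDl // in b5.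
  rewrite (@pint_split_t _ _ (r + h + h) t (t + k)) ?lerDl // in b5.
  have t1k : t + k <= t2 by rewrite (le_trans _ b4) // lerDl.
  have t2k : t1 <= t + k by rewrite (le_trans b3) // lerDl.
  have e4 : K / 4 ^+ n = 4 * (K / 4 ^+ n.+1) by rewrite exprS; field; rewrite expf_neq0.
  set A := pint G r (r + h) t (t + k) in b5; set B := pint G r (r + h) _ _ in b5.
  set A' := pint G (r + h) _ t (t + k) in b5; set B' := pint G (r + h) _ _ _ in b5.
  set K' := K / 4 ^+ n.+1 in e4.
  have [a1|a1] := leP K' (nc A).
    exists (r, t); split; last by rewrite /nxt /= !lexx !lerDl.
    by split.
  have [a2|a2] := leP K' (nc B).
    exists (r, t + k); split; last by rewrite /nxt /= !lexx !lerDl.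
    by split.
  have [a3|a3] := leP K' (nc A').
    exists (r + h, t); split; last by rewrite /nxt /= !lexx !lerDl.
    by split.
  have [a4|a4] := leP K' (nc B').
    exists (r + h, t + k); split; last by rewrite /nxt /= !lexx !lerDl.
    by split.
  have := ncD (A + B) (A' + B'); have := ncD A B; have := ncD A' B'; lra.
have /choice [F hF] (p : nat * (R * R)) :
    exists q, bad p.1 p.2 -> bad p.1.+1 q /\ nxt p.1 p.2 q.
  case: p => n q; have [hb|hb] := pselect (bad n q); last by exists q => /hb.
  by have [q' hq] := step _ _ hb; exists q'.
pose s := fix s n := if n is m.+1 then F (m, s m) else (ra, t1).
have bs n : bad n (s n).
  elim: n => [|n IH]; last by have [] := hF (n, s n) IH.
  split => //=; rewrite /dr /dt ?expr0 ?divr1 //; try by rewrite addrC subrK.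
  by rewrite ![_ + (_ - _)]addrC !subrK.
have ns n : nxt n (s n) (s n.+1) by have [] := hF (n, s n) (bs n).
have [r hr] : exists x, forall n, (s n).1 <= x <= (s n).1 + dr n.
  apply: nested_intervals => // n; have [] := ns n => //.
  by move=> _ + _ _; rewrite [dr n]drS addrA lerD2r.
have [t ht] : exists x, forall n, (s n).2 <= x <= (s n).2 + dt n.
  apply: nested_intervals => // n; have [] := ns n => //.
  by move=> _ _ _; rewrite [dt n]dtS addrA lerD2r.
have hra : ra <= r <= rb.
  have := hr 0%N; rewrite /= /dr expr0 divr1 [ra + _]addrC subrK //.
pose z := polar r t; have [d hd] := hG z (annulus_polar t hra).
pose L := (rb - ra) + (t2 - t1).
have L0 : 0 <= L by rewrite addr_ge0 // subr_ge0.
(* The estimate below gives [K <= 8 e L ^ 2], which this choice contradicts; the summand 1 covers a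
   degenerate rectangle with [L = 0]. *)
pose e := K / (16 * L ^+ 2 + 1).
have D0 : 0 < 16 * L ^+ 2 + 1 by rewrite ltr_wpDl // mulr_ge0 // sqr_ge0.
have e0 : 0 < e by rewrite divr_gt0.
have [del del0 hdel] := hd e e0.
have [n hn] : exists n, 2 * L / 2 ^+ n < del.
  have [n hn] : exists n : nat, 2 * L / del < n%:R.
    by exists (Num.bound (2 * L / del)); rewrite (le_lt_trans _ (archi_boundP _)) // divr_ge0 ?mulr_ge0 // ltW.
  exists n; rewrite ltr_pdivrMr ?exprn_gt0 // [del * _]mulrC -ltr_pdivrMr // (lt_trans hn) //.
  by rewrite -natrX ltr_nat ltn_expl.
have [b1 b2 b3 b4 b5] := bs n.
(* The first-order approximation of [G] at [z], written so that it is visibly affine in [y]. *)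
pose H y := (G z - d * z) + d * y.
pose E y := G y - H y.
have cH : cont_ann H by move=> y _; exact: affine_cont.
have cE : cont_ann E.
  by move=> y hy; exact: (cvgB (cG y hy) (cH y hy)).
have dn : dr n + dt n = L / 2 ^+ n by rewrite /dr /dt -mulrDl.
have hE u v : (s n).1 <= u <= (s n).1 + dr n -> (s n).2 <= v <= (s n).2 + dt n ->
    nc (E (polar u v)) <= e * (2 * L / 2 ^+ n).
  move=> hu hv; have hz : nc (polar u v - z) <= 2 * L / 2 ^+ n.
    rewrite (le_trans (polar_dist _ _ _ _)) // -mulrA -dn.
    have x1 : `|u - r| <= dr n by rewrite ler_norml; have := hr n; lra.
    have x2 : `|v - t| <= dt n by rewrite ler_norml; have := ht n; lra.
    have x3 : `|r| <= 1.
      case/andP: hra => k1 k2.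
      by rewrite ger0_norm ?(le_trans k2 rb1) // (le_trans ra0 k1).
    have : `|r| * (2 * `|v - t|) <= 2 * dt n by rewrite -[leRHS]mul1r ler_pM // ler_wpM2l.
    have := dr0 n; lra.
  have -> : E (polar u v) = G (polar u v) - G z - d * (polar u v - z).
    by rewrite /E /H; ring.
  rewrite (le_trans (hdel _ (le_lt_trans hz hn))) // ler_wpM2l // ltW //.
have hle : nc (pint E (s n).1 ((s n).1 + dr n) (s n).2 ((s n).2 + dt n)) <=
    4 * (e * (2 * L / 2 ^+ n)) * (dr n + dt n).
  have := @pint_le E _ _ _ _ _ cE b1 _ b2 _ hE.
  by rewrite !lerDl => /(_ (dr0 n) (dt0 n)); rewrite ![_ + _ - _]addrAC !subrr !add0r.
have eqE : pint E (s n).1 ((s n).1 + dr n) (s n).2 ((s n).2 + dt n) =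
    pint G (s n).1 ((s n).1 + dr n) (s n).2 ((s n).2 + dt n).
  by rewrite /E (pintB _ _ cG cH) ?lerDl // pint_affine ?lerDl // subr0.
rewrite eqE dn in hle.
have := le_trans b5 hle.
have -> : 4 * (e * (2 * L / 2 ^+ n)) * (L / 2 ^+ n) = 8 * e * L ^+ 2 / 4 ^+ n.
  have -> : (4 : R) ^+ n = 2 ^+ n * 2 ^+ n by rewrite -exprMn; congr (_ ^+ _); ring.
  by field; rewrite expf_neq0.
rewrite ler_pM2r ?invr_gt0 ?exprn_gt0 // /e => hK.
have : K * (16 * L ^+ 2 + 1) <= 8 * K * L ^+ 2.
  rewrite -ler_pdivlMr //; have <- : 8 * (K / (16 * L ^+ 2 + 1)) * L ^+ 2 =
    8 * K * L ^+ 2 / (16 * L ^+ 2 + 1) by field; rewrite gt_eqF.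
  exact: hK.
have := mulr_ge0 (ltW K0) (sqr_ge0 L); lra.
Qed.

End PolarRectangle.

(** Over a full turn the two radial edges coincide and cancel in [goursat], which leaves the two
    circles. *)
Lemma circle_const G ra rb : 0 <= ra -> ra <= rb -> rb <= 1 ->
  (forall z, ra <= nc z <= rb -> cdiff G z) ->
  cint 0 (2 * pi) (fun t => G (polar ra t) * polar ra t) =
  cint 0 (2 * pi) (fun t => G (polar rb t) * polar rb t).
Proof.
move=> ra0 rab rb1 hG.
have pi0 : 0 <= 2 * pi :> R by rewrite mulr_ge0 // pi_ge0.
have := goursat ra0 rb1 rab pi0 hG; rewrite /pint.
have -> : radf G (2 * pi) = radf G 0.
  by apply/funext => r; rewrite /radf !polar_2pi.
have cG : cont_ann ra rb G by move=> z /hG; exact: cdiff_cont.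
have key r : ra <= r <= rb -> cint 0 (2 * pi) (arcf G r) =
    'i%C * cint 0 (2 * pi) (fun t => G (polar r t) * polar r t).
  move=> hr; rewrite -cintZ; first by apply: eq_cint => t _; rewrite /arcf; ring.
  apply: (@cont_onM _ _ _ (fun t => G (polar r t)) (fun t => polar r t)).
    move=> t _; apply: cvg_comp (@polar_cont_t r t) _.
    by apply: cG; exact: annulus_polar.
  exact: (@cont_onT _ _ _ _ (@polar_cont_t r)).
rewrite !key ?lexx ?rab // => h.
have i0 : ('i%C : C) != 0 by rewrite -nc_eq0 nc_i oner_eq0.
apply: (mulfI i0); apply/esym/eqP; rewrite -subr_eq0 -h; apply/eqP; ring.
Qed.

End Goursat.

(** * Cauchy's formula and Taylor estimates in one variable *)

Section Cauchy.
Variable R : realType.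
Notation C := R[i].
Notation nc := (@Normc.normc R).
Notation Re := (@complex.Re R).
Notation Im := (@complex.Im R).
Notation mu := (@lebesgue_measure R).
Notation polar := (@polar R).
Notation p2 := (2 * pi : R).

Lemma p2_gt0 : 0 < p2. Proof. by rewrite mulr_gt0 // pi_gt0. Qed.
Lemma p2_ge0 : 0 <= p2. Proof. exact: ltW p2_gt0. Qed.

Lemma cdiffP (g : C -> C) z : cdiff g z <-> derivable g z 1.
Proof.
split=> [[d hd]|/cvg_ex [d]].
  apply/cvg_ex; exists d; apply/cvgC => e e0.
  have e2 : 0 < e / 2 by rewrite divr_gt0.
  have [del del0 h] := hd _ e2.
  apply/nbhsC; exists del => // y; rewrite subr0 => ydel yn0 /=.
  have ny : 0 < nc y by rewrite nc_gt0.
  have ydel' : nc (y + z - z) < del by rewrite addrK.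
  have := h _ ydel'; rewrite addrK => h1.
  have -> : y^-1 *: (g (y *: 1 + z) - g z) - d = y^-1 * (g (y + z) - g z - d * y).
    by rewrite /GRing.scale /= mulr1; field.
  rewrite ncM ncV mulrC ltr_pdivrMr // (le_lt_trans h1) // ltr_pM2r //.
  by rewrite ltr_pdivrMr // mulr_natr mulr2n ltrDl.
move=> /cvgC hd; exists d => e e0.
have /nbhsC [del del0 h] := hd e e0.
exists del => // y ydel; have [->|yz] := eqVneq y z.
  by rewrite !subrr mulr0 subrr nc0 mulr0.
have yz0 : y - z != 0 by rewrite subr_eq0.
have := h (y - z); rewrite subr0 => /(_ ydel yz0) /= h1.
have -> : g y - g z - d * (y - z) =
    ((y - z)^-1 *: (g ((y - z) *: 1 + z) - g z) - d) * (y - z).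
  by rewrite /GRing.scale /= mulr1 subrK; field.
by rewrite ncM ler_wpM2r ?nc_ge0 // ltW.
Qed.

Lemma cdiff_cst (c z : C) : cdiff (fun=> c : C) z.
Proof. by apply/cdiffP; exact: derivable_cst. Qed.
Lemma cdiff_id (z : C) : cdiff (fun x : C => x) z.
Proof. by apply/cdiffP; exact: derivable_id. Qed.
Lemma cdiffB (f g : C -> C) (z : C) : cdiff f z -> cdiff g z -> cdiff (fun x => f x - g x) z.
Proof. by move=> /cdiffP hf /cdiffP hg; apply/cdiffP; exact: (derivableB hf hg). Qed.
Lemma cdiffM (f g : C -> C) (z : C) : cdiff f z -> cdiff g z -> cdiff (fun x => f x * g x) z.
Proof. by move=> /cdiffP hf /cdiffP hg; apply/cdiffP; exact: (derivableM hf hg). Qed.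
Lemma cdiffV (f : C -> C) (z : C) : f z != 0 -> cdiff f z -> cdiff (fun x => (f x)^-1) z.
Proof. by move=> h /cdiffP hf; apply/cdiffP; exact: (derivableV h hf). Qed.
Lemma cdiffX n (z : C) : cdiff (fun x : C => x ^+ n) z.
Proof.
elim: n => [|n IH]; first exact: cdiff_cst.
have -> : (fun x : C => x ^+ n.+1) = (fun x => x * x ^+ n) by apply/funext => x; rewrite exprS.
by apply: cdiffM => //; exact: cdiff_id.
Qed.

Lemma contM (f g : C -> C) (z : C) : ccont f z -> ccont g z ->
  ccont (fun x => f x * g x) z.
Proof. by move=> hf hg; exact: (cvgM hf hg). Qed.

Lemma cdiff_near (f g : C -> C) (z : C) (e : R) : 0 < e -> (forall y, nc (y - z) < e -> f y = g y) ->
  cdiff f z -> cdiff g z.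
Proof.
move=> e0 h [d hd]; exists d => e1 e10; have [del del0 hdel] := hd e1 e10.
exists (Num.min e del); first by rewrite lt_min e0.
move=> y; rewrite lt_min => /andP[y1 y2]; rewrite -!h ?subrr ?nc0 //; exact: hdel.
Qed.

Lemma circ_cont a b (H : C -> C) r : (forall z, nc z = `|r| -> ccont H z) ->
  cont_on a b (fun t => H (polar r t)).
Proof.
move=> h t _; apply: cvg_comp (@polar_cont_t _ r t) _.
by apply: h; rewrite nc_polar.
Qed.

Lemma bounded_rect (a b c d : R) (F : R -> R -> C) :
  (forall x y, a <= x <= b -> c <= y <= d -> forall e, 0 < e -> exists2 del, 0 < del &
    forall x' y', `|x' - x| < del -> `|y' - y| < del -> nc (F x' y' - F x y) < e) ->
  exists2 M, 0 <= M & forall x y, a <= x <= b -> c <= y <= d -> nc (F x y) <= M.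
Proof.
move=> h; pose f (p : R * R) : R := nc (F p.1 p.2).
have cK : compact (`[a, b]%classic `*` `[c, d]%classic : set (R * R)).
  by apply: compact_setX; exact: segment_compact.
have cf : {within `[a, b]%classic `*` `[c, d]%classic, continuous f}.
  apply: continuous_in_subspaceT => -[x y]; rewrite inE /= !in_itv /= => -[hx hy].
  apply/cvgrPdist_lt => e e0; have [del del0 hd] := h x y hx hy e e0.
  exists (ball x del, ball y del); first by split; exact: nbhsx_ballx.
  move=> [x' y'] [/= hx' hy'].
  rewrite /f /=; have := hd x' y'; rewrite distrC => /(_ hx'); rewrite distrC => /(_ hy').
  apply: le_lt_trans; rewrite ler_norml.
  have := ler_ncB (F x' y') (F x y); have := ler_ncB (F x y) (F x' y').
  by rewrite (nc_dist (F x y)); lra.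
have /compact_bounded [M [Mr hM]] := continuous_compact cf cK.
exists (`|M| + 1); first by rewrite addr_ge0.
move=> x y hx hy; have := hM (`|M| + 1); rewrite (le_lt_trans (ler_norm M)) ?ltrDl //.
move=> /(_ isT (f (x, y))); rewrite /f /= ger0_norm ?nc_ge0 //; apply.
by exists (x, y) => //=; rewrite !in_itv.
Qed.

Lemma bounded_polar (H : C -> C) (a b : R) : -1 < a -> b < 1 ->
  (forall z, nc z < 1 -> ccont H z) ->
  exists2 M, 0 <= M & forall r t, a <= r <= b -> 0 <= t <= p2 -> nc (H (polar r t)) <= M.
Proof.
move=> a1 b1 hH; apply: bounded_rect => r t /andP[hr1 hr2] ht e e0.
have r1 : `|r| < 1 by rewrite ltr_norml (lt_le_trans a1 hr1) (le_lt_trans hr2 b1).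
have [|del del0 h] := (continuousC H (polar r t)).1 _ e e0.
  by apply: hH; rewrite nc_polar.
exists (del / 4); first by rewrite divr_gt0.
move=> r' t' hr' ht'; apply: h; rewrite (le_lt_trans (polar_dist _ _ _ _)) //.
have : `|r| * (2 * `|t' - t|) <= 2 * `|t' - t| by rewrite ler_piMl ?mulr_ge0 // ltW.
have := normr_ge0 (t' - t); lra.
Qed.

Lemma continuous_circle_integral (H : C -> C) (r : R) : -1 < r < 1 ->
  (forall z, nc z < 1 -> ccont H z) ->
  {for r, continuous (fun r => cint 0 p2 (fun t => H (polar r t)))}.
Proof.
move=> /andP[r1 r2] hH.
pose u := (r - 1) / 2; pose v := (r + 1) / 2.
have u1 : -1 < u by rewrite /u; lra.
have v1 : v < 1 by rewrite /v; lra.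
have ruv : r \in `]u, v[%classic by rewrite inE /= in_itv /= /u /v; lra.
have [M M0 hM] := bounded_polar u1 v1 hH.
have hc x : `]u, v[%classic x -> cont_on 0 p2 (fun t => H (polar x t)).
  rewrite /= in_itv /= => /andP[x1 x2]; apply: circ_cont => z hz; apply: hH.
  by rewrite hz ltr_norml (lt_trans u1 x1) (lt_trans x2 v1).
have hr x y : x \in `]u, v[%classic -> {for x, continuous (fun r => H (polar r y))}.
  rewrite inE /= in_itv /= => /andP[x1 x2]; apply: cvg_comp (@polar_cont_r _ y x) _.
  by apply: hH; rewrite nc_polar ltr_norml (lt_trans u1 x1) (lt_trans x2 v1).
have hb x y : `]u, v[%classic x -> `[0, p2]%classic y -> nc (H (polar x y)) <= M.
  by rewrite /= !in_itv /= => /andP[x1 x2] hy; apply: hM => //; rewrite !ltW.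
have iM : mu.-integrable `[0, p2] (EFin \o cst M).
  apply: continuous_compact_integrable; first exact: segment_compact.
  by apply: continuous_subspaceT => t; exact: cvg_cst.
apply: cvg_ReImC.
  apply: (@continuity_under_integral R _ _ mu (fun x y => Re (H (polar x y))) `[0, p2]%classic _ u v _ _ (cst M)) => //.
  - by move=> x hx; exact: (cont_on_iRe (hc x hx)).
  - by apply: aeW => y _ x hx; apply: cvg_ReC; exact: hr.
  - by move=> x hx; apply: aeW => y hy; apply: le_trans (Re_le_nc _) (hb x y hx hy).
apply: (@continuity_under_integral R _ _ mu (fun x y => Im (H (polar x y))) `[0, p2]%classic _ u v _ _ (cst M)) => //.
- by move=> x hx; exact: (cont_on_iIm (hc x hx)).
- by apply: aeW => y _ x hx; apply: cvg_ImC; exact: hr.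
- by move=> x hx; apply: aeW => y hy; apply: le_trans (Im_le_nc _) (hb x y hx hy).
Qed.

Section CauchyFormula.
Variable g : C -> C.
Hypothesis hg : forall z, nc z < 1 -> cdiff g z.

(** The slope [G] of [g] at [z], completed by the derivative [d], is continuous on the disc and
    differentiable off [z]. Its circle integral [J] is therefore constant on either side of the
    radius [|z|], continuous there, and 0 at radius 0. *)
Lemma slope_integral0 z r : nc z < 1 -> nc z < r -> r < 1 ->
  cint 0 p2 (fun t => (g (polar r t) - g z) / (polar r t - z) * polar r t) = 0.
Proof.
move=> z1 zr r1; have [d hd] := hg z1.
pose G x := if x == z then d else (g x - g z) / (x - z).
pose J r := cint 0 p2 (fun t => G (polar r t) * polar r t).
have Gd x : nc x < 1 -> x != z -> cdiff G x.
  move=> x1 xz; have e0 : 0 < nc (x - z) by rewrite nc_gt0 subr_eq0.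
  apply: (@cdiff_near (fun y => (g y - g z) * (y - z)^-1) _ _ _ e0).
    move=> y hy; rewrite /G; case: eqP => // yz.
    by move: hy; rewrite yz nc_dist ltxx.
  apply: cdiffM; first by apply: cdiffB; [exact: hg|exact: cdiff_cst].
  apply: cdiffV; first by rewrite subr_eq0.
  by apply: cdiffB; [exact: cdiff_id|exact: cdiff_cst].
have Gc x : nc x < 1 -> ccont G x.
  move=> x1; have [->|xz] := eqVneq x z; last exact: cdiff_cont (Gd x x1 xz).
  apply/continuousC => e e0; have e2 : 0 < e / 2 by rewrite divr_gt0.
  have [del del0 h] := hd _ e2; exists del => // y yz; rewrite /G eqxx.
  case: eqP => [_|/eqP ynz]; first by rewrite subrr nc0.
  have ny : 0 < nc (y - z) by rewrite nc_gt0 subr_eq0.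
  have -> : (g y - g z) / (y - z) - d = (g y - g z - d * (y - z)) / (y - z).
    by field; rewrite subr_eq0.
  rewrite ncM ncV ltr_pdivrMr // (le_lt_trans (h y yz)) // ltr_pM2r //.
  by rewrite ltr_pdivrMr // mulr_natr mulr2n ltrDl.
have cJ s : -1 < s < 1 -> {for s, continuous J}.
  move=> hs; have Gx x : nc x < 1 -> ccont (fun x => G x * x) x.
    by move=> x1; exact: (contM (Gc x x1) (cdiff_cont (cdiff_id x))).
  exact: (@continuous_circle_integral (fun x => G x * x) s hs Gx).
have J0 s : 0 <= s -> s < nc z -> J s = 0.
  move=> s0 sz; rewrite /J -(@circle_const _ G 0 s) //.
  - rewrite [LHS](_ : _ = cint 0 p2 (fun=> 0)); last first.
      by apply: eq_cint => t _; rewrite (_ : polar 0 t = 0) ?mulr0 // polarE mul0r.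
    by rewrite cint_cst ?mulr0 // p2_ge0.
  - by rewrite ltW // (lt_trans sz).
  - move=> x /andP[_ xs]; have xz := le_lt_trans xs sz.
    by apply: Gd; [exact: lt_trans xz z1|apply/eqP => E; rewrite E ltxx in xz].
have cJz e : 0 < e -> exists2 del : R, 0 < del &
    forall s, `|s - nc z| < del -> nc (J s - J (nc z)) < e.
  have : {for nc z, continuous J}.
    by apply: cJ; rewrite z1 andbT (lt_le_trans _ (nc_ge0 _)) // ltrN10.
  move=> /(@cvgC _ _ _ (nbhs_filter (nc z))) h e0.
  have /nbhs_ballP [del /= del0 hdel] := h e e0.
  by exists del => // s hs; apply: hdel; rewrite /ball /= distrC.
have Jz : J (nc z) = 0.
  have [z0|z0] := eqVneq (nc z) 0.
    rewrite z0 /J [LHS](_ : _ = cint 0 p2 (fun=> 0)); last first.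
      by apply: eq_cint => t _; rewrite (_ : polar 0 t = 0) ?mulr0 // polarE mul0r.
    by rewrite cint_cst ?mulr0 // p2_ge0.
  have nz : 0 < nc z by rewrite lt_def z0 nc_ge0.
  apply/eqP; rewrite -nc_eq0 eq_le nc_ge0 andbT leNgt; apply/negP => K0.
  have [del del0 h] := cJz _ K0.
  have [lzd|dlz] := leP (del / 2) (nc z).
    have := h (nc z - del / 2); rewrite J0 ?sub0r ?ncN ?ltxx ?subr_ge0 //; last first.
      by rewrite ltrBlDr ltrDl divr_gt0.
    rewrite addrAC subrr add0r normrN ger0_norm ?divr_ge0 ?(ltW del0) // => /(_ _)/notF.
    by apply; rewrite ltr_pdivrMr // mulr_natr mulr2n ltrDl.
  have := h 0; rewrite J0 // [0 - J _]sub0r ncN ltxx sub0r normrN ger0_norm ?nc_ge0 // => /(_ _)/notF.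
  by apply; rewrite (lt_trans dlz) // ltr_pdivrMr // mulr_natr mulr2n ltrDl.
have r0 : 0 <= r by rewrite (le_trans (nc_ge0 z)) // ltW.
have Jr : J r = 0.
  apply/eqP; rewrite -nc_eq0 eq_le nc_ge0 andbT leNgt; apply/negP => K0.
  have [del del0 h] := cJz _ K0.
  pose s := Num.min r (nc z + del / 2).
  have sz : nc z < s by rewrite lt_min zr ltrDl divr_gt0.
  have sr : s <= r by rewrite ge_min lexx.
  have := h s; rewrite Jz subr0 (_ : J s = J r); last first.
    apply: circle_const => //; first by rewrite (le_trans (nc_ge0 z)) // ltW.
      exact: ltW.
    move=> x /andP[sx xr]; apply: Gd; first exact: le_lt_trans xr r1.
    by apply: contraTneq sx => ->; rewrite -ltNge.
  rewrite ltxx => /(_ _)/notF; apply.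
  rewrite ger0_norm ?subr_ge0 ?(ltW sz) // ltrBlDl gt_min; apply/orP; right.
  by rewrite ltrD2l ltr_pdivrMr // mulr_natr mulr2n ltrDl.
rewrite -Jr; apply: eq_cint => t _; rewrite /G.
case: eqP => // E; move: zr; rewrite -E nc_polar ger0_norm //; by rewrite ltxx.
Qed.

Lemma polarX (r t : R) n : polar r t ^+ n = polar (r ^+ n) (n%:R * t).
Proof.
elim: n => [|n IH].
  by rewrite !expr0 mul0r; apply: complex_ext; rewrite /= ?cos0 ?sin0 ?mulr0 ?mulr1.
by rewrite exprS IH polar_mul -exprS mulrSr mulrDl mul1r addrC.
Qed.

Lemma polarV (r t : R) : r != 0 -> (polar r t)^-1 = polar r^-1 (- t).
Proof.
move=> r0; apply: (mulfI (polar_neq0 t r0)); rewrite mulfV ?polar_neq0 //.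
rewrite polar_mul mulfV // subrr; apply: complex_ext; rewrite /= ?cos0 ?sin0; ring.
Qed.

Lemma cint_power (a : R) (k : int) : k != 0 ->
  cint 0 p2 (fun t => polar a (k%:~R * t)) = 0.
Proof.
move=> k0; have kC : (k%:~R : C) != 0 by rewrite intr_eq0.
have hd : cder (fun t => ('i%C * k%:~R)^-1 * polar a (k%:~R * t)) (fun t => polar a (k%:~R * t)).
  have i0 : ('i%C : C) != 0 by rewrite -nc_eq0 nc_i oner_eq0.
  have h : cder (fun t => polar a (k%:~R * t)) (fun t => 'i%C * k%:~R * polar a (k%:~R * t)).
    move=> t; have hl : is_derive t (1 : R) (fun t : R => k%:~R * t) k%:~R.
      have -> : (fun t : R => k%:~R * t) = (cst k%:~R : R -> R) * id by [].
      by apply: is_derive_eq; rewrite /= /GRing.scale /=; ring.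
    have [h1 h2] := cder_polar_t a (k%:~R * t).
    have e1 : (k%:~R : C) = (k%:~R : R)%:C%C by rewrite rmorph_int.
    split.
      have := @is_derive1_comp _ (Re \o polar a) _ t _ _ h1 hl.
      by congr is_derive; rewrite e1 /=; ring.
    have := @is_derive1_comp _ (Im \o polar a) _ t _ _ h2 hl.
    by congr is_derive; rewrite e1 /=; ring.
  have := cderM (@cder_cst _ ('i%C * k%:~R)^-1) h; congr cder; apply/funext => t /=.
  by field; apply/andP.
have hc : continuous (fun t : R => polar a (k%:~R * t)).
  move=> t; apply: (@cvg_comp _ _ _ (fun t : R => k%:~R * t)); last exact: polar_cont_t.
  by apply: cvgM; [exact: cvg_cst|exact: cvg_id].
rewrite (cint_FTC p2_ge0 hd (cont_onT hc)) -mulrBr mulr0.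
have per n : polar a (n%:R * p2) = polar a 0.
  rewrite polarE [RHS]polarE; congr (_ * _).
  have -> : polar 1 (n%:R * p2) = polar 1 p2 ^+ n by rewrite polarX expr1n.
  by rewrite polar_2pi polarX expr1n mulr0.
case: k {k0 kC hd hc} => n; first by rewrite [_ * p2](_ : _ = n%:R * p2) // per subrr mulr0.
rewrite NegzE mulrNz mulNr -polar_conj [_ * p2](_ : _ = n.+1%:R * p2) // per.
by rewrite polar_conj oppr0 subrr mulr0.
Qed.

Definition cauchy_coef (h : C -> C) (r : R) (m : nat) : C :=
  (p2^-1)%:C%C * cint 0 p2 (fun t => h (polar r t) * (polar r t ^+ m)^-1).

Lemma cint_mean_le (F : R -> C) M : cont_on 0 p2 F ->
  (forall t, 0 <= t <= p2 -> nc (F t) <= M) ->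
  nc ((p2^-1)%:C%C * cint 0 p2 F) <= 2 * M.
Proof.
move=> hF hM; rewrite ncM nc_real ger0_norm ?invr_ge0 ?p2_ge0 //.
rewrite mulrC ler_pdivrMr ?p2_gt0 //.
by have := cint_le p2_ge0 hF hM; rewrite subr0.
Qed.

(** The geometric expansion of [x / (x - z)] in powers of [z / x], integrated over the circle; [h]
    only has to be continuous on it. The remainder is [(z / x) ^ N] times the kernel, and the factor
    2 is that of [cint_le]. *)
Lemma cauchy_kernel (h : C -> C) z r M N : nc z < r -> 0 <= M ->
  (forall x, nc x = r -> ccont h x) ->
  (forall t, 0 <= t <= p2 -> nc (h (polar r t)) <= M) ->
  nc ((p2^-1)%:C%C * cint 0 p2 (fun t => h (polar r t) * (polar r t / (polar r t - z))) -
      \sum_(m < N) cauchy_coef h r m * z ^+ m) <= 2 * M * (nc z / r) ^+ N * (r / (r - nc z)).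
Proof.
move=> zr M0 ch hM.
have r0 : 0 < r := le_lt_trans (nc_ge0 z) zr.
have pr0 t : polar r t != 0 by rewrite polar_neq0 // gt_eqF.
have xz x : nc x = r -> x - z != 0.
  by move=> xr; rewrite subr_eq0; apply: contraTneq zr => <-; rewrite xr ltxx.
have x0 x : nc x = r -> x != 0 by move=> xr; rewrite -nc_gt0 xr.
have np t : nc (polar r t) = r by rewrite nc_polar ger0_norm // ltW.
have crc f : (forall x, nc x = r -> ccont f x) ->
    cont_on 0 p2 (fun t => f (polar r t)).
  by move=> hf; apply: circ_cont => x; rewrite ger0_norm ?(ltW r0) //; exact: hf.
have cm m x : nc x = r -> ccont (fun x => h x * (x ^+ m)^-1) x.
  move=> xr; have xm : x ^+ m != 0 by rewrite expf_neq0 // x0.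
  exact: (contM (ch x xr) (cdiff_cont (cdiffV (f := fun y => y ^+ m) xm (cdiffX m x)))).
have ck x : nc x = r -> ccont (fun x => h x * (x / (x - z))) x.
  move=> xr; have hB := cdiffB (cdiff_id x) (cdiff_cst z x).
  exact: (contM (ch x xr) (cdiff_cont (cdiffM (cdiff_id x) (cdiffV (f := fun y => y - z) (xz x xr) hB)))).
have sumE : \sum_(m < N) cauchy_coef h r m * z ^+ m = (p2^-1)%:C%C * cint 0 p2 (fun t =>
    \sum_(m < N) z ^+ m * (h (polar r t) * (polar r t ^+ m)^-1)).
  have [|-> _] := @cint_sum _ 0 p2 N (fun m t => z ^+ m * (h (polar r t) * (polar r t ^+ m)^-1)).
    by move=> k _; exact: (cont_onM (@cont_on_cst _ 0 p2 (z ^+ k)) (crc _ (cm k))).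
  rewrite mulr_sumr; apply: eq_bigr => m _; rewrite cintZ; last exact: crc _ (cm m).
  by rewrite /cauchy_coef; ring.
have cS : cont_on 0 p2 (fun t => \sum_(m < N) z ^+ m * (h (polar r t) * (polar r t ^+ m)^-1)).
  have [|_ //] := @cint_sum _ 0 p2 N (fun m t => z ^+ m * (h (polar r t) * (polar r t ^+ m)^-1)).
  by move=> k _; exact: (cont_onM (@cont_on_cst _ 0 p2 (z ^+ k)) (crc _ (cm k))).
rewrite sumE -mulrBr -(cintB (crc _ ck) cS) -!mulrA.
have geo t : h (polar r t) * (polar r t / (polar r t - z)) -
    \sum_(m < N) z ^+ m * (h (polar r t) * (polar r t ^+ m)^-1) =
    h (polar r t) * ((z / polar r t) ^+ N * (polar r t / (polar r t - z))).
  have xz' := xz _ (np t); have p0 := pr0 t; set x := polar r t in xz' p0 *.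
  have -> : \sum_(m < N) z ^+ m * (h x * (x ^+ m)^-1) = h x * \sum_(m < N) (z / x) ^+ m.
    by rewrite mulr_sumr; apply: eq_bigr => m _; rewrite expr_div_n; ring.
  rewrite -mulrBr; congr (_ * _).
  have q1 : 1 - z / x != 0 by rewrite -{1}(divff p0) -mulrBl mulf_neq0 // invr_neq0.
  have -> : \sum_(m < N) (z / x) ^+ m = (1 - (z / x) ^+ N) / (1 - z / x).
    by apply: (mulIf q1); rewrite mulfVK // mulrC -(opprB _ 1) mulNr -subrX1 opprB.
  have -> : (1 - z / x)^-1 = x / (x - z) by field; apply/andP.
  ring.
rewrite (eq_cint (fun t _ => geo t)).
apply: cint_mean_le => [|t tp].
  have := cont_onD (crc _ ck) (cont_onM (@cont_on_cst _ 0 p2 (-1)) cS).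
  by congr cont_on; apply/funext => t; rewrite mulN1r geo.
rewrite ncM ler_pM ?nc_ge0 ?hM //.
have -> : nc ((z / polar r t) ^+ N * (polar r t / (polar r t - z))) =
    (nc z / r) ^+ N * (r / nc (polar r t - z)) by rewrite ncM ncX !ncM !ncV np.
rewrite ler_wpM2l ?exprn_ge0 ?divr_ge0 ?nc_ge0 ?(ltW r0) // ler_pM2l //.
rewrite lef_pV2 ?posrE ?subr_gt0 ?nc_gt0 ?xz //.
by have := ler_ncB (polar r t) z; rewrite np.
Qed.

Lemma cvg_geo_bound (K q e : R) : 0 <= q < 1 -> 0 < e -> exists N, forall n, (N <= n)%N -> K * q ^+ n < e.
Proof.
move=> /andP[q0 q1] e0; have K0 : 0 < `|K| + 1 by rewrite ltr_wpDl.
have aq : `|q| < 1 by rewrite ger0_norm.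
have /cvgrPdist_lt /(_ (e / (`|K| + 1)) (divr_gt0 e0 K0)) [N _ h] := cvg_expr aq.
exists N => n /h /=; rewrite sub0r normrN ger0_norm ?exprn_ge0 // => h2.
apply: (@le_lt_trans _ _ ((`|K| + 1) * q ^+ n)).
  by rewrite ler_wpM2r ?exprn_ge0 // (le_trans (ler_norm K)) // lerDl.
by rewrite mulrC -ltr_pdivlMr.
Qed.

Lemma cauchy_coef_series r m : 0 < r -> cauchy_coef (fun=> 1) r m = (m == 0)%:R.
Proof.
move=> r0; rewrite /cauchy_coef; case: m => [|m].
  rewrite (eq_cint (G := fun=> 1)); last by move=> t _; rewrite expr0 invr1 mulr1.
  rewrite cint_cst ?p2_ge0 // subr0 mulr1 -rmorphM /= mulVf ?gt_eqF ?p2_gt0 //.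
rewrite (eq_cint (G := fun t => polar (r ^+ m.+1)^-1 ((- m.+1%:Z)%:~R * t))).
  by rewrite cint_power ?mulr0.
move=> t _; rewrite mul1r polarX polarV ?expf_neq0 ?gt_eqF // -mulNr.
by rewrite mulrNz.
Qed.

Lemma cauchy_estimate z r M N : nc z < r -> r < 1 -> 0 <= M ->
  (forall t, 0 <= t <= p2 -> nc (g (polar r t)) <= M) ->
  nc (g z - \sum_(m < N) cauchy_coef g r m * z ^+ m) <= 2 * M * (nc z / r) ^+ N * (r / (r - nc z)).
Proof.
move=> zr r1 M0 hM; have z1 := lt_trans zr r1.
have r0 : 0 < r := le_lt_trans (nc_ge0 z) zr.
have ch x : nc x = r -> ccont g x by move=> xr; apply: cdiff_cont; apply: hg; rewrite xr.
apply: le_trans (cauchy_kernel N zr M0 ch hM).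
rewrite le_eqVlt; apply/orP; left; apply/eqP; congr (nc (_ - _)).
(* The kernel has mean 1: for the constant function 1 all coefficients but the first vanish, so
   [cauchy_kernel] puts the mean at a distance from 1 below every positive bound. *)
have k1 : (p2^-1)%:C%C * cint 0 p2 (fun t => 1 * (polar r t / (polar r t - z))) = 1.
  apply/eqP; rewrite -subr_eq0 -nc_eq0 eq_le nc_ge0 andbT leNgt; apply/negP => K0.
  set X := _ - 1 in K0.
  have q01 : 0 <= nc z / r < 1 by rewrite divr_ge0 ?nc_ge0 ?(ltW r0) // ltr_pdivrMr // mul1r.
  have [n hn] := cvg_geo_bound (2 * (r / (r - nc z))) q01 K0.
  have := hn n.+1 (leqnSn n).
  have cst1 x : nc x = r -> ccont (fun=> 1) x by move=> _; exact: cdiff_cont (cdiff_cst 1 x).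
  have le1 t : 0 <= t <= p2 -> nc ((fun=> 1) (polar r t)) <= 1 by rewrite nc1.
  have := cauchy_kernel n.+1 zr ler01 cst1 le1.
  rewrite big_ord_recl big1 => [|i _]; last by rewrite cauchy_coef_series // mul0r.
  rewrite cauchy_coef_series // expr0 mulr1 addr0 -/X mulr1 => h1 h2.
  by rewrite mulrAC in h1; have := le_lt_trans h1 h2; rewrite ltxx.
have xz t : polar r t - z != 0.
  by rewrite subr_eq0; apply: contraTneq zr => <-; rewrite nc_polar ger0_norm ?ltxx // ltW.
have crc f : (forall x, nc x = r -> ccont f x) ->
    cont_on 0 p2 (fun t => f (polar r t)).
  by move=> hf; apply: circ_cont => x; rewrite ger0_norm ?(ltW r0) //; exact: hf.
have ck x : nc x = r -> ccont (fun x => x / (x - z)) x.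
  move=> xr; have xz' : x - z != 0.
    by rewrite subr_eq0; apply: contraTneq zr => <-; rewrite xr ltxx.
  have hB := cdiffB (cdiff_id x) (cdiff_cst z x).
  exact: (cdiff_cont (cdiffM (cdiff_id x) (cdiffV (f := fun y => y - z) xz' hB))).
have cgk x : nc x = r -> ccont (fun x => g x * (x / (x - z))) x.
  by move=> xr; exact: contM (ch x xr) (ck x xr).
have := slope_integral0 z1 zr r1.
rewrite (eq_cint (G := fun t => g (polar r t) * (polar r t / (polar r t - z)) -
  g z * (polar r t / (polar r t - z)))); last first.
  by move=> t _; have := xz t; set x := polar r t => hx; field.
rewrite cintB ?cintZ; last 3 first.
- exact: crc _ ck.
- exact: crc _ cgk.
- exact: (cont_onM (@cont_on_cst _ 0 p2 (g z)) (crc _ ck)).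
move=> /subr0_eq ->; rewrite mulrCA.
have <- : cint 0 p2 (fun t => 1 * (polar r t / (polar r t - z))) =
    cint 0 p2 (fun t => polar r t / (polar r t - z)).
  by apply: eq_cint => t _; rewrite mul1r.
by rewrite k1 mulr1.
Qed.

(** The function [g x / x ^ (m + 1)] is differentiable on the annulus between the two circles, so
    [circle_const] applies. *)
Lemma cauchy_coef_indep r s m : 0 < r -> r <= s -> s < 1 -> cauchy_coef g r m = cauchy_coef g s m.
Proof.
move=> r0 rs s1.
suff E : cint 0 p2 (fun t => g (polar r t) * (polar r t ^+ m)^-1) =
    cint 0 p2 (fun t => g (polar s t) * (polar s t ^+ m)^-1) by rewrite /cauchy_coef E.
have e u : u != 0 -> cint 0 p2 (fun t => g (polar u t) * (polar u t ^+ m)^-1) =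
    cint 0 p2 (fun t => (g (polar u t) * (polar u t ^+ m.+1)^-1) * polar u t).
  move=> u0; apply: eq_cint => t _; rewrite exprS invfM; have := polar_neq0 t u0.
  set x := polar u t => x0; rewrite -!mulrA; congr (_ * _).
  by rewrite mulrCA [x^-1 * x]mulVf // mulr1.
have s0 := lt_le_trans r0 rs.
rewrite (e r (lt0r_neq0 r0)) (e s (lt0r_neq0 s0)).
have hG x : r <= nc x <= s -> cdiff (fun x => g x * (x ^+ m.+1)^-1) x.
  move=> /andP[x1 x2]; have x0 : x ^+ m.+1 != 0.
    by rewrite expf_neq0 // -nc_gt0 (lt_le_trans r0).
  exact: (cdiffM (hg (le_lt_trans x2 s1)) (cdiffV (f := fun y => y ^+ m.+1) x0 (cdiffX m.+1 x))).
exact: (circle_const (ltW r0) rs (ltW s1) hG).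
Qed.

End CauchyFormula.
End Cauchy.

(** * Convergence of complex series *)

Section ComplexSeries.
Variable R : realType.
Notation C := R[i].
Notation nc := (@Normc.normc R).
Notation Re := (@complex.Re R).
Notation Im := (@complex.Im R).

Definition csum (x : nat -> C) (s : C) := forall e : R, 0 < e ->
  exists N, forall n, (N <= n)%N -> nc (\sum_(m < n) x m - s) < e.

Lemma csumP x s : csum x s <-> (fun n => \sum_(m < n) x m) @ \oo --> s.
Proof.
split=> [h|/cvgC h e e0]; last by have [N _ hN] := h e e0; exists N.
by apply/cvgC => e e0; have [N hN] := h e e0; exists N.
Qed.

Lemma csum_uniq x s t : csum x s -> csum x t -> s = t.
Proof.
move=> hs ht; apply/eqP; rewrite -subr_eq0 -nc_eq0 eq_le nc_ge0 andbT leNgt.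
apply/negP => K0; have K2 : 0 < nc (s - t) / 2 by rewrite divr_gt0.
have [N1 h1] := hs _ K2; have [N2 h2] := ht _ K2.
have := h1 (maxn N1 N2) (leq_maxl _ _); have := h2 (maxn N1 N2) (leq_maxr _ _).
have := nc_sub s (\sum_(m < maxn N1 N2) x m) t; rewrite (nc_dist s (\sum_(m < _) x m)); lra.
Qed.

Lemma csum_lin c x s y t : csum x s -> csum y t ->
  csum (fun m => c * x m + y m) (c * s + t).
Proof.
move=> hs ht e e0; have c0 : 0 < 2 * (nc c + 1) by rewrite mulr_gt0 // ltr_wpDl ?nc_ge0.
have [N1 h1] := hs _ (divr_gt0 e0 c0); have [N2 h2] := ht _ (divr_gt0 e0 (ltr0n _ 2)).
exists (maxn N1 N2) => n; rewrite geq_max => /andP[/h1 k1 /h2 k2].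
have -> : \sum_(m < n) (c * x m + y m) - (c * s + t) =
    c * (\sum_(m < n) x m - s) + (\sum_(m < n) y m - t).
  by rewrite big_split /= -mulr_sumr; ring.
rewrite (le_lt_trans (ncD _ _)) // [ltRHS]splitr ler_ltD // ncM.
rewrite ltr_pdivlMr // in k1.
have : nc c * nc (\sum_(m < n) x m - s) <= (nc c + 1) * nc (\sum_(m < n) x m - s).
  by rewrite ler_wpM2r ?nc_ge0 // lerDl.
by move: k1; set X := nc (_ - s); set Y := nc c => k1 k3; lra.
Qed.

Lemma csum_ext x y s : (forall m, x m = y m) -> csum x s -> csum y s.
Proof. by move=> h; have -> : x = y by apply/funext. Qed.

Lemma csumZ c x s : csum x s -> csum (fun m => c * x m) (c * s).
Proof.
move=> hs; have h0 : csum (fun=> 0) 0.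
  by move=> e e0; exists 0%N => n _; rewrite big1 // subrr nc0.
have := csum_lin c hs h0; rewrite addr0; apply: csum_ext => m; exact: addr0.
Qed.

Lemma csum_le x s (B : R) : csum x s -> (forall n, nc (\sum_(m < n) x m) <= B) -> nc s <= B.
Proof.
move=> h hB; rewrite leNgt; apply/negP => K.
have K0 : 0 < nc s - B by rewrite subr_gt0.
have [N hN] := h _ K0; have := hN N (leqnn N); have := hB N.
have := ler_ncB s (\sum_(m < N) x m); rewrite nc_dist; lra.
Qed.

Lemma geo_le (q : R) n : 0 <= q < 1 -> \sum_(m < n) q ^+ m <= (1 - q)^-1.
Proof.
move=> /andP[q0 q1]; have d0 : 0 < 1 - q by rewrite subr_gt0.
rewrite -[leRHS]mul1r ler_pdivlMr // mulrC -(opprB q 1) mulNr -subrX1 opprB.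
by rewrite gerDl oppr_le0 exprn_ge0.
Qed.

Lemma csum_geo_le x s K q : csum x s -> 0 <= K -> 0 <= q < 1 ->
  (forall m, nc (x m) <= K * q ^+ m) -> nc s <= K / (1 - q).
Proof.
move=> h K0 q01 hx; apply: csum_le h _ => n.
rewrite (le_trans (nc_sum _ _ _)) // (@le_trans _ _ (\sum_(m < n) K * q ^+ m)) //.
  by apply: ler_sum => m _; exact: hx.
by rewrite -mulr_sumr ler_wpM2l // geo_le.
Qed.

Lemma csum_geo_exists x K q : 0 <= q < 1 ->
  (forall m, nc (x m) <= K * q ^+ m) -> exists s, csum x s.
Proof.
move=> /andP[q0 q1] hx.
have key (f : nat -> R) : (forall m, `|f m| <= K * q ^+ m) -> cvgn (series f).
  move=> hf; apply: normed_cvg; apply: (@series_le_cvg _ _ (geometric K q)).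
  - by move=> n; rewrite normr_ge0.
  - by move=> n; rewrite (le_trans _ (hf n)).
  - exact: hf.
  - by apply: is_cvg_geometric_series; rewrite ger0_norm.
have /cvg_ex [a ha] := key (Re \o x) (fun m => le_trans (Re_le_nc _) (hx m)).
have /cvg_ex [b hb] := key (Im \o x) (fun m => le_trans (Im_le_nc _) (hx m)).
exists (a +i* b)%C; apply/csumP; apply: cvg_ReImC.
  by under eq_fun do rewrite cRe_sum -(big_mkord xpredT (Re \o x)).
by under eq_fun do rewrite cIm_sum -(big_mkord xpredT (Im \o x)).
Qed.

Lemma csum_term_bound x s : csum x s -> exists2 K : R, 0 <= K & forall m, nc (x m) <= K.
Proof.
move=> /csumP h; have /cvg_ncC hn := h.
have /cvg_seq_bounded := cvgP _ hn => -[M [Mr hM]].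
exists (2 * (`|M| + 1)); first by rewrite mulr_ge0 // addr_ge0.
have hb n : nc (\sum_(m < n) x m) <= `|M| + 1.
  have := hM (`|M| + 1); rewrite (le_lt_trans (ler_norm M)) ?ltrDl // => /(_ isT n Logic.I).
  by rewrite /= ger0_norm // nc_ge0.
move=> m; have -> : x m = \sum_(k < m.+1) x k - \sum_(k < m) x k.
  by rewrite big_ord_recr /= addrAC subrr add0r.
by rewrite (le_trans (ncB _ _)) // mulr_natl mulr2n lerD.
Qed.

Lemma pser_coef_bound (a : nat -> C) s (r : R) : 0 < r -> csum (fun m => a m * (r%:C%C) ^+ m) s ->
  exists2 K : R, 0 <= K & forall m, nc (a m) <= K * r^-1 ^+ m.
Proof.
move=> r0 /csum_term_bound [K K0 hK]; exists K => // m.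
have := hK m; rewrite ncM ncX nc_real ger0_norm ?(ltW r0) // exprVn.
by rewrite -ler_pdivlMr ?exprn_gt0.
Qed.

End ComplexSeries.

(** * Taylor expansion of holomorphic functions of one and of two variables *)

Section PowerSeries.
Variable R : realType.
Notation C := R[i].
Notation nc := (@Normc.normc R).
Notation Re := (@complex.Re R).
Notation Im := (@complex.Im R).
Notation mu := (@lebesgue_measure R).
Notation polar := (@polar R).
Notation p2 := (2 * pi : R).

(** The condition [2^-1 <= r] allows coefficients defined on the circle of radius 1/2 to be
    recomputed on a circle around a given point. *)
Lemma between (x : R) : 0 <= x -> x < 1 -> exists r, [/\ x < r, 2^-1 <= r & r < 1].
Proof.
move=> x0 x1; exists ((Num.max x 2^-1 + 1) / 2); set M := Num.max _ _.
have h1 : x <= M by rewrite le_max lexx.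
have h2 : 2^-1 <= M by rewrite le_max lexx orbT.
have h3 : M < 1 by rewrite gt_max x1 invf_lt1 // ltr1n.
by split; lra.
Qed.

Lemma holomorphic_power_series (g : C -> C) :
  (forall z, nc z < 1 -> cdiff g z) ->
  forall z, nc z < 1 -> csum (fun m => cauchy_coef g 2^-1 m * z ^+ m) (g z).
Proof.
move=> hg z z1; have [r [zr hr r1]] := between (nc_ge0 z) z1.
have cg x : nc x < 1 -> ccont g x by move=> x1; exact: cdiff_cont (hg x x1).
have r0 : 0 < r := le_lt_trans (nc_ge0 z) zr.
have N1 : -1 < r by rewrite (lt_trans _ r0) // ltrN10.
have [M M0 hM] := bounded_polar N1 r1 cg.
have hM' t : 0 <= t <= p2 -> nc (g (polar r t)) <= M by move=> ht; apply: hM => //; rewrite lexx.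
have q01 : 0 <= nc z / r < 1 by rewrite divr_ge0 ?nc_ge0 ?(ltW r0) // ltr_pdivrMr // mul1r.
move=> e e0; have [N hN] := cvg_geo_bound (2 * M * (r / (r - nc z))) q01 e0.
exists N => n /hN; apply: le_lt_trans; rewrite nc_dist mulrAC.
have -> : \sum_(m < n) cauchy_coef g 2^-1 m * z ^+ m = \sum_(m < n) cauchy_coef g r m * z ^+ m.
  by apply: eq_bigr => m _; rewrite (cauchy_coef_indep hg m _ hr r1).
exact: (cauchy_estimate hg n zr r1 M0 hM').
Qed.

Lemma continuous_param_integral (F : R -> R -> C) (t0 M : R) :
  (forall t, cont_on 0 p2 (F t)) -> (forall u, continuous (F ^~ u)) ->
  (forall t u, t0 - 1 <= t <= t0 + 1 -> 0 <= u <= p2 -> nc (F t u) <= M) ->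
  {for t0, continuous (fun t => cint 0 p2 (F t))}.
Proof.
move=> h1 h2 hM.
have t0I : t0 \in `]t0 - 1, t0 + 1[%classic.
  by rewrite inE /= in_itv /=; lra.
have hb x y : `]t0 - 1, t0 + 1[%classic x -> `[0, p2]%classic y -> nc (F x y) <= M.
  by rewrite /= !in_itv /= => /andP[x1 x2] hy; apply: hM => //; rewrite !ltW.
have iM : mu.-integrable `[0, p2] (EFin \o cst M).
  apply: continuous_compact_integrable; first exact: segment_compact.
  by apply: continuous_subspaceT => t; exact: cvg_cst.
apply: cvg_ReImC.
  apply: (@continuity_under_integral R _ _ mu (fun x y => Re (F x y)) `[0, p2]%classic _ (t0 - 1) (t0 + 1) _ _ (cst M)) => //.
  - by move=> x hx; exact: (cont_on_iRe (h1 x)).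
  - by apply: aeW => y _ x hx; apply: cvg_ReC; exact: h2.
  - by move=> x hx; apply: aeW => y hy; apply: le_trans (Re_le_nc _) (hb x y hx hy).
apply: (@continuity_under_integral R _ _ mu (fun x y => Im (F x y)) `[0, p2]%classic _ (t0 - 1) (t0 + 1) _ _ (cst M)) => //.
- by move=> x hx; exact: (cont_on_iIm (h1 x)).
- by apply: aeW => y _ x hx; apply: cvg_ImC; exact: h2.
- by move=> x hx; apply: aeW => y hy; apply: le_trans (Im_le_nc _) (hb x y hx hy).
Qed.

Section TwoVariables.
Variable f : C * C -> C.
Hypothesis hf : forall x, bidisc x -> differentiable f x.

Lemma bidiscE (z w : C) : bidisc (z, w) <-> nc z < 1 /\ nc w < 1.
Proof. by rewrite /bidisc /= !normC_lt1. Qed.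

Lemma cdiff_fst z w : nc z < 1 -> nc w < 1 -> cdiff (fun x => f (x, w)) z.
Proof.
move=> z1 w1; apply/cdiffP.
have hd : differentiable f (z, w) by apply: hf; apply/bidiscE.
have /cvg_ex [d /cvgC hd2] := @diff_derivable _ _ _ f (z, w) (1, 0) hd.
apply/cvg_ex; exists d; apply/cvgC => e e0; apply: filterS (hd2 e e0) => h.
have E : h *: ((1, 0) : C * C) + (z, w) = (h *: 1 + z, w).
  by apply/eqP; rewrite /eq_op /= scaler0 add0r !eqxx.
by rewrite /= E.
Qed.

Lemma cdiff_snd z w : nc z < 1 -> nc w < 1 -> cdiff (fun x => f (z, x)) w.
Proof.
move=> z1 w1; apply/cdiffP.
have hd : differentiable f (z, w) by apply: hf; apply/bidiscE.
have /cvg_ex [d /cvgC hd2] := @diff_derivable _ _ _ f (z, w) (0, 1) hd.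
apply/cvg_ex; exists d; apply/cvgC => e e0; apply: filterS (hd2 e e0) => h.
have E : h *: ((0, 1) : C * C) + (z, w) = (z, h *: 1 + w).
  by apply/eqP; rewrite /eq_op /= scaler0 add0r !eqxx.
by rewrite /= E.
Qed.

Lemma bidisc_cont z w : nc z < 1 -> nc w < 1 -> forall e : R, 0 < e ->
  exists2 del : R, 0 < del & forall z' w', nc (z' - z) < del -> nc (w' - w) < del ->
    nc (f (z', w') - f (z, w)) < e.
Proof.
move=> z1 w1 e e0.
have hd : differentiable f (z, w) by apply: hf; apply/bidiscE.
have /(@cvgC _ _ _ (nbhs_filter (z, w))) /(_ e e0) := differentiable_continuous hd.
by move=> /nbhsC2 [del del0 h]; exists del => // z' w' h1 h2; exact: (h (z', w')).
Qed.

Definition coef2 (m n : nat) : C :=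
  cauchy_coef (fun z => cauchy_coef (fun w => f (z, w)) 2^-1 n) 2^-1 m.

(** For [z] on the circle of radius 1/2, the expansion of [f(z, .)] at [w] has a remainder uniform
    in [z], since [f] is bounded on a torus. It may therefore be integrated term by term against
    [z ^ -m]. *)
Lemma coef2_inner m w : nc w < 1 ->
  csum (fun n => coef2 m n * w ^+ n) (cauchy_coef (fun z => f (z, w)) 2^-1 m).
Proof.
move=> w1; have [s [ws hs s1]] := between (nc_ge0 w) w1.
have s0 : 0 < s := le_lt_trans (nc_ge0 w) ws.
have h0 : 0 < 2^-1 :> R by rewrite invr_gt0.
have h1 : 2^-1 < 1 :> R by rewrite invf_lt1 // ltr1n.
have nh t : nc (polar 2^-1 t) < 1 by rewrite nc_polar ger0_norm // ltW.
have nsu r u : 0 < r -> r < 1 -> nc (polar r u) < 1.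
  by move=> r0 r1; rewrite nc_polar ger0_norm // ltW.
have bnd r (a b : R) : 0 < r -> r < 1 -> exists2 M, 0 <= M & forall t u, a <= t <= b -> 0 <= u <= p2 ->
    nc (f (polar 2^-1 t, polar r u)) <= M.
  move=> r0 r1; apply: (@bounded_rect _ a b 0 p2 (fun t u => f (polar 2^-1 t, polar r u))).
  move=> t u _ _ e e0.
  have [del del0 hd] := bidisc_cont (nh t) (nsu r u r0 r1) e0.
  exists (del / 2); first by rewrite divr_gt0.
  move=> t' u' ht hu; apply: hd; apply: le_lt_trans (polar_dist _ _ _ _) _;
    rewrite subrr normr0 add0r ger0_norm ?ltW //.
    by have := normr_ge0 (t' - t); lra.
  have : r * `|u' - u| <= `|u' - u| by rewrite ler_piMl // ltW.
  by rewrite mulrCA; lra.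
have [M M0 hM] := bnd s 0 p2 s0 s1.
have hol t : forall z, nc z < 1 -> cdiff (fun w => f (polar 2^-1 t, w)) z.
  by move=> z z1; exact: (cdiff_snd (nh t) z1).
have q01 : 0 <= nc w / s < 1 by rewrite divr_ge0 ?nc_ge0 ?(ltW s0) // ltr_pdivrMr // mul1r.
pose b n z := cauchy_coef (fun w => f (z, w)) 2^-1 n.
have est N t : 0 <= t <= p2 -> nc (f (polar 2^-1 t, w) - \sum_(n < N) b n (polar 2^-1 t) * w ^+ n) <=
    2 * M * (nc w / s) ^+ N * (s / (s - nc w)).
  move=> ht; have -> : \sum_(n < N) b n (polar 2^-1 t) * w ^+ n =
      \sum_(n < N) cauchy_coef (fun w => f (polar 2^-1 t, w)) s n * w ^+ n.
    by apply: eq_bigr => n _; rewrite /b (cauchy_coef_indep (hol t) n h0 hs s1).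
  by apply: (cauchy_estimate (hol t) N ws s1 M0) => u hu; exact: hM.
have cpow k : cont_on 0 p2 (fun t => (polar 2^-1 t ^+ k)^-1).
  apply: (@circ_cont _ 0 p2 (fun x => (x ^+ k)^-1)) => z hz.
  have zk : z ^+ k != 0 by rewrite expf_neq0 // -nc_gt0 hz normr_gt0 gt_eqF.
  exact: (cdiff_cont (cdiffV (f := fun y => y ^+ k) zk (cdiffX k z))).
have cb n : cont_on 0 p2 (fun t => b n (polar 2^-1 t)).
  (* The range of [t] is enlarged by 1 on both sides because [continuous_param_integral] asks for a
     bound on an interval of radius 1 around each point. *)
  have [M1 M10 hM1] := bnd 2^-1 (0 - 1) (p2 + 1) h0 h1.
  have hI : cont_on 0 p2 (fun t => cint 0 p2 (fun u =>
      f (polar 2^-1 t, polar 2^-1 u) * (polar 2^-1 u ^+ n)^-1)).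
    move=> t ht; apply: (@continuous_param_integral (fun t u =>
      f (polar 2^-1 t, polar 2^-1 u) * (polar 2^-1 u ^+ n)^-1) t (M1 * 2 ^+ n)).
    - move=> t'; apply: (cont_onM _ (cpow n)).
      apply: (@circ_cont _ 0 p2 (fun x => f (polar 2^-1 t', x))) => z hz.
      by apply: cdiff_cont; apply: hol; rewrite hz ger0_norm // ltW.
    - move=> u t'; have hF : cont_on t' t' (fun t => f (polar 2^-1 t, polar 2^-1 u)).
        apply: (@circ_cont _ t' t' (fun x => f (x, polar 2^-1 u))) => z hz.
        by apply: cdiff_cont; apply: cdiff_fst => //; rewrite hz ger0_norm // ltW.
      have := cont_onM hF (@cont_on_cst _ t' t' (polar 2^-1 u ^+ n)^-1).
      by apply; rewrite !lexx.
    - move=> t' u ht' hu; rewrite ncM ncV ncX nc_polar ger0_norm ?(ltW h0) // exprVn invrK.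
      rewrite ler_wpM2r ?exprn_ge0 // hM1 //; move: ht ht' => /andP[] ? ? /andP[]; lra.
  exact: (cont_onM (@cont_on_cst _ 0 p2 (p2^-1)%:C%C) hI).
have cw : cont_on 0 p2 (fun t => f (polar 2^-1 t, w)).
  apply: (@circ_cont _ 0 p2 (fun x => f (x, w))) => z hz.
  by apply: cdiff_cont; apply: cdiff_fst => //; rewrite hz ger0_norm // ltW.
have cSb N : cont_on 0 p2 (fun t => \sum_(n < N) b n (polar 2^-1 t) * w ^+ n).
  have [|_ //] := @cint_sum _ 0 p2 N (fun n t => b n (polar 2^-1 t) * w ^+ n).
  by move=> k _; exact: (cont_onM (cb k) (@cont_on_cst _ 0 p2 (w ^+ k))).
move=> e e0.
have [N hN] := cvg_geo_bound (2 * (2 * M * (s / (s - nc w)) * 2 ^+ m)) q01 e0.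
exists N => k /hN; apply: le_lt_trans; rewrite nc_dist.
have -> : cauchy_coef (fun z => f (z, w)) 2^-1 m - \sum_(n < k) coef2 m n * w ^+ n =
    (p2^-1)%:C%C * cint 0 p2 (fun t =>
     (f (polar 2^-1 t, w) - \sum_(n < k) b n (polar 2^-1 t) * w ^+ n) * (polar 2^-1 t ^+ m)^-1).
  have -> : \sum_(n < k) coef2 m n * w ^+ n = (p2^-1)%:C%C * cint 0 p2 (fun t =>
      (\sum_(n < k) b n (polar 2^-1 t) * w ^+ n) * (polar 2^-1 t ^+ m)^-1).
    have [|hs1 _] := @cint_sum _ 0 p2 k (fun n t => w ^+ n * (b n (polar 2^-1 t) * (polar 2^-1 t ^+ m)^-1)).
      by move=> j _; exact: (cont_onM (@cont_on_cst _ 0 p2 (w ^+ j)) (cont_onM (cb j) (cpow m))).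
    rewrite (eq_cint (G := fun t => \sum_(n < k) w ^+ n * (b n (polar 2^-1 t) * (polar 2^-1 t ^+ m)^-1))); last first.
      by move=> t _; rewrite mulr_suml; apply: eq_bigr => j _; ring.
    rewrite hs1 mulr_sumr; apply: eq_bigr => j _; rewrite cintZ; last exact: (cont_onM (cb j) (cpow m)).
    by rewrite /coef2 {1}/cauchy_coef mulrC mulrCA.
  rewrite /cauchy_coef -mulrBr -(cintB (cont_onM cw (cpow m)) (cont_onM (cSb k) (cpow m))).
  by congr (_ * _); apply: eq_cint => t _; rewrite mulrBl.
have -> : 2 * (2 * M * (s / (s - nc w)) * 2 ^+ m) * (nc w / s) ^+ k =
    2 * ((2 * M * (nc w / s) ^+ k * (s / (s - nc w))) * 2 ^+ m) by ring.
apply: cint_mean_le.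
  have cB := cont_onD cw (cont_onM (@cont_on_cst _ 0 p2 (-1)) (cSb k)).
  have := cont_onM cB (cpow m); congr cont_on; apply/funext => t.
  by rewrite mulN1r.
move=> t ht; rewrite ncM ncV ncX nc_polar ger0_norm ?(ltW h0) // exprVn invrK.
by rewrite ler_wpM2r ?exprn_ge0 // est.
Qed.

End TwoVariables.

(* [f(z, w)] is the iterated sum, first over [n], of [a m n z^m w^n]. *)
Definition repr (f : C * C -> C) (a : nat -> nat -> C) := exists b : nat -> C -> C,
  (forall m w, nc w < 1 -> csum (fun n => a m n * w ^+ n) (b m w)) /\
  (forall z w, nc z < 1 -> nc w < 1 -> csum (fun m => b m w * z ^+ m) (f (z, w))).

Lemma holomorphic_repr f : (forall x, bidisc x -> differentiable f x) ->
  exists a, repr f a.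
Proof.
move=> hf; exists (coef2 f), (fun m w => cauchy_coef (fun z => f (z, w)) 2^-1 m); split.
  by move=> m w w1; exact: coef2_inner.
by move=> z w z1 w1; apply: (holomorphic_power_series (g := fun z => f (z, w))) => // x x1; exact: cdiff_fst.
Qed.

End PowerSeries.

(** * Convergent double power series are complex differentiable *)

Section PowerSeriesDifferentiable.
Variable R : realType.
Notation C := R[i].
Notation nc := (@Normc.normc R).

Section PowerIncrement.
Variables (z h : C) (p d : R).
Hypotheses (d0 : 0 < d) (zp : nc z + d <= p) (hd : nc h <= d).

Lemma increment_p_ge0 : 0 <= p.
Proof. by rewrite (le_trans _ zp) // addr_ge0 ?nc_ge0 // ltW. Qed.

(** Enlarging the radius from [|z|] to [p >= |z| + d] absorbs the factor [m] of the mean value bound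
    into [1 / d]. All increments thus keep bounds that are geometric in [m] and can be summed
    against the coefficients. *)
Lemma power_increment1 m : nc ((z + h) ^+ m - z ^+ m) <= nc h / d * p ^+ m.
Proof.
have p0 := increment_p_ge0.
elim: m => [|m IH]; first by rewrite !expr0 subrr nc0 mulr1 divr_ge0 ?nc_ge0 // ltW.
have -> : (z + h) ^+ m.+1 - z ^+ m.+1 = z * ((z + h) ^+ m - z ^+ m) + h * (z + h) ^+ m.
  by rewrite !exprS; ring.
rewrite (le_trans (ncD _ _)) // !ncM ncX.
have zh : nc (z + h) <= p by rewrite (le_trans (ncD _ _)) // (le_trans _ zp) // lerD2l.
have l1 : nc z * nc ((z + h) ^+ m - z ^+ m) <= nc z * (nc h / d * p ^+ m).
  by rewrite ler_wpM2l ?nc_ge0.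
have l2 : nc h * nc (z + h) ^+ m <= nc h * p ^+ m.
  by rewrite ler_wpM2l ?nc_ge0 // lerXn2r ?nnegrE ?nc_ge0.
rewrite (le_trans (lerD l1 l2)) //.
have -> : nc z * (nc h / d * p ^+ m) + nc h * p ^+ m = nc h / d * p ^+ m * (nc z + d).
  by field; rewrite gt_eqF.
by rewrite exprSr mulrA ler_wpM2l // mulr_ge0 ?exprn_ge0 // divr_ge0 ?nc_ge0 // ltW.
Qed.

Lemma power_deriv_bound m : nc (m%:R * z ^+ m.-1) <= d^-1 * p ^+ m.
Proof.
have p0 := increment_p_ge0; have d1 : 0 <= d^-1 by rewrite invr_ge0 ltW.
have zp' : nc z <= p by rewrite (le_trans _ zp) // lerDl ltW.
elim: m => [|m IH]; first by rewrite mul0r nc0 mulr1.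
have -> : m.+1%:R * z ^+ m.+1.-1 = z * (m%:R * z ^+ m.-1) + z ^+ m.
  by case: m {IH} => [|m]; rewrite /= ?expr0 ?mul0r ?mulr0 ?add0r ?mulr1 // !exprS -[m.+2]addn1 natrD; ring.
rewrite (le_trans (ncD _ _)) // ncM.
have l1 : nc z * nc (m%:R * z ^+ m.-1) <= nc z * (d^-1 * p ^+ m).
  by rewrite ler_wpM2l ?nc_ge0.
have l2 : nc (z ^+ m) <= p ^+ m by rewrite ncX lerXn2r ?nnegrE ?nc_ge0.
rewrite (le_trans (lerD l1 l2)) //.
have -> : nc z * (d^-1 * p ^+ m) + p ^+ m = d^-1 * p ^+ m * (nc z + d).
  by field; rewrite gt_eqF.
by rewrite exprSr mulrA ler_wpM2l // mulr_ge0 ?exprn_ge0.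
Qed.

Lemma power_increment2 m :
  nc ((z + h) ^+ m - z ^+ m - m%:R * z ^+ m.-1 * h) <= (nc h / d) ^+ 2 * p ^+ m.
Proof.
have p0 := increment_p_ge0.
elim: m => [|m IH]; first by rewrite !expr0 subrr !mul0r subrr nc0 mulr1 sqr_ge0.
have -> : (z + h) ^+ m.+1 - z ^+ m.+1 - m.+1%:R * z ^+ m.+1.-1 * h =
    z * ((z + h) ^+ m - z ^+ m - m%:R * z ^+ m.-1 * h) + h * ((z + h) ^+ m - z ^+ m).
  by case: m {IH} => [|m]; rewrite /= ?expr0 ?expr1 ?mul0r ?mulr1 ?subr0; [ring|rewrite !exprS -[m.+2]addn1 natrD; ring].
rewrite (le_trans (ncD _ _)) // !ncM.
have l1 : nc z * nc ((z + h) ^+ m - z ^+ m - m%:R * z ^+ m.-1 * h) <=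
    nc z * ((nc h / d) ^+ 2 * p ^+ m) by rewrite ler_wpM2l ?nc_ge0.
have l2 : nc h * nc ((z + h) ^+ m - z ^+ m) <= nc h * (nc h / d * p ^+ m).
  by rewrite ler_wpM2l ?nc_ge0 // power_increment1.
rewrite (le_trans (lerD l1 l2)) //.
have -> : nc z * ((nc h / d) ^+ 2 * p ^+ m) + nc h * (nc h / d * p ^+ m) =
    (nc h / d) ^+ 2 * p ^+ m * (nc z + d) by field; rewrite gt_eqF.
by rewrite [p ^+ m.+1]exprSr mulrA ler_wpM2l // mulr_ge0 ?exprn_ge0 // divr_ge0 ?nc_ge0 // ltW.
Qed.

End PowerIncrement.

Lemma differentiable_quadratic (f : C * C -> C) (x : C * C) (A B : C) (K d : R) :
  0 < d -> 0 <= K ->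
  (forall h k, nc h <= d -> nc k <= d ->
    nc (f (x.1 + h, x.2 + k) - f x - (A * h + B * k)) <= K * (nc h + nc k) ^+ 2) ->
  differentiable f x.
Proof.
move=> d0 K0 hf.
pose L (v : C * C) := A * v.1 + B * v.2.
have linL : linear (L : C * C -> C).
  by move=> c u v; rewrite /L /= /GRing.scale /=; ring.
pose df : {linear (C * C)%type -> C} := HB.pack (L : C * C -> C)
  (GRing.isLinear.Build C (C * C)%type C *:%R L linL).
have cont : continuous (L : C * C -> C).
  move=> v; apply/(@cvgC _ _ _ (nbhs_filter v)) => e e0; apply/nbhsC2.
  pose M := nc A + nc B + 1; have M0 : 0 < M by rewrite ltr_wpDl // addr_ge0 ?nc_ge0.
  exists (e / M) => [|y h1 h2]; first by rewrite divr_gt0.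
  have -> : L y - L v = A * (y.1 - v.1) + B * (y.2 - v.2) by rewrite /L; ring.
  rewrite (le_lt_trans (ncD _ _)) // !ncM.
  have k1 : nc A * nc (y.1 - v.1) <= nc A * (e / M) by rewrite ler_wpM2l ?nc_ge0 // ltW.
  have k2 : nc B * nc (y.2 - v.2) <= nc B * (e / M) by rewrite ler_wpM2l ?nc_ge0 // ltW.
  rewrite (le_lt_trans (lerD k1 k2)) // -mulrDl mulrA ltr_pdivrMr // mulrC ltr_pM2l //.
  by rewrite /M ltrDl.
have lo : f \o shift x = cst (f x) + (df : C * C -> C) +o_ (0 : C * C) id.
  apply/eqaddoP => e e0; have [r r0 ->] := gt0C e0.
  (* On the ball of radius [s] the quadratic error [K (2 N) ^ 2] is at most [r N]; the summand 1
     avoids dividing by 0 when [K = 0]. *)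
  pose s := Num.min d (r / (2 * (2 * K + 1))).
  have K1 : 0 < 2 * (2 * K + 1) by rewrite mulr_gt0 // ltr_wpDl // mulr_ge0.
  have s0 : 0 < s by rewrite lt_min d0 divr_gt0.
  apply/nbhsC2; exists s => // y; rewrite !subr0 => y1 y2.
  have N1 : nc y.1 <= Num.max (nc y.1) (nc y.2) by rewrite le_max lexx.
  have N2 : nc y.2 <= Num.max (nc y.1) (nc y.2) by rewrite le_max lexx orbT.
  set N := Num.max _ _ in N1 N2.
  have Ns : N < s by rewrite gt_max y1.
  have N0 : 0 <= N by rewrite (le_trans (nc_ge0 y.1)).
  have -> : `|y| = N%:C%C.
    rewrite /N prod_normE /= !normE_nc; have [h|h] := leP (nc y.1) (nc y.2).
      by rewrite max_r // lecR.
    by rewrite max_l // lecR ltW.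
  rewrite -rmorphM /= normE_nc lecR !fctE /=.
  have -> : f (y + x) - (f x + L y) = f (x.1 + y.1, x.2 + y.2) - f x - (A * y.1 + B * y.2).
    by rewrite [y + x]addrC opprD addrA.
  have sd : s <= d by rewrite ge_min lexx.
  rewrite (le_trans (hf _ _ _ _)) ?(le_trans (ltW y1)) ?(le_trans (ltW y2)) //.
  have l1 : (nc y.1 + nc y.2) ^+ 2 <= (2 * N) ^+ 2.
    by rewrite lerXn2r ?nnegrE ?addr_ge0 ?nc_ge0 ?mulr_ge0 //; lra.
  rewrite (le_trans (ler_wpM2l K0 l1)) // exprMn expr2 !mulrA ler_wpM2r //.
  have Nr : N * (2 * (2 * K + 1)) <= r.
    by rewrite -ler_pdivlMr // ltW // (lt_le_trans Ns) // ge_min lexx orbT.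
  by have := mulr_ge0 K0 N0; lra.
have E := @diff_unique _ _ _ f df x cont lo.
by apply/diff_locallyP; rewrite E; split.
Qed.

(** Cauchy's bounds for every radius below 1, that is, absolute convergence on the bidisc. *)
Definition geo_bounded (a : nat -> nat -> C) := forall r : R, 0 < r -> r < 1 ->
  exists2 K : R, 0 <= K & forall m n, nc (a m n) <= K * r^-1 ^+ m * r^-1 ^+ n.

(** After removal of the formal differential, the increment of the series is a sum over [m] whose
    terms are quadratic in the increments and geometric in [m], so [differentiable_quadratic]
    applies. *)
Lemma power_series_differentiable a : geo_bounded a -> exists f : C * C -> C,
  [/\ repr f a, forall x, ~ bidisc x -> f x = 0 & forall x, bidisc x -> differentiable f x].
Proof.
move=> ha.
have inner w : nc w < 1 -> forall m, exists s, csum (fun n => a m n * w ^+ n) s.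
  move=> w1 m; have [r [wr _ r1]] := between (nc_ge0 w) w1.
  have r0 : 0 < r := le_lt_trans (nc_ge0 w) wr.
  have [K K0 hK] := ha r r0 r1.
  have q01 : 0 <= nc w / r < 1 by rewrite divr_ge0 ?nc_ge0 ?(ltW r0) // ltr_pdivrMr // mul1r.
  apply: (csum_geo_exists (K := K * r^-1 ^+ m) q01) => n.
  rewrite ncM ncX expr_div_n -exprVn [leRHS]mulrCA [leRHS]mulrC.
  by rewrite ler_wpM2r ?exprn_ge0 ?nc_ge0.
have [b hb] : exists b : nat -> C -> C, forall m w, nc w < 1 ->
    csum (fun n => a m n * w ^+ n) (b m w).
  have /choice [b hb] : forall mw : nat * C, exists s, nc mw.2 < 1 ->
      csum (fun n => a mw.1 n * mw.2 ^+ n) s.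
    move=> [m w]; have [w1|w1] := pselect (nc w < 1); last by exists 0 => /w1.
    by have [s hs] := inner w w1 m; exists s.
  by exists (fun m w => b (m, w)) => m w; exact: (hb (m, w)).
have bbound r : 0 < r -> r < 1 -> forall p, 0 <= p -> p < r -> exists2 K : R, 0 <= K &
    forall m w, nc w <= p -> nc (b m w) <= K * r^-1 ^+ m.
  move=> r0 r1 p p0 pr; have [K K0 hK] := ha r r0 r1.
  have q01 : 0 <= p / r < 1 by rewrite divr_ge0 ?(ltW r0) // ltr_pdivrMr // mul1r.
  exists (K / (1 - p / r)); first by rewrite divr_ge0 // subr_ge0 ltW //; case/andP: q01.
  move=> m w wp; have := csum_geo_le (hb m w _) (K := K * r^-1 ^+ m) _ q01 _.
  have -> : K / (1 - p / r) * r^-1 ^+ m = K * r^-1 ^+ m / (1 - p / r) by ring.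
  apply.
  - by rewrite (le_lt_trans wp) // (lt_trans pr).
  - by rewrite mulr_ge0 // exprn_ge0 // invr_ge0 ltW.
  - move=> n; rewrite ncM ncX expr_div_n -exprVn [leRHS]mulrCA [leRHS]mulrC.
    by rewrite ler_pM ?exprn_ge0 ?nc_ge0 // lerXn2r ?nnegrE ?nc_ge0.
have outer z w : nc z < 1 -> nc w < 1 -> exists s, csum (fun m => b m w * z ^+ m) s.
  move=> z1 w1.
  have [M [zM wM M1]] : exists M, [/\ nc z <= M, nc w <= M & M < 1].
    exists (Num.max (nc z) (nc w)); rewrite !le_max !lexx orbT; split => //.
    by rewrite gt_max z1.
  have M0 : 0 <= M := le_trans (nc_ge0 z) zM.
  have [r [Mr _ r1]] := between M0 M1; have r0 : 0 < r := le_lt_trans M0 Mr.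
  have [K K0 hK] := bbound r r0 r1 M M0 Mr.
  have q01 : 0 <= M / r < 1 by rewrite divr_ge0 ?(ltW r0) // ltr_pdivrMr // mul1r.
  apply: (csum_geo_exists (K := K) q01) => m; rewrite ncM ncX expr_div_n -exprVn.
  rewrite [_ ^+ m * _]mulrC mulrA ler_pM ?exprn_ge0 ?nc_ge0 ?hK //.
  by rewrite lerXn2r ?nnegrE ?nc_ge0.
have [f [hf f0]] : exists f : C * C -> C, (forall z w, nc z < 1 -> nc w < 1 ->
    csum (fun m => b m w * z ^+ m) (f (z, w))) /\ forall x, ~ bidisc x -> f x = 0.
  have /choice [f h] : forall x : C * C, exists s, (bidisc x -> csum (fun m => b m x.2 * x.1 ^+ m) s) /\
      (~ bidisc x -> s = 0).
    move=> [z w]; have [/bidiscE [z1 w1]|w1] := pselect (bidisc (z, w)).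
      have [s hs] := outer z w z1 w1; exists s; split => // nb.
      by exfalso; apply: nb; apply/bidiscE.
    by exists 0; split.
  exists f; split=> [z w z1 w1|x]; last by have [_] := h x.
  by have [+ _] := h (z, w); apply; apply/bidiscE.
exists f; split => //; first by exists b.
move=> [z w] /bidiscE [z1 w1].
have [M [zM wM M1]] : exists M, [/\ nc z <= M, nc w <= M & M < 1].
  exists (Num.max (nc z) (nc w)); rewrite !le_max !lexx orbT; split => //.
  by rewrite gt_max z1.
have M0 : 0 <= M := le_trans (nc_ge0 z) zM.
(* A third of the distance to the boundary: [p = M + d] leaves room for the increments, and
   [r = p + d], still below 1, for the ratio [p / r]. *)
pose d := (1 - M) / 3; have d0 : 0 < d by rewrite divr_gt0 // subr_gt0.
pose p := M + d; pose r := p + d.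
have p0 : 0 <= p by rewrite addr_ge0 // ltW.
have pr : p < r by rewrite ltrDl.
have r1 : r < 1 by rewrite /r /p /d; lra.
have r0 : 0 < r by exact: le_lt_trans pr.
have [K K0 hK] := ha r r0 r1; have [K' K'0 hK'] := bbound r r0 r1 p p0 pr.
pose q := p / r; have q01 : 0 <= q < 1 by rewrite divr_ge0 ?(ltW r0) // ltr_pdivrMr // mul1r.
have q1 : 0 < 1 - q by rewrite subr_gt0; case/andP: q01.
have zp : nc z + d <= p by rewrite lerD2r.
have wp : nc w + d <= p by rewrite lerD2r.
have inp y h : nc y + d <= p -> nc h <= d -> nc (y + h) <= p.
  by move=> h1 h2; rewrite (le_trans (ncD _ _)) // (le_trans _ h1) // lerD2l.
have p1 : p < 1 := lt_trans pr r1.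
have hq m n : r^-1 ^+ m * r^-1 ^+ n * p ^+ n = r^-1 ^+ m * q ^+ n.
  by rewrite /q expr_div_n -exprVn -mulrA [r^-1 ^+ n * _]mulrC.
have rm m : 0 <= r^-1 ^+ m by rewrite exprn_ge0 // invr_ge0 ltW.
pose k0 := K / (1 - q).
have k00 : 0 <= k0 by rewrite divr_ge0 // ltW.
have di0 : 0 <= d^-1 by rewrite invr_ge0 ltW.
have tb m n x c : 0 <= c -> nc x <= c * p ^+ n -> nc (a m n * x) <= K * r^-1 ^+ m * c * q ^+ n.
  move=> c0 hx; rewrite ncM (@le_trans _ _ (K * r^-1 ^+ m * r^-1 ^+ n * (c * p ^+ n))) //.
    by rewrite ler_pM ?nc_ge0.
  rewrite le_eqVlt; apply/orP; left; apply/eqP.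
  have -> : K * r^-1 ^+ m * r^-1 ^+ n * (c * p ^+ n) = K * c * (r^-1 ^+ m * r^-1 ^+ n * p ^+ n) by ring.
  by rewrite hq; ring.
have Kc m c : 0 <= c -> 0 <= K * r^-1 ^+ m * c by move=> c0; rewrite !mulr_ge0.
have kE m c : K * r^-1 ^+ m * c / (1 - q) = k0 * c * r^-1 ^+ m by rewrite /k0; ring.
have /choice [b' hb'] : forall m, exists s, csum (fun n => a m n * (n%:R * w ^+ n.-1)) s.
  move=> m; apply: (csum_geo_exists (K := K * r^-1 ^+ m * d^-1) q01) => n.
  by apply: tb => //; exact: power_deriv_bound.
have b'b m : nc (b' m) <= k0 * d^-1 * r^-1 ^+ m.
  rewrite -kE; apply: (csum_geo_le (hb' m) (Kc m _ di0) q01) => n.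
  by apply: tb => //; exact: power_deriv_bound.
have wk k : nc k <= d -> nc (w + k) < 1 by move=> /(inp w k wp) /le_lt_trans; apply.
have zh h : nc h <= d -> nc (z + h) < 1 by move=> /(inp z h zp) /le_lt_trans; apply.
have b1 m k : nc k <= d -> nc (b m (w + k) - b m w) <= k0 * (nc k / d) * r^-1 ^+ m.
  move=> hk; rewrite -kE; have c0 : 0 <= nc k / d by rewrite mulr_ge0 ?nc_ge0.
  have hs := csum_lin (-1) (hb m w w1) (hb m (w + k) (wk k hk)).
  have E : -1 * b m w + b m (w + k) = b m (w + k) - b m w by ring.
  rewrite E in hs.
  apply: (csum_geo_le hs (Kc m _ c0) q01) => n.
  have -> : -1 * (a m n * w ^+ n) + a m n * (w + k) ^+ n = a m n * ((w + k) ^+ n - w ^+ n) by ring.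
  by apply: tb => //; exact: power_increment1.
have b2 m k : nc k <= d -> nc (b m (w + k) - b m w - b' m * k) <= k0 * (nc k / d) ^+ 2 * r^-1 ^+ m.
  move=> hk; rewrite -kE; have c0 : 0 <= (nc k / d) ^+ 2 by rewrite sqr_ge0.
  have hs1 := csum_lin (-1) (hb m w w1) (hb m (w + k) (wk k hk)).
  have hs := csum_lin (- k) (hb' m) hs1.
  have E : - k * b' m + (-1 * b m w + b m (w + k)) = b m (w + k) - b m w - b' m * k by ring.
  rewrite E in hs.
  apply: (csum_geo_le hs (Kc m _ c0) q01) => n.
  have -> : - k * (a m n * (n%:R * w ^+ n.-1)) + (-1 * (a m n * w ^+ n) + a m n * (w + k) ^+ n) =
    a m n * ((w + k) ^+ n - w ^+ n - n%:R * w ^+ n.-1 * k) by ring.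
  by apply: tb => //; exact: power_increment2.
have hq' m : r^-1 ^+ m * p ^+ m = q ^+ m by rewrite /q expr_div_n -exprVn mulrC.
have wp' : nc w <= p by rewrite (le_trans _ wp) // lerDl ltW.
have zp' : nc z <= p by rewrite (le_trans _ zp) // lerDl ltW.
have prodb x y c e m : 0 <= c -> 0 <= e -> nc x <= c * r^-1 ^+ m -> nc y <= e * p ^+ m ->
    nc (x * y) <= c * e * q ^+ m.
  move=> c0 e0 hx hy; rewrite ncM (le_trans (ler_pM (nc_ge0 _) (nc_ge0 _) hx hy)) //.
  by rewrite -hq' mulrACA.
have [A hA] : exists s, csum (fun m => b m w * (m%:R * z ^+ m.-1)) s.
  apply: (csum_geo_exists (K := K' * d^-1) q01) => m.
  by apply: prodb => //; [exact: hK'|exact: power_deriv_bound].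
have [B hB] : exists s, csum (fun m => b' m * z ^+ m) s.
  apply: (csum_geo_exists (K := k0 * d^-1 * 1) q01) => m.
  apply: prodb => //; first by rewrite mulr_ge0.
  by rewrite mul1r ncX lerXn2r ?nnegrE ?nc_ge0.
apply: (@differentiable_quadratic f (z, w) A B ((K' + k0 + k0) * d^-2 / (1 - q)) d d0).
  by rewrite divr_ge0 ?(ltW q1) // mulr_ge0 ?addr_ge0 // invr_ge0 sqr_ge0.
move=> h k hh hk /=.
have hs : csum (fun m => b m (w + k) * (z + h) ^+ m - b m w * z ^+ m -
    (b m w * (m%:R * z ^+ m.-1) * h + b' m * z ^+ m * k))
    (f (z + h, w + k) - f (z, w) - (A * h + B * k)).
  have t1 := csum_lin (-1) (hf z w z1 w1) (hf _ _ (zh h hh) (wk k hk)).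
  have t2 := csum_lin (- h) hA t1; have := csum_lin (- k) hB t2.
  have -> : - k * B + (- h * A + (-1 * f (z, w) + f (z + h, w + k))) =
    f (z + h, w + k) - f (z, w) - (A * h + B * k) by ring.
  by apply: csum_ext => m; ring.
have nh0 := nc_ge0 h; have nk0 := nc_ge0 k.
have -> : (K' + k0 + k0) * d^-2 / (1 - q) * (nc h + nc k) ^+ 2 =
    (K' + k0 + k0) * ((nc h + nc k) / d) ^+ 2 / (1 - q).
  by field; rewrite !gt_eqF.
set c := (nc h + nc k) / d; have c0 : 0 <= c by rewrite mulr_ge0 // addr_ge0.
have hc : nc h / d <= c by rewrite ler_wpM2r // lerDl.
have kc : nc k / d <= c by rewrite ler_wpM2r // lerDr.
have hd0 : 0 <= nc h / d by rewrite mulr_ge0.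
have kd0 : 0 <= nc k / d by rewrite mulr_ge0.
apply: (csum_geo_le hs) => //; first by rewrite mulr_ge0 ?sqr_ge0 // !addr_ge0.
move=> m.
(* The second-order part of a product: second order in [z], second order in [w], and the mixed
   product of two first-order increments. *)
have -> : b m (w + k) * (z + h) ^+ m - b m w * z ^+ m -
    (b m w * (m%:R * z ^+ m.-1) * h + b' m * z ^+ m * k) =
  b m w * ((z + h) ^+ m - z ^+ m - m%:R * z ^+ m.-1 * h) +
  (b m (w + k) - b m w - b' m * k) * z ^+ m +
  (b m (w + k) - b m w) * ((z + h) ^+ m - z ^+ m) by ring.
have e1 : nc (b m w * ((z + h) ^+ m - z ^+ m - m%:R * z ^+ m.-1 * h)) <= K' * c ^+ 2 * q ^+ m.
  apply: prodb; rewrite ?sqr_ge0 //; first exact: hK'.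
  rewrite (le_trans (power_increment2 d0 zp hh m)) // ler_wpM2r ?exprn_ge0 //.
  by rewrite lerXn2r ?nnegrE.
have e2 : nc ((b m (w + k) - b m w - b' m * k) * z ^+ m) <= k0 * c ^+ 2 * 1 * q ^+ m.
  apply: prodb => //; first by rewrite mulr_ge0 // sqr_ge0.
    rewrite (le_trans (b2 m k hk)) // ler_wpM2r // ler_wpM2l //.
    by rewrite lerXn2r ?nnegrE.
  by rewrite mul1r ncX lerXn2r ?nnegrE ?nc_ge0.
have e3 : nc ((b m (w + k) - b m w) * ((z + h) ^+ m - z ^+ m)) <= k0 * c * c * q ^+ m.
  apply: prodb => //; first by rewrite mulr_ge0.
    by rewrite (le_trans (b1 m k hk)) // ler_wpM2r // ler_wpM2l.
  by rewrite (le_trans (power_increment1 d0 zp hh m)) // ler_wpM2r ?exprn_ge0.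
rewrite (le_trans (ncD _ _)) // (le_trans (lerD (ncD _ _) (lexx _))) //.
rewrite (le_trans (lerD (lerD e1 e2) e3)) // le_eqVlt; apply/orP; left; apply/eqP; ring.
Qed.

End PowerSeriesDifferentiable.

(** * Parseval's identity on circles, Tonelli on rectangles, and measurability of complex
    functions *)

Section Parseval.
Variable R : realType.
Notation C := R[i].
Notation nc := (@Normc.normc R).
Notation Re := (@complex.Re R).
Notation Im := (@complex.Im R).
Notation mu := (@lebesgue_measure R).
Notation polar := (@polar R).
Notation p2 := (2 * pi : R).

Lemma polar_cont_pow (r : R) m : cont_on 0 p2 (fun t => polar r t ^+ m).
Proof.
have hc (x : C) : nc x = `|r| -> ccont (fun x => x ^+ m) x.
  by move=> _; exact: cdiff_cont (cdiffX m x).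
exact: (circ_cont hc).
Qed.

Lemma polar_cont_powJ (r : R) m : cont_on 0 p2 (fun t => (polar r t)^*%C ^+ m).
Proof.
have hc (x : C) : nc x = `|r| -> ccont (fun x => x^*%C ^+ m) x.
  move=> _; apply/continuousC => e e0.
  have [d d0 h] := (continuousC _ x).1 (cdiff_cont (cdiffX m x)) e e0.
  by exists d => // y /h; rewrite -!rmorphXn -rmorphB ncJ.
exact: (circ_cont hc).
Qed.

Lemma cint_monomials (r : R) m k :
  cint 0 p2 (fun t => polar r t ^+ m * (polar r t)^*%C ^+ k) =
  if m == k then (p2 * (r ^+ 2) ^+ m)%:C%C else 0.
Proof.
rewrite (eq_cint (G := fun t => polar (r ^+ m * r ^+ k) ((m%:Z - k%:Z)%:~R * t))); last first.
  by move=> t _; rewrite polar_conj !polarX polar_mul rmorphB /= mulrBl mulrN.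
case: eqP => [->|mk]; last by rewrite cint_power // subr_eq0; apply/eqP => -[].
rewrite (eq_cint (G := fun t => (r ^+ k * r ^+ k)%:C%C)); last first.
  by move=> t _; rewrite subrr mul0r; apply: complex_ext; rewrite /= ?cos0 ?sin0; ring.
by rewrite cint_cst ?p2_ge0 // subr0 -rmorphM /= -exprMn expr2.
Qed.

Lemma poly_circle_sqr (a : nat -> C) (r : R) N :
  \int[mu]_(t in `[0%R, p2]) (nc (\sum_(m < N) a m * polar r t ^+ m) ^+ 2) =
  p2 * \sum_(m < N) nc (a m) ^+ 2 * (r ^+ 2) ^+ m.
Proof.
pose F m k t := a m * (a k)^*%C * (polar r t ^+ m * (polar r t)^*%C ^+ k).
have cF m k : cont_on 0 p2 (F m k).
  exact: (cont_onM (@cont_on_cst _ 0 p2 _) (cont_onM (@polar_cont_pow r m) (@polar_cont_powJ r k))).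
have E t : \sum_(m < N) \sum_(k < N) F m k t =
    (nc (\sum_(m < N) a m * polar r t ^+ m) ^+ 2)%:C%C.
  rewrite -mulrJ rmorph_sum /= mulr_suml; apply: eq_bigr => m _.
  rewrite mulr_sumr; apply: eq_bigr => k _; rewrite /F rmorphM /= rmorphXn /=; ring.
have cS m : cont_on 0 p2 (fun t => \sum_(k < N) F m k t).
  by have [|_ //] := @cint_sum _ 0 p2 N (F m).
have I1 : cint 0 p2 (fun t => \sum_(m < N) \sum_(k < N) F m k t) =
    (p2 * \sum_(m < N) nc (a m) ^+ 2 * (r ^+ 2) ^+ m)%:C%C.
  have [//|-> _] := @cint_sum _ 0 p2 N (fun m t => \sum_(k < N) F m k t).
  rewrite mulr_sumr rmorph_sum; apply: eq_bigr => m _ /=.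
  have [//|-> _] := @cint_sum _ 0 p2 N (F m).
  rewrite (bigD1 m) //= big1 ?addr0.
    rewrite /F cintZ ?cint_monomials ?eqxx.
      by rewrite mulrJ -rmorphM /=; congr (_%:C)%C; ring.
    exact: (cont_onM (@polar_cont_pow r m) (@polar_cont_powJ r m)).
  move=> k km; rewrite /F cintZ ?cint_monomials; last first.
    exact: (cont_onM (@polar_cont_pow r m) (@polar_cont_powJ r k)).
  by rewrite eq_sym; case: eqP => [E0|]; [move/eqP: km => /(_ (ord_inj E0))|rewrite mulr0].
have := congr1 Re I1; rewrite /= => <-; apply: eq_Rintegral => t _.
by rewrite E.
Qed.

(** Orthogonality of the monomials settles the partial sums. They are bounded uniformly on the
    circle by a geometric series, so dominated convergence gives the limit. *)
Lemma circle_parseval (a : nat -> C) (g : C -> C) (r : R) :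
  (forall z, nc z < 1 -> csum (fun m => a m * z ^+ m) (g z)) -> 0 <= r < 1 ->
  (\int[mu]_(t in `[0%R, p2]) (nc (g (polar r t)) ^+ 2)%:E =
   \sum_(m <oo) (nc (a m) ^+ 2 * (p2 * (r ^+ 2) ^+ m))%:E)%E.
Proof.
move=> hg /andP[r0 r1].
have [s [rs _ s1]] := between r0 r1; have s0 : 0 < s := le_lt_trans r0 rs.
have ns : nc s%:C%C < 1 by rewrite nc_real ger0_norm // ltW.
have [K K0 hK] := pser_coef_bound s0 (hg _ ns).
have q01 : 0 <= r / s < 1 by rewrite divr_ge0 ?(ltW s0) // ltr_pdivrMr // mul1r.
have q1 : 0 < 1 - r / s by rewrite subr_gt0; case/andP: q01.
pose G N t := \sum_(m < N) a m * polar r t ^+ m.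
have np t : nc (polar r t) = r by rewrite nc_polar ger0_norm.
have tb t m : nc (a m * polar r t ^+ m) <= K * (r / s) ^+ m.
  rewrite ncM ncX np.
  have -> : K * (r / s) ^+ m = K * s^-1 ^+ m * r ^+ m by rewrite expr_div_n -exprVn; ring.
  by rewrite ler_wpM2r ?exprn_ge0.
have GB N t : nc (G N t) <= K / (1 - r / s).
  rewrite (le_trans (nc_sum _ _ _)) // (@le_trans _ _ (\sum_(m < N) K * (r / s) ^+ m)) //.
    by apply: ler_sum => m _; exact: tb.
  by rewrite -mulr_sumr ler_wpM2l // geo_le.
set B := K / (1 - r / s) in GB.
have B0 : 0 <= B := le_trans (nc_ge0 _) (GB 0%N 0).
have cG N : cont_on 0 p2 (G N).
  have [|_ //] := @cint_sum _ 0 p2 N (fun m t => a m * polar r t ^+ m).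
  by move=> k _; exact: (cont_onM (@cont_on_cst _ 0 p2 (a k)) (@polar_cont_pow r k)).
have mG N : measurable_fun `[0%R, p2] (fun t => (nc (G N t) ^+ 2)%:E).
  have -> : (fun t => (nc (G N t) ^+ 2)%:E) = (fun t => (Re (G N t) ^+ 2 + Im (G N t) ^+ 2)%:E).
    by apply/funext => t; rewrite sqr_nc.
  apply/measurable_EFinP; apply: measurable_funD; apply: measurable_funX.
    by have /measurable_int/measurable_EFinP := cont_on_iRe (cG N).
  by have /measurable_int/measurable_EFinP := cont_on_iIm (cG N).
have lim : (fun N => \int[mu]_(t in `[0%R, p2]) (nc (G N t) ^+ 2)%:E)%E @ \oo -->
    (\int[mu]_(t in `[0%R, p2]) (nc (g (polar r t)) ^+ 2)%:E)%E.
  apply: (@dominated_cvg _ _ _ mu `[0%R, p2]%classic _ (fun N t => (nc (G N t) ^+ 2)%:E) _ (EFin \o cst (B ^+ 2))) => //.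
  - move=> t _; apply: cvg_EFin; first exact: nearW.
    have h1 : csum (fun m => a m * polar r t ^+ m) (g (polar r t)) by apply: hg; rewrite np.
    have /csumP/cvg_ncC h2 := h1.
    by rewrite [X in _ --> X]expr2; exact: (cvgM h2 h2).
  - apply: continuous_compact_integrable; first exact: segment_compact.
    by apply: continuous_subspaceT => t; exact: cvg_cst.
  - move=> n t _; rewrite gee0_abs ?lee_fin ?sqr_ge0 //.
    by rewrite lerXn2r ?nnegrE ?nc_ge0.
have fin N : (\int[mu]_(t in `[0%R, p2]) (nc (G N t) ^+ 2)%:E =
    \sum_(0 <= m < N) (nc (a m) ^+ 2 * (p2 * (r ^+ 2) ^+ m))%:E)%E.
  rewrite sumEFin big_mkord.
  have -> : \sum_(i < N) nc (a i) ^+ 2 * (p2 * (r ^+ 2) ^+ i) =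
      p2 * \sum_(m < N) nc (a m) ^+ 2 * (r ^+ 2) ^+ m.
    by rewrite mulr_sumr; apply: eq_bigr => m _; ring.
  rewrite -poly_circle_sqr /Rintegral fineK //.
  rewrite ge0_fin_numE; last by apply: integral_ge0 => t _; rewrite lee_fin sqr_ge0.
  apply: (@le_lt_trans _ _ (\int[mu]_(t in `[0%R, p2]) (B ^+ 2)%:E)%E).
    apply: ge0_le_integral => //; do ?[exact: mG|by move=> t _; rewrite lee_fin ?sqr_ge0].
    by move=> t _; rewrite lee_fin lerXn2r ?nnegrE ?nc_ge0 //; exact: GB.
  rewrite integral_cst //= [X in (_ * X)%E](_ : _ = mu `[0%R, p2]%classic) //.
  by rewrite lebesgue_measure_itv /= lte_fin p2_gt0 -EFinD -EFinM ltry.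
apply/esym; move: lim; rewrite (_ : (fun N => _) = (fun N => \sum_(0 <= m < N)
  (nc (a m) ^+ 2 * (p2 * (r ^+ 2) ^+ m))%:E)%E); last by apply/funext.
exact: cvg_lim.
Qed.

Section Tonelli.
Local Open Scope ereal_scope.
Context d1 d2 (T1 : measurableType d1) (T2 : measurableType d2).
Variables (m1 : {sigma_finite_measure set T1 -> \bar R})
  (m2 : {sigma_finite_measure set T2 -> \bar R}).

(** Extension by 0 reduces this to the whole product. Both orders are recorded together because
    [disc_parseval] compares them. *)
Lemma tonelli_rect (D1 : set T1) (D2 : set T2) (F : T1 * T2 -> \bar R) :
  measurable D1 -> measurable D2 -> measurable_fun (D1 `*` D2) F ->
  (forall p, (D1 `*` D2) p -> 0 <= F p) ->
  \int[m1 \x m2]_(p in D1 `*` D2) F p = \int[m2]_(y in D2) \int[m1]_(x in D1) F (x, y) /\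
  \int[m1 \x m2]_(p in D1 `*` D2) F p = \int[m1]_(x in D1) \int[m2]_(y in D2) F (x, y).
Proof.
move=> mD1 mD2 mF F0; have mD : measurable (D1 `*` D2) by exact: measurableX.
have mr : measurable_fun setT (F \_ (D1 `*` D2)) by apply/(measurable_restrictT F mD).
have r0 p : 0 <= (F \_ (D1 `*` D2)) p.
  by rewrite patchE; case: ifP => // /set_mem /F0.
rewrite integral_mkcond; split.
  rewrite (fubini_tonelli2 _ mr r0) [RHS]integral_mkcond; apply: eq_integral => y _.
  rewrite patchE; case: ifPn => [/set_mem yD|yD].
    rewrite [RHS]integral_mkcond; apply: eq_integral => x _; rewrite !patchE.
    case: ifPn => [/set_mem [/= xD _]|]; first by rewrite mem_set.
    by rewrite notin_setE => xD; case: ifPn => // /set_mem xD'; exfalso; apply: xD.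
  rewrite /fubini_G integral0_eq // => x _; rewrite patchE; case: ifPn => // /set_mem [_ /= y1].
  by rewrite mem_set in yD.
rewrite (fubini_tonelli1 _ mr r0) [RHS]integral_mkcond; apply: eq_integral => x _.
rewrite patchE; case: ifPn => [/set_mem xD|xD].
  rewrite [RHS]integral_mkcond; apply: eq_integral => y _; rewrite !patchE.
  case: ifPn => [/set_mem [/= _ yD]|]; first by rewrite mem_set.
  by rewrite notin_setE => yD; case: ifPn => // /set_mem yD'; exfalso; apply: yD.
rewrite /fubini_F integral0_eq // => y _; rewrite patchE; case: ifPn => // /set_mem [/= x1 _].
by rewrite mem_set in xD.
Qed.

End Tonelli.

Section ComplexMeasurable.
Context d (T : measurableType d).
Implicit Types (D : set T) (F G : T -> C).

Definition cmeas D F := measurable_fun D (fun t => Re (F t)) /\ measurable_fun D (fun t => Im (F t)).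

Lemma cmeas_cst D c : cmeas D (fun=> c).
Proof. by split; exact: measurable_cst. Qed.

Lemma cmeasD D F G : cmeas D F -> cmeas D G -> cmeas D (fun t => F t + G t).
Proof.
move=> [f1 f2] [g1 g2]; split.
  by under eq_fun do rewrite cReD; exact: measurable_funD.
by under eq_fun do rewrite cImD; exact: measurable_funD.
Qed.

Lemma cmeasM D F G : cmeas D F -> cmeas D G -> cmeas D (fun t => F t * G t).
Proof.
move=> [f1 f2] [g1 g2]; split.
  under eq_fun do rewrite cReM.
  by apply: measurable_funB; exact: measurable_funM.
under eq_fun do rewrite cImM.
by apply: measurable_funD; exact: measurable_funM.
Qed.

Lemma cmeasX D F m : cmeas D F -> cmeas D (fun t => F t ^+ m).
Proof.
move=> hF; elim: m => [|m IH]; first exact: cmeas_cst.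
have -> : (fun t => F t ^+ m.+1) = (fun t => F t * F t ^+ m) by apply/funext => t; rewrite exprS.
exact: cmeasM.
Qed.

Lemma cmeas_sum D (F : nat -> T -> C) n : (forall m, cmeas D (F m)) ->
  cmeas D (fun t => \sum_(m < n) F m t).
Proof.
move=> hF; elim: n => [|n IH].
  have -> : (fun t => \sum_(m < 0) F m t) = (fun=> 0) by apply/funext => t; rewrite big_ord0.
  exact: cmeas_cst.
have -> : (fun t => \sum_(m < n.+1) F m t) = (fun t => \sum_(m < n) F m t + F n t).
  by apply/funext => t; rewrite big_ord_recr.
exact: cmeasD.
Qed.

Lemma cmeas_csum D (F : nat -> T -> C) (G : T -> C) : (forall m, cmeas D (F m)) ->
  (forall t, D t -> csum (fun m => F m t) (G t)) -> cmeas D G.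
Proof.
move=> hF h; split.
  apply: (measurable_fun_cvg (h := fun n t => Re (\sum_(m < n) F m t))).
    by move=> n; have [] := cmeas_sum n hF.
  by move=> t /h /csumP /cvg_ReC.
apply: (measurable_fun_cvg (h := fun n t => Im (\sum_(m < n) F m t))).
  by move=> n; have [] := cmeas_sum n hF.
by move=> t /h /csumP /cvg_ImC.
Qed.

Lemma cmeas_sqr D F : cmeas D F -> measurable_fun D (fun t => nc (F t) ^+ 2).
Proof.
move=> [f1 f2].
have -> : (fun t => nc (F t) ^+ 2) = (fun t => Re (F t) ^+ 2 + Im (F t) ^+ 2).
  by apply/funext => t; rewrite sqr_nc.
by apply: measurable_funD; exact: measurable_funX.
Qed.

End ComplexMeasurable.

Lemma cmeas_comp d d' (T : measurableType d) (T' : measurableType d') (D : set T)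
    (F : T -> C) (h : T' -> T) (D' : set T') :
  measurable D -> cmeas D F -> measurable_fun D' h -> h @` D' `<=` D ->
  cmeas D' (F \o h).
Proof.
move=> mD [f1 f2] mh hD.
by split; [exact: (measurable_comp mD hD f1 mh)|exact: (measurable_comp mD hD f2 mh)].
Qed.

End Parseval.

(** * Parseval's identity in two variables, and the Hardy norm in coefficients *)

Section TwoVariableParseval.
Variable R : realType.
Notation C := R[i].
Notation nc := (@Normc.normc R).
Notation mu := (@lebesgue_measure R).
Notation polar := (@polar R).
Notation p2 := (2 * pi : R).

(** Square truncations of the weighted double sum: for nonnegative weights they increase with [K],
    and their supremum will be the squared norm. *)
Definition wsq (Om : nat -> R) (K : nat) (a : nat -> nat -> C) : R :=
  \sum_(m < K) \sum_(n < K) nc (a m n) ^+ 2 * (Om m * Om n).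

Lemma double_nneseries_sup (x : nat -> nat -> R) : (forall m n, 0 <= x m n) ->
  (\sum_(m <oo) \sum_(n <oo) (x m n)%:E =
   ereal_sup (range (fun K : nat => (\sum_(m < K) \sum_(n < K) x m n)%:E)))%E.
Proof.
move=> x0.
have i0 m : (0 <= \sum_(n <oo) (x m n)%:E)%E by apply: nneseries_ge0 => n _ _; rewrite lee_fin.
apply/eqP; rewrite eq_le; apply/andP; split; last first.
  apply: ge_ereal_sup => _ [K _ <-].
  apply: (@le_trans _ _ (\sum_(0 <= m < K) \sum_(n <oo) (x m n)%:E)%E); last first.
    by apply: nneseries_lim_ge => m _ _.
  rewrite big_mkord -sumEFin; apply: lee_sum => m _.
  rewrite -sumEFin -(big_mkord xpredT (fun n => (x m n)%:E)).
  by apply: nneseries_lim_ge => n _ _; rewrite lee_fin.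
apply: lime_le; first by apply: is_cvg_nneseries => m _ _.
apply: nearW => M.
have -> : (\sum_(0 <= m < M) \sum_(n <oo) (x m n)%:E =
    \sum_(n <oo) \sum_(0 <= m < M) (x m n)%:E)%E.
  by apply/esym/(@nneseries_sum_nat R 0 M (fun m n => (x m n)%:E) 0) => k l; rewrite lee_fin.
apply: lime_le.
  by apply: is_cvg_nneseries => n _ _; apply: sume_ge0 => m _; rewrite lee_fin.
apply: nearW => N; apply: (@le_trans _ _ (\sum_(m < maxn M N) \sum_(n < maxn M N) x m n)%:E); last first.
  by apply: ereal_sup_ubound; exists (maxn M N).
rewrite (_ : (\sum_(0 <= n < N) \sum_(0 <= m < M) (x m n)%:E)%E = (\sum_(m < M) \sum_(n < N) x m n)%:E).
  rewrite lee_fin.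
  have widen (F : nat -> R) k l : (forall i, 0 <= F i) -> (k <= l)%N -> \sum_(i < k) F i <= \sum_(i < l) F i.
    move=> F0 kl; rewrite -!(big_mkord xpredT F) (big_cat_nat (leq0n k) kl) /= lerDl.
    by apply: sumr_ge0.
  apply: (@le_trans _ _ (\sum_(m < M) \sum_(n < maxn M N) x m n)).
    by apply: ler_sum => m _; apply: (widen (x m)) => //; rewrite leq_maxr.
  apply: (widen (fun m => \sum_(n < maxn M N) x m n)); rewrite ?leq_maxl // => i.
  exact: sumr_ge0.
rewrite exchange_big_nat /= big_mkord -sumEFin; apply: eq_bigr => m _.
by rewrite big_mkord sumEFin.
Qed.

Section Abstract.
Local Open Scope ereal_scope.
Context d (T : measurableType d) (m : {sigma_finite_measure set T -> \bar R}).
Variables (D : set T) (phi : T -> C) (W : T -> R) (Om : nat -> R).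
Hypotheses (mD : measurable D) (mphi : cmeas D phi) (phi1 : forall t, D t -> (nc (phi t) < 1)%R).
Hypotheses (mW : measurable_fun D W) (W0 : forall t, D t -> (0 <= W t)%R) (Om0 : forall k, (0 <= Om k)%R).
Hypothesis parseval : forall (a : nat -> C) (g : C -> C),
  (forall z, (nc z < 1)%R -> csum (fun k => a k * z ^+ k)%R (g z)) ->
  \int[m]_(t in D) (nc (g (phi t)) ^+ 2 * W t)%:E = \sum_(k <oo) (nc (a k) ^+ 2 * Om k)%:E.

Lemma repr_cmeas (f : C * C -> C) a : repr f a ->
  cmeas (D `*` D) (fun p : T * T => f (phi p.1, phi p.2)).
Proof.
move=> [b [hb hf]].
have mDD : measurable (D `*` D) by exact: measurableX.
have m1 : cmeas (D `*` D) (phi \o fst).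
  by apply: (cmeas_comp mD mphi) => [|_ [[x y] [] ? _ <-]//]; exact: measurable_funTS.
have mb k : cmeas D (fun t => b k (phi t)).
  apply: (@cmeas_csum _ _ _ D (fun n t => a k n * phi t ^+ n)%R).
    by move=> n; apply: cmeasM; [exact: cmeas_cst|exact: cmeasX].
  by move=> t Dt; apply: hb; exact: phi1.
have mb2 k : cmeas (D `*` D) (fun p => b k (phi p.2)).
  apply: (cmeas_comp mD (mb k)) => [|_ [[x y] [] ? ? <-]//]; exact: measurable_funTS.
apply: (@cmeas_csum _ _ _ (D `*` D) (fun k p => b k (phi p.2) * phi p.1 ^+ k)%R).
  by move=> n; apply: cmeasM; [exact: mb2|exact: (cmeasX n m1)].
by move=> [x y] [/= Dx Dy]; apply: hf; exact: phi1.
Qed.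

(** The one-variable identity is applied to [f(., w)] with [w] frozen, then to each coefficient as a
    function of [w]; Tonelli and nonnegativity justify the interchanges. The data [D], [phi], [W]
    cover both a circle and the weighted disc. *)
Lemma parseval2 (f : C * C -> C) a : repr f a ->
  \int[m \x m]_(p in D `*` D) (nc (f (phi p.1, phi p.2)) ^+ 2 * (W p.1 * W p.2))%:E =
  ereal_sup (range (fun K => (wsq Om K a)%:E)).
Proof.
move=> fa; have mf := repr_cmeas fa; move: fa => [b [hb hf]].
have mDD : measurable (D `*` D) by exact: measurableX.
have mb k : cmeas D (fun t => b k (phi t)).
  apply: (@cmeas_csum _ _ _ D (fun n t => a k n * phi t ^+ n)%R).
    by move=> n; apply: cmeasM; [exact: cmeas_cst|exact: cmeasX].
  by move=> t Dt; apply: hb; exact: phi1.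
have mWW : measurable_fun (D `*` D) (fun p => W p.1 * W p.2)%R.
  apply: measurable_funM.
    apply: (measurable_comp mD _ mW (g := fst)) => [_ [[x y] [] ? _ <-]//|]; exact: measurable_funTS.
  apply: (measurable_comp mD _ mW (g := snd)) => [_ [[x y] [] ? ? <-]//|]; exact: measurable_funTS.
have mF : measurable_fun (D `*` D) (fun p => (nc (f (phi p.1, phi p.2)) ^+ 2 * (W p.1 * W p.2))%:E).
  by apply/measurable_EFinP; apply: measurable_funM => //; exact: cmeas_sqr.
rewrite (tonelli_rect m m mD mD mF _).1; last first.
  by move=> [x y] [/= Dx Dy]; rewrite lee_fin mulr_ge0 ?sqr_ge0 // mulr_ge0 ?W0.
have inner y : D y -> \int[m]_(x in D) (nc (f (phi x, phi y)) ^+ 2 * (W x * W y))%:E =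
    \sum_(k <oo) (nc (b k (phi y)) ^+ 2 * W y * Om k)%:E.
  move=> Dy; have my : measurable_fun D (fun x => (nc (f (phi x, phi y)) ^+ 2 * W x)%:E).
    apply/measurable_EFinP; apply: measurable_funM => //; apply: cmeas_sqr.
    apply: (@cmeas_csum _ _ _ D (fun k x => b k (phi y) * phi x ^+ k)%R).
      by move=> n; apply: cmeasM; [exact: cmeas_cst|exact: cmeasX].
    by move=> x Dx; apply: hf; exact: phi1.
  under eq_integral do rewrite [(W _ * _)%R]mulrC mulrCA EFinM.
  rewrite ge0_integralZl ?lee_fin ?W0 //; last first.
    by move=> x Dx; rewrite lee_fin mulr_ge0 ?sqr_ge0 // W0.
  rewrite (parseval (a := fun k => b k (phi y)) (g := fun z => f (z, phi y))); last first.
    by move=> z z1; apply: hf => //; exact: phi1.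
  rewrite -nneseriesZl; last by move=> k *; rewrite lee_fin mulr_ge0 ?sqr_ge0.
  by apply: eq_eseriesr => k _; rewrite -EFinM; congr (_%:E); ring.
rewrite (eq_integral (fun y => \sum_(k <oo) (nc (b k (phi y)) ^+ 2 * W y * Om k)%:E)); last first.
  by move=> y /set_mem Dy; exact: inner.
rewrite integral_nneseries //; last 2 first.
- move=> k; apply/measurable_EFinP; apply: measurable_funM => //.
  by apply: measurable_funM => //; exact: cmeas_sqr.
- by move=> k y Dy; rewrite lee_fin mulr_ge0 // mulr_ge0 ?sqr_ge0 // W0.
rewrite /wsq -(@double_nneseries_sup (fun i j => nc (a i j) ^+ 2 * (Om i * Om j))%R); last by move=> i j; rewrite mulr_ge0 ?sqr_ge0 // mulr_ge0.
apply: eq_eseriesr => k _.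
under eq_integral do rewrite mulrC EFinM.
rewrite ge0_integralZl ?lee_fin //; last 2 first.
- by apply/measurable_EFinP; apply: measurable_funM => //; exact: cmeas_sqr.
- by move=> y Dy; rewrite lee_fin mulr_ge0 ?sqr_ge0 // W0.
rewrite (parseval (a := a k) (g := b k)); last by move=> z; exact: hb.
rewrite -nneseriesZl; last by move=> n *; rewrite lee_fin mulr_ge0 ?sqr_ge0.
by apply: eq_eseriesr => n _; rewrite -EFinM; congr (_%:E); ring.
Qed.

End Abstract.

Lemma bernoulli_le (r : R) k : 0 <= r <= 1 -> 1 - k%:R * (1 - r) <= r ^+ k.
Proof.
move=> /andP[r0 r1]; elim: k => [|k IH]; first by rewrite mul0r subr0.
rewrite exprS; apply: (@le_trans _ _ (r * (1 - k%:R * (1 - r)))); last by rewrite ler_wpM2l.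
have h : 0 <= k%:R * (1 - r) ^+ 2 by rewrite mulr_ge0 ?sqr_ge0.
rewrite mulrSr; lra.
Qed.

Lemma sq_ge0 Om K a : (forall k, 0 <= Om k) -> 0 <= wsq Om K a.
Proof. by move=> h; apply: sumr_ge0 => m _; apply: sumr_ge0 => n _; rewrite mulr_ge0 ?sqr_ge0 // mulr_ge0. Qed.

(** On the circles of radius [r] the weights are [r ^ (2 m)]. They are at most 1 and tend to 1
    uniformly on each square truncation, so the two suprema, over [r] and over [K], may be
    exchanged. *)
Lemma hardy_sqnorm_repr (f : C * C -> C) a : repr f a ->
  hardy_sqnorm f = ereal_sup (range (fun K => (wsq (fun=> 1) K a)%:E)).
Proof.
move=> fa.
have circ r : 0 < r < 1 -> (((p2 ^- 2 : R)%:E *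
    \int[@leb2 R]_(t in @angles R) (nc (f (polar r t.1, polar r t.2)) ^+ 2)%:E)%E : \bar R) =
    ereal_sup (range (fun K => (wsq (fun m => (r ^+ 2) ^+ m) K a)%:E)).
  move=> /andP[r0 r1].
  have mphi : cmeas (`[0, p2]%classic : set R) (fun t => polar r t).
    have cp : cont_on 0 p2 (fun t => polar r t) by exact: (@cont_onT _ 0 p2 _ (@polar_cont_t _ r)).
    split; first by have /measurable_int/measurable_EFinP := cont_on_iRe cp.
    by have /measurable_int/measurable_EFinP := cont_on_iIm cp.
  have mI : measurable (`[0, p2]%classic : set R) by exact: measurable_itv.
  have np t : nc (polar r t) < 1 by rewrite nc_polar ger0_norm // ltW.
  have pi0 : 0 <= p2^-1 by rewrite invr_ge0 p2_ge0.
  have par (c : nat -> C) (g : C -> C) :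
    (forall z, nc z < 1 -> csum (fun k => c k * z ^+ k) (g z)) ->
    (\int[mu]_(t in `[0%R, p2]) (nc (g (polar r t)) ^+ 2 * p2^-1)%:E =
     \sum_(k <oo) (nc (c k) ^+ 2 * (r ^+ 2) ^+ k)%:E)%E.
    move=> hg; have mg : cmeas (`[0, p2]%classic : set R) (fun t => g (polar r t)).
      apply: (@cmeas_csum _ _ _ `[0, p2]%classic (fun k t => c k * polar r t ^+ k)).
        by move=> n; apply: cmeasM; [exact: cmeas_cst|exact: cmeasX].
      by move=> t _; apply: hg.
    under eq_integral do rewrite mulrC EFinM.
    rewrite ge0_integralZl ?lee_fin //; last 2 first.
    - by apply/measurable_EFinP; exact: cmeas_sqr.
    - by move=> t _; rewrite lee_fin sqr_ge0.
    rewrite (circle_parseval hg) ?(ltW r0) //.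
    rewrite -nneseriesZl; last first.
      by move=> k *; rewrite lee_fin mulr_ge0 ?sqr_ge0 // mulr_ge0 ?p2_ge0 // exprn_ge0 // sqr_ge0.
    apply: eq_eseriesr => k _; rewrite -EFinM; congr (_%:E).
    by rewrite mulrCA; congr (_ * _); rewrite mulrA mulVf ?mul1r // gt_eqF // p2_gt0.
  have := @parseval2 _ (measurableTypeR R) mu `[0, p2]%classic (fun t => polar r t) (fun=> p2^-1) (fun m => (r ^+ 2) ^+ m)
    mI mphi (fun t _ => np t) (measurable_cst _) (fun t _ => pi0) (fun k => exprn_ge0 k (sqr_ge0 r)) par f a fa.
  move=> <-.
  have mF := @repr_cmeas _ (measurableTypeR R) `[0, p2]%classic (fun t => polar r t) mI mphi (fun t _ => np t) f a fa.
  have mp1 : measurable (@angles R) by exact: measurableX.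
  rewrite -ge0_integralZl ?lee_fin ?invr_ge0 ?exprn_ge0 ?p2_ge0 //; last 2 first.
  - by apply/measurable_EFinP; exact: cmeas_sqr.
  - by move=> t _; rewrite lee_fin sqr_ge0.
  apply: eq_integral => t _; rewrite -EFinM mulrC; congr (_%:E); congr (_ * _).
  by rewrite expr2 invfM.
have circ_le r K : 0 < r < 1 -> wsq (fun m => (r ^+ 2) ^+ m) K a <= wsq (fun=> 1) K a.
  move=> /andP[r0 r1]; apply: ler_sum => m _; apply: ler_sum => n _.
  rewrite ler_wpM2l ?sqr_ge0 // mulr1 -exprD exprn_ile1 ?sqr_ge0 //.
  by rewrite exprn_ile1 // ltW.
(* For [m, n < K] the exponent [2 m + 2 n] is at most [4 K]. *)
have circ_ge r K : 0 < r < 1 -> r ^+ (4 * K) * wsq (fun=> 1) K a <= wsq (fun m => (r ^+ 2) ^+ m) K a.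
  move=> /andP[r0 r1]; rewrite mulr_sumr; apply: ler_sum => m _; rewrite mulr_sumr.
  apply: ler_sum => n _; rewrite mulr1 mulr1 mulrC ler_wpM2l ?sqr_ge0 // -exprD -exprM.
  rewrite ler_wiXn2l ?(ltW r0) ?(ltW r1) // (_ : 4 = 2 * 2)%N // -mulnA leq_mul2l /=.
  by rewrite mul2n -addnn leq_add // ltnW.
apply/eqP; rewrite eq_le; apply/andP; split.
  apply: ge_ereal_sup => _ [r hr <-]; have r01 : 0 < r < 1 by move: hr; rewrite /= in_itv.
  rewrite circ //; apply: ge_ereal_sup => _ [K _ <-].
  apply: (@le_trans _ _ (wsq (fun=> 1) K a)%:E); first by rewrite lee_fin circ_le.
  by apply: ereal_sup_ubound; exists K.
apply: ge_ereal_sup => _ [K _ <-].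
have hS r : 0 < r < 1 -> ((r ^+ (4 * K) * wsq (fun=> 1) K a)%:E <= hardy_sqnorm f)%E.
  move=> r01; apply: (@le_trans _ _ (wsq (fun m => (r ^+ 2) ^+ m) K a)%:E).
    by rewrite lee_fin circ_ge.
  apply: (@le_trans _ _ (ereal_sup (range (fun K => (wsq (fun m => (r ^+ 2) ^+ m) K a)%:E)))).
    by apply: ereal_sup_ubound; exists K.
  by rewrite -circ //; apply: ereal_sup_ubound; exists r => //; rewrite /= in_itv.
have s0 : 0 <= wsq (fun=> 1) K a by apply: sq_ge0.
set s := wsq _ K a in hS s0 *.
have h2 : 0 < (2^-1 : R) < 1 by rewrite invr_gt0 ltr0n /= invf_lt1 // ltr1n.
case: (hardy_sqnorm f) hS => [l| |] hS; [|by rewrite leey|by have := hS _ h2; rewrite leeNy_eq].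
rewrite lee_fin leNgt; apply/negP => ls.
pose c := (4 * K)%:R * s + 1; have c0 : 0 < c by rewrite ltr_wpDl // mulr_ge0.
(* By Bernoulli's inequality the loss is at most [4 K e s], here at most half of the gap [s - l];
   the bound 1/2 keeps [1 - e] positive. *)
pose e := Num.min 2^-1 ((s - l) / (2 * c)).
have e0 : 0 < e by rewrite lt_min invr_gt0 ltr0n divr_gt0 ?subr_gt0 ?mulr_gt0.
have e2 : e <= 2^-1 by rewrite ge_min lexx.
have e3 : e <= (s - l) / (2 * c) by rewrite ge_min lexx orbT.
have r01 : 0 < 1 - e < 1 by lra.
have := hS _ r01; rewrite lee_fin => h3.
have h4 := @bernoulli_le (1 - e) (4 * K) _.
have {h4} : 1 - (4 * K)%:R * e <= (1 - e) ^+ (4 * K).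
  have E : 1 - (1 - e) = e by ring.
  by rewrite E in h4; apply: h4; apply/andP; split; lra.
move=> /(ler_wpM2r s0) h4.
rewrite ler_pdivlMr ?mulr_gt0 // in e3.
have h5 : (4 * K)%:R * s * e <= c * e by rewrite ler_wpM2r ?(ltW e0) // lerDl.
have := le_trans h4 h3; rewrite mulrBl mul1r mulrAC; lra.
Qed.

End TwoVariableParseval.

(** * Sigma-finiteness of product measures *)

Section ProductSigmaFinite.
Local Open Scope ereal_scope.
Context d1 d2 (T1 : measurableType d1) (T2 : measurableType d2) (R : realType).
Variables (m1 : {sigma_finite_measure set T1 -> \bar R}) (m2 : {sigma_finite_measure set T2 -> \bar R}).

Lemma sigma_finite_product : sigma_finite setT (m1 \x m2).
Proof.
have /sigma_finiteP[F [TF ndF Foo]] := sigma_finiteT m1.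
have /sigma_finiteP[G [TG ndG Goo]] := sigma_finiteT m2.
exists (fun n => F n `*` G n) => [|k].
  rewrite -setXTT TF TG; apply/seteqP; split => -[x y] /=; last by move=> [n _ []]; split; exists n.
  move=> [[n _ Fn] [k _ Gk]]; exists (maxn n k) => //; split.
    by move: x Fn; exact/subsetPset/ndF/leq_maxl.
  by move: y Gk; exact/subsetPset/ndG/leq_maxr.
have [[mF Ff] [mG Gf]] := (Foo k, Goo k); split; first exact: measurableX.
by rewrite product_measure1E // lte_mul_pinfty // ge0_fin_numE.
Qed.

(** The area of the plane repackaged as a sigma-finite measure, so that it can itself be a factor of
    a product, as in [leb4]. *)
Definition sigma_finite_prod : {sigma_finite_measure set (T1 * T2)%type -> \bar R} :=
  let P : {measure set (T1 * T2)%type -> \bar R} := m1 \x m2 in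
  HB.pack (P : set (T1 * T2)%type -> \bar R) (Measure.class P)
    (Measure_isSigmaFinite.Build _ _ _ P sigma_finite_product).

End ProductSigmaFinite.

(** * Rotation invariance of the area, and Parseval's identity on the disc *)

Section Rotation.
Variable R : realType.
Notation C := R[i].
Notation nc := (@Normc.normc R).
Notation mu := (@lebesgue_measure R).
Notation polar := (@polar R).
Notation p2 := (2 * pi : R).
Notation T1 := (measurableTypeR R).
Notation T2 := ((measurableTypeR R * measurableTypeR R)%type).
Local Open Scope ereal_scope.

Lemma lebesgue_measure_shift (c : R) (A : set T1) : measurable A ->
  pushforward mu ((fun x => x + c)%R : _ -> T1) A = mu A.
Proof.
move=> mA.
have mphi : measurable_fun setT ((fun x => x + c)%R : T1 -> T1).
  by apply: measurable_funD => //; exact: measurable_id.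
pose phi : {mfun T1 >-> T1} := HB.pack ((fun x => x + c)%R : T1 -> T1) (isMeasurableFun.Build _ _ _ _ _ mphi).
apply/esym/(@lebesgue_measure_unique _ (pushforward mu phi)) => //= _ [[a b]] _ <-.
rewrite /pushforward /=.
have -> : ((fun x => x + c)%R @^-1` `]a, b]%classic : set R) = `](a - c)%R, (b - c)%R]%classic.
  by apply/seteqP; split => x; rewrite /= !in_itv /= ltrBlDr lerBrDr.
rewrite !lebesgue_measure_itv /= !lte_fin ltrD2r; case: ifPn => // _.
by rewrite -!EFinD; congr (_%:E); ring.
Qed.

Lemma integral_shift (c : R) (F : T1 -> \bar R) : measurable_fun setT F ->
  (forall x, 0 <= F x) -> \int[mu]_x F (x + c)%R = \int[mu]_x F x.
Proof.
move=> mF F0.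
have mphi : measurable_fun setT ((fun x => x + c)%R : T1 -> T1).
  by apply: measurable_funD => //; exact: measurable_id.
have := @ge0_integral_pushforward _ _ T1 T1 R _ mphi mu setT F measurableT mF (fun x _ => F0 x).
rewrite preimage_setT /comp => <-.
by apply: eq_measure_integral => A mA _; exact: lebesgue_measure_shift.
Qed.

Lemma integral_shear1 (k : R) (F : T2 -> \bar R) : measurable_fun setT F ->
  (forall x, 0 <= F x) ->
  \int[(mu \x mu)]_p F (p.1 + k * p.2, p.2)%R = \int[(mu \x mu)]_p F p.
Proof.
move=> mF F0.
have mh : measurable_fun setT (fun p : T2 => (p.1 + k * p.2, p.2)%R : T2).
  apply: measurable_fun_pair; last exact: measurable_snd.
  by apply: measurable_funD; [exact: measurable_fst|apply: measurable_funM => //; exact: measurable_snd].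
have mFh : measurable_fun setT (fun p : T2 => F (p.1 + k * p.2, p.2)%R).
  exact: (measurableT_comp mF mh).
rewrite (fubini_tonelli2 _ mFh) // (fubini_tonelli2 _ mF) //; apply: eq_integral => y _.
rewrite /fubini_G /= (@integral_shift (k * y) (fun x => F (x, y))) //.
exact: (measurableT_comp mF (measurable_pair2 y)).
Qed.

Lemma integral_shear2 (k : R) (F : T2 -> \bar R) : measurable_fun setT F ->
  (forall x, 0 <= F x) ->
  \int[(mu \x mu)]_p F (p.1, p.2 + k * p.1)%R = \int[(mu \x mu)]_p F p.
Proof.
move=> mF F0.
have mh : measurable_fun setT (fun p : T2 => (p.1, p.2 + k * p.1)%R : T2).
  apply: measurable_fun_pair; first exact: measurable_fst.
  by apply: measurable_funD; [exact: measurable_snd|apply: measurable_funM => //; exact: measurable_fst].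
have mFh : measurable_fun setT (fun p : T2 => F (p.1, p.2 + k * p.1)%R).
  exact: (measurableT_comp mF mh).
rewrite (fubini_tonelli1 _ mFh) // (fubini_tonelli1 _ mF) //; apply: eq_integral => x _.
rewrite /fubini_F /= (@integral_shift (k * x) (fun y => F (x, y))) //.
exact: (measurableT_comp mF (measurable_pair1 x)).
Qed.

Definition rot (c s : R) (p : T2) : T2 := (p.1 * c - p.2 * s, p.1 * s + p.2 * c)%R.

Lemma measurable_rot c s : measurable_fun setT (rot c s).
Proof.
have h1 k : measurable_fun setT (fun p : T2 => p.1 * k)%R.
  by apply: measurable_funM => //; exact: measurable_fst.
have h2 k : measurable_fun setT (fun p : T2 => p.2 * k)%R.
  by apply: measurable_funM => //; exact: measurable_snd.
by apply: measurable_fun_pair; [exact: measurable_funB|exact: measurable_funD].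
Qed.

(* A rotation is a product of three shears, and shears preserve the area by Tonelli and translation invariance. *)
Lemma integral_rot c s (F : T2 -> \bar R) : (c ^+ 2 + s ^+ 2 = 1)%R -> measurable_fun setT F ->
  (forall x, 0 <= F x) -> \int[(mu \x mu)]_p F (rot c s p) = \int[(mu \x mu)]_p F p.
Proof.
have key c' s' (G : T2 -> \bar R) : (s' != 0)%R -> (c' ^+ 2 + s' ^+ 2 = 1)%R -> measurable_fun setT G ->
    (forall x, 0 <= G x) -> \int[(mu \x mu)]_p G (rot c' s' p) = \int[(mu \x mu)]_p G p.
  move=> s0 cs mG G0; pose k := ((c' - 1) / s')%R.
  pose G1 (p : T2) := G (p.1 + k * p.2, p.2)%R.
  pose G2 (p : T2) := G1 (p.1, p.2 + s' * p.1)%R.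
  have mh1 : measurable_fun setT (fun p : T2 => (p.1 + k * p.2, p.2)%R : T2).
    apply: measurable_fun_pair; last exact: measurable_snd.
    by apply: measurable_funD; [exact: measurable_fst|apply: measurable_funM => //; exact: measurable_snd].
  have mh2 : measurable_fun setT (fun p : T2 => (p.1, p.2 + s' * p.1)%R : T2).
    apply: measurable_fun_pair; first exact: measurable_fst.
    by apply: measurable_funD; [exact: measurable_snd|apply: measurable_funM => //; exact: measurable_fst].
  have mG1 : measurable_fun setT G1 by exact: (measurableT_comp mG mh1).
  have mG2 : measurable_fun setT G2 by exact: (measurableT_comp mG1 mh2).
  rewrite -(integral_shear1 k mG) // -(integral_shear2 s' mG1) //; last by move=> p; exact: G0.
  rewrite -(integral_shear1 k mG2) //; last by move=> p; exact: G0.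
  apply: eq_integral => -[x y] _; rewrite /G2 /G1 /rot /=; congr G.
  have e1 : (k * s' = c' - 1)%R by rewrite /k mulfVK.
  have e2 : (k * (1 + c') = - s')%R.
    apply: (mulIf s0); rewrite mulrAC e1; move: cs; rewrite !expr2 => cs.
    by rewrite mulNr -[(s' * s')%R](addrK (c' * c')%R) [(s' * s' + _)%R]addrC cs; ring.
  congr (_, _)%R.
    transitivity (x * (1 + k * s') + y * (k * (1 + (k * s' + 1))))%R; last by ring.
    by rewrite e1 subrK -[(1 + c')%R]/(1 + c')%R e2; ring.
  transitivity (s' * x + (k * s' + 1) * y)%R; last by ring.
  by rewrite e1; ring.
(* The shear coefficient [(c - 1) / s] requires [s] nonzero. For [s = 0] the map is the identity or
   the half turn, a product of two quarter turns. *)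
move=> cs mF F0; have [s0|s0] := eqVneq s 0%R; last exact: key.
have c2 : (c ^+ 2 = 1)%R by move: cs; rewrite s0 expr0n addr0.
have c0 : (- c != 0)%R.
  by rewrite oppr_eq0; apply/eqP => E; move: c2; rewrite E expr0n => /eqP; rewrite eq_sym oner_eq0.
have mFr : measurable_fun setT (fun p => F (rot 0 (- c) p)).
  exact: (measurableT_comp mF (measurable_rot 0 (- c))).
rewrite -(key 0%R (- c)%R F c0) //; last by rewrite expr0n add0r sqrrN.
rewrite -(key 0%R 1%R _ (oner_neq0 _) _ mFr) //; last by rewrite expr0n add0r expr1n.
apply: eq_integral => -[x y] _; rewrite /rot s0 /=; congr F; congr (_, _)%R; ring.
Qed.

Definition cx (p : T2) : C := (p.1 +i* p.2)%C.
Definition disc : set T2 := [set p | (nc (cx p) < 1)%R].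

Lemma cmeas_cx (D : set T2) : cmeas D cx.
Proof. by split; apply: measurable_funTS; [exact: measurable_fst|exact: measurable_snd]. Qed.

Lemma measurable_ncsq : measurable_fun setT (fun p : T2 => nc (cx p) ^+ 2)%R.
Proof. exact: (cmeas_sqr (cmeas_cx _)). Qed.

Lemma discE p : disc p <-> (nc (cx p) ^+ 2 < 1)%R.
Proof. by rewrite /disc /= expr_lt1 ?nc_ge0. Qed.

Lemma measurable_disc : measurable disc.
Proof.
have -> : disc = setT `&` (fun p : T2 => nc (cx p) ^+ 2)%R @^-1` `]-oo, 1%R[%classic.
  by apply/seteqP; split => p; rewrite setTI /= in_itv /= => /discE.
by apply: measurable_ncsq => //; exact: measurable_itv.
Qed.

Lemma cx_rot t p : (cx (rot (cos t) (sin t) p) = polar 1 t * cx p)%R.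
Proof. by apply: complex_ext; rewrite /=; ring. Qed.

Section DiscParseval.
Variable W : T2 -> R.
Hypotheses (mW : measurable_fun disc W) (W0 : forall p, disc p -> (0 <= W p)%R).
Hypothesis Wrad : forall p q, nc (cx p) = nc (cx q) -> W p = W q.
Hypothesis Wfin : \int[(mu \x mu)]_(p in disc) (W p)%:E < +oo.

Definition Om (k : nat) : R := fine (\int[(mu \x mu)]_(p in disc) ((nc (cx p) ^+ 2) ^+ k * W p)%:E).

Lemma Om_int_meas k : measurable_fun disc (fun p => ((nc (cx p) ^+ 2) ^+ k * W p)%:E).
Proof.
apply/measurable_EFinP; apply: measurable_funM => //; apply: measurable_funX.
exact: measurable_funTS measurable_ncsq.
Qed.

Lemma Om_int_ge0 k p : disc p -> 0 <= ((nc (cx p) ^+ 2) ^+ k * W p)%:E.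
Proof. by move=> Dp; rewrite lee_fin mulr_ge0 ?W0 // exprn_ge0 // sqr_ge0. Qed.

Lemma OmE k : (Om k)%:E = \int[(mu \x mu)]_(p in disc) ((nc (cx p) ^+ 2) ^+ k * W p)%:E.
Proof.
rewrite fineK // ge0_fin_numE; last by apply: integral_ge0 => p; exact: Om_int_ge0.
apply: le_lt_trans Wfin; apply: ge0_le_integral => //.
- exact: measurable_disc.
- by move=> p; exact: Om_int_ge0.
- exact: Om_int_meas.
- exact/measurable_EFinP.
- move=> p Dp; rewrite lee_fin ler_piMl ?W0 // exprn_ile1 ?sqr_ge0 // ltW //.
  exact/discE.
Qed.

Lemma Om_ge0 k : (0 <= Om k)%R.
Proof. by rewrite fine_ge0 // integral_ge0 // => p; exact: Om_int_ge0. Qed.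

(** Averaging over rotations takes the place of polar coordinates. The integral of [H] over the
    plane and all angles is [2 pi] times that over the plane, by rotation invariance; in the other
    order the inner integral runs over a circle, where [circle_parseval] applies and the radial
    weight is constant. *)
Lemma disc_parseval (a : nat -> C) (g : C -> C) :
  (forall z, (nc z < 1)%R -> csum (fun k => a k * z ^+ k)%R (g z)) ->
  \int[(mu \x mu)]_(p in disc) (nc (g (cx p)) ^+ 2 * W p)%:E = \sum_(k <oo) (nc (a k) ^+ 2 * Om k)%:E.
Proof.
move=> hg; have mD := measurable_disc.
have mg : cmeas disc (fun p => g (cx p)).
  apply: (@cmeas_csum _ _ _ disc (fun k p => a k * cx p ^+ k)%R).
    by move=> n; apply: cmeasM; [exact: cmeas_cst|apply: cmeasX; exact: cmeas_cx].
  by move=> p Dp; apply: hg.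
pose F p := (nc (g (cx p)) ^+ 2 * W p)%:E.
have mF : measurable_fun disc F.
  by apply/measurable_EFinP; apply: measurable_funM => //; exact: cmeas_sqr.
have F0 p : disc p -> 0 <= F p by move=> Dp; rewrite lee_fin mulr_ge0 ?sqr_ge0 ?W0.
pose H := F \_ disc.
have mH : measurable_fun setT H by apply/(measurable_restrictT F mD).
have H0 p : 0 <= H p by rewrite /H patchE; case: ifPn => // /set_mem /F0.
have -> : \int[(mu \x mu)]_(p in disc) F p = \int[(mu \x mu)]_p H p by exact: integral_mkcond.
pose G (q : T1 * T2) := H (rot (cos q.1) (sin q.1) q.2).
have mG : measurable_fun setT G.
  have mrot : measurable_fun setT (fun q : T1 * T2 => rot (cos q.1) (sin q.1) q.2).
    have mc : measurable_fun setT (fun q : T1 * T2 => cos q.1).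
      apply: (@measurableT_comp _ _ _ _ _ _ (@cos R)); last exact: measurable_fst.
      by apply: continuous_measurable_fun; exact: continuous_cos.
    have ms : measurable_fun setT (fun q : T1 * T2 => sin q.1).
      apply: (@measurableT_comp _ _ _ _ _ _ (@sin R)); last exact: measurable_fst.
      by apply: continuous_measurable_fun; exact: continuous_sin.
    have m1 : measurable_fun setT (fun q : T1 * T2 => q.2.1).
      exact: (measurableT_comp measurable_fst measurable_snd).
    have m2 : measurable_fun setT (fun q : T1 * T2 => q.2.2).
      exact: (measurableT_comp measurable_snd measurable_snd).
    apply: measurable_fun_pair.
      by apply: measurable_funB; exact: measurable_funM.
    by apply: measurable_funD; exact: measurable_funM.
  exact: (measurableT_comp mH mrot).
have mI : measurable (`[0%R, p2]%classic : set T1) by exact: measurable_itv.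
have [E1 E2] := @tonelli_rect _ _ _ T1 T2 mu (sigma_finite_prod mu mu) `[0%R, p2]%classic setT G mI measurableT
  (measurable_funTS mG) (fun q _ => H0 _).
rewrite E1 in E2.
have muI : mu `[0%R, p2]%classic = p2%:E.
  by rewrite lebesgue_measure_itv /= lte_fin p2_gt0 -EFinD subr0.
have L : \int[mu]_(t in `[0%R, p2]) \int[(mu \x mu)]_p G (t, p) = p2%:E * \int[(mu \x mu)]_p H p.
  rewrite (eq_integral (fun=> \int[(mu \x mu)]_p H p)); last first.
    by move=> t _; rewrite /G /=; apply: integral_rot => //; exact: cos2Dsin2.
  by rewrite integral_cst // muleC; congr (_ * _).
rewrite L in E2.
have inner p : disc p -> \int[mu]_(t in `[0%R, p2]) G (t, p) =
    \sum_(k <oo) (nc (a k) ^+ 2 * (p2 * ((nc (cx p) ^+ 2) ^+ k * W p)))%:E.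
  move=> Dp; set r := nc (cx p).
  have r01 : (0 <= r < 1)%R by rewrite nc_ge0.
  (* The phase of the point, set to 1 at the origin. Replacing [g] by [g(u z)] multiplies the
     coefficients by unimodular numbers, so the circle may be taken to start at the positive radius
     [r]. *)
  have [u [u1 ur]] : exists u : C, nc u = 1%R /\ (cx p = r%:C%C * u)%R.
    have [z0|z0] := eqVneq (cx p) 0%R.
      by exists 1%R; rewrite nc1 /r z0 nc0 mul0r.
    have r0 : (r != 0)%R by rewrite nc_eq0.
    exists (cx p / r%:C%C)%R; split; first by rewrite ncM ncV nc_real ger0_norm ?nc_ge0 // mulfV.
    by rewrite mulrC mulfVK // -nc_eq0 nc_real normr_eq0.
  have hg' z : (nc z < 1)%R -> csum (fun k => (a k * u ^+ k) * z ^+ k)%R (g (u * z)%R).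
    move=> z1; have := hg (u * z)%R; rewrite ncM u1 mul1r => /(_ z1).
    by apply: csum_ext => k; rewrite exprMn mulrA.
  have := circle_parseval hg' r01.
  have -> : \sum_(k <oo) (nc (a k * u ^+ k) ^+ 2 * (p2 * (r ^+ 2) ^+ k))%:E =
      \sum_(k <oo) (nc (a k) ^+ 2 * (p2 * (r ^+ 2) ^+ k))%:E.
    by apply: eq_eseriesr => k _; rewrite ncM ncX u1 expr1n mulr1.
  move=> cp.
  have GE t : G (t, p) = (W p)%:E * (nc (g (u * polar r t)%R) ^+ 2)%:E.
    have e : (polar 1 t * cx p = u * polar r t)%R by rewrite ur [polar r t]polarE; ring.
    have nr : nc (cx (rot (cos t) (sin t) p)) = r by rewrite cx_rot ncM nc_polar normr1 mul1r.
    rewrite /G /H patchE mem_set; last by rewrite /disc /= nr; case/andP: r01.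
    rewrite /F -EFinM mulrC; congr (_%:E); congr (_ * _)%R; first exact: Wrad.
    by rewrite cx_rot e.
  under eq_integral do rewrite GE.
  have mgc : measurable_fun `[0%R, p2] (fun t => (nc (g (u * polar r t)%R) ^+ 2)%:E).
    apply/measurable_EFinP; apply: cmeas_sqr.
    have cpl : cont_on 0 p2 (fun t => polar r t) by exact: (@cont_onT _ 0%R p2 _ (@polar_cont_t _ r)).
    apply: (@cmeas_csum _ _ _ `[0%R, p2]%classic (fun k t => a k * u ^+ k * polar r t ^+ k)%R).
      move=> n; apply: cmeasM; first exact: cmeas_cst.
      apply: cmeasX; split; first by have /measurable_int/measurable_EFinP := cont_on_iRe cpl.
      by have /measurable_int/measurable_EFinP := cont_on_iIm cpl.
    by move=> t _; apply: hg'; rewrite nc_polar ger0_norm; case/andP: r01.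
  rewrite ge0_integralZl ?lee_fin ?W0 //; last by move=> t _; rewrite lee_fin sqr_ge0.
  rewrite cp -nneseriesZl; last first.
    by move=> k *; rewrite lee_fin mulr_ge0 ?sqr_ge0 // mulr_ge0 ?p2_ge0 // exprn_ge0 // sqr_ge0.
  by apply: eq_eseriesr => k _; rewrite -EFinM; congr (_%:E); ring.
have outer p : ~ disc p -> \int[mu]_(t in `[0%R, p2]) G (t, p) = 0.
  move=> Dp; apply: integral0_eq => t _; rewrite /G /H patchE; case: ifPn => // /set_mem.
  by rewrite /disc /= cx_rot ncM nc_polar normr1 mul1r.
have E3 : \int[(mu \x mu)]_(p in setT) \int[mu]_(t in `[0%R, p2]) G (t, p) =
    \int[(mu \x mu)]_(p in disc) \sum_(k <oo) (nc (a k) ^+ 2 * (p2 * ((nc (cx p) ^+ 2) ^+ k * W p)))%:E.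
  rewrite [RHS]integral_mkcond; apply: eq_integral => p _; rewrite patchE.
  by case: ifPn => [/set_mem /inner //|]; rewrite notin_setE => /outer.
have c0 k : (0 <= nc (a k) ^+ 2 * p2)%R by rewrite mulr_ge0 ?sqr_ge0 ?p2_ge0.
have E4 : \int[(mu \x mu)]_(p in disc) \sum_(k <oo) (nc (a k) ^+ 2 * (p2 * ((nc (cx p) ^+ 2) ^+ k * W p)))%:E =
    p2%:E * \sum_(k <oo) (nc (a k) ^+ 2 * Om k)%:E.
  have mk k : measurable_fun disc (fun p => (nc (a k) ^+ 2 * (p2 * ((nc (cx p) ^+ 2) ^+ k * W p)))%:E).
    have -> : (fun p => (nc (a k) ^+ 2 * (p2 * ((nc (cx p) ^+ 2) ^+ k * W p)))%:E) =
      (fun p => (nc (a k) ^+ 2 * p2)%:E * ((nc (cx p) ^+ 2) ^+ k * W p)%:E).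
      by apply/funext => p; rewrite -EFinM mulrA.
    by apply: emeasurable_funM => //; exact: Om_int_meas.
  rewrite integral_nneseries //; last first.
    by move=> k p Dp; rewrite lee_fin mulrA mulr_ge0 // mulr_ge0 ?W0 // exprn_ge0 // sqr_ge0.
  rewrite -nneseriesZl; last by move=> k *; rewrite lee_fin mulr_ge0 ?sqr_ge0 ?Om_ge0.
  apply: eq_eseriesr => k _; rewrite [in RHS](EFinM (nc (a k) ^+ 2)%R (Om k)) OmE.
  under eq_integral do rewrite mulrA EFinM.
  rewrite ge0_integralZl ?lee_fin //; [|exact: Om_int_meas|by move=> p; exact: Om_int_ge0].
  by rewrite EFinM muleA [(p2)%:E * _]muleC.
move: E2; rewrite E3 E4 => E2.
have h := p2_gt0 R.
have cancel x y : p2%:E * x = p2%:E * y -> x = y.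
  by move=> E; have := congr1 (fun u => (p2^-1)%:E * u) E; rewrite !muleA -EFinM mulVf ?mul1e // gt_eqF.
exact: cancel.
Qed.

End DiscParseval.
End Rotation.

(** * Scaling of the area, and the moments of the Bergman weights *)

Section DiscWeights.
Variable R : realType.
Notation C := R[i].
Notation nc := (@Normc.normc R).
Notation mu := (@lebesgue_measure R).
Notation T1 := (measurableTypeR R).
Notation T2 := ((measurableTypeR R * measurableTypeR R)%type).
Notation disc := (@disc R).
Local Open Scope ereal_scope.

Lemma lebesgue_measure_scale (c : R) (c0 : (0 < c)%R) (A : set T1) : measurable A ->
  c%:E * pushforward mu ((fun x => c * x)%R : _ -> T1) A = mu A.
Proof.
move=> mA.
have mphi : measurable_fun setT ((fun x => c * x)%R : T1 -> T1).
  by apply: measurable_funM => //; exact: measurable_id.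
pose phi : {mfun T1 >-> T1} := HB.pack ((fun x => c * x)%R : T1 -> T1) (isMeasurableFun.Build _ _ _ _ _ mphi).
apply/esym/(@lebesgue_measure_unique _ (mscale (NngNum (ltW c0)) (pushforward mu phi))) => //= _ [[a b]] _ <-.
rewrite /mscale /= /pushforward.
have -> : ((fun x => c * x)%R @^-1` `]a, b]%classic : set R) = `](a / c)%R, (b / c)%R]%classic.
  by apply/seteqP; split => x; rewrite /= !in_itv /= ltr_pdivrMr // ler_pdivlMr // mulrC.
rewrite !lebesgue_measure_itv /= !lte_fin ltr_pM2r ?invr_gt0 //; case: ifPn => ab; last by rewrite mule0.
by rewrite -!EFinD -EFinM -mulrBl mulrC mulfVK // gt_eqF.
Qed.

Lemma integral_scale (c : R) (F : T1 -> \bar R) : (0 < c)%R -> measurable_fun setT F ->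
  (forall x, 0 <= F x) -> c%:E * \int[mu]_x F (c * x)%R = \int[mu]_x F x.
Proof.
move=> c0 mF F0.
have mphi : measurable_fun setT ((fun x => c * x)%R : T1 -> T1).
  by apply: measurable_funM => //; exact: measurable_id.
pose phi : {mfun T1 >-> T1} := HB.pack ((fun x => c * x)%R : T1 -> T1) (isMeasurableFun.Build _ _ _ _ _ mphi).
have := @ge0_integral_pushforward _ _ T1 T1 R _ mphi mu setT F measurableT mF (fun x _ => F0 x).
rewrite preimage_setT /comp => <-.
have /= <- := @ge0_integral_mscale _ T1 R (pushforward mu phi) setT measurableT (NngNum (ltW c0)) F mF (fun x _ => F0 x).
apply: eq_measure_integral => A mA _; exact: lebesgue_measure_scale.
Qed.

Lemma integral_scale2 (c : R) (F : T2 -> \bar R) : (0 < c)%R -> measurable_fun setT F ->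
  (forall x, 0 <= F x) ->
  (c ^+ 2)%:E * \int[(mu \x mu)]_p F (c * p.1, c * p.2)%R = \int[(mu \x mu)]_p F p.
Proof.
move=> c0 mF F0.
have mc : measurable_fun setT ((fun x => c * x)%R : T1 -> T1).
  by apply: measurable_funM => //; exact: measurable_id.
have m1 : measurable_fun setT (fun p : T2 => c * p.1)%R by exact: (measurableT_comp mc measurable_fst).
have m2 : measurable_fun setT (fun p : T2 => c * p.2)%R by exact: (measurableT_comp mc measurable_snd).
have mFh : measurable_fun setT (fun p : T2 => F (c * p.1, c * p.2)%R).
  exact: (measurableT_comp mF (measurable_fun_pair m1 m2)).
have mF2 y : measurable_fun setT (fun x => F (x, y)) by exact: (measurableT_comp mF (measurable_pair2 y)).
rewrite (fubini_tonelli2 _ mFh) // (fubini_tonelli2 _ mF) //.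
have mG := @measurable_fun_fubini_tonelli_G _ _ T1 T1 R mu F mF F0.
have mG' := @measurable_fun_fubini_tonelli_G _ _ T1 T1 R mu _ mFh (fun p => F0 _).
have G0 y : 0 <= fubini_G mu F y by apply: integral_ge0 => x _.
have G'0 y : 0 <= fubini_G mu (fun p : T2 => F (c * p.1, c * p.2)%R) y by apply: integral_ge0 => x _.
rewrite -(integral_scale c0 mG G0) expr2 EFinM -muleA; congr (_ * _).
rewrite -ge0_integralZl ?lee_fin ?(ltW c0) //; apply: eq_integral => y _.
exact: (integral_scale c0 (mF2 (c * y)%R)).
Qed.

Definition ball2 (r : R) : set T2 := [set p | (nc (cx p) < r)%R].
Definition area : R := fine ((mu \x mu) disc).

Lemma measurable_ball2 r : measurable (ball2 r).
Proof.
have [r0|r0] := ltrP 0%R r; last first.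
  rewrite (_ : ball2 r = set0) //; apply/seteqP; split => // p /= pr.
  by have := le_lt_trans (nc_ge0 (cx p)) pr; rewrite ltNge r0.
have -> : ball2 r = setT `&` (fun p : T2 => nc (cx p) ^+ 2)%R @^-1` `]-oo, (r ^+ 2)%R[%classic.
  apply/seteqP; split => p; rewrite setTI /= in_itv /= => h; first by rewrite ltr_pXn2r ?nnegrE ?nc_ge0 // ltW.
  by move: h; rewrite ltr_pXn2r ?nnegrE ?nc_ge0 // ltW.
by apply: measurable_ncsq => //; exact: measurable_itv.
Qed.

Lemma nc_cx_le p : (nc (cx p) <= `|p.1| + `|p.2|)%R.
Proof. exact: nc_le_ReIm. Qed.

Lemma measure_square (a : R) : (0 < a)%R ->
  (mu \x mu) (`[(- a)%R, a]%classic `*` `[(- a)%R, a]%classic) = ((a + a) * (a + a))%:E.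
Proof.
move=> a0; have mI : measurable (`[(- a)%R, a]%classic : set T1) by exact: measurable_itv.
have muI : mu `[(- a)%R, a]%classic = (a + a)%:E.
  by rewrite lebesgue_measure_itv /= lte_fin ifT -?EFinD ?opprK //; lra.
exact: (eq_trans (product_measure1E mu mu mI mI) (congr2 (fun x y => x * y) muI muI)).
Qed.

Lemma area_fin : (mu \x mu) disc < +oo.
Proof.
apply: (@le_lt_trans _ _ ((mu \x mu) (`[(-1)%R, 1%R]%classic `*` `[(-1)%R, 1%R]%classic))).
  apply: le_measure; rewrite ?inE; [exact: measurable_disc|by apply: measurableX; exact: measurable_itv|].
  move=> p /= p1; have h1 := le_lt_trans (Re_le_nc (cx p)) p1; have h2 := le_lt_trans (Im_le_nc (cx p)) p1.
  by move: h1 h2; rewrite /= !in_itv /= -!ler_norml => /ltW -> /ltW ->.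
by rewrite measure_square ?ltry.
Qed.

Lemma areaE : area%:E = (mu \x mu) disc.
Proof. by rewrite /area fineK // ge0_fin_numE ?area_fin. Qed.

Lemma area_gt0 : (0 < area)%R.
Proof.
rewrite -lte_fin areaE.
apply: (@lt_le_trans _ _ ((mu \x mu) (`[(- 4^-1)%R, 4^-1%R]%classic `*` `[(- 4^-1)%R, 4^-1%R]%classic))).
  have h4 : (0 < 4^-1 :> R)%R by rewrite invr_gt0.
  by rewrite measure_square // lte_fin mulr_gt0 // addr_gt0.
apply: le_measure; rewrite ?inE; [by apply: measurableX; exact: measurable_itv|exact: measurable_disc|].
move=> [x y] /= []; rewrite !in_itv /= -!ler_norml => x1 y1.
by apply: (le_lt_trans (nc_cx_le _)); rewrite /=; lra.
Qed.

Lemma measure_ball2 r : (0 < r)%R -> (mu \x mu) (ball2 r) = (r ^+ 2 * area)%:E.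
Proof.
move=> r0; have r20 : (r ^+ 2 != 0)%R by rewrite expf_neq0 // gt_eqF.
have mI : measurable_fun setT (fun p : T2 => (\1_disc p : R)%:E).
  by apply/measurable_EFinP; apply: measurable_indic; exact: measurable_disc.
have ri : (0 < r^-1)%R by rewrite invr_gt0.
have i0 p : 0 <= (\1_disc p : R)%:E by rewrite lee_fin.
have I1 : \int[(mu \x mu)]_p (\1_disc p : R)%:E = area%:E.
  by rewrite (integral_indic (mu \x mu) measurableT (@measurable_disc R)) setIT areaE.
have := integral_scale2 ri mI i0; rewrite I1.
rewrite (_ : (fun p : T2 => (\1_disc (r^-1 * p.1, r^-1 * p.2)%R)%:E) = (fun p => (\1_(ball2 r) p)%:E)); last first.
  apply/funext => -[x y] /=; congr (_%:E); rewrite !indicE; congr (nat_of_bool _)%:R; apply/idP/idP.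
    rewrite !inE /disc /ball2 /=.
    have -> : cx (r^-1 * x, r^-1 * y)%R = ((r^-1)%:C%C * cx (x, y))%R by apply: complex_ext; rewrite /=; ring.
    by rewrite ncM nc_real ger0_norm ?(ltW ri) // mulrC ltr_pdivrMr // mul1r.
  rewrite !inE /disc /ball2 /=.
  have -> : cx (r^-1 * x, r^-1 * y)%R = ((r^-1)%:C%C * cx (x, y))%R by apply: complex_ext; rewrite /=; ring.
  by rewrite ncM nc_real ger0_norm ?(ltW ri) // mulrC ltr_pdivrMr // mul1r.
rewrite (integral_indic (mu \x mu) measurableT (measurable_ball2 r)) setIT => h.
have : (r ^+ 2)%:E * ((r^-1 ^+ 2)%:E * (mu \x mu) (ball2 r)) = (r ^+ 2)%:E * area%:E by rewrite h.
by rewrite muleA -!EFinM exprVn mulfV // mul1e.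
Qed.

Lemma measure_annulus r : (0 < r < 1)%R ->
  (mu \x mu) (disc `\` ball2 r) = ((1 - r ^+ 2) * area)%:E.
Proof.
move=> /andP[r0 r1]; rewrite measureD; [|exact: measurable_disc|exact: measurable_ball2|exact: area_fin].
rewrite (_ : disc `&` ball2 r = ball2 r); last first.
  by apply/seteqP; split => p; [case|move=> pr; split => //; exact: lt_trans pr r1].
by transitivity (area%:E - (r ^+ 2 * area)%:E); [rewrite areaE -measure_ball2|rewrite -EFinD mulrBl mul1r].
Qed.

Section PowerWeight.
Variable alpha : R.
Hypothesis alpha_gt : (-1 < alpha)%R.

Definition weight1 (p : T2) : R := ((1 - nc (cx p) ^+ 2) `^ alpha)%R.

Lemma weight1_ge0 p : (0 <= weight1 p)%R. Proof. exact: powR_ge0. Qed.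

Lemma measurable_weight1 D : measurable_fun D weight1.
Proof.
apply: measurable_funTS; apply: (measurableT_comp (@measurable_powR R alpha)).
by apply: measurable_funB => //; exact: measurable_ncsq.
Qed.

(** For [alpha >= 0] the weight decreases with the modulus, so its value at [r] is a lower bound;
    for [alpha < 0] it is at least 1. *)
Lemma weight1_ge (r : R) : (r < 1)%R -> exists2 c : R, (0 < c)%R & forall p, (nc (cx p) <= r)%R -> (c <= weight1 p)%R.
Proof.
have [r0|r0] := ltrP r 0%R; first by exists 1%R => // p h; have := le_lt_trans h r0; rewrite ltNge nc_ge0.
move=> r1; have rr : (r ^+ 2 < 1)%R by rewrite expr_lt1.
have u0 p : (nc (cx p) <= r)%R -> (1 - r ^+ 2 <= 1 - nc (cx p) ^+ 2)%R.
  by move=> h; rewrite lerB // lerXn2r ?nnegrE ?nc_ge0.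
have [a0|a0] := lerP 0%R alpha.
  exists ((1 - r ^+ 2) `^ alpha)%R; first by rewrite powR_gt0 // subr_gt0.
  move=> p /u0 h; apply: ge0_ler_powR => //; rewrite nnegrE; first by rewrite subr_ge0 ltW.
  by apply: le_trans h; rewrite subr_ge0 ltW.
exists 1%R => // p h; rewrite -(powRr0 (1 - nc (cx p) ^+ 2)%R); apply: ger_powR; last exact: ltW.
by rewrite (lt_le_trans _ (u0 p h)) ?subr_gt0 //= gerBl sqr_ge0.
Qed.

Lemma powR2N k : (((2^-1 : R) `^ alpha) ^+ k = ((2^-1) ^+ k) `^ alpha)%R.
Proof.
have h : (0 <= (2^-1 : R))%R by rewrite invr_ge0.
by rewrite -(powR_mulrn k (powR_ge0 _ _)) -(powR_mulrn k h) powRAC.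
Qed.

(* Dyadic layers: the weight is at most [2 ^ (- k alpha)] where [1 - |z|^2] is about [2 ^ - k], an annulus of area about [2 ^ - k]. *)
Lemma weight1_fin : \int[(mu \x mu)]_(p in disc) (weight1 p)%:E < +oo.
Proof.
have mD := @measurable_disc R.
have [a0|a0] := lerP 0%R alpha.
  apply: (@le_lt_trans _ _ (\int[(mu \x mu)]_(p in disc) (cst 1%E) p)); last first.
    by rewrite integral_cst // mul1e area_fin.
  apply: ge0_le_integral => //.
  - by move=> p _; rewrite lee_fin weight1_ge0.
  - by apply/measurable_EFinP; exact: measurable_weight1.
  - move=> p Dp; rewrite lee_fin -(powRr0 (1 - nc (cx p) ^+ 2)%R); apply: ger_powR => //.
    by rewrite subr_gt0 gerBl sqr_ge0 andbT; apply/discE.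
pose q := ((2^-1 : R) `^ alpha)%R.
have q0 : (0 < q)%R by rewrite powR_gt0 // invr_gt0.
pose r k := Num.sqrt (1 - 2^-1 ^+ k : R).
have r2 k : (r k ^+ 2 = 1 - 2^-1 ^+ k)%R by rewrite sqr_sqrtr // subr_ge0 exprn_ile1 // ?invr_ge0 // invf_le1 ?ler1n.
pose A k := disc `\` ball2 (r k.+1).
have r01 k : (0 < r k.+1 < 1)%R.
  have h1 : (2^-1 ^+ k.+1 < 1 :> R)%R by rewrite exprn_ilt1 // ?invr_ge0 // invf_lt1 ?ltr1n.
  have h2 : (0 < 2^-1 ^+ k.+1 :> R)%R by rewrite exprn_gt0 // invr_gt0.
  rewrite sqrtr_gt0 subr_gt0 h1 /= -[ltRHS]sqrtr1 ltr_sqrt //; lra.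
have mA k : measurable (A k) by apply: measurableD => //; exact: measurable_ball2.
(* With [k] least such that [2^-k <= 1 - |z|^2], the weight is at most [q ^ k]. The constant
   [q >= 1] covers [k = 0] and [k = 1]; in the case [k + 2] the point lies in the collar [A k]. The
   collars are nested, and counting points repeatedly is harmless for an upper bound. *)
have key p : disc p -> (weight1 p)%:E <= (q)%:E + \sum_(k <oo) (q ^+ k.+2 * \1_(A k) p)%:E.
  move=> Dp; have s0 : (0 < 1 - nc (cx p) ^+ 2 <= 1)%R by rewrite subr_gt0 gerBl sqr_ge0 andbT; apply/discE.
  set s := (1 - nc (cx p) ^+ 2)%R in s0 *.
  have : exists k, ((2^-1 : R) ^+ k <= s)%R.
    have h : (fun k => (2^-1 : R) ^+ k)%R @ \oo --> (0 : R)%R.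
      by apply: cvg_expr; rewrite ger0_norm ?invr_ge0 // invf_lt1 ?ltr1n.
    have /andP[sp _] := s0; have /cvgrPdist_lt /(_ _ sp) [k _ hk] := h.
    exists k; apply/ltW/(le_lt_trans _ (hk k (leqnn k))).
    by rewrite /= sub0r normrN ler_norm.
  move=> [k0 hk0]; have [k hk kmin] := ex_minnP (ex_intro (fun k => (2^-1 : R) ^+ k <= s)%R k0 hk0).
  have wq : (weight1 p <= q ^+ k)%R.
    rewrite /q powR2N /weight1 -/s -[alpha]opprK !(powRN _ (- alpha)) lef_pV2 ?posrE ?powR_gt0 ?exprn_gt0 ?invr_gt0 //; last by case/andP: s0.
    apply: ge0_ler_powR => //; rewrite ?nnegrE ?oppr_ge0 ?(ltW a0) ?exprn_ge0 ?invr_ge0 //.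
    by case/andP: s0 => /ltW.
  have pos i : 0 <= (q ^+ i.+2 * \1_(A i) p)%:E by rewrite lee_fin mulr_ge0 // exprn_ge0 // ltW.
  case: k hk kmin wq => [|[|k]] hk kmin wq.
  - apply: (@le_trans _ _ q%:E); last by rewrite leeDl // nneseries_ge0.
    rewrite lee_fin (le_trans wq) // expr0 -(powRr0 (2^-1 : R)); apply: ger_powR; last exact: ltW.
    by rewrite invr_gt0 ltr0n invf_le1 ?ler1n.
  - by apply: (@le_trans _ _ q%:E); [rewrite lee_fin|rewrite leeDl // nneseries_ge0].
  have Ap : \1_(A k) p = 1%R :> R.
    rewrite indicE mem_set //; split => //; rewrite /ball2 /= => h.
    have h2 : (s < 2^-1 ^+ k.+1)%R by rewrite ltNge; apply/negP => /kmin; rewrite ltnn.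
    have /andP[rr _] := r01 k; have : (nc (cx p) ^+ 2 < r k.+1 ^+ 2)%R by rewrite ltr_pXn2r ?nnegrE ?nc_ge0 // ltW.
    by rewrite r2 /s in h2 *; move: h2; rewrite /s; lra.
  apply: (@le_trans _ _ (\sum_(k <oo) (q ^+ k.+2 * \1_(A k) p)%:E)); last by rewrite leeDr // lee_fin ltW.
  apply: (@le_trans _ _ (q ^+ k.+2 * \1_(A k) p)%:E); first by rewrite Ap mulr1 lee_fin.
  have := @nneseries_lim_ge R (fun i => (q ^+ i.+2 * \1_(A i) p)%:E) xpredT 0 k.+1 (fun i _ _ => pos i).
  apply: le_trans; rewrite big_nat_recr //= leeDr //; exact: sume_ge0.
have mq k : measurable_fun disc (fun p => (q ^+ k.+2 * \1_(A k) p)%:E).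
  by apply/measurable_EFinP; apply: measurable_funM => //; exact: measurable_indic.
have pos i p : 0 <= (q ^+ i.+2 * \1_(A i) p)%:E by rewrite lee_fin mulr_ge0 // exprn_ge0 // ltW.
apply: (@le_lt_trans _ _ (\int[(mu \x mu)]_(p in disc) (q%:E + \sum_(k <oo) (q ^+ k.+2 * \1_(A k) p)%:E))).
  apply: ge0_le_integral => //.
  - by move=> p _; rewrite lee_fin weight1_ge0.
  - by apply/measurable_EFinP; exact: measurable_weight1.
  - by apply: emeasurable_funD => //; apply: ge0_emeasurable_sum.
rewrite ge0_integralD //; last 3 first.
- by move=> p _; rewrite lee_fin ltW.
- by move=> p _; apply: nneseries_ge0.
- by apply: ge0_emeasurable_sum.
rewrite integral_cst // lte_add_pinfty //.
  by apply: lte_mul_pinfty => //; [rewrite lee_fin ltW|exact: area_fin].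
rewrite integral_nneseries //.
have -> : \sum_(k <oo) \int[(mu \x mu)]_(p in disc) (q ^+ k.+2 * \1_(A k) p)%:E =
    \sum_(k <oo) ((q * area) * (q / 2) ^+ k.+1)%:E.
  apply: eq_eseriesr => k _.
  under eq_integral do rewrite EFinM.
  rewrite ge0_integralZl ?lee_fin ?exprn_ge0 ?(ltW q0) //; last first.
    by apply/measurable_EFinP; exact: measurable_indic.
  rewrite integral_indic // (_ : A k `&` disc = A k); last by apply/setIidl => p [].
  transitivity ((q ^+ k.+2)%:E * ((1 - r k.+1 ^+ 2) * area)%:E).
    by congr (_ * _); exact: measure_annulus.
  rewrite r2 -EFinM; congr (_%:E).
  by rewrite subKr exprMn [in LHS]exprS; ring.
(* [q / 2] equals [2^-(alpha + 1)]: here [-1 < alpha] makes the layers summable. *)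
have q1 : (q / 2 < 1)%R.
  have h : (0 <= (2^-1 : R))%R by rewrite invr_ge0.
  have -> : (q / 2 = 2^-1 `^ (alpha + 1))%R.
    by rewrite powRD ?powRr1 // invr_eq0 pnatr_eq0 implybT.
  have ap : (0 < alpha + 1)%R by rewrite -ltrBlDr sub0r.
  have /(_ (2^-1)%R 1%R) := @gt0_ltr_powR R _ ap; rewrite powR1 /=; apply; rewrite ?nnegrE //.
  by rewrite invf_lt1 ?ltr1n.
have h2 : (0 < q / 2)%R by rewrite divr_gt0.
have qa : (0 <= q * area * (q / 2))%R by rewrite !mulr_ge0 ?(ltW h2) ?(ltW q0) // ltW // area_gt0.
apply: (@le_lt_trans _ _ ((q * area * (q / 2)) / (1 - q / 2))%:E); last by rewrite ltry.
apply: lime_le; first by apply: is_cvg_nneseries => k _ _; rewrite lee_fin exprS mulrA mulr_ge0 // exprn_ge0 // ltW.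
apply: nearW => n; rewrite sumEFin lee_fin.
have := @geometric_le_lim _ n _ _ qa h2; rewrite ger0_norm ?(ltW h2) // => /(_ q1).
by apply: le_trans; rewrite /series /= le_eqVlt; apply/orP; left; apply/eqP; apply: eq_bigr => k _; rewrite exprS mulrA.
Qed.

Lemma weight1_near_circle r : (0 < r < 1)%R -> 0 < \int[(mu \x mu)]_(p in disc `\` ball2 r) (weight1 p)%:E.
Proof.
move=> /andP[r0 r1]; pose r' := ((r + 1) / 2)%R; have r'1 : (r' < 1)%R by rewrite /r'; lra.
have rr' : (r < r')%R by rewrite /r'; lra.
have [c c0 hc] := weight1_ge r'1.
have mE : measurable (ball2 r' `\` ball2 r) by apply: measurableD; exact: measurable_ball2.
have mE' : measurable (disc `\` ball2 r) by apply: measurableD; [exact: measurable_disc|exact: measurable_ball2].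
apply: (@lt_le_trans _ _ (\int[(mu \x mu)]_(p in ball2 r' `\` ball2 r) (cst c%:E) p)); last first.
  apply: (@le_trans _ _ (\int[(mu \x mu)]_(p in ball2 r' `\` ball2 r) (weight1 p)%:E)).
    apply: ge0_le_integral => //.
    - by move=> p _; rewrite lee_fin ltW.
    - by apply/measurable_EFinP; exact: measurable_weight1.
    - by move=> p [h _]; rewrite lee_fin hc // ltW.
  apply: ge0_subset_integral => //.
  - by apply/measurable_EFinP; exact: measurable_weight1.
  - by move=> p _; rewrite lee_fin weight1_ge0.
  - by move=> p [h1 h2]; split => //; exact: lt_trans h1 r'1.
rewrite integral_cst //.
have E : (mu \x mu) (ball2 r' `\` ball2 r) = ((r' ^+ 2 - r ^+ 2) * area)%:E.
  have r'0 : (0 < r')%R by exact: lt_trans rr'.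
  have fin : (mu \x mu) (ball2 r') < +oo by rewrite measure_ball2 ?ltry.
  rewrite measureD //; [|exact: measurable_ball2|exact: measurable_ball2].
  rewrite (_ : ball2 r' `&` ball2 r = ball2 r); last first.
    by apply/seteqP; split => p; [case|move=> pr; split => //; exact: lt_trans pr rr'].
  by rewrite mulrBl EFinB -!measure_ball2.
suff : 0 < c%:E * ((r' ^+ 2 - r ^+ 2) * area)%:E by rewrite -E.
rewrite -EFinM lte_fin mulr_gt0 // mulr_gt0 ?area_gt0 // subr_gt0 ltr_pXn2r // nnegrE ltW //.
exact: lt_trans rr'.
Qed.

(** The one-variable normalization; [bergman_cst] turns out to be the inverse of its square. *)
Definition mass : R := fine (\int[(mu \x mu)]_(p in disc) (weight1 p)%:E).

Lemma massE : mass%:E = \int[(mu \x mu)]_(p in disc) (weight1 p)%:E.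
Proof. by rewrite fineK // ge0_fin_numE ?weight1_fin // integral_ge0 // => p _; rewrite lee_fin weight1_ge0. Qed.

Lemma mass_gt0 : (0 < mass)%R.
Proof.
have h : (0 < (2^-1 : R) < 1)%R by rewrite invr_gt0 ltr0n /= invf_lt1 // ltr1n.
rewrite -lte_fin massE; apply: lt_le_trans (weight1_near_circle h) _; apply: ge0_subset_integral => //.
- by apply: measurableD; [exact: measurable_disc|exact: measurable_ball2].
- exact: measurable_disc.
- by apply/measurable_EFinP; exact: measurable_weight1.
- by move=> p _; rewrite lee_fin weight1_ge0.
Qed.

Definition nweight (p : T2) : R := (weight1 p / mass)%R.

Lemma nweight_ge0 p : (0 <= nweight p)%R.
Proof. by rewrite divr_ge0 ?weight1_ge0 // ltW // mass_gt0. Qed.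

Lemma measurable_nweight D : measurable_fun D nweight.
Proof. by apply: measurable_funM => //; exact: measurable_weight1. Qed.

Lemma nweight_int D : measurable D -> 
  \int[(mu \x mu)]_(p in D) (nweight p)%:E = (mass^-1)%:E * \int[(mu \x mu)]_(p in D) (weight1 p)%:E.
Proof.
move=> mD; under eq_integral do rewrite /nweight mulrC EFinM.
rewrite ge0_integralZl ?lee_fin ?invr_ge0 ?(ltW mass_gt0) //.
  by apply/measurable_EFinP; exact: measurable_weight1.
by move=> p _; rewrite lee_fin weight1_ge0.
Qed.

Lemma nweight_disc : \int[(mu \x mu)]_(p in disc) (nweight p)%:E = 1.
Proof.
rewrite nweight_int; last exact: measurable_disc.
by rewrite -massE -EFinM mulVf // gt_eqF // mass_gt0.
Qed.

Notation u := (fun k (p : T2) => (nc (cx p) ^+ 2) ^+ k)%R.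
(** For [D = disc], the squared norm of [z ^ k] in the normalized one-variable space. Subsets are
    needed to cut the disc in [wint_ratio]. *)
Definition moment D k := fine (\int[(mu \x mu)]_(p in D) (u k p * nweight p)%:E).

Lemma u01 k p : disc p -> (0 <= u k p <= 1)%R.
Proof. by move=> /discE /ltW h; rewrite (exprn_ge0 _ (sqr_ge0 _)) exprn_ile1 ?sqr_ge0. Qed.

Lemma measurable_u D k : measurable_fun D (fun p => (u k p * nweight p)%:E).
Proof.
apply/measurable_EFinP; apply: measurable_funM; last exact: measurable_nweight.
by apply: measurable_funX; apply: measurable_funTS; exact: measurable_ncsq.
Qed.

Lemma u_ge0 k p : 0 <= (u k p * nweight p)%:E.
Proof. by rewrite lee_fin mulr_ge0 ?nweight_ge0 // exprn_ge0 // sqr_ge0. Qed.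

Lemma wintE D k : measurable D -> D `<=` disc ->
  (moment D k)%:E = \int[(mu \x mu)]_(p in D) (u k p * nweight p)%:E.
Proof.
move=> mD Dd; rewrite fineK // ge0_fin_numE; last by apply: integral_ge0 => p _; exact: u_ge0.
apply: (@le_lt_trans _ _ 1); last by rewrite ltry.
rewrite -nweight_disc; apply: (@le_trans _ _ (\int[(mu \x mu)]_(p in D) (nweight p)%:E)).
  apply: ge0_le_integral => //.
  - by move=> p _; exact: u_ge0.
  - exact: measurable_u.
  - by apply/measurable_EFinP; exact: measurable_nweight.
  - by move=> p /Dd Dp; rewrite lee_fin ler_piMl ?nweight_ge0 //; case/andP: (u01 k Dp).
apply: ge0_subset_integral => //; first exact: measurable_disc.
- by apply/measurable_EFinP; exact: measurable_nweight.
- by move=> p _; rewrite lee_fin nweight_ge0.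
Qed.

Lemma wint_le D k l (c1 c2 : R) : measurable D -> D `<=` disc -> (0 <= c1)%R -> (0 <= c2)%R ->
  (forall p, D p -> (c1 * u k p <= c2 * u l p)%R) -> (c1 * moment D k <= c2 * moment D l)%R.
Proof.
move=> mD Dd c10 c20 h; rewrite -lee_fin !EFinM !wintE //.
rewrite -!ge0_integralZl //; try by [exact: measurable_u|move=> p _; exact: u_ge0].
apply: ge0_le_integral => //.
- by move=> p _; apply: mule_ge0; [rewrite lee_fin|exact: u_ge0].
- by apply: emeasurable_funM => //; exact: measurable_u.
- by apply: emeasurable_funM => //; exact: measurable_u.
- by move=> p /h hp; rewrite -!EFinM lee_fin mulrA [leRHS]mulrA; apply: ler_wpM2r hp; exact: nweight_ge0.
Qed.

Lemma wint_ge0 D k : (0 <= moment D k)%R.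
Proof. by rewrite fine_ge0 // integral_ge0 // => p _; exact: u_ge0. Qed.

Lemma wint_disc0 : moment disc 0 = 1%R.
Proof.
rewrite /moment (eq_integral (fun p => (nweight p)%:E)) ?nweight_disc // => p _.
by rewrite expr0 mul1r.
Qed.

Lemma wint_decr k : (moment disc k.+1 <= moment disc k)%R.
Proof.
have := @wint_le disc k.+1 k 1 1 (@measurable_disc R) (fun p h => h) ler01 ler01.
rewrite !mul1r; apply => p Dp; rewrite !mul1r exprS ler_piMl //; last by apply/ltW/discE.
by case/andP: (u01 k Dp).
Qed.

(** Cut the disc at radius [r]. On the collar [A] each further factor [|z|^2] costs at most [r ^ 2].
    The inner ball contributes at most [r ^ (2 m)] to the [m]-th moment, hence at most the collar's
    [m]-th moment divided by [moment A 0]. The collar therefore controls the whole moment up to a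
    constant independent of [m] and [k]. *)
Lemma wint_ratio r : (0 < r < 1)%R -> exists2 K : R, (0 <= K)%R &
  forall m k, (moment disc m * (r ^+ 2) ^+ k <= K * moment disc (m + k))%R.
Proof.
move=> r01; have /andP[r0 r1] := r01; pose A := disc `\` ball2 r.
have mB : measurable (ball2 r) := measurable_ball2 r.
have mA : measurable A by apply: measurableD => //; exact: measurable_disc.
have Bd : ball2 r `<=` disc by move=> p h; exact: lt_trans h r1.
have Ad : A `<=` disc by move=> p [].
have split m : moment disc m = (moment (ball2 r) m + moment A m)%R.
  apply: EFin_inj; rewrite EFinD !wintE //; last exact: measurable_disc.
  rewrite -ge0_integral_setU //; last 3 first.
  - exact: measurable_u.
  - by move=> p _; exact: u_ge0.
  - by apply/disj_setPS => p [] h [].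
  congr integral; apply/seteqP; split => p; last by case=> [/Bd|[]].
  by move=> dp; have [h|h] := pselect (ball2 r p); [left|right].
have r20 : (0 < r ^+ 2)%R by rewrite exprn_gt0.
have s0 : (0 < moment A 0)%R.
  rewrite -lte_fin wintE //; under eq_integral do rewrite expr0 mul1r.
  by rewrite nweight_int // mule_gt0 ?lte_fin ?invr_gt0 ?mass_gt0 // weight1_near_circle.
have ur p : A p -> (r ^+ 2 <= nc (cx p) ^+ 2)%R.
  by move=> [_ /negP]; rewrite -leNgt => h; rewrite lerXn2r // nnegrE ?nc_ge0 // ltW.
have ub p : ball2 r p -> (nc (cx p) ^+ 2 <= r ^+ 2)%R.
  by move=> /ltW h; rewrite lerXn2r // nnegrE ?nc_ge0 // ltW.
have e0 m : (0 <= (r ^+ 2) ^+ m)%R by rewrite exprn_ge0 // ltW.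
have h1 m k : ((r ^+ 2) ^+ k * moment A m <= moment A (m + k))%R.
  rewrite -[leRHS]mul1r; apply: wint_le => // p Ap.
  rewrite mul1r exprD mulrC; apply: ler_wpM2l; first exact: (exprn_ge0 _ (sqr_ge0 _)).
  by apply: lerXn2r; rewrite ?nnegrE ?sqr_ge0 ?ur.
have h2 m : (moment (ball2 r) m <= (r ^+ 2) ^+ m * moment (ball2 r) 0)%R.
  rewrite -[leLHS]mul1r; apply: wint_le => // p Bp.
  by rewrite mul1r expr0 mulr1; apply: lerXn2r; rewrite ?nnegrE ?sqr_ge0 ?ub.
have h3 : (moment (ball2 r) 0 <= 1)%R by rewrite -wint_disc0 split lerDl wint_ge0.
exists (1 + (moment A 0)^-1)%R => [|m k]; first by rewrite addr_ge0 // invr_ge0 ltW.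
have h4 : ((r ^+ 2) ^+ m * moment A 0 <= moment A m)%R by have := h1 0%N m; rewrite add0n.
have h5 : (moment disc m <= (1 + (moment A 0)^-1) * moment A m)%R.
  rewrite split mulrDl mul1r addrC lerD2l; apply: (le_trans (h2 m)).
  apply: (@le_trans _ _ ((r ^+ 2) ^+ m)%R); first by rewrite ler_piMr.
  by rewrite mulrC ler_pdivlMr.
have K0 : (0 <= 1 + (moment A 0)^-1)%R by rewrite addr_ge0 // invr_ge0 ltW.
apply: (le_trans (ler_wpM2r (e0 k) h5)); rewrite -mulrA ler_wpM2l //.
rewrite [leLHS]mulrC; apply: (le_trans (h1 m k)); rewrite [leRHS]split lerDr wint_ge0 //.
Qed.

Lemma of_real_bidisc : @of_real R @^-1` @bidisc R = disc `*` disc.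
Proof.
apply/seteqP; split => -[[x y] [x' y']]; rewrite /disc /bidisc /of_real /=.
  by rewrite !normC_lt1.
by rewrite !normC_lt1.
Qed.

Lemma leb4E : @leb4 R = (sigma_finite_prod mu mu \x sigma_finite_prod mu mu).
Proof. by []. Qed.

Lemma bergman_int f a : repr f a -> \int[@leb4 R]_(t in @of_real R @^-1` @bidisc R)
     (Normc.normc (f (of_real t)) ^+ 2 * bergman_weight alpha (of_real t))%:E =
  (mass ^+ 2)%:E * ereal_sup (range (fun K => (wsq (moment disc) K a)%:E)).
Proof.
move=> fa; rewrite of_real_bidisc.
have mD := @measurable_disc R.
have np p : disc p -> (nc (cx p) < 1)%R by [].
have nw0 p : disc p -> (0 <= nweight p)%R by move=> _; exact: nweight_ge0.
have rad p q : nc (cx p) = nc (cx q) -> nweight p = nweight q by rewrite /nweight /weight1 => ->.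
have fin : \int[(mu \x mu)]_(p in disc) (nweight p)%:E < +oo by rewrite nweight_disc ltry.
have par := disc_parseval (@measurable_nweight disc) nw0 rad fin.
have P2 := @parseval2 R _ T2 (sigma_finite_prod mu mu) disc (@cx R) nweight (moment disc) mD (@cmeas_cx R disc)
  np (@measurable_nweight disc) nw0 (wint_ge0 disc) par f a fa.
have mm0 : (0 <= mass ^+ 2)%R by rewrite sqr_ge0.
have mf := @repr_cmeas R _ T2 disc (@cx R) mD (@cmeas_cx R disc) np f a fa.
pose H (p : T2 * T2) := (nc (f (cx p.1, cx p.2)) ^+ 2 * (nweight p.1 * nweight p.2))%R.
have mH : measurable_fun (disc `*` disc) (EFin \o H).
  apply/measurable_EFinP; apply: measurable_funM; first exact: cmeas_sqr.
  apply: measurable_funM.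
    by apply: measurable_funTS; apply: (measurableT_comp (@measurable_nweight setT)); exact: measurable_fst.
  by apply: measurable_funTS; apply: (measurableT_comp (@measurable_nweight setT)); exact: measurable_snd.
have H0 p : 0 <= (H p)%:E by rewrite lee_fin mulr_ge0 ?sqr_ge0 // mulr_ge0 ?nweight_ge0.
have HE t : (nc (f (of_real t)) ^+ 2 * bergman_weight alpha (of_real t))%R = (mass ^+ 2 * H t)%R.
  rewrite /H [RHS]mulrCA -[of_real t]/(cx t.1, cx t.2); congr (_ * _)%R.
  have h := mass_gt0; have m0 : mass != 0%R by rewrite gt_eqF.
  by rewrite /bergman_weight /nweight /weight1 /=; field.
rewrite leb4E -P2 -(ge0_integralZl _ (measurableX mD mD) mH (fun p _ => H0 p)) ?lee_fin //.
by apply: eq_integral => t _; rewrite HE.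
Qed.

(** The normalizing constant is found by applying [bergman_int] to the constant function 1. *)
Lemma bergman_sqnorm_repr f a : repr f a ->
  bergman_sqnorm alpha f = ereal_sup (range (fun K => (wsq (moment disc) K a)%:E)).
Proof.
move=> fa; rewrite /bergman_sqnorm (bergman_int fa).
have mm1 : (mass ^+ 2 != 0)%R by rewrite expf_neq0 // gt_eqF // mass_gt0.
have one : repr (fun=> 1%R) (fun m n => ((m == 0%N) && (n == 0%N))%:R : C).
  have c1 (c : C) z : csum (fun n => (n == 0%N)%:R * c * z ^+ n)%R c.
    move=> e e0; exists 1%N => n n1.
    rewrite (bigD1 (Ordinal n1)) //= mul1r expr0 mulr1 big1 ?addr0 ?subrr ?nc0 //.
    by move=> i /negPf i0; rewrite (_ : (i : nat) == 0%N = false) ?mul0r.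
  exists (fun m w => (m == 0%N)%:R)%R; split.
    move=> m w _; apply: csum_ext (c1 (m == 0%N)%:R w)%R => n.
    by rewrite -natrM mulnb andbC.
  by move=> z w _ _; apply: csum_ext (c1 1%R z) => n; rewrite mulr1.
have sup1 : ereal_sup (range (fun K => (wsq (moment disc) K (fun m n => ((m == 0%N) && (n == 0%N))%:R : C))%:E)) = 1.
  have s1 K : wsq (moment disc) K.+1 (fun m n => ((m == 0%N) && (n == 0%N))%:R : C) = 1%R.
    rewrite /wsq big_ord_recl big_ord_recl /= nc1 wint_disc0 expr1n !mulr1.
    rewrite big1 ?addr0; last by move=> i _; rewrite nc0 expr0n mul0r.
    by rewrite big1 ?addr0 // => i _; apply: big1 => j _; rewrite nc0 expr0n mul0r.
  apply/eqP; rewrite eq_le; apply/andP; split; last by apply: ereal_sup_ubound; exists 1%N; rewrite ?s1.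
  apply: ge_ereal_sup => _ [[|K] _ <-]; last by rewrite s1.
  by rewrite /wsq big_ord0 lee_fin.
have := bergman_int one; rewrite sup1 mule1 => E.
have E2 : \int[@leb4 R]_(t in @of_real R @^-1` @bidisc R) (bergman_weight alpha (of_real t))%:E = (mass ^+ 2)%:E.
  by rewrite -E leb4E; apply: eq_integral => t _; rewrite nc1 expr1n mul1r.
rewrite /bergman_cst E2 -[fine _]/(mass ^+ 2)%R.
by rewrite muleA -EFinM mulVf // mul1e.
Qed.

End PowerWeight.
End DiscWeights.

(** * Hilbert spaces inside an ambient vector space, up to the projection theorem *)

Section HilbertSubspace.
Variables (R : realType) (V : lmodType R[i]) (N : V -> R).
Notation C := R[i].
Notation nc := (@Normc.normc R).
Notation Re := (@complex.Re R).
Notation dot := (dotp N).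

Definition subspace (M : set V) := M 0 /\ forall (c : C) x y, M x -> M y -> M (c *: x + y).

Lemma subspaceD M x y : subspace M -> M x -> M y -> M (x + y).
Proof. by move=> [_ h] Mx My; rewrite -[x]scale1r; exact: h. Qed.
Lemma subspaceZ M (c : C) x : subspace M -> M x -> M (c *: x).
Proof. by move=> [h0 h] Mx; rewrite -[c *: x]addr0; exact: h. Qed.
Lemma subspaceN M x : subspace M -> M x -> M (- x).
Proof. by move=> hM Mx; rewrite -scaleN1r; exact: subspaceZ. Qed.
Lemma subspaceB M x y : subspace M -> M x -> M y -> M (x - y).
Proof. by move=> hM Mx My; apply: subspaceD => //; exact: subspaceN. Qed.

Definition ncauchy (u : nat -> V) := forall e : R, 0 < e ->
  exists n0, forall m n, (n0 <= m)%N -> (n0 <= n)%N -> N (u m - u n) < e.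
Definition nlim (u : nat -> V) x := forall e : R, 0 < e ->
  exists n0, forall n, (n0 <= n)%N -> N (u n - x) < e.

(** The axioms are relative to [H], since [N] and its polarization behave as a norm and an inner
    product only there. Definiteness is kept apart, as a separate hypothesis of the results that use
    it. *)
Definition hilbert (H : set V) := [/\ subspace H,
  forall (c : C) x y z, H x -> H y -> H z -> dot (c *: x + y) z = c * dot x z + dot y z,
  forall x y, H x -> H y -> dot y x = (dot x y)^*%C,
  forall x, H x -> dot x x = (N x ^+ 2)%:C%C /\ 0 <= N x &
  forall u, (forall n, H (u n)) -> ncauchy u -> exists2 x, H x & nlim u x].

Variable H : set V.
Hypothesis hH : hilbert H.

Lemma hilb_sub : subspace H. Proof. by case: hH. Qed.
Hint Resolve hilb_sub : core.
Lemma hilb0 : H 0. Proof. by case: hilb_sub. Qed.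
Lemma nrm_ge0 x : H x -> 0 <= N x. Proof. by case: hH => _ _ _ h _ /h[]. Qed.
Lemma dotxx x : H x -> dot x x = (N x ^+ 2)%:C%C. Proof. by case: hH => _ _ _ h _ /h[]. Qed.
Lemma dotC x y : H x -> H y -> dot y x = (dot x y)^*%C. Proof. by case: hH => _ _ h _ _; exact: h. Qed.
Lemma dotDl x y z : H x -> H y -> H z -> dot (x + y) z = dot x z + dot y z.
Proof. by case: hH => _ h _ _ _ Hx Hy Hz; rewrite -{1}[x]scale1r h // mul1r. Qed.
Lemma dot0l z : H z -> dot 0 z = 0.
Proof. by move=> Hz; apply: (addIr (dot 0 z)); rewrite -dotDl ?addr0 ?add0r //; exact: hilb0. Qed.
Lemma dotZl (c : C) x z : H x -> H z -> dot (c *: x) z = c * dot x z.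
Proof. by case: hH => _ h _ _ _ Hx Hz; rewrite -[c *: x]addr0 h ?dot0l ?addr0 //; exact: hilb0. Qed.
Lemma dotNl x z : H x -> H z -> dot (- x) z = - dot x z.
Proof. by move=> Hx Hz; rewrite -scaleN1r dotZl // mulN1r. Qed.
Lemma dotBl x y z : H x -> H y -> H z -> dot (x - y) z = dot x z - dot y z.
Proof. by move=> Hx Hy Hz; rewrite dotDl ?dotNl //; exact: subspaceN. Qed.
Lemma dotDr x y z : H x -> H y -> H z -> dot z (x + y) = dot z x + dot z y.
Proof.
move=> Hx Hy Hz; have HS : H (x + y) by exact: subspaceD.
by rewrite (dotC HS Hz) dotDl // rmorphD /= -!dotC.
Qed.
Lemma dotZr (c : C) x z : H x -> H z -> dot z (c *: x) = c^*%C * dot z x.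
Proof.
move=> Hx Hz; have HS : H (c *: x) by exact: subspaceZ.
by rewrite (dotC HS Hz) dotZl // rmorphM /= -!dotC.
Qed.

Lemma dotNr x z : H x -> H z -> dot z (- x) = - dot z x.
Proof. by move=> Hx Hz; rewrite -scaleN1r dotZr // rmorphN rmorph1 mulN1r. Qed.

Lemma sqr_nrmD x y : H x -> H y -> N (x + y) ^+ 2 = N x ^+ 2 + N y ^+ 2 + 2 * Re (dot x y).
Proof.
move=> Hx Hy; have HS : H (x + y) by exact: subspaceD.
have : dot (x + y) (x + y) = dot x x + dot y y + (dot x y + (dot x y)^*%C).
  by rewrite dotDl // !dotDr // (dotC Hx Hy); ring.
rewrite !dotxx // => /(congr1 (fun u => Re u)); rewrite !cReD cReJ /= => ->; ring.
Qed.

Lemma nrmZ (c : C) x : H x -> N (c *: x) = nc c * N x.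
Proof.
move=> Hx; have HS : H (c *: x) by exact: subspaceZ.
have : dot (c *: x) (c *: x) = (nc c ^+ 2)%:C%C * dot x x.
  by rewrite dotZl // dotZr // mulrA mulrJ.
rewrite !dotxx // => /(congr1 (fun u => Re u)); rewrite /= !mul0r !subr0 -exprMn => /eqP.
by rewrite eqrXn2 ?mulr_ge0 ?nc_ge0 ?nrm_ge0 // => /eqP.
Qed.

Lemma nrmN x : H x -> N (- x) = N x.
Proof. by move=> Hx; rewrite -scaleN1r nrmZ // ncN nc1 mul1r. Qed.

Lemma nrm0 : N 0 = 0.
Proof. by rewrite -(scale0r 0) nrmZ ?nc0 ?mul0r //; exact: hilb0. Qed.

Lemma cauchy_schwarz x y : H x -> H y -> nc (dot x y) <= N x * N y.
Proof.
move=> Hx Hy; set d := dot x y.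
have key s : 0 <= N x ^+ 2 - 2 * s * nc d ^+ 2 + s ^+ 2 * nc d ^+ 2 * N y ^+ 2.
  pose c := - (s%:C%C * d); have Hc : H (c *: y) by exact: subspaceZ.
  have := sqr_ge0 (N (x + c *: y)); rewrite sqr_nrmD // nrmZ // dotZr // -/d.
  rewrite /c ncN ncM nc_real !exprMn real_normK ?num_real //.
  have -> : Re ((- (s%:C%C * d))^*%C * d) = - (s * nc d ^+ 2).
    by rewrite sqr_nc; case: (d) => p q /=; ring.
  lra.
have [y0|y0] := eqVneq (N y) 0.
  rewrite y0 mulr0 le_eqVlt; apply/orP; left; rewrite nc_eq0; apply/eqP/eqP.
  rewrite -nc_eq0 -sqrf_eq0 eq_le sqr_ge0 andbT leNgt; apply/negP => d0.
  have := key ((N x ^+ 2 + 1) / nc d ^+ 2); rewrite y0 expr0n /= mulr0 addr0 -mulrA mulfVK ?gt_eqF //.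
  have := sqr_ge0 (N x); lra.
have yp : 0 < N y by rewrite lt_neqAle eq_sym y0 nrm_ge0.
have yp2 : 0 < N y ^+ 2 by rewrite exprn_gt0.
rewrite -(@ler_pXn2r _ 2) ?nnegrE ?nc_ge0 ?mulr_ge0 ?nrm_ge0 // exprMn.
have := key (N y ^+ 2)^-1.
have -> : N x ^+ 2 - 2 * (N y ^+ 2)^-1 * nc d ^+ 2 + (N y ^+ 2)^-1 ^+ 2 * nc d ^+ 2 * N y ^+ 2 =
  N x ^+ 2 - nc d ^+ 2 / N y ^+ 2 by field.
by rewrite subr_ge0 ler_pdivrMr.
Qed.

Lemma nrmD x y : H x -> H y -> N (x + y) <= N x + N y.
Proof.
move=> Hx Hy; have HS : H (x + y) by exact: subspaceD.
rewrite -(@ler_pXn2r _ 2) ?nnegrE ?addr_ge0 ?nrm_ge0 // sqr_nrmD // sqrrD.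
have := le_trans (le_trans (ler_norm _) (Re_le_nc (dot x y))) (cauchy_schwarz Hx Hy).
by rewrite mulr2n; lra.
Qed.

Lemma nrmB x y : H x -> H y -> N (x - y) <= N x + N y.
Proof. by move=> Hx Hy; rewrite -(nrmN Hy) nrmD //; exact: subspaceN. Qed.

Lemma nrm_dist x y : H x -> H y -> N (x - y) = N (y - x).
Proof. by move=> Hx Hy; rewrite -nrmN ?opprB //; exact: subspaceB. Qed.

Lemma nrm_sub x y z : H x -> H y -> H z -> N (x - z) <= N (x - y) + N (y - z).
Proof. by move=> Hx Hy Hz; rewrite -[x - z](subrKA y) nrmD //; exact: subspaceB. Qed.

Lemma nrm_subr x y : H x -> H y -> N x - N y <= N (x - y).
Proof. by move=> Hx Hy; rewrite lerBlDr -{1}[x](subrK y) nrmD //; exact: subspaceB. Qed.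

Lemma projection M x : subspace M -> M `<=` H ->
  (forall y, H y -> (forall e : R, 0 < e -> exists2 m, M m & N (y - m) < e) -> M y) ->
  H x -> exists2 m, M m & forall h, M h -> dot (x - m) h = 0.
Proof.
move=> hM MH cM Hx; pose D := [set N (x - m) ^+ 2 | m in M].
have lD : lbound D 0 by move=> _ [m _ <-]; exact: sqr_ge0.
have D0 : D !=set0 by exists (N (x - 0) ^+ 2); exists 0 => //; case: hM.
have iD : has_inf D by split => //; exists 0.
set d := inf D.
have dm m : M m -> d <= N (x - m) ^+ 2 by move=> Mm; apply: ge_inf; [exists 0|exists m].
have /choice [u hu] : forall n : nat, exists m, M m /\ N (x - m) ^+ 2 < d + n.+1%:R^-1.
  move=> n; have n0 : 0 < n.+1%:R^-1 :> R by rewrite invr_gt0.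
  by have [_ [m Mm <-] h] := inf_adherent n0 iD; exists m.
have uM n : M (u n) by case: (hu n).
have uH n : H (u n) by exact: MH.
have Hxu n : H (x - u n) by exact: subspaceB.
have par m n : N (u m - u n) ^+ 2 <= 2 * m.+1%:R^-1 + 2 * n.+1%:R^-1.
  have E1 : u m - u n = (x - u n) + - (x - u m) by rewrite opprB [RHS]addrC addrA subrK.
  have Nn : H (- (x - u m)) by exact: subspaceN.
  have MM : M (2^-1 *: (u m + u n)) by apply: subspaceZ => //; exact: subspaceD.
  have HM := MH _ MM.
  have E2 : (x - u n) + (x - u m) = 2 *: (x - 2^-1 *: (u m + u n)).
    rewrite scalerBr scalerA mulfV ?pnatr_eq0 // scale1r scaler_nat mulr2n.
    by rewrite addrACA -opprD [u n + _]addrC.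
  have h := sqr_nrmD (Hxu n) (Hxu m).
  rewrite E2 nrmZ in h; last exact: subspaceB.
  have n2 : nc (2 : C) = 2 by rewrite -[(2 : C)]/((1 + 1 : C)) -(rmorphD (real_complex R)) nc_real ger0_norm // addr_ge0.
  rewrite E1 sqr_nrmD // nrmN // dotNr // cReN.
  have ar (a b q r d' e1 e2 : R) : d' <= q -> a < d' + e1 -> b < d' + e2 -> 2 ^+ 2 * q = b + a + 2 * r ->
      b + a + 2 * - r <= 2 * e1 + 2 * e2.
    have -> : (2 : R) ^+ 2 = 4 by ring.
    by move=> *; lra.
  have [_ hm] := hu m; have [_ hn] := hu n; move: h; rewrite n2 exprMn.
  exact: (ar _ _ _ _ _ _ _ (dm _ MM) hm hn).
have cu : ncauchy u.
  move=> e e0; have e20 : 0 < e ^+ 2 / 4 by rewrite divr_gt0 // exprn_gt0.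
  have [n0 hn0] : exists n0 : nat, forall n, (n0 <= n)%N -> n.+1%:R^-1 < e ^+ 2 / 4.
    by have [n0 _ h] := near_infty_natSinv_lt (PosNum e20); exists n0.
  exists n0 => m n hm hn; have HS : H (u m - u n) by exact: subspaceB.
  rewrite -(@ltr_pXn2r _ 2) ?nnegrE ?nrm_ge0 ?(ltW e0) //.
  apply: le_lt_trans (par m n) _.
  have ar (a b c : R) : a < c / 4 -> b < c / 4 -> 2 * a + 2 * b < c by move=> *; lra.
  exact: (ar _ _ _ (hn0 m hm) (hn0 n hn)).
have [m Hm um] : exists2 m, H m & nlim u m by case: hH => _ _ _ _ h; exact: h.
have Mm : M m.
  apply: cM => // e e0; have [n0 h] := um _ e0; exists (u n0) => //.
  by rewrite nrm_dist //; exact: h.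
have Hxm : H (x - m) by exact: subspaceB.
have dE : N (x - m) ^+ 2 <= d.
  have d0 : 0 <= d by apply: lb_le_inf => //; exact: lD.
  rewrite leNgt; apply/negP => dp; set p := N (x - m) in dp.
  have p0 : 0 <= p by exact: nrm_ge0.
  have qp : Num.sqrt d < p by rewrite -(ger0_norm p0) -sqrtr_sqr ltr_sqrt // (le_lt_trans d0).
  pose t := (p + Num.sqrt d) / 2; have q0 := sqrtr_ge0 d.
  have td : 0 < t ^+ 2 - d.
    rewrite subr_gt0 -{1}(sqr_sqrtr d0) ltr_pXn2r ?nnegrE //; rewrite /t; lra.
  have [n1 _ h1] := near_infty_natSinv_lt (PosNum td).
  have pt : 0 < p - t by rewrite /t; lra.
  have [n2 h2] := um _ pt; pose n := maxn n1 n2.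
  have h3 : N (x - u n) < t.
    rewrite -(@ltr_pXn2r _ 2) ?nnegrE ?nrm_ge0 //; last by rewrite /t; lra.
    have [_ hn] := hu n; apply: (lt_trans hn); rewrite -ltrBrDl; exact: (h1 n (leq_maxl _ _)).
  by have := nrm_sub Hx (uH n) Hm; have := h2 n (leq_maxr _ _); rewrite -/p; lra.
(* Moving from [m] along [h] by [s d'] changes the squared distance by [- s |d'|^2 (2 - s |h|^2)].
   With this [s] the last factor is at least 1, so minimality forces [d' = 0]. *)
exists m => // h Mh; have Hh := MH _ Mh.
set d' := dot (x - m) h; pose s := (N h ^+ 2 + 1)^-1; pose c := - (s%:C%C * d').
have s0 : 0 < s by rewrite invr_gt0 ltr_wpDl // sqr_ge0.
have Hc : H (c *: h) by exact: subspaceZ.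
have : d <= N (x - m + c *: h) ^+ 2.
  have -> : x - m + c *: h = x - (m + - c *: h) by rewrite opprD scaleNr opprK addrA.
  by apply: dm; apply: subspaceD => //; exact: subspaceZ.
rewrite sqr_nrmD // nrmZ // dotZr // -/d' /c ncN ncM nc_real !exprMn real_normK ?num_real //.
have -> : Re ((- (s%:C%C * d'))^*%C * d') = - (s * nc d' ^+ 2).
  by rewrite sqr_nc; case: (d') => p q /=; ring.
move=> h1; apply/eqP; rewrite -nc_eq0 -sqrf_eq0 eq_le sqr_ge0 andbT.
have h2 : s * nc d' ^+ 2 * (2 - s * N h ^+ 2) <= 0 by move: h1 dE; lra.
have h3 : s * N h ^+ 2 <= 1.
  by rewrite /s mulrC ler_pdivrMr ?mul1r ?lerDl // -invr_gt0.
move: h2; rewrite -mulrA pmulr_rle0 // pmulr_lle0 //; lra.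
Qed.

Lemma nlim_sub u x (f : V -> V) (M : R) : (forall n, H (u n)) -> H x ->
  (forall y, H y -> N (f y) <= M * N y) -> (forall y z, H y -> H z -> f (y - z) = f y - f z) ->
  nlim u x -> nlim (f \o u) (f x).
Proof.
move=> Hu Hx hM fB ux e e0; have M0 : 0 < Num.max M 1 by rewrite lt_max ltr01 orbT.
have [n0 h] := ux _ (divr_gt0 e0 M0); exists n0 => n /h hn /=.
have HB : H (u n - x) by exact: subspaceB.
rewrite -fB //; apply: le_lt_trans (hM _ HB) _.
apply: (@le_lt_trans _ _ (Num.max M 1 * N (u n - x))).
  by rewrite ler_wpM2r ?nrm_ge0 // le_max lexx.
by rewrite mulrC -ltr_pdivlMr.
Qed.

Lemma nlim_uniq u x y : (forall n, H (u n)) -> H x -> H y -> nlim u x -> nlim u y -> N (x - y) = 0.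
Proof.
move=> Hu Hx Hy ux uy; have HB : H (x - y) by exact: subspaceB.
apply/eqP; rewrite eq_le nrm_ge0 // andbT leNgt; apply/negP => e0.
have e2 : 0 < N (x - y) / 2 by rewrite divr_gt0.
have [n1 h1] := ux _ e2; have [n2 h2] := uy _ e2; pose n := maxn n1 n2.
have := nrm_sub Hx (Hu n) Hy; rewrite (nrm_dist Hx (Hu n)).
have := h1 n (leq_maxl _ _); have := h2 n (leq_maxr _ _); lra.
Qed.

End HilbertSubspace.

Lemma patch_in (T U : Type) (f g : T -> U) (A : set T) x : A x -> patch f A g x = g x.
Proof. by move=> Ax; rewrite /patch mem_set. Qed.

Lemma patch_out (T U : Type) (f g : T -> U) (A : set T) x : ~ A x -> patch f A g x = f x.
Proof. by move=> Ax; rewrite /patch memNset. Qed.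

(** * The orthocomplement of a closed subspace, and compressions to it *)

Section Orthocomplement.
Variables (R : realType) (V : lmodType R[i]) (N : V -> R) (H M : set V).
Notation C := R[i].
Notation Re := (@complex.Re R).
Notation dot := (dotp N).
Hypotheses (hH : hilbert N H) (def : forall x, H x -> N x = 0 -> x = 0).
Hypotheses (hM : subspace M) (MH : M `<=` H).
Hypothesis cM : forall y, H y -> (forall e : R, 0 < e -> exists2 m, M m & N (y - m) < e) -> M y.
Let hs := hilb_sub hH.
Local Notation Q := (orthocomplement N H M).

Lemma ortho_sub : subspace Q.
Proof.
split; first by split; [exact: hilb0 hH|move=> y /MH Hy; exact: (dot0l hH Hy)].
move=> c x y [Hx xM] [Hy yM]; have Hc := subspaceZ c hs Hx; split; first exact: subspaceD.
by move=> z Mz; have Hz := MH Mz; rewrite (dotDl hH) // (dotZl hH) // xM // yM // mulr0 addr0.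
Qed.

Lemma ortho_disjoint x : M x -> Q x -> x = 0.
Proof.
move=> Mx [Hx xM]; apply: def => //; have := dotxx hH Hx; rewrite xM // => /(congr1 (fun u => Re u)) /= /esym/eqP.
by rewrite sqrf_eq0 => /eqP.
Qed.

Lemma ortho_decomp x : H x -> exists2 m, M m & Q (x - m).
Proof.
move=> Hx; have [m Mm h] := projection hH hM MH cM Hx; exists m => //.
by split => //; apply: subspaceB => //; exact: MH.
Qed.

Lemma ortho_perp x y : M x -> Q y -> dot x y = 0.
Proof. by move=> Mx [Hy yM]; rewrite (dotC hH Hy (MH Mx)) yM // conjc0. Qed.

(** The default value of [xget] is not reached, since [p] is a witness; two witnesses differ by a
    vector orthogonal to itself, which definiteness makes 0. *)
Lemma orthoprojE x p : H x -> Q p -> M (x - p) -> orthoproj N Q x = p.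
Proof.
move=> Hx Qp Mp; rewrite /orthoproj; case: xgetP => [y _ [Qy hy]|/(_ p)]; last first.
  by case; split => // h Qh; exact: ortho_perp.
have Qd : Q (p - y) by exact: subspaceB ortho_sub _ _.
have [Hd _] := Qd; have Mp' := MH Mp.
apply/eqP; rewrite eq_sym -subr_eq0; apply/eqP; apply: def => //.
have : dot (p - y) (p - y) = 0.
  rewrite {1}(_ : p - y = (x - y) - (x - p)); last by rewrite opprB [RHS]addrC addrA subrK.
  rewrite (dotBl hH) //; last by apply: subspaceB => //; case: Qy.
  by rewrite hy // (ortho_perp Mp Qd) subrr.
rewrite (dotxx hH Hd) => /(congr1 (fun u => Re u)) /= /eqP.
by rewrite sqrf_eq0 => /eqP.
Qed.

Lemma orthoproj_spec x : H x -> Q (orthoproj N Q x) /\ M (x - orthoproj N Q x).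
Proof.
move=> Hx; have [m Mm Qm] := ortho_decomp Hx.
have E : x - (x - m) = m by rewrite subKr.
by rewrite (orthoprojE Hx Qm) E.
Qed.

Lemma orthoproj_le x : H x -> N (orthoproj N Q x) <= N x.
Proof.
move=> Hx; have [Qp Mp] := orthoproj_spec Hx; have [Hp _] := Qp; have Hm := MH Mp.
rewrite -(@ler_pXn2r _ 2) ?nnegrE ?(nrm_ge0 hH) // -{2}[x](subrK (orthoproj N Q x)) (sqr_nrmD hH) //.
by rewrite (ortho_perp Mp Qp) /= mulr0 addr0 lerDr sqr_ge0.
Qed.

Lemma orthoproj_lin (c : C) x y : H x -> H y ->
  orthoproj N Q (c *: x + y) = c *: orthoproj N Q x + orthoproj N Q y.
Proof.
move=> Hx Hy; have [Qx Mx] := orthoproj_spec Hx; have [Qy My] := orthoproj_spec Hy.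
apply: orthoprojE; first by case: hs => _; exact.
  by case: ortho_sub => _; exact.
by rewrite opprD addrACA -scalerBr; case: hM => _; exact.
Qed.

Lemma hilbert_ortho : hilbert N Q.
Proof.
case: (hH) => _ h2 h3 h4 h5; split.
- exact: ortho_sub.
- by move=> c x y z [Hx _] [Hy _] [Hz _]; exact: h2.
- by move=> x y [Hx _] [Hy _]; exact: h3.
- by move=> x [Hx _]; exact: h4.
move=> u Qu cu; have Hu n : H (u n) by case: (Qu n).
have [x Hx ux] := h5 u Hu cu; exists x => //; split => // y My; have Hy := MH My.
apply/eqP; rewrite -nc_eq0 eq_le nc_ge0 andbT leNgt; apply/negP => d0.
have Ny : 0 < N y + 1 by rewrite ltr_wpDl ?(nrm_ge0 hH).
have [n /(_ n (leqnn n)) hn] := ux _ (divr_gt0 d0 Ny).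
have Hd : H (u n - x) by exact: subspaceB.
have := cauchy_schwarz hH Hd Hy; rewrite (dotBl hH) //; case: (Qu n) => _ -> //.
rewrite sub0r ncN leNgt => /negP; apply.
apply: (@le_lt_trans _ _ (N (u n - x) * (N y + 1))).
  by rewrite ler_wpM2l ?(nrm_ge0 hH) // lerDl.
by rewrite -ltr_pdivlMr.
Qed.

Lemma bounded_compression (m : V -> V) (B : R) : (forall x, H x -> H (m x)) ->
  (forall x, H x -> N (m x) <= B * N x) ->
  (forall (c : C) x y, m (c *: x + y) = c *: m x + m y) ->
  bounded_op N Q (patch (fun=> 0) Q (fun x => orthoproj N Q (m x))).
Proof.
move=> Hm mB ml; split.
- by move=> x Qx; rewrite patch_in //; have [Hx _] := Qx; case: (orthoproj_spec (Hm x Hx)).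
- move=> c x y Qx Qy; have [_ /(_ c x y Qx Qy) Qxy] := ortho_sub.
  have [[Hx _] [Hy _]] := (Qx, Qy).
  by rewrite !patch_in // ml orthoproj_lin //; exact: Hm.
- exists B => x Qx; rewrite patch_in //; have [Hx _] := Qx.
  by apply: le_trans (mB x Hx); apply: orthoproj_le; exact: Hm.
- by move=> x nQ; rewrite patch_out.
Qed.

End Orthocomplement.

(** * Bounded operators and the Fredholm alternative *)

Section Fredholm.
Variables (R : realType) (V : lmodType R[i]) (N : V -> R) (H : set V).
Notation C := R[i].
Notation nc := (@Normc.normc R).
Hypotheses (hH : hilbert N H) (def : forall x, H x -> N x = 0 -> x = 0).
Let hs := hilb_sub hH.
Local Notation bop := (bounded_op N H).

Lemma bop0 T : bop T -> T 0 = 0.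
Proof.
move=> [_ h _ _]; have := h 1 0 0 (hilb0 hH) (hilb0 hH); rewrite scale1r addr0 scale1r => E.
by apply: (addrI (T 0)); rewrite -E addr0.
Qed.

Lemma bopZ T (c : C) x : bop T -> H x -> T (c *: x) = c *: T x.
Proof.
move=> hT Hx; have T0 := bop0 hT; have [_ h _ _] := hT.
by have := h c x 0 Hx (hilb0 hH); rewrite T0 !addr0.
Qed.

Lemma bopD T x y : bop T -> H x -> H y -> T (x + y) = T x + T y.
Proof. by move=> [_ h _ _] Hx Hy; rewrite -{1}[x]scale1r h // scale1r. Qed.

Lemma bopB T x y : bop T -> H x -> H y -> T (x - y) = T x - T y.
Proof.
move=> hT Hx Hy; have Hn : H (- y) by exact: subspaceN.
by rewrite bopD // -scaleN1r bopZ // scaleN1r.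
Qed.

Lemma bop_bound T : bop T -> exists2 M : R, 0 <= M & forall x, H x -> N (T x) <= M * N x.
Proof.
move=> [_ _ [M h] _]; exists (Num.max M 0); first by rewrite le_max lexx orbT.
by move=> x Hx; apply: le_trans (h x Hx) _; rewrite ler_wpM2r ?(nrm_ge0 hH) // le_max lexx.
Qed.

Lemma bounded_op0 : bop 0.
Proof.
split => //; first by move=> x _; exact: hilb0 hH.
- by move=> c x y _ _; rewrite scaler0 addr0.
- by exists 0 => x _; rewrite mul0r (nrm0 hH).
Qed.

Lemma op_linE (a : C) (S T : V -> V) x : (a *: S + T) x = a *: S x + T x.
Proof. by []. Qed.

Lemma bounded_op_lin (a : C) S T : bop S -> bop T -> bop (a *: S + T).
Proof.
move=> hS hT; have [HS _ _ S0] := hS; have [HT _ _ T0] := hT; split.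
- by move=> x Hx; case: hs => _; apply; [exact: HS|exact: HT].
- move=> c x y Hx Hy /=; have Hc := subspaceZ c hs Hx.
  change (a *: S (c *: x + y) + T (c *: x + y) = c *: (a *: S x + T x) + (a *: S y + T y)).
  rewrite (bopD hS Hc Hy) (bopD hT Hc Hy) (bopZ c hS Hx) (bopZ c hT Hx) !scalerDr !scalerA.
  by rewrite [c * a]mulrC addrACA.
- have [M1 M10 h1] := bop_bound hS; have [M2 M20 h2] := bop_bound hT.
  exists (nc a * M1 + M2) => x Hx; apply: le_trans (nrmD hH _ _) _.
  + by apply: subspaceZ => //; exact: HS.
  + exact: HT.
  + change (N (a *: S x) + N (T x) <= (nc a * M1 + M2) * N x).
    rewrite (nrmZ hH _ (HS x Hx)) mulrDl lerD ?h2 // -mulrA ler_wpM2l ?nc_ge0 //; exact: h1.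
- by move=> x nH; rewrite op_linE S0 // T0 // addr0; exact: scaler0.
Qed.

Lemma bounded_op_comp S T : bop S -> bop T -> bop (S \o T).
Proof.
move=> hS hT; have [HS _ _ S0] := hS; have [HT lT _ T0] := hT; split => /=.
- by move=> x Hx; apply: HS; exact: HT.
- by move=> c x y Hx Hy; case: (hS) => _ lS _ _; rewrite lT // lS //; exact: HT.
- have [M1 M10 h1] := bop_bound hS; have [M2 M20 h2] := bop_bound hT.
  exists (M1 * M2) => x Hx; apply: le_trans (h1 _ (HT _ Hx)) _.
  by rewrite -mulrA ler_wpM2l //; exact: h2.
- by move=> x nH; rewrite T0 // bop0.
Qed.

Lemma bounded_idop : bop (idop H).
Proof.
split; rewrite /idop.
- by move=> x Hx; rewrite patch_in.
- move=> c x y Hx Hy; rewrite !patch_in //; case: hs => _; exact.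
- by exists 1 => x Hx; rewrite patch_in // mul1r.
- by move=> x nH; rewrite patch_out.
Qed.

Lemma bounded_op_cstar : cstar_subalgebra N H bop.
Proof.
split => //.
- by split; [exact: bounded_op0|exact: bounded_op_lin].
- exact: bounded_op_comp.
- move=> T hT; rewrite /adjoint; case: xgetP => [S _ [] //|_]; exact: bounded_op0.
Qed.

(** Riesz's argument for [F = W S], which is the identity plus the compact operator [L]. If [F] were
    injective but not onto, the ranges of its powers would decrease strictly; unit vectors nearly
    orthogonal to the next range would have images under [L] that stay apart. *)
Lemma fredholm_alternative S B W K : bop S -> bop B -> bop W -> compact_op N H K ->
  (forall x, H x -> S x = B x + K x) ->
  (forall x, H x -> W (B x) = x) -> (forall x, H x -> B (W x) = x) ->
  (forall x, H x -> S x = 0 -> x = 0) -> forall y, H y -> exists2 x, H x & S x = y.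
Proof.
move=> hS hB hW [hK cK] SE WB BW inj.
have [HS _ _ _] := hS; have [HB _ _ _] := hB; have [HW _ _ _] := hW; have [HK _ _ _] := hK.
pose F := W \o S; pose L := W \o K.
have hF : bop F := bounded_op_comp hW hS; have hL : bop L := bounded_op_comp hW hK.
have [HF _ _ _] := hF; have [HL _ _ _] := hL.
have FE x : H x -> F x = x + L x.
  by move=> Hx; rewrite /F /L /= SE // bopD ?WB //; [exact: HB|exact: HK].
have Finj x : H x -> F x = 0 -> x = 0.
  move=> Hx F0; apply: inj => //; rewrite -[S x]BW; last exact: HS.
  by rewrite -[W (S x)]/(F x) F0 (bop0 hB).
have cL u : (forall n, H (u n) /\ N (u n) <= 1) -> exists k : nat -> nat, exists y,
    [/\ {homo k : m n / (m < n)%N}, H y & nlim N (L \o (u \o k)) y].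
  move=> Hu; have [k [y [hk Hy ky]]] := cK u Hu; exists k; exists (W y); split => //; first exact: HW.
  have [M M0 hM] := bop_bound hW.
  have HKu n : H (K (u (k n))) by apply: HK; case: (Hu (k n)).
  apply: (nlim_sub hH HKu Hy hM (fun a b Ha Hb => bopB hW Ha Hb)) => e e0.
  have /cvgrPdist_lt /(_ _ e0) [n0 _ hn0] := ky; exists n0 => n /hn0 /=.
  by rewrite sub0r normrN ger0_norm ?(nrm_ge0 hH) //; exact: subspaceB.
have mono (k : nat -> nat) : {homo k : m n / (m < n)%N} -> forall n, (n <= k n)%N.
  by move=> hk; elim=> // n IH; apply: leq_ltn_trans IH (hk _ _ _).
have [MF MF0 hMF] := bop_bound hF.
(* Otherwise there are unit vectors [v n] with [F (v n)] tending to 0. Along a subsequence [L (v n)]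
   converges, hence so does [v n], and its limit is a unit vector in the kernel of [F]. *)
have below : exists2 c : R, 0 < c & forall x, H x -> N x <= c * N (F x).
  apply: contrapT => hno.
  have /choice [x hx] : forall n : nat, exists x, H x /\ n.+1%:R * N (F x) < N x.
    move=> n; apply: contrapT => hn; apply: hno; exists n.+1%:R => // x Hx.
    by rewrite leNgt; apply/negP => h; apply: hn; exists x.
  have Hx n : H (x n) by case: (hx n).
  have xp n : 0 < N (x n).
    by have [_ h] := hx n; apply: le_lt_trans h; rewrite mulr_ge0 // (nrm_ge0 hH) //; exact: HF.
  pose v n := (N (x n))^-1%:C%C *: x n.
  have Hv n : H (v n) by exact: subspaceZ.
  have Nv n : N (v n) = 1.
    by rewrite (nrmZ hH) // nc_real ger0_norm ?invr_ge0 ?(ltW (xp n)) // mulVf // gt_eqF.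
  have NFv n : N (F (v n)) < n.+1%:R^-1.
    rewrite /v (bopZ _ hF (Hx n)) (nrmZ hH _ (HF _ (Hx n))) nc_real ger0_norm ?invr_ge0 ?(ltW (xp n)) //.
    by rewrite mulrC ltr_pdivrMr // ltr_pdivlMl //; case: (hx n).
  have [|k [y [hk Hy Ly]]] := cL v; first by move=> n; rewrite Nv.
  have Hny : H (- y) by exact: subspaceN.
  have Hvk n : H (v (k n)) by [].
  have HFv n : H (F (v (k n))) by exact: HF.
  have HLv n : H (L (v (k n))) by exact: HL.
  have Fv0 : nlim N (F \o (v \o k)) 0.
    move=> e e0; have [n0 _ h] := near_infty_natSinv_lt (PosNum e0); exists n0 => n hn.
    rewrite subr0 /=; apply: lt_trans (NFv _) _; apply: h => /=.
    exact: leq_trans hn (mono k hk n).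
  have vy : nlim N (v \o k) (- y).
    move=> e e0; have e2 : 0 < e / 2 by rewrite divr_gt0.
    have [n1 h1] := Fv0 _ e2; have [n2 h2] := Ly _ e2; exists (maxn n1 n2) => n.
    rewrite geq_max => /andP[/h1 /= a1 /h2 /= a2]; rewrite subr0 in a1.
    have -> : v (k n) - - y = F (v (k n)) - (L (v (k n)) - y).
      by rewrite FE // opprK opprB [RHS]addrCA addrK addrC.
    have HB' : H (L (v (k n)) - y) by exact: subspaceB.
    by apply: le_lt_trans (nrmB hH _ HB') _ => //; lra.
  have Fvy := nlim_sub hH Hvk Hny hMF (fun a b Ha Hb => bopB hF Ha Hb) vy.
  have := nlim_uniq hH HFv (HF _ Hny) (hilb0 hH) Fvy Fv0.
  rewrite subr0 => /(def (HF _ Hny)) /(Finj _ Hny) y0.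
  have [n /(_ n (leqnn n))] := vy 1 ltr01.
  by rewrite y0 subr0 /= Nv ltxx.
have [c c0 hc] := below.
apply: contrapT => /existsNP [y0 /not_implyP [Hy0 ny0]].
pose y := W y0; have Hy : H y by exact: HW.
have yF x : H x -> F x <> y.
  move=> Hx Fx; apply: ny0; exists x => //.
  by rewrite -(BW _ Hy0) -/y -Fx /F /= (BW _ (HS _ Hx)).
(* The range of [F] is closed because [F] is bounded below, so [y] has a positive distance to it. *)
have [dl dl0 hdl] : exists2 dl : R, 0 < dl & forall x, H x -> dl <= N (y - F x).
  apply: contrapT => hno.
  have /choice [x hx] : forall n : nat, exists x, H x /\ N (y - F x) < n.+1%:R^-1.
    move=> n; apply: contrapT => hn; apply: hno; exists n.+1%:R^-1; first by rewrite invr_gt0.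
    by move=> x Hx; rewrite leNgt; apply/negP => h; apply: hn; exists x.
  have Hx n : H (x n) by case: (hx n).
  have HFx n : H (F (x n)) by exact: HF.
  have Fxy : nlim N (F \o x) y.
    move=> e e0; have [n0 _ h] := near_infty_natSinv_lt (PosNum e0); exists n0 => n hn /=.
    rewrite (nrm_dist hH) //; have [_ h1] := hx n; apply: lt_trans h1 _; exact: h.
  have cx : ncauchy N x.
    move=> e e0; have e2 : 0 < e / c / 2 by rewrite !divr_gt0.
    have [n0 h] := Fxy _ e2; exists n0 => m n /h hm /h hn; rewrite /= in hm hn.
    have Hd : H (x m - x n) by exact: subspaceB.
    apply: le_lt_trans (hc _ Hd) _; rewrite mulrC -ltr_pdivlMr // bopB //.
    apply: le_lt_trans (nrm_sub hH (HFx m) Hy (HFx n)) _.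
    by rewrite (nrm_dist hH Hy) // [e / c]splitr; exact: ltrD.
  have [x' Hx' xx'] : exists2 x', H x' & nlim N x x' by case: hH => _ _ _ _ h; exact: h.
  have Fx' := nlim_sub hH Hx Hx' hMF (fun a b Ha Hb => bopB hF Ha Hb) xx'.
  have E := nlim_uniq hH HFx (HF _ Hx') Hy Fx' Fxy.
  apply: (yF x') => //; apply/eqP; rewrite -subr_eq0; apply/eqP; apply: def => //.
  by apply: subspaceB => //; exact: HF.
have itH n x : H x -> H (iter n F x) by move=> Hx; elim: n => //= n; exact: HF.
have itB n a b : H a -> H b -> iter n F (a - b) = iter n F a - iter n F b.
  by move=> Ha Hb; elim: n => //= n ->; rewrite bopB //; exact: itH.
have itZ n (t : C) a : H a -> iter n F (t *: a) = t *: iter n F a.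
  by move=> Ha; elim: n => //= n ->; rewrite bopZ //; exact: itH.
have itS n a : iter n.+1 F a = iter n F (F a) by rewrite iterSr.
have itc n a : H a -> N a <= c ^+ n * N (iter n F a).
  move=> Ha; elim: n => [|n IH]; first by rewrite mul1r.
  apply: le_trans IH _; rewrite exprSr -mulrA ler_wpM2l ?exprn_ge0 ?(ltW c0) //.
  by apply: hc; exact: itH.
(* A near-minimizer of [|F ^ n (y - F x)|], within a factor 2 of the infimum, is normalized: it lies
   in the [n]-th range at distance at least 1/2 from the next one. The infimum is positive because
   [F ^ n] is bounded below by [c ^ -n]. *)
have /choice [v hv] : forall n, exists v, [/\ N v = 1, exists2 a, H a & v = iter n F a &
    forall x, H x -> 2^-1 <= N (v - iter n.+1 F x)].
  move=> n; pose D := [set N (iter n F (y - F x)) | x in H].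
  have HyF x : H x -> H (y - F x) by move=> Hx; apply: subspaceB => //; exact: HF.
  have cn : 0 < c ^+ n by rewrite exprn_gt0.
  have lD : lbound D (dl / c ^+ n).
    move=> _ [x Hx <-]; rewrite ler_pdivrMr // mulrC.
    by apply: le_trans (itc n _ (HyF x Hx)); exact: hdl.
  have D0 : D !=set0 by eexists; exists 0 => //; exact: hilb0 hH.
  have iD : has_inf D by split => //; exists (dl / c ^+ n).
  have d0 : 0 < inf D by apply: lt_le_trans (lb_le_inf D0 lD); rewrite divr_gt0.
  have [_ [x1 Hx1 <-] hx1] := inf_adherent d0 iD.
  set t := N _ in hx1.
  have t0 : 0 < t by apply: lt_le_trans d0 _; apply: ge_inf; [exists (dl / c ^+ n)|exists x1].
  have Ha := HyF x1 Hx1.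
  exists (t^-1%:C%C *: iter n F (y - F x1)); split.
  - by rewrite (nrmZ hH _ (itH _ _ Ha)) nc_real ger0_norm ?invr_ge0 ?(ltW t0) // -/t mulVf // gt_eqF.
  - by exists (t^-1%:C%C *: (y - F x1)); [exact: subspaceZ|rewrite itZ].
  - move=> x Hx; have Htx : H (t%:C%C *: x) by exact: subspaceZ.
    have HX : H (x1 + t%:C%C *: x) by exact: subspaceD.
    have E : t^-1%:C%C *: iter n F (y - F x1) - iter n.+1 F x =
        t^-1%:C%C *: iter n F (y - F (x1 + t%:C%C *: x)).
      have -> : y - F (x1 + t%:C%C *: x) = (y - F x1) - t%:C%C *: F x.
        by rewrite bopD // bopZ // opprD addrA.
      have HFx := HF _ Hx; have HtF : H (t%:C%C *: F x) by exact: subspaceZ.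
      rewrite [in RHS]itB // scalerBr itZ // scalerA -rmorphM /= mulVf ?gt_eqF // scale1r.
      by rewrite -(itS n x).
    rewrite E (nrmZ hH _ (itH n _ (HyF _ HX))) nc_real ger0_norm ?invr_ge0 ?(ltW t0) //.
    have h1 : inf D <= N (iter n F (y - F (x1 + t%:C%C *: x))).
      by apply: ge_inf; [exists (dl / c ^+ n)|exists (x1 + t%:C%C *: x)].
    by rewrite mulrC ler_pdivlMr //; lra.
have Hv n : H (v n) by have [_ [a Ha ->] _] := hv n; exact: itH.
have [|k [z [hk Hz Lz]]] := cL v; first by move=> n; case: (hv n) => -> _ _.
have e4 : 0 < 4^-1 :> R by rewrite invr_gt0.
have [n0 h0] := Lz _ e4; pose p := k n0; pose q := k n0.+1.
have pq : (p < q)%N by exact: hk.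
have h1 : N (L (v p) - z) < 4^-1 by exact: h0.
have h2 : N (L (v q) - z) < 4^-1 by apply: h0; exact: leqnSn.
have HLp : H (L (v p)) by exact: HL.
have HLq : H (L (v q)) by exact: HL.
have := nrm_sub hH HLp Hz HLq; rewrite (nrm_dist hH Hz HLq).
have [_ [a Ha vp] hp] := hv p; have [_ [b Hb vq] _] := hv q.
pose c1 := iter (q - p.+1) F b; have Hc1 : H c1 by exact: itH.
have vq1 : v q = iter p.+1 F c1 by rewrite vq -iterD addnC subnK.
have Fvp : F (v p) = iter p.+1 F a by rewrite vp.
have Fvq : F (v q) = iter p.+1 F (F c1) by rewrite vq1 -itS.
have HFc1 := HF _ Hc1; have Hd : H (F c1 - c1) by exact: subspaceB.
have HX : H (a - (F c1 - c1)) by exact: subspaceB.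
(* Since [p < q], every term other than [v p] lies in the range of [F ^ (p + 1)]. The difference has
   norm at least 1/2, while convergence keeps it below 1/4 + 1/4. *)
have -> : L (v p) - L (v q) = - (v p - iter p.+1 F (a - (F c1 - c1))).
  rewrite itB // itB // -Fvp -Fvq -vq1 !FE //.
  set A := v p; set B' := v q; set A' := L A; set C' := L B'.
  by rewrite [B' + C']addrC addrK opprB addrAC [A + A']addrC addrK.
rewrite (nrmN hH); last by apply: subspaceB => //; exact: itH.
have := hp _ HX; lra.
Qed.

End Fredholm.

Section ComplexComplete.
Variable R : realType.
Notation C := R[i].
Notation nc := (@Normc.normc R).
Notation Re := (@complex.Re R).
Notation Im := (@complex.Im R).

Lemma complex_complete (x : nat -> C) : (forall e : R, 0 < e -> exists n0, forall m n, (n0 <= m)%N -> (n0 <= n)%N ->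
  nc (x m - x n) < e) -> exists l : C, x @ \oo --> l.
Proof.
move=> h; have key (f : C -> R) : (forall u v, `|f u - f v| <= nc (u - v)) -> cvgn (f \o x).
  move=> fl; apply: R_complete; apply: cauchy_exP => e e0.
  have [n0 hn] := h _ e0; exists (f (x n0)); exists n0 => // n /= nn.
  by apply: le_lt_trans (fl _ _) _; exact: hn.
have /cvg_ex [a ha] := key Re (fun u v => ltac:(by rewrite -cReB Re_le_nc)).
have /cvg_ex [b hb] := key Im (fun u v => ltac:(by rewrite -cImB Im_le_nc)).
by exists (a +i* b)%C; apply: cvg_ReImC.
Qed.

End ComplexComplete.

(** * The common form of the Hardy and Bergman norms *)

Section Weights.
Variable R : realType.

(* What the proof uses of the squared norms [om k] of [z^k] in the one-variable space: [1] for Hardy, the moments of [|z|^2] for Bergman. *)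
Definition weights (om : nat -> R) := [/\ om 0%N = 1, forall k, om k.+1 <= om k &
  forall r, 0 < r < 1 -> exists2 K, 0 <= K & forall m k, om m * (r ^+ 2) ^+ k <= K * om (m + k)%N].

Lemma sqnorm_repr (alpha : R) : -1 <= alpha -> exists2 om, weights om &
  forall f a, repr f a -> sqnorm alpha f = ereal_sup (range (fun K => (wsq om K a)%:E)).
Proof.
rewrite le_eqVlt => /orP[/eqP E|a1].
  exists (fun=> 1); last by move=> f a fa; rewrite /sqnorm -E eqxx; exact: hardy_sqnorm_repr.
  split => // r /andP[r0 r1]; exists 1 => // m k.
  by rewrite !mul1r exprn_ile1 ?sqr_ge0 // exprn_ile1 // ltW.
exists (moment alpha (@disc R)); last first.
  by move=> f a fa; rewrite /sqnorm gt_eqF //; exact: bergman_sqnorm_repr.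
by split; [exact: wint_disc0|exact: wint_decr|exact: wint_ratio].
Qed.

End Weights.

(** * Norm and inner product of the function space in Taylor coefficients *)

Section CoefficientSpace.
Variables (R : realType) (alpha : R) (om : nat -> R).
Notation C := R[i].
Notation nc := (@Normc.normc R).
Notation E := (C * C -> C).
Notation A := (bergman_space alpha).
Notation N := (norm_alpha alpha).
Notation sq := (wsq om).
Hypotheses (hw : weights om).
Hypothesis hs : forall f a, repr f a -> sqnorm alpha f = ereal_sup (range (fun K => (sq K a)%:E)).

(** The ratio condition from index 0 to index [k] bounds a positive number by [K * om k]. *)
Lemma om_gt0 k : 0 < om k.
Proof.
have [om0 _ hr] := hw; have h2 : 0 < (2^-1 : R) < 1 by rewrite invr_gt0 ltr0n invf_lt1 ?ltr1n.
have [K K0 /(_ 0%N k)] := hr _ h2; rewrite om0 mul1r add0n => h.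
have : 0 < K * om k by apply: lt_le_trans h; rewrite exprn_gt0 // exprn_gt0 // invr_gt0.
by move: K0; rewrite le_eqVlt => /orP[/eqP <-|K0]; rewrite ?mul0r ?ltxx // pmulr_rgt0.
Qed.
Lemma om_ge0 k : 0 <= om k. Proof. exact/ltW/om_gt0. Qed.
Hint Resolve om_ge0 om_gt0 : core.

Lemma sq_mono a : {homo (fun K => sq K a) : m n / (m <= n)%N >-> m <= n}.
Proof.
move=> k l kl; have t0 i j : 0 <= nc (a i j) ^+ 2 * (om i * om j) by rewrite mulr_ge0 ?sqr_ge0 // mulr_ge0.
have widen (F : nat -> R) : (forall i, 0 <= F i) -> \sum_(i < k) F i <= \sum_(i < l) F i.
  move=> F0; rewrite -!(big_mkord xpredT F) (big_cat_nat (leq0n k) kl) /= lerDl.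
  exact: sumr_ge0.
apply: (@le_trans _ _ (\sum_(m < k) \sum_(n < l) nc (a m n) ^+ 2 * (om m * om n))).
  by apply: ler_sum => i _; exact: (widen (fun j => nc (a i j) ^+ 2 * (om i * om j))).
apply: (widen (fun i => \sum_(j < l) nc (a i j) ^+ 2 * (om i * om j))) => i.
exact: sumr_ge0.
Qed.

Lemma sq_ge_term a m n : nc (a m n) ^+ 2 * (om m * om n) <= sq (maxn m n).+1 a.
Proof.
have t0 i j : 0 <= nc (a i j) ^+ 2 * (om i * om j) by rewrite mulr_ge0 ?sqr_ge0 // mulr_ge0.
have hm : (m < (maxn m n).+1)%N by rewrite ltnS leq_maxl.
have hn : (n < (maxn m n).+1)%N by rewrite ltnS leq_maxr.
rewrite /wsq (bigD1 (Ordinal hm)) //= (bigD1 (Ordinal hn)) //= -addrA lerDl addr_ge0 ?sumr_ge0 //.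
by move=> i _; exact: sumr_ge0.
Qed.

Lemma repr_lin (f g : E) a b (c : C) : repr f a -> repr g b -> repr (c *: f + g) (fun m n => c * a m n + b m n).
Proof.
move=> [fa [h1 h2]] [gb [h3 h4]]; exists (fun m w => c * fa m w + gb m w); split.
  move=> m w w1; apply: csum_ext (csum_lin c (h1 m w w1) (h3 m w w1)) => n.
  by rewrite mulrA -mulrDl.
move=> z w z1 w1; apply: csum_ext (csum_lin c (h2 z w z1 w1) (h4 z w z1 w1)) => n.
by rewrite mulrA -mulrDl.
Qed.

Lemma repr_ext (f : E) a b : (forall m n, a m n = b m n) -> repr f a -> repr f b.
Proof. by move=> h; have -> : b = a by apply/funext => m; apply/funext => n; rewrite h. Qed.

Lemma repr_sub (f g : E) a b : repr f a -> repr g b -> repr (f - g) (fun m n => a m n - b m n).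
Proof.
move=> fa gb; have := repr_lin (-1) gb fa; rewrite scaleN1r addrC; apply: repr_ext => m n.
by rewrite mulN1r addrC.
Qed.

Lemma space_intro f a (B : R) : (forall x, bidisc x -> differentiable f x) ->
  (forall x, ~ bidisc x -> f x = 0) -> repr f a -> (forall K, sq K a <= B) -> A f.
Proof.
move=> df f0 fa hB; split => //; rewrite (hs fa); apply: (@le_lt_trans _ _ B%:E); last by rewrite ltry.
by apply: ge_ereal_sup => _ [K _ <-]; rewrite lee_fin.
Qed.

Lemma space_repr f : A f -> exists a, repr f a.
Proof. by move=> [df _ _]; exact: holomorphic_repr. Qed.

Lemma normE f a : A f -> repr f a -> ((N f ^+ 2)%:E = ereal_sup (range (fun K => (sq K a)%:E)))%E.
Proof.
move=> [_ _ fin] fa; rewrite -(hs fa) /norm_alpha.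
have s0 : (0 <= sqnorm alpha f)%E.
  rewrite (hs fa); apply: (@le_trans _ _ (sq 0 a)%:E); first by rewrite lee_fin sq_ge0.
  by apply: ereal_sup_ubound; exists 0%N.
by rewrite sqr_sqrtr ?fine_ge0 // fineK // ge0_fin_numE.
Qed.

Lemma norm_ge0 f : 0 <= N f. Proof. exact: sqrtr_ge0. Qed.

Lemma sq_le f a K : A f -> repr f a -> sq K a <= N f ^+ 2.
Proof. by move=> Af fa; rewrite -lee_fin (normE Af fa); apply: ereal_sup_ubound; exists K. Qed.

Lemma norm_le f a (B : R) : A f -> repr f a -> (forall K, sq K a <= B) -> N f ^+ 2 <= B.
Proof.
move=> Af fa h; rewrite -lee_fin (normE Af fa); apply: ge_ereal_sup => _ [K _ <-].
by rewrite lee_fin.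
Qed.

Lemma sq_cvg f a : A f -> repr f a -> (fun K => sq K a) @ \oo --> N f ^+ 2.
Proof.
move=> Af fa; apply/cvgrPdist_lt => e e0.
have [K hK] : exists K, N f ^+ 2 - e < sq K a.
  apply: contrapT => hn; have : N f ^+ 2 <= N f ^+ 2 - e.
    by apply: (norm_le Af fa) => K; rewrite leNgt; apply/negP => h; apply: hn; exists K.
  by rewrite lerBrDr gerDl leNgt e0.
exists K => // n /= Kn; have h1 := sq_mono a Kn; have h2 := sq_le n Af fa.
by rewrite ger0_norm ?subr_ge0 //; lra.
Qed.

Lemma sq_parallelogram K a b : sq K (fun m n => a m n + b m n) <= 2 * sq K a + 2 * sq K b.
Proof.
rewrite /wsq !mulr_sumr -big_split; apply: ler_sum => m _ /=.
rewrite !mulr_sumr -big_split; apply: ler_sum => n _ /=.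
rewrite !mulrA -!mulrDl !ler_wpM2r //; have := sqr_ncD (a m n) (b m n).
have := sqr_ncD (a m n) (- b m n); rewrite ncN rmorphN mulrN cReN.
have := sqr_ge0 (nc (a m n - b m n)); lra.
Qed.

Lemma sqZ K (c : C) a : sq K (fun m n => c * a m n) = nc c ^+ 2 * sq K a.
Proof.
rewrite /wsq mulr_sumr; apply: eq_bigr => m _; rewrite mulr_sumr; apply: eq_bigr => n _.
by rewrite ncM exprMn mulrA.
Qed.

Lemma space_sub : subspace A.
Proof.
split.
  have z0 (x : C) : csum (fun n => 0 * x ^+ n) 0.
    by move=> e e0; exists 0%N => n _; rewrite big1 ?subrr ?nc0 // => i _; rewrite mul0r.
  apply: (@space_intro 0 (fun _ _ => 0) 0) => //.
    by exists (fun _ _ => 0); split=> *; exact: z0.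
  by move=> K; rewrite /wsq big1 // => i _; rewrite big1 // => j _; rewrite nc0 expr0n mul0r.
move=> c f g Af Ag; have [a fa] := space_repr Af; have [b gb] := space_repr Ag.
have [df f0 _] := Af; have [dg g0 _] := Ag.
apply: (space_intro (B := 2 * (nc c ^+ 2 * N f ^+ 2) + 2 * N g ^+ 2) _ _ (repr_lin c fa gb)).
- by move=> x bx; apply: differentiableD; [apply: differentiableZ; exact: df|exact: dg].
- by move=> x bx; change (c *: f x + g x = 0); rewrite f0 // g0 // scaler0 addr0.
- move=> K; apply: le_trans (sq_parallelogram K (fun m n => c * a m n) b) _.
  by rewrite sqZ lerD // ler_wpM2l // ?(sq_le _ Ag gb) // ler_wpM2l ?sqr_ge0 // sq_le.
Qed.

Definition weighted_dot K (a b : nat -> nat -> C) : C :=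
  \sum_(m < K) \sum_(n < K) a m n * (b m n)^*%C * (om m * om n)%:C%C.

Lemma polarization K a b : weighted_dot K a b = 4^-1 * \sum_(k < 4)
  'i%C ^+ k * (sq K (fun m n => 'i%C ^+ k * b m n + a m n))%:C%C.
Proof.
have key (u v : C) (t : R) : u * v^*%C * t%:C%C = 4^-1 * \sum_(k < 4)
   'i%C ^+ k * (nc ('i%C ^+ k * v + u) ^+ 2 * t)%:C%C.
  have c4 : (4 : C) = (4 : R)%:C%C by rewrite rmorph_nat.
  have c40 : (4 : C) != 0 by rewrite pnatr_eq0.
  have i2 : ('i%C : C) ^+ 2 = -1 by apply: complex_ext => /=; ring.
  have i3 : ('i%C : C) ^+ 3 = - 'i%C by rewrite exprS i2 mulrN1.
  apply: (mulfI c40); rewrite mulVKf // {}c4.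
  rewrite -(big_mkord xpredT (fun k => 'i%C ^+ k * (nc ('i%C ^+ k * v + u) ^+ 2 * t)%:C%C)).
  rewrite /index_iota /= !big_cons big_nil i3 i2 expr1 expr0 !mul1r !mulN1r !sqr_nc addr0.
  by case: u => u1 u2; case: v => v1 v2; apply: complex_ext => /=; ring.
transitivity (4^-1 * \sum_(k < 4) \sum_(m < K) \sum_(n < K)
    'i%C ^+ k * (nc ('i%C ^+ k * b m n + a m n) ^+ 2 * (om m * om n))%:C%C).
  rewrite exchange_big mulr_sumr; apply: eq_bigr => m _.
  rewrite exchange_big mulr_sumr; apply: eq_bigr => n _; exact: key.
congr (_ * _); apply: eq_bigr => k _.
rewrite rmorph_sum mulr_sumr; apply: eq_bigr => m _.
by rewrite rmorph_sum mulr_sumr.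
Qed.

(** The inner product is defined from the norm alone; this limit of truncated weighted sums is what
    transfers sesquilinearity to it. *)
Lemma dotp_cvg f g a b : A f -> A g -> repr f a -> repr g b -> (fun K => weighted_dot K a b) @ \oo --> dotp N f g.
Proof.
move=> Af Ag fa gb; have [_ lin] := space_sub.
under eq_fun do rewrite polarization.
rewrite /dotp; apply: cvgM; first exact: cvg_cst.
apply: (@cvg_big _ _ +%R); first exact: add_continuous.
move=> k _; apply: cvgM; first exact: cvg_cst.
have h := sq_cvg (lin ('i%C ^+ k) _ _ Ag Af) (repr_lin ('i%C ^+ k) gb fa).
rewrite [f + _]addrC; apply: cvg_ReImC => /=; last exact: cvg_cst.
exact: h.
Qed.

End CoefficientSpace.

(** * Completeness: the function space is a Hilbert space *)

Section CoefficientSpace.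
Variables (R : realType) (alpha : R) (om : nat -> R).
Notation C := R[i].
Notation nc := (@Normc.normc R).
Notation E := (C * C -> C).
Notation A := (bergman_space alpha).
Notation N := (norm_alpha alpha).
Notation sq := (wsq om).
Notation ip := (weighted_dot om).
Hypotheses (hw : weights om).
Hypothesis hs : forall f a, repr f a -> sqnorm alpha f = ereal_sup (range (fun K => (sq K a)%:E)).

Lemma ratio0 (r : R) : 0 < r < 1 -> exists2 K : R, 0 < K & forall m, (r ^+ 2) ^+ m <= K * om m.
Proof.
move=> r01; have [om0 _ /(_ r r01) [K K0 h]] := hw.
exists (K + 1) => [|m]; first by rewrite ltr_wpDl.
have := h 0%N m; rewrite om0 mul1r add0n => /le_trans; apply.
by rewrite ler_wpM2r ?(om_ge0 hw) // lerDl.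
Qed.

(** Converse of Taylor expansion. By [ratio0] the weights dominate [r ^ (2 m) / K], so a bound on
    the weighted sums gives the geometric bounds that make the double series holomorphic on the
    bidisc. *)
Lemma space_make a (B : R) : (forall K, sq K a <= B) -> exists2 f, A f & repr f a.
Proof.
move=> hB; have B0 : 0 <= B by apply: le_trans (hB 0%N); exact: (sq_ge0 _ _ (om_ge0 hw)).
have ga : geo_bounded a.
  move=> r r0 r1; have [K K0 hK] := ratio0 (r := r) (ltac:(by rewrite r0)).
  have s0 := sqrtr_ge0 B; exists (Num.sqrt B * K) => [|m n]; first by rewrite mulr_ge0 // ltW.
  have rm k : 0 < (r ^+ k) by rewrite exprn_gt0.
  rewrite -(@ler_pXn2r _ 2) ?nnegrE ?nc_ge0 //; last first.
    by rewrite !mulr_ge0 ?(ltW K0) // exprn_ge0 // invr_ge0 ltW.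
  rewrite !exprMn sqr_sqrtr // !exprVn -!exprVn.
  have h1 : nc (a m n) ^+ 2 * (om m * om n) <= B := le_trans (sq_ge_term hw a m n) (hB _).
  have h2 : (r ^+ 2) ^+ m * (r ^+ 2) ^+ n <= K ^+ 2 * (om m * om n).
    by rewrite [K ^+ 2]expr2 mulrACA; apply: ler_pM; rewrite ?hK // exprn_ge0 // sqr_ge0.
  have h3 : nc (a m n) ^+ 2 * ((r ^+ 2) ^+ m * (r ^+ 2) ^+ n) <= B * K ^+ 2.
    apply: (le_trans (ler_wpM2l (sqr_ge0 _) h2)).
    by rewrite mulrCA [leRHS]mulrC ler_wpM2l ?sqr_ge0.
  rewrite -mulrA -!exprM !(mulnC _ 2) !exprM !exprVn -invfM ler_pdivlMr //.
  by rewrite mulr_gt0 // exprn_gt0 // exprn_gt0.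
have [f [fa f0 df]] := power_series_differentiable ga.
by exists f => //; exact: (space_intro hs df f0 fa hB).
Qed.

Lemma space_definite f : A f -> N f = 0 -> f = 0.
Proof.
move=> Af Nf; have [a fa] := space_repr Af; have [_ f0 _] := Af.
have a0 m n : a m n = 0.
  have h := le_trans (sq_ge_term hw a m n) (sq_le hw hs _ Af fa).
  have t0 : 0 < om m * om n by rewrite mulr_gt0 ?(om_gt0 hw).
  apply/eqP; rewrite -nc_eq0 -sqrf_eq0 eq_le sqr_ge0 andbT.
  by move: h; rewrite Nf expr0n /= pmulr_lle0.
apply/funext => -[z w]; have [b|b] := pselect (bidisc (z, w)); last by rewrite f0.
have [b1 b2] := b; rewrite /= !normC_lt1 in b1 b2.
have [c [h1 h2]] := fa.
have c0 m : c m w = 0.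
  apply: csum_uniq (h1 m w b2) _ => e e0; exists 0%N => n _.
  by rewrite big1 ?subrr ?nc0 // => i _; rewrite a0 mul0r.
apply: csum_uniq (h2 z w b1 b2) _ => e e0; exists 0%N => n _.
by rewrite big1 ?subrr ?nc0 // => i _; rewrite c0 mul0r.
Qed.

Lemma ip_lin (c : C) K a b d : ip K (fun m n => c * a m n + b m n) d = c * ip K a d + ip K b d.
Proof.
rewrite /weighted_dot mulr_sumr -big_split; apply: eq_bigr => m _.
by rewrite mulr_sumr -big_split; apply: eq_bigr => n _ /=; ring.
Qed.

Lemma ip_conj K a b : ip K b a = (ip K a b)^*%C.
Proof.
rewrite /weighted_dot rmorph_sum; apply: eq_bigr => m _; rewrite rmorph_sum; apply: eq_bigr => n _.
case: (a m n) => p q; case: (b m n) => p' q'.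
by apply: complex_ext => /=; ring.
Qed.

Lemma ip_diag K a : ip K a a = (sq K a)%:C%C.
Proof.
rewrite /weighted_dot rmorph_sum; apply: eq_bigr => m _; rewrite rmorph_sum; apply: eq_bigr => n _.
by rewrite mulrJ -rmorphM.
Qed.

Lemma sqrt_le_nrm (f : E) (e : R) : 0 <= e -> N f ^+ 2 <= e ^+ 2 -> N f <= e.
Proof. by move=> e0; rewrite ler_pXn2r // nnegrE ?norm_ge0. Qed.

(** The coefficients converge one by one. On each finite truncation the Cauchy bound passes to the
    limit, and [space_make] turns the limit array into a function. *)
Lemma space_complete u : (forall n, A (u n)) -> ncauchy N u -> exists2 f, A f & nlim N u f.
Proof.
move=> Au cu; have As := space_sub hw hs.
have /choice [a ua] : forall n, exists a, repr (u n) a by move=> n; exact: space_repr.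
have sqd m n K : sq K (fun i j => a m i j - a n i j) <= N (u m - u n) ^+ 2.
  by apply: (sq_le hw hs); [exact: subspaceB|exact: repr_sub].
have /choice [l hl] : forall p : nat * nat, exists l : C, (fun n => a n p.1 p.2) @ \oo --> l.
  move=> [i j] /=; apply: complex_complete => e e0.
  have t0 : 0 < om i * om j by rewrite mulr_gt0 ?(om_gt0 hw).
  have e1 : 0 < e * Num.sqrt (om i * om j) by rewrite mulr_gt0 // sqrtr_gt0.
  have [n0 h] := cu _ e1; exists n0 => m n hm hn.
  have h1 := h m n hm hn.
  have h2 := le_trans (sq_ge_term hw (fun i j => a m i j - a n i j) i j) (sqd m n _).
  have h3 : (nc (a m i j - a n i j) * Num.sqrt (om i * om j)) ^+ 2 < (e * Num.sqrt (om i * om j)) ^+ 2.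
    rewrite exprMn sqr_sqrtr ?(ltW t0) //; apply: le_lt_trans h2 _.
    by rewrite ltr_pXn2r // nnegrE ?norm_ge0 // ltW.
  move: h3; rewrite ltr_pXn2r ?nnegrE ?mulr_ge0 ?nc_ge0 ?(ltW e0) ?sqrtr_ge0 //.
  by rewrite ltr_pM2r // sqrtr_gt0.
pose c i j := l (i, j).
have key e n0 : (forall m n, (n0 <= m)%N -> (n0 <= n)%N -> N (u m - u n) < e) ->
    forall n K, (n0 <= n)%N -> sq K (fun i j => a n i j - c i j) <= e ^+ 2.
  move=> h n K hn.
  have lim : (fun m => sq K (fun i j => a n i j - a m i j)) @ \oo --> sq K (fun i j => a n i j - c i j).
    apply: (@cvg_big _ _ +%R); first exact: add_continuous.
    move=> i _; apply: (@cvg_big _ _ +%R); first exact: add_continuous.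
    move=> j _; apply: cvgM; last exact: cvg_cst.
    have h1 : nc (a n i j - a m i j) @[m --> \oo] --> nc (a n i j - c i j).
      by apply: cvg_ncC; apply: cvgB; [exact: cvg_cst|exact: (hl (nat_of_ord i, nat_of_ord j))].
    exact: (cvgM h1 h1).
  have e0 : 0 <= e by apply/ltW/(le_lt_trans (norm_ge0 alpha (u n0 - u n0))); exact: h.
  rewrite -(cvg_lim (@Rhausdorff R) lim); apply: limr_le; first by apply/cvg_ex; eexists; exact: lim.
  exists n0 => // m hm.
  apply: le_trans (sqd n m K) _; rewrite ler_pXn2r ?nnegrE ?norm_ge0 //.
  exact/ltW/h.
have [n0 h0] := cu 1 ltr01.
have bd K : sq K c <= 2 * N (u n0) ^+ 2 + 2 * 1 ^+ 2.
  have := sq_parallelogram hw K (a n0) (fun i j => - 1 * (a n0 i j - c i j)).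
  rewrite sqZ ncN nc1 expr1n mul1r.
  have -> : (fun m n => a n0 m n + -1 * (a n0 m n - c m n)) = c.
    by apply/funext => i; apply/funext => j; ring.
  move=> /le_trans; apply; apply: lerD; rewrite ler_wpM2l //; first exact: (sq_le hw hs).
  by have := key _ _ h0 n0 K (leqnn _); rewrite expr1n.
have [f Af fc] := space_make bd; exists f => // e e0.
have e2 : 0 < e / 2 by rewrite divr_gt0.
have [n1 h1] := cu _ e2; exists n1 => n hn; apply: (@le_lt_trans _ _ (e / 2)); last by lra.
apply: sqrt_le_nrm; first exact: ltW.
apply: (norm_le hw hs (subspaceB As (Au n) Af) (repr_sub (ua n) fc)) => K.
exact: (key _ _ h1).
Qed.

Lemma cvgC_uniq (x : nat -> C) (s t : C) : x @ \oo --> s -> x @ \oo --> t -> s = t.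
Proof.
move=> /cvgC hs' /cvgC ht; apply/eqP; rewrite -subr_eq0 -nc_eq0 eq_le nc_ge0 andbT leNgt.
apply/negP => e0; have e2 : 0 < nc (s - t) / 2 by rewrite divr_gt0.
have [n1 _ h1] := hs' _ e2; have [n2 _ h2] := ht _ e2.
have := nc_sub s (x (maxn n1 n2)) t; rewrite (nc_dist s (x _)).
have := h1 (maxn n1 n2) (leq_maxl _ _); have := h2 (maxn n1 n2) (leq_maxr _ _).
by rewrite /=; lra.
Qed.

Lemma hilbert_space : hilbert N A.
Proof.
split; first exact: space_sub hw hs.
- move=> c x y z Ax Ay Az; have [[_ lin] [[a xa] [[b yb] [d zd]]]] :=
    (space_sub hw hs, (space_repr Ax, (space_repr Ay, space_repr Az))).
  have h := dotp_cvg hw hs (lin c x y Ax Ay) Az (repr_lin c xa yb) zd.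
  apply: cvgC_uniq h _; under eq_fun do rewrite ip_lin.
  by apply: cvgD; [apply: cvgM; first exact: cvg_cst|]; exact: (dotp_cvg hw hs).
- move=> x y Ax Ay; have [[a xa] [b yb]] := (space_repr Ax, space_repr Ay).
  apply: cvgC_uniq (dotp_cvg hw hs Ay Ax yb xa) _; under eq_fun do rewrite ip_conj.
  have h := dotp_cvg hw hs Ax Ay xa yb; apply: cvg_ReImC.
    by under eq_fun do rewrite cReJ; rewrite cReJ; exact: cvg_ReC.
  by under eq_fun do rewrite cImJ; rewrite cImJ; apply: cvgN; exact: cvg_ImC.
- move=> x Ax; split; last exact: norm_ge0.
  have [a xa] := space_repr Ax.
  apply: cvgC_uniq (dotp_cvg hw hs Ax Ax xa xa) _; under eq_fun do rewrite ip_diag.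
  by apply: cvg_ReImC => /=; [exact: (sq_cvg hw hs)|exact: cvg_cst].
- exact: space_complete.
Qed.

End CoefficientSpace.

(** * Multiplication by the coordinates and by polynomials; backward shifts *)

Section CoefficientShift.
Variables (R : realType) (alpha : R) (om : nat -> R).
Notation C := R[i].
Notation nc := (@Normc.normc R).
Notation E := (C * C -> C).
Notation bidisc := (@bidisc R).
Notation A := (bergman_space alpha).
Notation N := (norm_alpha alpha).
Notation sq := (wsq om).
Hypotheses (hw : weights om).
Hypothesis hs : forall f a, repr f a -> sqnorm alpha f = ereal_sup (range (fun K => (sq K a)%:E)).
Let hA := hilbert_space hw hs.
Let As := space_sub hw hs.

Lemma repr_inj (f g : E) a : repr f a -> repr g a -> forall x, bidisc x -> f x = g x.
Proof.
move=> [b [h1 h2]] [c [h3 h4]] [z w] [/= z1 w1]; rewrite !normC_lt1 in z1 w1.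
apply: csum_uniq (h2 z w z1 w1) _; apply: csum_ext (h4 z w z1 w1) => m.
by congr (_ * _); exact: csum_uniq (h3 m w w1) (h1 m w w1).
Qed.

Lemma space_intro2 (f : E) a (B : R) : (forall x, ~ bidisc x -> f x = 0) -> repr f a ->
  (forall K, sq K a <= B) -> A f.
Proof.
move=> f0 fa hB; have [g Ag ga] := space_make hw hs hB.
suff -> : f = g by [].
apply/funext => x; have [b|b] := pselect (bidisc x); first exact: repr_inj fa ga x b.
by rewrite f0 //; have [_ g0 _] := Ag; rewrite g0.
Qed.

Lemma csum_cons (x : nat -> C) s : csum x s -> csum (fun m => if m is k.+1 then x k else 0) s.
Proof.
move=> h e e0; have [M hM] := h e e0; exists M.+1 => -[//|n] hn.
by rewrite big_ord_recl add0r; exact: hM.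
Qed.

Lemma csum_fin (x : nat -> C) n : (forall k, (n <= k)%N -> x k = 0) -> csum x (\sum_(k < n) x k).
Proof.
move=> h e e0; exists n => m nm.
rewrite -!(big_mkord xpredT x) (big_cat_nat (leq0n n) nm) /= addrAC subrr add0r.
rewrite big_nat_cond big1 ?nc0 // => k /andP[/andP[nk _] _]; exact: h.
Qed.

(** Transposition of the coefficient array. The flag stands for the second variable [w], so that
    statements on the first index serve both variables. *)
Definition tr (t : bool) (a : nat -> nat -> C) := if t then (fun m n => a n m) else a.

Lemma sq_tr t K a : sq K (tr t a) = sq K a.
Proof.
case: t => //=; rewrite /wsq exchange_big; apply: eq_bigr => m _; apply: eq_bigr => n _.
by rewrite [om m * _]mulrC.
Qed.

Definition rshift (a : nat -> nat -> C) m n := if m is k.+1 then a k n else 0.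

Lemma sq_rshift K a : sq K (rshift a) <= sq K a.
Proof.
have [_ dec _] := hw; have o0 := om_ge0 hw.
case: K => [|K]; first by rewrite /wsq !big_ord0.
have t0 i j : 0 <= nc (a i j) ^+ 2 * (om i * om j) by rewrite mulr_ge0 ?sqr_ge0 // mulr_ge0.
rewrite /wsq big_ord_recl big1 ?add0r; last by move=> j _; rewrite /= nc0 expr0n mul0r.
rewrite [leRHS]big_ord_recr /=; apply: (@le_trans _ _ (\sum_(i < K) \sum_(n < K.+1) nc (a i n) ^+ 2 * (om i * om n))).
  apply: ler_sum => i _; apply: ler_sum => j _.
  by rewrite ler_wpM2l ?sqr_ge0 // ler_wpM2r.
by rewrite lerDl sumr_ge0.
Qed.

Definition mulc (t : bool) (f : E) : E := fun x => (if t then x.2 else x.1) * f x.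

Lemma repr_mulc t f a : repr f a -> repr (mulc t f) (tr t (rshift (tr t a))).
Proof.
move=> [b [h1 h2]]; case: t => /=; last first.
  exists (fun m w => if m is k.+1 then b k w else 0); split.
    move=> [|m] w w1 /=; last exact: h1.
    by move=> e e0; exists 0%N => n _; rewrite big1 ?subrr ?nc0 // => i _; rewrite mul0r.
  move=> z w z1 w1; have := csum_cons (csumZ z (h2 z w z1 w1)); apply: csum_ext => -[|m].
    by rewrite mul0r.
  by rewrite exprS mulrCA.
exists (fun m w => w * b m w); split.
  move=> m w w1; have := csum_cons (csumZ w (h1 m w w1)); apply: csum_ext => -[|n] /=.
    by rewrite mul0r.
  by rewrite exprS mulrCA.
move=> z w z1 w1; have := csumZ w (h2 z w z1 w1); apply: csum_ext => m.
by rewrite mulrA.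
Qed.

Lemma mulc_space t f : A f -> A (mulc t f) /\ N (mulc t f) <= N f.
Proof.
move=> Af; have [a fa] := space_repr Af; have [_ f0 _] := Af.
have hB K : sq K (tr t (rshift (tr t a))) <= N f ^+ 2.
  rewrite sq_tr; apply: le_trans (sq_rshift K (tr t a)) _; rewrite sq_tr; exact: (sq_le hw hs).
have Am : A (mulc t f).
  by apply: (space_intro2 _ (repr_mulc t fa) hB) => x nx; rewrite /mulc f0 // mulr0.
split => //; apply: sqrt_le_nrm; first exact: norm_ge0.
exact: (norm_le hw hs Am (repr_mulc t fa) hB).
Qed.

(** Horner's scheme in each variable, from the contractivity of the coordinate multiplications in
    [mulc_space]. *)
Lemma poly_mul_space (p : {poly {poly C}}) : exists2 M : R, 0 <= M &
  forall f, A f -> A (peval p \* f) /\ N (peval p \* f) <= M * N f.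
Proof.
have inner (c : {poly C}) : exists2 M : R, 0 <= M &
    forall f, A f -> A (fun x => c.[x.1] * f x) /\ N (fun x => c.[x.1] * f x) <= M * N f.
  elim/poly_ind: c => [|c d [M M0 IH]].
    exists 0 => // f Af; have -> : (fun x => 0.[x.1] * f x) = 0 :> E by apply/funext => x; rewrite horner0 mul0r.
    by rewrite mul0r (nrm0 hA); split => //; case: As.
  exists (M + nc d) => [|f Af]; first by rewrite addr_ge0 ?nc_ge0.
  have -> : (fun x => (c * 'X + d%:P).[x.1] * f x) = d *: f + (fun x => c.[x.1] * mulc false f x) :> E.
    apply/funext => x; change ((c * 'X + d%:P).[x.1] * f x = d * f x + c.[x.1] * (x.1 * f x)).
    by rewrite hornerMXaddC mulrDl addrC mulrA.
  have [Am Nm] := mulc_space false Af; have [Ac Nc] := IH _ Am; have Ad := subspaceZ d As Af.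
  split; first exact: subspaceD.
  apply: le_trans (nrmD hA Ad Ac) _; rewrite (nrmZ hA _ Af) addrC mulrDl lerD2r.
  by apply: le_trans Nc _; rewrite ler_wpM2l.
elim/poly_ind: p => [|p d [M M0 IH]].
  exists 0 => // f Af; have -> : peval 0 \* f = 0 :> E.
    by apply/funext => x; rewrite /peval /= !horner0 mul0r.
  by rewrite mul0r (nrm0 hA); split => //; case: As.
have [M' M'0 hd] := inner d; exists (M + M') => [|f Af]; first by rewrite addr_ge0.
have -> : peval (p * 'X + d%:P) \* f = (fun x => d.[x.1] * f x) + peval p \* mulc true f :> E.
  apply/funext => x; change (peval (p * 'X + d%:P) x * f x = d.[x.1] * f x + peval p x * (x.2 * f x)).
  by rewrite /peval hornerMXaddC hornerD hornerM hornerC mulrDl addrC mulrA.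
have [Am Nm] := mulc_space true Af; have [Ac Nc] := IH _ Am; have [Ad Nd] := hd _ Af.
split; first exact: subspaceD.
apply: le_trans (nrmD hA Ad Ac) _; rewrite addrC mulrDl lerD //.
by apply: le_trans Nc _; rewrite ler_wpM2l.
Qed.

(** Distinct powers of [w] are orthogonal, and [w ^ k] has squared norm [om k] because
    [om 0 = 1]. *)
Lemma finite_sum_space n (c : nat -> C) : (forall k, (n <= k)%N -> c k = 0) ->
  let f := patch (fun=> 0) bidisc (fun x : C * C => \sum_(k < n) c k * x.2 ^+ k) in
  A f /\ N f ^+ 2 = \sum_(k < n) nc (c k) ^+ 2 * om k.
Proof.
move=> cn f; pose a m k := if m == 0%N then c k else 0.
have fa : repr f a.
  exists (fun m w => if m == 0%N then \sum_(k < n) c k * w ^+ k else 0); split.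
    move=> m w _; rewrite /a; case: eqP => _.
      by apply: (@csum_fin (fun k => c k * w ^+ k)) => k /cn ->; rewrite mul0r.
    have := @csum_fin (fun k => 0 * w ^+ k) 0; rewrite big_ord0; apply => k _; exact: mul0r.
  move=> z w z1 w1; rewrite /f patch_in; last by split; rewrite normC_lt1.
  have := @csum_fin (fun m => (if m == 0%N then \sum_(k < n) c k * w ^+ k else 0) * z ^+ m) 1.
  by rewrite big_ord1 /= mulr1; apply => -[//|k] _; rewrite mul0r.
have [om0 _ _] := hw; have o0 := om_ge0 hw.
have sqE K : sq K.+1 a = \sum_(k < K.+1) nc (c k) ^+ 2 * om k.
  rewrite /wsq big_ord_recl /= [X in _ + X]big1 ?addr0.
    by apply: eq_bigr => k _; rewrite om0 mul1r.
  by move=> i _; rewrite big1 // => j _; rewrite /a /= nc0 expr0n mul0r.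
have t0 k : 0 <= nc (c k) ^+ 2 * om k by rewrite mulr_ge0 ?sqr_ge0.
have stab K : (n <= K)%N -> \sum_(k < K) nc (c k) ^+ 2 * om k = \sum_(k < n) nc (c k) ^+ 2 * om k.
  move=> nK; rewrite -!(big_mkord xpredT (fun k => nc (c k) ^+ 2 * om k)).
  rewrite (big_cat_nat (leq0n n) nK) /= [X in _ + X]big_nat_cond [X in _ + X]big1 ?addr0 //.
  by move=> k /andP[/andP[nk _] _]; rewrite cn // nc0 expr0n mul0r.
have hB K : sq K a <= \sum_(k < n) nc (c k) ^+ 2 * om k.
  apply: le_trans (sq_mono hw a (leq_trans (leq_maxr n K) (leqnSn _))) _.
  by rewrite sqE stab // (leq_trans (leq_maxl n K)).
have Af : A f by apply: (space_intro2 _ fa hB) => x nx; rewrite /f patch_out.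
split => //; apply/eqP; rewrite eq_le (norm_le hw hs Af fa hB) /=.
by rewrite -(stab n.+1) // -sqE; exact: (sq_le hw hs).
Qed.

Lemma poly_fun_space p : A (poly_fun p).
Proof.
have [A1 _] := @finite_sum_space 1 (fun k => (k == 0%N)%:R) (fun k => ltac:(by case: k)).
have [M _ hM] := poly_mul_space p; have [Am _] := hM _ A1.
suff -> : poly_fun p = peval p \* patch (fun=> 0) bidisc (fun x : C * C => \sum_(k < 1) (nat_of_ord k == 0%N)%:R * x.2 ^+ k).
  exact: Am.
apply/funext => x /=; rewrite /poly_fun; have [b|b] := pselect (bidisc x).
  by rewrite !patch_in // big_ord1 /= !mulr1.
by rewrite !patch_out // mulr0.
Qed.

Lemma norm_poly1 : N (poly_fun 1) = 1.
Proof.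
have [om0 _ _] := hw.
have [_] := @finite_sum_space 1 (fun k => (k == 0%N)%:R) (fun k => ltac:(by case: k)).
rewrite big_ord1 /= nc1 expr1n mul1r om0.
have -> : patch (fun=> 0) bidisc (fun x : C * C => \sum_(k < 1) (nat_of_ord k == 0%N)%:R * x.2 ^+ k) = poly_fun 1 :> E.
  rewrite /poly_fun; congr patch; apply/funext => x; by rewrite big_ord1 /= mulr1 /peval !hornerE.
by move/eqP; rewrite sqrf_eq1 => /orP[/eqP //|/eqP E]; have := norm_ge0 alpha (poly_fun 1); rewrite E oppr_ge0 ler10.
Qed.

(** The constant does not depend on [j]: the powers of the backward shift grow no faster than
    [r ^ -j], whereas iterating a bound for one step would give a power of the constant. *)
Lemma sq_shift (r : R) : 0 < r < 1 -> exists2 K0 : R, 0 <= K0 & forall a B, (forall K, sq K a <= B) ->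
  forall j K, sq K (fun m n => a (m + j)%N n) <= K0 * (r ^- 2) ^+ j * B.
Proof.
move=> r01; have [_ _ /(_ r r01) [K0 K00 h]] := hw; have o0 := om_ge0 hw.
have /andP[r0 _] := r01; exists K0 => // a B hB j K.
have rj : 0 < (r ^+ 2) ^+ j by rewrite !exprn_gt0.
rewrite exprVn mulrAC ler_pdivlMr //; apply: (@le_trans _ _ (K0 * sq (K + j) a)); last by rewrite ler_wpM2l.
have t0 i n : 0 <= nc (a i n) ^+ 2 * (om i * om n) by rewrite mulr_ge0 ?sqr_ge0 // mulr_ge0.
apply: (@le_trans _ _ (K0 * \sum_(m < K) \sum_(n < K) nc (a (m + j)%N n) ^+ 2 * (om (m + j)%N * om n))).
  rewrite mulr_suml mulr_sumr; apply: ler_sum => m _; rewrite mulr_suml mulr_sumr; apply: ler_sum => n _.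
  rewrite -mulrA [leRHS]mulrCA ler_wpM2l ?sqr_ge0 // mulrAC [leRHS]mulrA ler_wpM2r //.
rewrite ler_wpM2l //.
apply: (@le_trans _ _ (\sum_(m < K) \sum_(n < K + j) nc (a (m + j)%N n) ^+ 2 * (om (m + j)%N * om n))).
  apply: ler_sum => m _; rewrite -!(big_mkord xpredT (fun n => nc (a (m + j)%N n) ^+ 2 * (om (m + j)%N * om n))).
  by rewrite (big_cat_nat (leq0n K) (leq_addr j K)) /= lerDl sumr_ge0.
pose G i := \sum_(n < K + j) nc (a i n) ^+ 2 * (om i * om n).
have G0 i : 0 <= G i by exact: sumr_ge0.
rewrite /wsq -(big_mkord xpredT (fun i => G (i + j)%N)) -(big_mkord xpredT G).
have shiftE : \sum_(j <= i < K + j) G i = \sum_(0 <= i < K) G (i + j)%N.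
  by rewrite -[X in index_iota X _]add0n big_addn addnK.
rewrite [leRHS](big_cat_nat (leq0n j) (leq_addl K j)) /= shiftE.
by rewrite lerDr sumr_ge0.
Qed.

End CoefficientShift.

(** Unroll [J] times: the terms in [y] form a geometric sum of ratio [q s], and the remainder
    [q ^ J * x J] is at most [(q s) ^ J * X], which tends to 0. The crude bound [X] thus leaves no
    trace in the conclusion. *)
Lemma geometric_recursion (R : realType) (x y : nat -> R) (q s X Y : R) : 0 <= q -> 0 <= s -> q * s < 1 ->
  0 <= X -> 0 <= Y -> (forall j, x j <= y j.+1 + q * x j.+1) -> (forall j, x j <= s ^+ j * X) ->
  (forall j, y j <= s ^+ j * Y) -> x 0%N <= s / (1 - q * s) * Y.
Proof.
move=> q0 s0 qs X0 Y0 hr hX hY; have qs0 : 0 <= q * s by rewrite mulr_ge0.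
have step J : x 0%N <= s / (1 - q * s) * Y + (q * s) ^+ J * X.
  apply: (@le_trans _ _ (\sum_(j < J) (q * s) ^+ j * (s * Y) + q ^+ J * x J)).
    elim: J => [|J IH]; first by rewrite big_ord0 add0r mul1r.
    apply: (le_trans IH); rewrite big_ord_recr /= -addrA lerD2l.
    apply: (le_trans (ler_wpM2l (exprn_ge0 J q0) (hr J))); rewrite mulrDr lerD //.
      apply: (le_trans (ler_wpM2l (exprn_ge0 J q0) (hY J.+1))).
      by rewrite exprMn exprS; lra.
    by rewrite mulrA -exprSr.
  apply: lerD; last first.
    by rewrite exprMn -mulrA; apply: ler_wpM2l; [exact: exprn_ge0|exact: hX].
  have hS : \sum_(j < J) (q * s) ^+ j <= (1 - q * s)^-1.
    rewrite -[leRHS]mul1r ler_pdivlMr ?subr_gt0 //.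
    by have := subrX1 (q * s) J; have := exprn_ge0 J qs0; lra.
  rewrite -mulr_suml; apply: le_trans (ler_wpM2r (mulr_ge0 s0 Y0) hS) _.
  by rewrite mulrA [_^-1 * s]mulrC.
apply/ler_addgt0Pr => e e0.
have h : (fun J => (q * s) ^+ J * X) @ \oo --> (0 : R).
  rewrite -[0](mul0r X); apply: cvgM; last exact: cvg_cst.
  by apply: cvg_expr; rewrite ger0_norm.
have /cvgrPdist_lt /(_ _ e0) [n _ hn] := h.
apply: le_trans (step n) _; rewrite lerD2l; have := hn n (leqnn n).
by rewrite /= sub0r normrN => /ltW; apply: le_trans; exact: ler_norm.
Qed.

(** * Lower bounds for multiplication by [z - l] and [w - l], and Cesaro means *)

Section PointEstimates.
Variables (R : realType) (alpha : R) (om : nat -> R).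
Notation C := R[i].
Notation nc := (@Normc.normc R).
Notation E := (C * C -> C).
Notation bidisc := (@bidisc R).
Notation A := (bergman_space alpha).
Notation N := (norm_alpha alpha).
Notation sq := (wsq om).
Hypotheses (hw : weights om).
Hypothesis hs : forall f a, repr f a -> sqnorm alpha f = ereal_sup (range (fun K => (sq K a)%:E)).
Let hA := hilbert_space hw hs.
Let As := space_sub hw hs.

Lemma norm_eq (f g : E) a : A f -> A g -> repr f a -> repr g a -> N f = N g.
Proof.
move=> Af Ag fa ga; have : N f ^+ 2 = N g ^+ 2.
  by apply: EFin_inj; rewrite (normE hw hs Af fa) (normE hw hs Ag ga).
by move/eqP; rewrite eqrXn2 ?norm_ge0 // => /eqP.
Qed.

(* The backward shift [L] satisfies [u = L F + l L u], and [L ^ j] has norm at most [K r ^ -j] for every [r < 1]. *)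
Lemma shift_estimate t (l : C) : nc l < 1 -> exists2 K : R, 0 <= K & forall u F a b, A u -> A F ->
  repr u a -> repr F b -> (forall m n, tr t b m.+1 n = tr t a m n - l * tr t a m.+1 n) -> N u <= K * N F.
Proof.
move=> l1; have [r [lr _ r1]] := between (nc_ge0 l) l1.
have r0 : 0 < r := le_lt_trans (nc_ge0 l) lr.
have [K0 K00 hK] := sq_shift hw (r := r) (ltac:(by rewrite r0)).
pose k := Num.sqrt K0; have k0 : 0 <= k := sqrtr_ge0 K0.
have q1 : nc l * r^-1 < 1 by rewrite ltr_pdivrMr // mul1r.
have ri0 : 0 <= r^-1 by rewrite invr_ge0 ltW.
exists (r^-1 / (1 - nc l * r^-1) * k) => [|u F a b Au AF ua Fb rec].
  by rewrite mulr_ge0 // divr_ge0 // subr_ge0 ltW.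
(* Realizes the iterated backward shifts as functions of the space, with norms controlled by
   [sq_shift], since the recursion compares norms of functions. *)
have family f c : A f -> repr f c -> exists g : nat -> E, forall j,
    [/\ A (g j), repr (g j) (tr t (fun m n => tr t c (m + j)%N n)) & N (g j) <= r^-1 ^+ j * (k * N f)].
  move=> Af fc; have hB K : sq K (tr t c) <= N f ^+ 2 by rewrite sq_tr; exact: (sq_le hw hs).
  have hj j K : sq K (tr t (fun m n => tr t c (m + j)%N n)) <= (r^-1 ^+ j * (k * N f)) ^+ 2.
    rewrite sq_tr; apply: le_trans (hK _ _ hB j K) _.
    have -> // : (r^-1 ^+ j * (k * N f)) ^+ 2 = K0 * r ^- 2 ^+ j * N f ^+ 2.
    have kk : k ^+ 2 = K0 by rewrite sqr_sqrtr.
    have rr : (r^-1 ^+ j) ^+ 2 = r ^- 2 ^+ j by rewrite exprAC exprVn.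
    by rewrite !exprMn kk rr; ring.
  have /choice [g hg] j : exists g, A g /\ repr g (tr t (fun m n => tr t c (m + j)%N n)).
    by have [g Ag gc] := space_make hw hs (hj j); exists g.
  exists g => j; have [Ag gc] := hg j; split => //.
  apply: sqrt_le_nrm; first by rewrite mulr_ge0 ?exprn_ge0 // mulr_ge0 ?norm_ge0.
  exact: (norm_le hw hs Ag gc (hj j)).
have [U hU] := family u a Au ua; have [G hG] := family F b AF Fb.
have U0 : N u = N (U 0%N).
  have [A0 r0' _] := hU 0%N; apply: norm_eq ua _ => //.
  by apply: repr_ext r0' => m n; case: (t) => /=; rewrite addn0.
suff : N (U 0%N) <= r^-1 / (1 - nc l * r^-1) * (k * N F) by rewrite -U0 mulrA.
apply: (@geometric_recursion R (fun j => N (U j)) (fun j => N (G j)) (nc l) r^-1 (k * N u) (k * N F)).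
- exact: nc_ge0.
- exact: ri0.
- exact: q1.
- by rewrite mulr_ge0 ?norm_ge0.
- by rewrite mulr_ge0 ?norm_ge0.
- move=> j; have [A0 R0 _] := hU j; have [A1 R1 _] := hU j.+1; have [A2 R2 _] := hG j.+1.
  have Al := subspaceZ l As A1.
  have E1 : N (U j) = N (l *: U j.+1 + G j.+1).
    have AS := subspaceD As Al A2.
    suff RS : repr (l *: U j.+1 + G j.+1) (tr t (fun m n => tr t a (m + j)%N n)) by exact: (norm_eq A0 AS R0 RS).
    apply: repr_ext (repr_lin l R1 R2) => m n.
    case: (t) rec => /= rec; rewrite !addnS rec; ring.
  by rewrite E1 addrC -(nrmZ hA _ A1); apply: (nrmD hA).
- by move=> j; case: (hU j).
- by move=> j; case: (hG j).
Qed.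

(** Division with remainder by [z - l], or by [w - l], is bounded: [u] is the quotient of [F] and
    [v] its value on the line. The backward shift kills [v], which does not depend on the divided
    variable, so [shift_estimate] bounds [u], and [v] is what is left. *)
Lemma point_estimate t (l : C) : nc l < 1 -> exists2 K : R, 0 <= K & forall u v, A u -> A v ->
  (forall x y, bidisc x -> bidisc y -> (if t then x.1 = y.1 else x.2 = y.2) -> v x = v y) ->
  let F := (fun x => ((if t then x.2 else x.1) - l) * u x + v x) : E in N u <= K * N F /\ N v <= K * N F.
Proof.
move=> l1; have [K K0 hK] := shift_estimate t l1.
exists (1 + 2 * K) => [|u v Au Av vI F]; first by rewrite addr_ge0 // mulr_ge0.
have [[a ua] [b vb]] := (space_repr Au, space_repr Av).
have z0 : nc (0 : C) < 1 by rewrite nc0.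
have D0 (z : C) : nc z < 1 -> bidisc (0, z) by move=> z1; split; rewrite /= normC_lt1.
have D1 (z : C) : nc z < 1 -> bidisc (z, 0) by move=> z1; split; rewrite /= normC_lt1.
(* [v] is expanded afresh, so that its coefficients of positive order in the divided variable are
   zero by construction; the array [b] is only known to represent [v]. *)
have [c [vc hc]] : exists c, repr v c /\ forall m n, tr t c m.+1 n = 0.
  have [b' [h1 h2]] := vb.
  have at0 w : nc w < 1 -> v (0, w) = b' 0%N w.
    move=> w1; apply: csum_uniq (h2 0 w z0 w1) _.
    have := @csum_fin _ (fun m => b' m w * 0 ^+ m) 1; rewrite big_ord1 /= mulr1; apply => -[//|m] _.
    by rewrite exprS mul0r mulr0.
  case: t vI {F hK} => vI.
    exists (fun m n => if n == 0%N then b m 0%N else 0); split; last by [].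
    have b0 m : b' m 0 = b m 0%N.
      apply: csum_uniq (h1 m 0 z0) _.
      have := @csum_fin _ (fun n => b m n * 0 ^+ n) 1; rewrite big_ord1 /= mulr1; apply => -[//|n] _.
      by rewrite exprS mul0r mulr0.
    exists (fun m w => b m 0%N); split.
      move=> m w w1; have := @csum_fin _ (fun n => (if n == 0%N then b m 0%N else 0) * w ^+ n) 1.
      by rewrite big_ord1 /= mulr1; apply => -[//|n] _; rewrite mul0r.
    move=> z w z1 w1; rewrite (vI (z, w) (z, 0)) //; last exact: D1.
      by apply: csum_ext (h2 z 0 z1 z0) => m; rewrite b0.
    by split; rewrite normC_lt1.
  exists (fun m n => if m == 0%N then b 0%N n else 0); split; last by [].
  exists (fun m w => if m == 0%N then b' 0%N w else 0); split.
    move=> [|m] w w1 /=; first exact: h1.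
    have := @csum_fin R (fun n => 0 * w ^+ n) 0; rewrite big_ord0; apply => n _; exact: mul0r.
  move=> z w z1 w1; rewrite (vI (z, w) (0, w)) //; [|by split; rewrite normC_lt1|exact: D0].
  rewrite at0 //; have := @csum_fin _ (fun m => (if m == 0%N then b' 0%N w else 0) * z ^+ m) 1.
  by rewrite big_ord1 /= mulr1; apply => -[//|m] _; rewrite mul0r.
have [Am Nm] := mulc_space hw hs t Au.
have Al := subspaceZ (- l) As Au; have Ad : A (- l *: u + mulc t u) by exact: subspaceD.
have FE : F = - l *: u + mulc t u + v.
  apply/funext => x; rewrite /F.
  change (((if t then x.2 else x.1) - l) * u x + v x = - l * u x + (if t then x.2 else x.1) * u x + v x).
  by rewrite mulrDl [- l * _ + _]addrC.
have AF : A F by rewrite FE; exact: subspaceD.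
have Fr := repr_lin 1 (repr_lin (- l) ua (repr_mulc t ua)) vc.
rewrite scale1r -FE in Fr.
have h1 : N u <= K * N F.
  apply: (hK u F _ _ Au AF ua Fr) => m n; rewrite -[RHS]addr0 -(hc m n).
  by case: (t) => /=; ring.
have NF0 := norm_ge0 alpha F; split; first by apply: le_trans h1 _; rewrite ler_wpM2r //; lra.
have vE : v = F - (- l *: u + mulc t u) by rewrite FE addrC addKr.
rewrite [in leLHS]vE; apply: le_trans (nrmB hA AF Ad) _.
have h2 := nrmD hA Al Am; rewrite (nrmZ hA _ Au) ncN in h2.
have h3 : nc l * N u <= N u by rewrite ler_piMl ?norm_ge0 // ltW.
rewrite mulrDl mul1r lerD2l; apply: le_trans h2 _.
by rewrite -mulrA mulrDl !mul1r; lra.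
Qed.

Lemma outer_estimate (mu : C) u : A u -> (nc mu - 1) * N u <= N (fun x => (x.2 - mu) * u x).
Proof.
move=> Au; have [Am Nm] := mulc_space hw hs true Au; have Al := subspaceZ mu As Au.
have -> : (fun x => (x.2 - mu) * u x) = mulc true u - mu *: u :> E.
  by apply/funext => x; change ((x.2 - mu) * u x = x.2 * u x - mu * u x); rewrite mulrBl.
rewrite (nrm_dist hA) //; apply: le_trans (nrm_subr hA Al Am); rewrite (nrmZ hA _ Au) mulrBl mul1r.
by rewrite lerB.
Qed.

Definition cesaro (mu : C) n : {poly {poly C}} :=
  \sum_(k < n.+1) (n.+1%:R^-1 * (mu ^- k.+1))%:P *: 'X^(k.+1).

(** The [n + 1] orthogonal terms have coefficients of modulus [1 / (n + 1)] and weights at most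
    1. *)
Lemma cesaro_norm (mu : C) n : nc mu = 1 -> N (poly_fun (cesaro mu n)) ^+ 2 <= n.+1%:R^-1.
Proof.
move=> mu1; pose c k : C := if (0 < k <= n.+1)%N then n.+1%:R^-1 * mu ^- k else 0.
have [|_] := @finite_sum_space _ _ _ hw hs n.+2 c.
  by move=> k h; rewrite /c [(k <= _)%N]leqNgt h andbF.
have -> : patch (fun=> 0) bidisc (fun x : C * C => \sum_(k < n.+2) c k * x.2 ^+ k) = poly_fun (cesaro mu n) :> E.
  rewrite /poly_fun; congr patch; apply/funext => x.
  rewrite /peval /cesaro horner_sum horner_sum big_ord_recl /c /= mul0r add0r; apply: eq_bigr => k _.
  by rewrite ltn_ord hornerZ hornerXn hornerM hornerC horner_exp hornerC.
move=> ->; rewrite big_ord_recl /c /= nc0 expr0n mul0r add0r.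
have [om0 dec _] := hw.
have om1 k : om k <= 1 by elim: k => [|k IH]; [rewrite om0|exact: le_trans (dec k) IH].
have n0 : 0 < n.+1%:R :> R by [].
have nn : nc (n.+1%:R : C) = n.+1%:R by rewrite -(rmorph_nat (real_complex R)) nc_real ger0_norm // ltW.
apply: (@le_trans _ _ (\sum_(k < n.+1) (n.+1%:R^-1) ^+ 2)).
  apply: ler_sum => k _; rewrite ltn_ord ncM !ncV ncX mu1 expr1n invr1 mulr1 nn.
  by rewrite ler_piMr ?sqr_ge0.
by rewrite sumr_const card_ord -[leLHS]mulr_natl expr2 mulrA mulfV ?mul1r // gt_eqF.
Qed.

End PointEstimates.

(** * Polynomials in two variables and their slices on the lines [z = l] *)

Section Slices.
Variable R : realType.
Notation C := R[i].
Notation nc := (@Normc.normc R).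
Notation P2 := {poly {poly C}}.

Lemma pevalD (p q : P2) x : peval (p + q) x = peval p x + peval q x.
Proof. by rewrite /peval !hornerD. Qed.
Lemma pevalM (p q : P2) x : peval (p * q) x = peval p x * peval q x.
Proof. by rewrite /peval !hornerM. Qed.
Lemma pevalB (p q : P2) x : peval (p - q) x = peval p x - peval q x.
Proof. by rewrite /peval !hornerE. Qed.
Lemma pevalC (c : {poly C}) x : peval c%:P x = c.[x.1].
Proof. by rewrite /peval hornerC. Qed.
Lemma peval1 x : peval (1 : P2) x = 1.
Proof. by rewrite /peval !hornerE. Qed.

Definition slice (l : C) (p : P2) : {poly C} := map_poly (horner_eval l) p.
Definition lift (q : {poly C}) : P2 := map_poly polyC q.

Lemma peval_slice (p : P2) l w : peval p (l, w) = (slice l p).[w].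
Proof.
rewrite /peval /slice /= -[LHS]/(horner_eval l p.[w%:P]) -horner_map /=.
by rewrite /horner_eval hornerC.
Qed.

Lemma peval_lift (q : {poly C}) x : peval (lift q) x = q.[x.2].
Proof. by rewrite /peval /lift horner_map hornerC. Qed.

Lemma slice_lift l q : slice l (lift q) = q.
Proof.
by apply/polyP => i; rewrite /slice /lift !coef_map /= /horner_eval hornerC.
Qed.

Lemma sliceM l (p q : P2) : slice l (p * q) = slice l p * slice l q.
Proof. exact: rmorphM. Qed.
Lemma sliceB l (p q : P2) : slice l (p - q) = slice l p - slice l q.
Proof. exact: rmorphB. Qed.
Lemma sliceC l c : slice l c%:P = c.[l]%:P.
Proof. by rewrite /slice map_polyC. Qed.

Lemma sliceD l (p q : P2) : slice l (p + q) = slice l p + slice l q.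
Proof. exact: rmorphD. Qed.
Lemma liftD p q : lift (p + q) = lift p + lift q.
Proof. exact: rmorphD. Qed.
Lemma liftM p q : lift (p * q) = lift p * lift q.
Proof. exact: rmorphM. Qed.
Lemma liftX : lift 'X = 'X.
Proof. exact: map_polyX. Qed.
Lemma liftC c : lift c%:P = c%:P%:P.
Proof. exact: map_polyC. Qed.
Lemma sliceX l : slice l 'X = 'X.
Proof. exact: map_polyX. Qed.

Lemma slice_decomp l (p : P2) : exists r : P2, p = ('X - l%:P)%:P * r + lift (slice l p).
Proof.
elim/poly_ind: p => [|p c [r IH]].
  by exists 0; rewrite /slice /lift !raddf0 mulr0 addr0.
have /factor_theorem [d hd] : root (c - c.[l]%:P) l by rewrite /root !hornerE subrr.
exists (r * 'X + d%:P).
have -> : lift (slice l (p * 'X + c%:P)) = lift (slice l p) * 'X + (c.[l])%:P%:P.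
  have -> : slice l (p * 'X + c%:P) = slice l p * 'X + (c.[l])%:P.
    by rewrite sliceD sliceM sliceX sliceC.
  by rewrite liftD liftM liftX liftC.
have cE : c%:P = (d * ('X - l%:P))%:P + (c.[l])%:P%:P :> P2 by rewrite -hd -polyCD subrK.
rewrite {1}cE {1}IH polyCM mulrDl mulrDr mulrA -!addrA; congr (_ + _).
by rewrite addrCA [_%:P * d%:P]mulrC.
Qed.

Lemma slice0_factor l (p : P2) : slice l p = 0 -> exists r : P2, p = ('X - l%:P)%:P * r.
Proof.
by move=> s0; have [r E] := slice_decomp l p; exists r; rewrite {1}E s0 /lift raddf0 addr0.
Qed.

Lemma slice_neq0 l (p : P2) : (lead_coef p).[l] != 0 -> slice l p != 0.
Proof.
apply: contraNneq => s0; have := congr1 (fun q : {poly C} => q`_(size p).-1) s0.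
by rewrite /slice coef_map coef0 => /eqP.
Qed.

Lemma finite_root (q : {poly C}) : q != 0 -> finite_set [set x | root q x].
Proof.
move=> q0; have [s E] := closed_field_poly_normal q.
apply: (@sub_finite_set _ _ [set` s]); last exact: finite_seq.
move=> x /=; rewrite E rootZ ?lead_coef_eq0 // root_prod_XsubC //.
Qed.

Lemma poly_lipschitz (q : {poly C}) : exists2 K : R, 0 <= K &
  forall x y, nc x <= 1 -> nc y <= 1 -> nc (q.[x] - q.[y]) <= K * nc (x - y).
Proof.
suff [K [K0 [M [M0 hM]]] hK] : exists2 K : R, 0 <= K /\ exists M : R, 0 <= M /\ (forall x, nc x <= 1 -> nc q.[x] <= M) &
    forall x y, nc x <= 1 -> nc y <= 1 -> nc (q.[x] - q.[y]) <= K * nc (x - y) by exists K.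
elim/poly_ind: q => [|q c [K [K0 [M [M0 hM]]] hK]].
  exists 0; first by split => //; exists 0; split => // x _; rewrite horner0 nc0.
  by move=> x y _ _; rewrite !horner0 subrr nc0 mul0r.
exists (K + M); first split; first exact: addr_ge0.
  exists (M + nc c); split; first by rewrite addr_ge0 ?nc_ge0.
  move=> x x1; rewrite hornerMXaddC; apply: le_trans (ncD _ _) _; rewrite lerD2r ncM.
  by apply: le_trans (hM x x1); rewrite ler_piMr ?nc_ge0.
move=> x y x1 y1; rewrite !hornerMXaddC.
have -> : q.[x] * x + c - (q.[y] * y + c) = (q.[x] - q.[y]) * x + q.[y] * (x - y) by ring.
apply: le_trans (ncD _ _) _; rewrite !ncM mulrDl lerD //; last by rewrite ler_wpM2r ?nc_ge0 ?hM.
by apply: le_trans (hK x y x1 y1); rewrite ler_piMr ?nc_ge0.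
Qed.

(** Each factor satisfies [|x - y| <= |l - y| (1 + |x - l| / e)] when the root [y] is farther than
    [e] from [l]. Read backwards, a value at [l] that is small compared with the value at [x] forces
    a root near [l]: a quantitative form of the continuity of roots. *)
Lemma root_near (q : {poly C}) (l x : C) (e : R) D : 0 < e -> (size q <= D)%N -> q != 0 ->
  (forall y, root q y -> e < nc (y - l)) -> nc q.[x] <= nc q.[l] * (1 + nc (x - l) / e) ^+ D.
Proof.
move=> e0 sD q0 far; have [s E] := closed_field_poly_normal q.
have t1 : 1 <= 1 + nc (x - l) / e by rewrite lerDl divr_ge0 ?nc_ge0 // ltW.
have lc0 : lead_coef q != 0 by rewrite lead_coef_eq0.
have ss : (size s <= D)%N.
  apply: leq_trans sD; rewrite E size_scale // size_prod_XsubC //.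
have far' y : y \in s -> e < nc (y - l).
  by move=> ys; apply: far; rewrite E rootZ // root_prod_XsubC.
apply: (@le_trans _ _ (nc q.[l] * (1 + nc (x - l) / e) ^+ size s)); last first.
  by rewrite ler_wpM2l ?nc_ge0 // ler_weXn2l.
rewrite E !hornerZ !ncM -mulrA ler_wpM2l ?nc_ge0 // !horner_prod.
elim: s {E ss} far' => [|y s IH] far'; first by rewrite !big_nil nc1 mulr1.
rewrite !big_cons !ncM exprS mulrACA ler_pM ?nc_ge0 //.
  rewrite !hornerXsubC; have h := far' y (mem_head _ _).
  have -> : x - y = (x - l) - (y - l) by ring.
  apply: le_trans (ncB _ _) _; rewrite (nc_dist l y) mulrDr mulr1 addrC lerD2l mulrCA.
  by rewrite ler_peMr ?nc_ge0 // ler_pdivlMr // mul1r ltW.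
by apply: IH => z zs; apply: far'; rewrite in_cons zs orbT.
Qed.

End Slices.

(** * Algebra and geometry of a distinguished ideal *)

Section DistinguishedIdeal.
Variable R : realType.
Notation C := R[i].
Notation nc := (@Normc.normc R).
Notation P2 := {poly {poly C}}.
Notation bidisc := (@bidisc R).
Variable I : set P2.
Hypothesis hI : is_ideal I.

Lemma ideal0 : I 0. Proof. by case: hI. Qed.
Lemma idealD p q : I p -> I q -> I (p + q). Proof. by case: hI => _ h _; exact: h. Qed.
Lemma idealM p q : I q -> I (p * q). Proof. by case: hI => _ _; exact. Qed.
Lemma idealZ c p : I p -> I (c *: p). Proof. by rewrite -mul_polyC; exact: idealM. Qed.
Lemma idealN p : I p -> I (- p). Proof. by rewrite -mulN1r; exact: idealM. Qed.
Lemma idealB p q : I p -> I q -> I (p - q). Proof. by move=> Ip Iq; apply: idealD => //; exact: idealN. Qed.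

(** The point [(l, m)] would be a boundary limit of [V] off the torus, because [|l| < 1]. *)
Lemma boundary_line (l m : C) : nc l < 1 -> nc m = 1 -> 
  (forall e : R, 0 < e -> exists x, [/\ (zero_set I `&` bidisc) x, nc (x.1 - l) < e & nc (x.2 - m) < e]) ->
  ~ distinguished I.
Proof.
move=> l1 m1 h [_ _ /(_ (l, m))]; case.
  split.
    move=> U /nbhsC2 [e e0 he]; have [x [Vx h1 h2]] := h e e0.
    by exists x; split => //; exact: he.
  split.
    move=> U /nbhsC2 [e e0 he]; have [x [[_ bx] h1 h2]] := h e e0.
    by exists x; split => //; exact: he.
  by move=> /interior_subset [_] /=; rewrite normC_lt1 m1 ltxx.
by move=> /= /normC_eq1 E _; move: l1; rewrite E ltxx.
Qed.

Hypothesis hd : distinguished I.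

(** Otherwise [V] contains a whole disc [z = l], whose closure meets the boundary at [(l, 1)]. *)
Lemma line_notin l : nc l < 1 -> exists2 p, I p & slice l p != 0.
Proof.
move=> l1; apply: contrapT => hno; apply: (boundary_line l1 (nc1 _)) hd => e e0.
have z p w : I p -> peval p (l, w) = 0.
  move=> Ip; rewrite peval_slice; have [->|s0] := eqVneq (slice l p) 0; first by rewrite horner0.
  by case: hno; exists p.
pose d := Num.min (e / 2) 2^-1.
have d0 : 0 < d by rewrite lt_min divr_gt0 // invr_gt0 ltr0n.
have de : d < e by apply: (@le_lt_trans _ _ (e / 2)); [rewrite ge_min lexx|lra].
have d1 : d <= 2^-1 by rewrite ge_min lexx orbT.
exists (l, (1 - d)%:C%C); split.
- split; first by move=> p; exact: z.
  by split; rewrite /= normC_lt1 // nc_real ger0_norm; lra.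
- by rewrite /= subrr nc0.
- by rewrite /= -(rmorph1 (real_complex R)) -rmorphB nc_real addrAC subrr add0r normrN gtr0_norm.
Qed.

Lemma generator : exists g, [/\ I g, g != 0 & forall p, I p -> (size p < size g)%N -> p = 0].
Proof.
have [p0 Ip0 s0] := line_notin (l := 0) (ltac:(by rewrite nc0)).
have p00 : p0 != 0 by apply: contraNneq s0 => ->; rewrite /slice raddf0.
pose P n := `[< exists g, [/\ I g, g != 0 & size g = n] >].
have exP : exists n, P n by exists (size p0); apply/asboolP; exists p0.
have [n /asboolP [g [Ig g0 gn]] hmin] := ex_minnP exP; exists g; split => // p Ip sp.
apply/eqP; apply: contraTT sp => p1; rewrite -leqNgt gn; apply: hmin.
by apply/asboolP; exists p.
Qed.

Variable g : P2.
Hypotheses (Ig : I g) (g0 : g != 0) (gmin : forall p, I p -> (size p < size g)%N -> p = 0).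

(** The pseudo-remainder lies in [I] and has smaller degree than [g], so minimality makes it 0. *)
Lemma pseudo_division p : I p -> exists k q, lead_coef g ^+ k *: p = q * g.
Proof.
move=> Ip; have E := Pdiv.Idomain.divp_eq p g; exists (scalp p g), (p %/ g).
rewrite E [p %% g]gmin ?addr0 //; last by rewrite Pdiv.Idomain.ltn_modp.
have -> : p %% g = lead_coef g ^+ scalp p g *: p - p %/ g * g by rewrite E addrC addKr.
by apply: idealB; [exact: idealZ|exact: idealM].
Qed.

(** Only finitely many lines [z = l] carry zeros of the leading coefficient, and each meets [V] in
    finitely many points by [line_notin]; but [V] is infinite. *)
Lemma good_point : exists2 x, (zero_set I `&` bidisc) x & (lead_coef g).[x.1] != 0.
Proof.
apply: contrapT => hno; have [_ infV _] := hd.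
have V0 x : (zero_set I `&` bidisc) x -> root (lead_coef g) x.1.
  by move=> Vx; apply/negPn/negP => h; apply: hno; exists x.
apply: infV; pose D := [set l | root (lead_coef g) l /\ nc l < 1].
have fD : finite_set D.
  by apply: (sub_finite_set _ (finite_root (q := lead_coef g) _)) => [l []|]; rewrite ?lead_coef_eq0.
have fW l : D l -> finite_set [set x | (zero_set I `&` bidisc) x /\ x.1 = l].
  move=> [_ l1]; have [p Ip sp] := line_notin l1.
  apply: (@sub_finite_set _ _ ((fun w => (l, w)) @` [set w | root (slice l p) w])).
    move=> [a w] [[hz _] /= al]; exists w; last by rewrite al.
    by rewrite /= /root -peval_slice -al; apply/eqP; exact: hz.
  by apply: finite_image; exact: finite_root.
apply: (sub_finite_set _ (bigcup_finite fD fW)) => x Vx; exists x.1 => //.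
by split; [exact: V0|case: Vx => _ []; rewrite normC_lt1].
Qed.

Variable l : C.
Hypotheses (l1 : nc l < 1) (gl : (lead_coef g).[l] != 0).

(** Multiplied by [z - l], the pseudo-remainder of [r] lies in [I] with degree below that of [g], so
    it is 0 and a power [c ^ k] of the leading coefficient sends [r] into [I]. As [c ^ k] is a
    nonzero constant modulo [z - l], so does that constant. *)
Lemma ideal_divide r : I (('X - l%:P)%:P * r) -> I r.
Proof.
move=> Ir; pose c := lead_coef g.
have E := Pdiv.Idomain.divp_eq r g; set k := scalp r g in E.
have r0 : r %% g = 0.
  have I1 : I (('X - l%:P) *: (r %% g)).
    have -> : ('X - l%:P) *: (r %% g) = c ^+ k *: (('X - l%:P)%:P * r) - (('X - l%:P)%:P * (r %/ g)) * g.
      have -> : r %% g = c ^+ k *: r - r %/ g * g by rewrite E addrC addKr.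
      by rewrite -!mul_polyC mulrBr mulrCA [X in _ - X]mulrA.
    by apply: idealB; [exact: idealZ|exact: idealM].
  have xl0 : 'X - l%:P != 0 :> {poly C} by rewrite polyXsubC_eq0.
  have := gmin I1; rewrite size_scale // Pdiv.Idomain.ltn_modp g0 => /(_ isT) /eqP.
  by rewrite -mul_polyC mulf_eq0 polyC_eq0 (negPf xl0) => /eqP.
rewrite r0 addr0 in E.
have Ic : I (c ^+ k *: r) by rewrite E; exact: idealM.
have e0 : (c ^+ k).[l] != 0 by rewrite horner_exp expf_neq0.
have /factor_theorem [d hd'] : root (c ^+ k - (c ^+ k).[l]%:P) l by rewrite /root !hornerE subrr.
have -> : r = ((c ^+ k).[l]^-1)%:P *: (c ^+ k *: r - d *: (('X - l%:P)%:P * r)).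
  rewrite -!mul_polyC mulrA -mulrBl -polyCM -polyCB -hd' subKr mulrA -polyCM -polyCM mulVf //.
  by rewrite mul1r.
by apply: idealZ; apply: idealB => //; exact: idealZ.
Qed.

Lemma slice_multiple p : I p -> exists h, slice l p = slice l g * h.
Proof.
move=> /pseudo_division [k [q E]]; exists (((lead_coef g).[l] ^- k)%:P * slice l q).
have := congr1 (slice l) E; rewrite -mul_polyC !sliceM sliceC horner_exp => E1.
rewrite mulrCA [slice l g * _]mulrC -E1 mulrA -polyCM mulVf ?mul1r // expf_neq0 //.
Qed.

Lemma zero_nonroot (q : {poly C}) : q != 0 -> exists x, q.[x] != 0.
Proof.
move=> q0; apply: contrapT => hno.
have h0 x : root q x by rewrite /root; apply/negPn/negP => h; apply: hno; exists x.
have := max_poly_roots (rs := [seq i%:R | i <- iota 0 (size q)]) q0.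
rewrite size_map size_iota ltnn => h; suff : false by []; apply: h; first by apply/allP.
rewrite map_inj_uniq ?iota_uniq // => i j /eqP; rewrite eqr_nat => /eqP //.
Qed.

Lemma size_horner_bound (p : P2) : exists D, forall w : C, (size p.[w%:P] <= D)%N.
Proof.
elim/poly_ind: p => [|p c [D hD]]; first by exists 0%N => w; rewrite horner0 size_poly0.
exists (maxn D (size c)) => w; rewrite hornerMXaddC mulrC mul_polyC.
apply: leq_trans (size_polyD _ _) _; rewrite geq_max leq_max leq_maxr andbT.
by rewrite (leq_trans (size_scale_leq _ _)).
Qed.

(** If [g(., m)] is not identically zero, then for [w] tending to [m] radially from inside the disc
    the polynomial [g(., w)] keeps a root near [l]. These are points of [V], since the leading
    coefficient does not vanish there, and they accumulate at [(l, m)]. *)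
Lemma root_inside (m : C) : nc m = 1 -> root (slice l g) m -> g.[m%:P] = 0.
Proof.
move=> m1 rm; apply/eqP; apply: contraT => F0; exfalso.
apply: (boundary_line l1 m1 _ hd) => e e0.
have [x0 hx0] := zero_nonroot F0; have [D hD] := size_horner_bound g.
have [Kc Kc0 hc] := poly_lipschitz (lead_coef g).
have [Kl Kl0 hl] := poly_lipschitz (slice l g).
have [Kx Kx0 hx] := poly_lipschitz (slice x0 g).
have cl0 : 0 < nc (lead_coef g).[l] by rewrite nc_gt0.
have a0 : 0 < nc (g.[m%:P]).[x0] by rewrite nc_gt0.
set cl := nc (lead_coef g).[l] in cl0; set a := nc (g.[m%:P]).[x0] in a0.
(* The three bounds keep the root within [e] of [l], inside the disc, and away from the zeros of the
   leading coefficient. *)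
pose ep := Num.min (e / 2) (Num.min ((1 - nc l) / 2) (cl / (2 * (Kc + 1)))).
have ep0 : 0 < ep.
  rewrite !lt_min !divr_gt0 ?subr_gt0 //=; rewrite mulr_gt0 // ltr_wpDl //.
have ep1 : ep <= e / 2 by rewrite ge_min lexx.
have ep2 : ep <= (1 - nc l) / 2 by rewrite !ge_min lexx orbT.
have ep3 : ep <= cl / (2 * (Kc + 1)) by rewrite !ge_min lexx !orbT.
pose Mx := (1 + nc (x0 - l) / ep) ^+ D.
have Mx0 : 0 <= Mx by rewrite exprn_ge0 // addr_ge0 // divr_ge0 ?nc_ge0 // ltW.
have B0 : 0 < 4 * (Kl * Mx + Kx + 1) by rewrite mulr_gt0 // ltr_wpDl // addr_ge0 // mulr_ge0.
(* The distance from [w] to [m]; the last bound is what makes the root search below succeed. *)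
pose s := Num.min 2^-1 (Num.min (e / 2) (a / (4 * (Kl * Mx + Kx + 1)))).
have s0 : 0 < s by rewrite !lt_min invr_gt0 !divr_gt0 ?ltr0n.
have s1 : s <= 2^-1 by rewrite ge_min lexx.
have s2 : s <= e / 2 by rewrite !ge_min lexx orbT.
have s3 : s <= a / (4 * (Kl * Mx + Kx + 1)) by rewrite !ge_min lexx !orbT.
have h21 : (2^-1 : R) < 1 by rewrite invf_lt1 ?ltr1n.
pose w := (1 - s)%:C%C * m.
have nw : nc w = 1 - s by rewrite ncM m1 mulr1 nc_real ger0_norm //; lra.
have wm : nc (w - m) = s.
  have -> : w - m = (- s)%:C%C * m by rewrite /w rmorphB rmorphN rmorph1 mulrBl mul1r addrAC subrr add0r mulNr.
  by rewrite ncM m1 mulr1 nc_real normrN ger0_norm // ltW.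
have w1 : nc w <= 1 by rewrite nw; lra.
have [y ry yl] : exists2 y, root g.[w%:P] y & nc (y - l) <= ep.
  apply: contrapT => hno.
  have far y : root g.[w%:P] y -> ep < nc (y - l).
    by move=> ry; rewrite ltNge; apply/negP => h; apply: hno; exists y.
  have Fw0 : g.[w%:P] != 0.
    by apply/eqP => E; have := far l; rewrite E root0 subrr nc0 ltNge (ltW ep0) => /(_ isT).
  have h1 := root_near x0 ep0 (hD w) Fw0 far.
  have E1 y : (g.[w%:P]).[y] = (slice y g).[w] := peval_slice g y w.
  have E2 y : (g.[m%:P]).[y] = (slice y g).[m] := peval_slice g y m.
  (* Without a root within [ep] of [l], [|g(x0, w)|] is at most [Mx |g(l, w)|], hence at most
     [Mx Kl s]. It also differs from [g(x0, m)], of modulus [a], by at most [Kx s], and [s] is too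
     small for both. *)
  have h2 := hl w m w1 (ltac:(by rewrite m1)); have h3 := hx m w (ltac:(by rewrite m1)) w1.
  rewrite (eqP rm) subr0 wm in h2; rewrite (nc_dist m) wm in h3.
  have h4 := ler_ncB (slice x0 g).[m] (slice x0 g).[w].
  rewrite !E1 -/Mx in h1; rewrite /a E2 in s3 a0 *.
  have h5 : nc (slice l g).[w] * Mx <= Kl * s * Mx by rewrite ler_wpM2r.
  rewrite ler_pdivlMr // in s3; nra.
have yd : nc y < 1.
  by have := ncD (y - l) l; rewrite subrK => h; apply: le_lt_trans h _; lra.
have wd : nc w < 1 by rewrite nw; lra.
have cy : (lead_coef g).[y] != 0.
  rewrite -nc_gt0; have h := hc l y (ltW l1) (ltW yd); rewrite (nc_dist l) in h.
  have h2 := ler_ncB (lead_coef g).[l] (lead_coef g).[y]; rewrite -/cl in h2.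
  rewrite ler_pdivlMr ?mulr_gt0 // in ep3; last by rewrite ltr_wpDl.
  have h3 : Kc * nc (y - l) <= Kc * ep by rewrite ler_wpM2l.
  nra.
exists (y, w); split => /=; [split|lra|by rewrite wm; lra].
  (* At [(y, w)] the polynomial [g] vanishes and its leading coefficient does not, so every multiple
     relation forces [p] to vanish too. *)
  move=> p /pseudo_division [k [q E]].
  have := congr1 (fun f => peval f (y, w)) E; rewrite -mul_polyC !pevalM pevalC.
  rewrite [peval g _](eqP ry) mulr0 horner_exp => /eqP; rewrite mulf_eq0 expf_eq0 (negPf cy) andbF /=.
  by move/eqP.
by split; rewrite /= normC_lt1.
Qed.

End DistinguishedIdeal.

(** * The closure of the ideal, and the operator of multiplication by [z - l] modulo it *)

Section IdealClosure.
Variables (R : realType) (alpha : R) (om : nat -> R) (I : set {poly {poly R[i]}}).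
Notation C := R[i].
Notation nc := (@Normc.normc R).
Notation E := (C * C -> C).
Notation bidisc := (@bidisc R).
Notation A := (bergman_space alpha).
Notation N := (norm_alpha alpha).
Notation M := (ideal_closure alpha I).
Notation P2 := {poly {poly C}}.
Hypotheses (hw : weights om).
Hypothesis hs : forall f a, repr f a -> sqnorm alpha f = ereal_sup (range (fun K => (wsq om K a)%:E)).
Hypotheses (hd : distinguished I) (hc : contracted alpha I).
Let hA := hilbert_space hw hs.
Let As := space_sub hw hs.
Let hI : is_ideal I. Proof. by case: hd. Qed.
Let Ap p := poly_fun_space hw hs p.

Lemma poly_funD (p q : P2) : poly_fun (p + q) = poly_fun p + poly_fun q.
Proof.
apply/funext => x; change (poly_fun (p + q) x = poly_fun p x + poly_fun q x); rewrite /poly_fun.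
have [b|b] := pselect (bidisc x); first by rewrite !patch_in // pevalD.
by rewrite !patch_out // addr0.
Qed.

Lemma poly_funM (p q : P2) : poly_fun (p * q) = peval p \* poly_fun q.
Proof.
apply/funext => x /=; rewrite /poly_fun.
have [b|b] := pselect (bidisc x); first by rewrite !patch_in // pevalM.
by rewrite !patch_out // mulr0.
Qed.

Lemma poly_funZ (c : C) (p : P2) : poly_fun (c%:P%:P * p) = c *: poly_fun p.
Proof.
rewrite poly_funM; apply/funext => x; change (peval c%:P%:P x * poly_fun p x = c * poly_fun p x).
by rewrite pevalC hornerC.
Qed.

Lemma poly_funB (p q : P2) : poly_fun (p - q) = poly_fun p - poly_fun q.
Proof.
rewrite -[in RHS]scaleN1r -poly_funZ -poly_funD; congr (poly_fun (_ + _)).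
by rewrite !rmorphN !rmorph1 mulN1r.
Qed.

Lemma closure_incl : M `<=` A. Proof. by move=> x []. Qed.

Lemma ideal_closure_ideal p : I p -> M (poly_fun p).
Proof.
move=> Ip; split => // e e0; exists (poly_fun p); first by exists p.
by rewrite subrr (nrm0 hA).
Qed.

Lemma closure_closed y : A y -> (forall e : R, 0 < e -> exists2 m, M m & N (y - m) < e) -> M y.
Proof.
move=> Ay h; split => // e e0; have e2 : 0 < e / 2 by rewrite divr_gt0.
have [m [Am hm] ym] := h _ e2; have [_ [p Ip <-] mp] := hm _ e2.
exists (poly_fun p); first by exists p.
by apply: le_lt_trans (nrm_sub hA Ay Am (Ap p)) _; rewrite [e]splitr ltrD.
Qed.

Lemma closure_sub : subspace M.
Proof.
split.
  suff -> : 0 = poly_fun 0 :> E by apply: ideal_closure_ideal; exact: ideal0.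
  by rewrite -[0 in RHS](subrr 0) poly_funB subrr.
move=> c x y [Ax hx] [Ay hy]; split; first exact: (proj2 As c x y Ax Ay).
move=> e e0; have n0 : 0 < 2 * (nc c + 1) by rewrite mulr_gt0 // ltr_wpDl ?nc_ge0.
have e1 : 0 < e / (2 * (nc c + 1)) by rewrite divr_gt0.
have e2 : 0 < e / 2 by rewrite divr_gt0.
have [_ [p Ip <-] xp] := hx _ e1; have [_ [q Iq <-] yq] := hy _ e2.
exists (poly_fun (c%:P%:P * p + q)).
  by exists (c%:P%:P * p + q) => //; apply: idealD => //; exact: idealM.
rewrite poly_funD poly_funZ opprD addrACA -scalerBr.
have Axp := subspaceB As Ax (Ap p); have Ayq := subspaceB As Ay (Ap q).
apply: le_lt_trans (nrmD hA (subspaceZ c As Axp) Ayq) _; rewrite (nrmZ hA _ Axp).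
rewrite ltr_pdivlMr // in xp; have := norm_ge0 alpha (x - poly_fun p); have := nc_ge0 c; nra.
Qed.

(* [w - m] is cyclic for [|m| = 1]: the Cesaro mean [c_n] of the powers of [w / m] tends to [0] in norm and [w - m] divides [1 - c_n]. *)
Lemma cyclic_divide (g : P2) m : nc m = 1 -> I (g * ('X - m%:P%:P)) -> I g.
Proof.
(* Contractedness reduces membership in [I] to approximability by elements of [I]. *)
move=> m1 Ig; rewrite -hc; split => // e e0.
have [B B0 hB] := poly_mul_space hw hs g.
have e1 : 0 < (e / (B + 1)) ^+ 2 by rewrite exprn_gt0 // divr_gt0 // ltr_wpDl.
have [n _ /(_ n (leqnn n)) hn] := near_infty_natSinv_lt (PosNum e1).
have m0 : m != 0 by rewrite -nc_eq0 m1 oner_eq0.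
have /factor_theorem [s hs'] : root (1 - cesaro m n) (m%:P).
  rewrite /root hornerD hornerN hornerE /cesaro horner_sum.
  under eq_bigr => k _.
    rewrite hornerZ hornerXn -polyC_exp -polyCM mulfVK ?expf_neq0 //; over.
  have n1 : n.+1%:R^-1 *+ n.+1 = 1 :> C by rewrite -[LHS]mulr_natr mulVf // pnatr_eq0.
  by rewrite sumr_const card_ord -polyCMn n1 subrr.
exists (poly_fun (s * (g * ('X - m%:P%:P)))).
  by exists (s * (g * ('X - m%:P%:P))) => //; exact: idealM.
have -> : s * (g * ('X - m%:P%:P)) = g - g * cesaro m n.
  by rewrite mulrCA -hs' mulrBr mulr1.
rewrite poly_funB subKr poly_funM; have [_ h] := hB _ (Ap (cesaro m n)).
apply: le_lt_trans h _.
have hN : N (poly_fun (cesaro m n)) < e / (B + 1).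
  rewrite -(@ltr_pXn2r _ 2) ?nnegrE ?norm_ge0 //; last by rewrite divr_ge0 ?(ltW e0) // addr_ge0.
  exact: le_lt_trans (cesaro_norm hw hs n m1) hn.
rewrite ltr_pdivlMr ?ltr_wpDl // in hN; have := norm_ge0 alpha (poly_fun (cesaro m n)); nra.
Qed.

Lemma no_unimodular_root g l m : I g -> g != 0 -> (forall p, I p -> (size p < size g)%N -> p = 0) ->
  nc l < 1 -> (lead_coef g).[l] != 0 -> nc m = 1 -> ~ root (slice l g) m.
Proof.
move=> Ig g0 gmin l1 gl m1 rm.
have /factor_theorem [g' E] : root g m%:P by rewrite /root (root_inside hI hd Ig g0 gmin l1 gl m1 rm).
have g'0 : g' != 0 by apply: contraNneq g0 => g'0; rewrite E g'0 mul0r.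
have Ig' : I g' by apply: (cyclic_divide m1); rewrite -E.
move/eqP: (g'0); apply; apply: gmin => //.
by rewrite E size_Mmonic ?monicXsubC // size_XsubC addn2.
Qed.

(** Factor [s] into linear terms: roots inside the disc are handled by [point_estimate] with
    remainder 0, roots outside by [outer_estimate]. *)
Lemma factor_bound (s : {poly C}) : s != 0 -> (forall m, nc m = 1 -> ~ root s m) ->
  exists2 K : R, 0 <= K & forall u, A u -> N u <= K * N (peval (lift s) \* u).
Proof.
move=> s0 hroot; have [r E] := closed_field_poly_normal s.
have rn z : z \in r -> nc z <> 1.
  by move=> zr z1; apply: (hroot z z1); rewrite E rootZ ?lead_coef_eq0 // root_prod_XsubC.
have [K K0 hK] : exists2 K : R, 0 <= K & forall u, A u ->
    N u <= K * N (peval (lift (\prod_(z <- r) ('X - z%:P))) \* u).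
  elim: r {E} rn => [|z r IH] rn.
    exists 1 => // u Au; rewrite big_nil mul1r le_eqVlt; apply/orP; left; apply/eqP; congr (N _).
    by apply/funext => x /=; rewrite peval_lift hornerC mul1r.
  have [|K K0 hK] := IH; first by move=> y yr; apply: rn; rewrite in_cons yr orbT.
  have [K' K'0 hK'] : exists2 K' : R, 0 <= K' & forall u, A u -> N u <= K' * N (fun x => (x.2 - z) * u x).
    have [z1|z1|z1] := ltgtP (nc z) 1; last by case: (rn z (mem_head _ _)).
      have [K' K'0 h] := point_estimate hw hs true z1; exists K' => // u Au.
      have [A0 _] := As; have [h1 _] := h u 0 Au A0 (fun _ _ _ _ _ => erefl).
      apply: le_trans h1 _; rewrite le_eqVlt; apply/orP; left; apply/eqP; congr (_ * N _).
      by apply/funext => x; change ((x.2 - z) * u x + 0 = (x.2 - z) * u x); rewrite addr0.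
    exists (nc z - 1)^-1 => [|u Au]; first by rewrite invr_ge0 subr_ge0 ltW.
    by rewrite mulrC ler_pdivlMr ?subr_gt0 // mulrC; exact: (outer_estimate hw hs).
  exists (K' * K) => [|u Au]; first by rewrite mulr_ge0.
  have [B _ hB] := poly_mul_space hw hs (lift (\prod_(z <- r) ('X - z%:P))); have [Ar _] := hB _ Au.
  have [B' _ hB'] := poly_mul_space hw hs (lift ('X - z%:P)); have [Az _] := hB' _ Au.
  apply: le_trans (hK' u Au) _; rewrite -mulrA ler_wpM2l //.
  have -> : (fun x => (x.2 - z) * u x) = peval (lift ('X - z%:P)) \* u.
    by apply/funext => x /=; rewrite peval_lift hornerXsubC.
  apply: le_trans (hK _ Az) _; rewrite le_eqVlt; apply/orP; left; apply/eqP; congr (_ * N _).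
  by apply/funext => x /=; rewrite !peval_lift big_cons hornerM mulrA [_.[_] * _]mulrC.
have lc0 : lead_coef s != 0 by rewrite lead_coef_eq0.
have c0 : 0 < nc (lead_coef s) by rewrite nc_gt0.
exists (K / nc (lead_coef s)) => [|u Au]; first by rewrite divr_ge0 // ltW.
have [B _ hB] := poly_mul_space hw hs (lift (\prod_(z <- r) ('X - z%:P))); have [Ar _] := hB _ Au.
have -> : peval (lift s) \* u = lead_coef s *: (peval (lift (\prod_(z <- r) ('X - z%:P))) \* u).
  apply/funext => x; rewrite {1}E.
  change (peval (lift (lead_coef s *: \prod_(z <- r) ('X - z%:P))) x * u x =
    lead_coef s * (peval (lift (\prod_(z <- r) ('X - z%:P))) x * u x)).
  by rewrite !peval_lift hornerZ mulrA.
rewrite (nrmZ hA _ Ar) mulrA mulfVK ?gt_eqF //; exact: hK.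
Qed.

Lemma zmulE l (f : E) : peval (polyz R) \* f - l *: f = (fun x => (x.1 - l) * f x).
Proof.
apply/funext => x; change (peval (polyz R) x * f x - l * f x = (x.1 - l) * f x).
by rewrite /polyz pevalC hornerX mulrBl.
Qed.

Lemma space_out f x : A f -> ~ bidisc x -> f x = 0.
Proof. by move=> [_ h _]; exact: h. Qed.

Section Point.
Variables (g : P2) (l w0 : C).
Hypotheses (Ig : I g) (g0 : g != 0) (gmin : forall p, I p -> (size p < size g)%N -> p = 0).
Hypotheses (l1 : nc l < 1) (gl : (lead_coef g).[l] != 0).

Lemma shift_injective (f : E) : A f -> M (fun x => (x.1 - l) * f x) -> M f.
Proof.
move=> Af [Azf hzf]; split => // e e0.
have sg0 := slice_neq0 gl.
have [K K0 hK] := point_estimate hw hs false l1.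
have [K2 K20 hK2] := factor_bound sg0 (fun m => @no_unimodular_root g l m Ig g0 gmin l1 gl).
have [B B0 hB] := poly_mul_space hw hs g.
(* [K (1 + B K2 K)] is the loss in passing from an approximation of [(z - l) f] to one of [f]; the
   summand 1 keeps [D] positive and the last inequality strict. *)
pose D := K * (1 + B * (K2 * K)) + 1.
have D0 : 0 < D by rewrite ltr_wpDl // mulr_ge0 // addr_ge0 // !mulr_ge0.
have e1 : 0 < e / D by rewrite divr_gt0.
have [_ [p Ip <-] hp] := hzf _ e1; set dl := e / D in e1 hp.
have [r' pE] := slice_decomp l p; set s := slice l p in pE.
have [h sE] := slice_multiple hI Ig g0 gmin gl Ip.
(* [(z - l) f - p] equals [(z - l) (f - r')] minus the function [s] of [w] alone, so
   [point_estimate] bounds [s] by the distance from [(z - l) f] to [p]. *)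
have Nv : N (poly_fun (lift s)) <= K * dl.
  have Au := subspaceB As Af (Ap r'); have Av := subspaceN As (Ap (lift s)).
  have [|_] := hK _ _ Au Av.
    move=> x y bx bz xy; change (- poly_fun (lift s) x = - poly_fun (lift s) y).
    by rewrite /poly_fun !patch_in // !peval_lift xy.
  rewrite (nrmN hA (Ap _)) => /le_trans; apply; rewrite ler_wpM2l //.
  apply: le_trans (ltW hp); rewrite le_eqVlt; apply/orP; left; apply/eqP; congr (N _).
  apply/funext => x.
  change ((x.1 - l) * (f x - poly_fun r' x) + - poly_fun (lift s) x = (x.1 - l) * f x - poly_fun p x).
  rewrite /poly_fun; have [b|b] := pselect (bidisc x).
    rewrite !patch_in // pE pevalD pevalM pevalC hornerXsubC; ring.
  by rewrite !patch_out // (space_out Af b); ring.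
(* Multiplication by the slice of [g] is bounded below, so the quotient [h] is as small as [s];
   subtracting [lift h * g] from [p] removes the slice at a small cost. *)
have Nh : N (poly_fun (lift h)) <= K2 * (K * dl).
  apply: le_trans (hK2 _ (Ap _)) _; rewrite ler_wpM2l //.
  by rewrite -poly_funM -liftM -sE.
have [r rE] : exists r : P2, p - lift h * g = ('X - l%:P)%:P * r.
  by apply: slice0_factor; rewrite sliceB sliceM slice_lift sE mulrC subrr.
have Ir : I r.
  apply: (ideal_divide hI Ig g0 gmin gl); rewrite -rE; apply: idealB => //; exact: idealM.
exists (poly_fun r); first by exists r.
have Ar := subspaceB As Af (Ap r); have [A0 _] := As.
have [h1 _] := hK _ _ Ar A0 (fun _ _ _ _ _ => erefl).
have [Agh Ngh] := hB _ (Ap (lift h)).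
apply: le_lt_trans h1 _.
have -> : (fun x => ((if false then x.2 else x.1) - l) * (f - poly_fun r) x + 0 x) =
    ((fun x => (x.1 - l) * f x) - poly_fun p) + peval g \* poly_fun (lift h).
  apply/funext => x.
  change ((x.1 - l) * (f x - poly_fun r x) + 0 = ((x.1 - l) * f x - poly_fun p x) + peval g x * poly_fun (lift h) x).
  rewrite /poly_fun addr0; have [b|b] := pselect (bidisc x).
    rewrite !patch_in //; have := congr1 (fun q => peval q x) rE.
    rewrite pevalB !pevalM pevalC hornerXsubC mulrBr => <-; ring.
  by rewrite !patch_out // (space_out Af b); ring.
have Ad := subspaceB As Azf (Ap p).
have h2 := nrmD hA Ad Agh.
have h3 : N (((fun x => (x.1 - l) * f x) - poly_fun p) + peval g \* poly_fun (lift h)) <= (1 + B * (K2 * K)) * dl.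
  apply: le_trans h2 _; rewrite mulrDl mul1r lerD ?(ltW hp) //.
  apply: le_trans Ngh _; rewrite -!mulrA ler_wpM2l //.
apply: le_lt_trans (ler_wpM2l K0 h3) _.
have -> : e = D * dl by rewrite /dl mulrC mulfVK // gt_eqF.
by rewrite [ltLHS]mulrA ltr_pM2r // /D ltrDl.
Qed.

(** Evaluation at [(l, w0)] is carried out in two bounded stages: restriction to the line [z = l]
    makes [1 - p(l, .)] small, and its value at [w0], which is 1 because [p] vanishes there, would
    then be small as well. *)
Lemma shift_not_surjective : nc w0 < 1 -> (forall p, I p -> peval p (l, w0) = 0) ->
  forall f, A f -> ~ M (poly_fun 1 - (fun x => (x.1 - l) * f x)).
Proof.
move=> w1 hz f Af [Ad hM].
have [K K0 hK] := point_estimate hw hs false l1.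
have [K' K'0 hK'] := point_estimate hw hs true w1.
(* With the tolerance [1 / (K' K + 1)] the two stages would give the constant 1 a norm below 1. *)
have D0 : 0 < K' * K + 1 by rewrite ltr_wpDl // mulr_ge0.
have e1 : 0 < (K' * K + 1)^-1 by rewrite invr_gt0.
have [_ [p Ip <-] hp] := hM _ e1.
have [r pE] := slice_decomp l p; set s := slice l p in pE.
have /factor_theorem [q qE] : root s w0 by rewrite /root -peval_slice hz.
have Au := subspaceN As (subspaceD As Af (Ap r)).
have Nv : N (poly_fun (1 - lift s)) <= K * (K' * K + 1)^-1.
  have [|_] := hK _ _ Au (Ap (1 - lift s)).
    by move=> x y bx bz xy; rewrite /poly_fun !patch_in // !pevalB !peval1 !peval_lift xy.
  move=> /le_trans; apply; rewrite ler_wpM2l //.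
  apply: le_trans (ltW hp); rewrite le_eqVlt; apply/orP; left; apply/eqP; congr (N _).
  apply/funext => x.
  change ((x.1 - l) * (- (f x + poly_fun r x)) + poly_fun (1 - lift s) x =
    poly_fun 1 x - (x.1 - l) * f x - poly_fun p x).
  rewrite /poly_fun; have [b|b] := pselect (bidisc x).
    rewrite !patch_in // pevalB peval1 pE pevalD pevalM pevalC hornerXsubC; ring.
  by rewrite !patch_out // (space_out Af b); ring.
have Aq := subspaceN As (Ap (lift q)).
have [|_] := hK' _ _ Aq (Ap 1).
  by move=> x y bx bz xy; rewrite /poly_fun !patch_in // !peval1.
rewrite (norm_poly1 hw hs) leNgt => /negP; apply.
have -> : (fun x => ((if true then x.2 else x.1) - w0) * (- poly_fun (lift q)) x + poly_fun 1 x) =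
    poly_fun (1 - lift s).
  apply/funext => x; change ((x.2 - w0) * (- poly_fun (lift q) x) + poly_fun 1 x = poly_fun (1 - lift s) x).
  rewrite /poly_fun; have [b|b] := pselect (bidisc x).
    by rewrite !patch_in // pevalB !peval_lift qE hornerM hornerXsubC; ring.
  by rewrite !patch_out // oppr0 mulr0 addr0.
apply: le_lt_trans (ler_wpM2l K'0 Nv) _.
by rewrite mulrA ltr_pdivrMr // mul1r ltrDl.
Qed.

End Point.

End IdealClosure.

(** * The boundary of the bidisc, and continuous functions extended by 0 *)

Section Continuity.
Variable R : realType.
Notation C := R[i].
Notation nc := (@Normc.normc R).
Notation bidisc := (@bidisc R).

Lemma bidisc_interior : bidisc `<=` interior bidisc.
Proof.
move=> x [x1 x2]; rewrite !normC_lt1 in x1 x2; apply/nbhsC2.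
exists (Num.min (1 - nc x.1) (1 - nc x.2)); first by rewrite lt_min !subr_gt0 x1.
move=> y; rewrite !lt_min => /andP[h1 _] /andP[_ h2].
have e1 := ncD (y.1 - x.1) x.1; have e2 := ncD (y.2 - x.2) x.2; rewrite !subrK in e1 e2.
by split; rewrite normC_lt1; [apply: le_lt_trans e1 _|apply: le_lt_trans e2 _]; rewrite -ltrBrDr.
Qed.

Lemma closure_bidisc x : closure bidisc x -> nc x.1 <= 1 /\ nc x.2 <= 1.
Proof.
move=> cx; suff h (p : C * C -> C) : (forall y, bidisc y -> nc (p y) < 1) ->
    (forall y z, nc (p y - p z) <= Num.max (nc (y.1 - z.1)) (nc (y.2 - z.2))) -> nc (p x) <= 1.
  split; apply: h => [y [y1 y2]|y z]; rewrite -?normC_lt1 // le_max lexx ?orbT //.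
move=> pb pl; apply/ler_addgt0Pr => e e0.
have [y [by' [h1 h2]]] : bidisc `&` [set y | nc (y.1 - x.1) < e /\ nc (y.2 - x.2) < e] !=set0.
  by apply: cx; apply/nbhsC2; exists e.
have h3 := nc_sub (p x) (p y) 0; rewrite !subr0 in h3; apply: le_trans h3 _; rewrite addrC lerD ?(ltW (pb _ _)) //.
by rewrite nc_dist; apply: le_trans (pl _ _) _; rewrite ge_max !ltW.
Qed.

Lemma bidisc_boundaryP x : bidisc_boundary x -> nc x.1 < 1 -> nc x.2 = 1.
Proof.
move=> [/closure_bidisc [_ h2] hi] h1; apply/eqP; rewrite eq_le h2 leNgt; apply/negP => h.
by apply: hi; apply: bidisc_interior; split; rewrite normC_lt1.
Qed.

Lemma cont_fun_patch (X : set (C * C)) (h : C * C -> C) : (forall x, X x -> {for x, continuous h}) ->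
  cont_fun X (patch (fun=> 0) X h).
Proof.
move=> hc; split; last by move=> x nX; rewrite patch_out.
apply: (@subspace_eq_continuous _ _ _ h).
  by move=> x /set_mem Xx; exact: (esym (patch_in _ _ Xx)).
apply: continuous_in_subspaceT => x /set_mem; exact: hc.
Qed.

End Continuity.

(** * Consequences of the definition of a *-homomorphism *)

Section StarHom.
Variables (R : realType) (U W : lmodType R[i]) (A : set U) (B : set W).
Variables (mulA : U -> U -> U) (starA : U -> U) (mulB : W -> W -> W) (starB : W -> W) (f : U -> W).
Hypotheses (As : subspace A) (hf : star_hom A mulA starA B mulB starB f).

Lemma star_hom_in a : A a -> B (f a). Proof. by case: hf => h _ _ _; exact: h. Qed.
Lemma star_homM a b : A a -> A b -> f (mulA a b) = mulB (f a) (f b).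
Proof. by case: hf => _ _ h _; exact: h. Qed.
Lemma star_homD a b : A a -> A b -> f (a + b) = f a + f b.
Proof. by case: hf => _ h _ _ Aa Ab; rewrite -{1}[a]scale1r h // scale1r. Qed.
Lemma star_homB a b : A a -> A b -> f (a - b) = f a - f b.
Proof. by case: hf => _ h _ _ Aa Ab; rewrite addrC -scaleN1r h // scaleN1r addrC. Qed.
Lemma star_homZ c a : A a -> f (c *: a) = c *: f a.
Proof.
case: hf => _ h _ _ Aa; have [A0 _] := As.
have f0 : f 0 = 0 by rewrite -(subrr 0) star_homB // subrr.
by have := h c a 0 Aa A0; rewrite f0 !addr0.
Qed.

End StarHom.

(** * The contradiction between a splitting and the properties of [z - l] *)

Section Main.
Variables (R : realType) (I : set {poly {poly R[i]}}) (alpha : R) (om : nat -> R).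
Notation C := R[i].
Notation nc := (@Normc.normc R).
Notation E := (C * C -> C).
Notation N := (norm_alpha alpha).
Notation M := (ideal_closure alpha I).
Notation Q := (quotient_module alpha I).
Notation X := (boundary_spectrum I).
Notation T := (compression alpha I (polyz R)).
Notation Qc := (qcstar alpha I).
Hypotheses (hw : weights om).
Hypothesis hs : forall f a, repr f a -> sqnorm alpha f = ereal_sup (range (fun K => (wsq om K a)%:E)).
Hypotheses (hd : distinguished I) (hc : contracted alpha I).
Let hA := hilbert_space hw hs.
Let def f := @space_definite _ _ _ hw hs f.
Let hM := closure_sub hw hs hd.
Let MA := @closure_incl R alpha I.
Let cM := closure_closed (I := I) hw hs.
Let hQ : hilbert N Q := hilbert_ortho hA MA.
Let Qs : subspace Q := ortho_sub hA MA.

Lemma quotient_definite x : Q x -> N x = 0 -> x = 0.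
Proof. by move=> [Ax _]; exact: def. Qed.

Lemma compression_bounded p : bounded_op N Q (compression alpha I p).
Proof.
have [B _ hB] := poly_mul_space hw hs p.
apply: (bounded_compression hA def hM MA cM (B := B)).
- by move=> x Ax; case: (hB x Ax).
- by move=> x Ax; case: (hB x Ax).
- move=> c x y; apply/funext => z; change (peval p z * (c * x z + y z) = c * (peval p z * x z) + peval p z * y z).
  by rewrite mulrDr mulrCA.
Qed.

Lemma qcstar_bounded S : Qc S -> bounded_op N Q S.
Proof.
apply: smallest_sub; first exact: (bounded_op_cstar hQ).
move=> S' [[]|] ->; [exact: compression_bounded|exact: compression_bounded|exact: (bounded_idop hQ)].
Qed.

Lemma qcstar_sub : subspace Qc.
Proof.
split; first by move=> B [[_ [h _] _ _ _] _].
by move=> c S S' hS hS' B hB; have [[_ [_ h] _ _ _] _] := hB; apply: h; [exact: hS|exact: hS'].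
Qed.

Lemma qcstar_gen S : [set T; compression alpha I (polyw R); idop Q] S -> Qc S.
Proof. by move=> hS B [_ h]; exact: h. Qed.

Lemma no_splitting (quo : (E -> E) -> E) : exact_sequence alpha I quo -> ~ splitting alpha I quo.
Proof.
move=> [hquo kerq imq qz _] [sigma [hsig sec]].
have [g [Ig g0 gmin]] := generator hd.
have [[l w0] [Vx bx] gl] := good_point hd g0.
have [l1 w1] := bx; rewrite /= !normC_lt1 in l1 w1; rewrite /= in gl.
(* A boundary point over [l] has [|x.2| = 1] because [|l| < 1], and would give a unimodular root of
   the slice of [g]. *)
have Xl x : X x -> x.1 - l != 0.
  move=> [zx bdx]; apply/eqP => /eqP; rewrite subr_eq0 => /eqP xl.
  have n1 : nc x.2 = 1 by apply: (bidisc_boundaryP bdx); rewrite xl.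
  apply: (no_unimodular_root hw hs hd hc Ig g0 gmin l1 gl n1).
  by rewrite /root -peval_slice -xl -surjective_pairing; apply/eqP; exact: zx.
pose e : E := patch (fun=> 0) X (fun=> 1).
pose u : E := patch (fun=> 0) X (fun x => x.1 - l).
pose v : E := patch (fun=> 0) X (fun x => (x.1 - l)^-1).
have cl x : {for x, continuous (fun x : C * C => x.1 - l)}.
  by apply: cvgB; [exact: cvg_fst|exact: cvg_cst].
have ce : cont_fun X e by apply: cont_fun_patch => x _; exact: cvg_cst.
have cu : cont_fun X u by apply: cont_fun_patch => x _; exact: cl.
have cv : cont_fun X v by apply: cont_fun_patch => x Xx; apply: cvgV; [exact: Xl|exact: cl].
have mulE (a b c : C * C -> C) : (forall x, X x -> a x * b x = c x) ->
    fun_mul (patch (fun=> 0) X a) (patch (fun=> 0) X b) = patch (fun=> 0) X c.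
  move=> h; apply/funext => x; rewrite /fun_mul /=; have [Xx|Xx] := pselect (X x).
    by rewrite !patch_in // h.
  by rewrite !patch_out // mul0r.
have ee : fun_mul e e = e by apply: mulE => x _; rewrite mul1r.
have ue : fun_mul u e = u by apply: mulE => x _; rewrite mulr1.
have eu : fun_mul e u = u by apply: mulE => x _; rewrite mul1r.
have ve : fun_mul v e = v by apply: mulE => x _; rewrite mulr1.
have ev : fun_mul e v = v by apply: mulE => x _; rewrite mul1r.
have uv : fun_mul u v = e by apply: mulE => x Xx; rewrite mulfV // Xl.
have vu : fun_mul v u = e by apply: mulE => x Xx; rewrite mulVf // Xl.
have qT : Qc T by apply: qcstar_gen; left; left.
have qid : Qc (idop Q) by apply: qcstar_gen; right.
have qs := qcstar_sub.
have idE x (Qx : Q x) : idop Q x = x := patch_in (fun=> 0) id Qx.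
have sg a : cont_fun X a -> Qc (sigma a) by exact: (star_hom_in hsig).
(* [sigma e] is an idempotent, possibly not the identity. Its complement [D] makes [sigma u + D] and
   [sigma v + D] inverse to each other, and it is invisible modulo the compact operators because
   [quo] sends it to 0. *)
pose D := idop Q - sigma e.
have qD : Qc D by exact: (subspaceB qs qid (sg _ ce)).
pose B := sigma u + D; pose W := sigma v + D.
have qB : Qc B by exact: (subspaceD qs (sg _ cu) qD).
have qW : Qc W by exact: (subspaceD qs (sg _ cv) qD).
pose S := T - l *: idop Q.
have qS : Qc S by exact: (subspaceB qs qT (subspaceZ l qs qid)).
pose K := S - B.
have qK : Qc K by exact: (subspaceB qs qS qB).
(* [star_hom] does not include preservation of units, so surjectivity is used: the image of the
   identity is a unit for [e], the image of some [Te], hence equals 1 on the spectrum. *)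
have qide : quo (idop Q) = e.
  have [Te qTe quoTe] : exists2 Te, Qc Te & quo Te = e by move: ce; rewrite -imq => -[Te]; exists Te.
  have idT : op_comp (idop Q) Te = Te.
    apply/funext => x; rewrite /op_comp /=; have [hQe _ _ out] := qcstar_bounded qTe.
    have [Qx|Qx] := pselect (Q x); first exact: (idE _ (hQe _ Qx)).
    by rewrite (out _ Qx); exact: (idE _ (proj1 Qs)).
  have := star_homM hquo qid qTe; rewrite idT quoTe => eE.
  have [_ out] := star_hom_in hquo qid.
  apply/funext => x; have [Xx|Xx] := pselect (X x).
    by have := congr1 (fun f : E => f x) eE; rewrite /fun_mul /= {2}/e (patch_in _ _ Xx) mulr1 => ->.
  by rewrite (out _ Xx) /e (patch_out _ _ Xx).
have quoK : quo K = 0.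
  have quoD : quo D = 0 by rewrite (star_homB hquo qid (sg _ ce)) sec // qide subrr.
  have quoB : quo B = u by rewrite (star_homD hquo (sg _ cu) qD) sec // quoD addr0.
  have quoS : quo S = u.
    rewrite (star_homB hquo qT (subspaceZ l qs qid)).
    rewrite (star_homZ qs hquo) // qide qz; apply/funext => x.
    change (patch (fun=> 0) X fst x - l * e x = u x); rewrite /e /u.
    have [Xx|Xx] := pselect (X x); first by rewrite !patch_in // mulr1.
    by rewrite !patch_out // mulr0 subr0.
  by rewrite (star_homB hquo qS qB) quoS quoB subrr.
have compK : compact_op N Q K.
  by rewrite -[compact_op N Q]/(qcompact alpha I) -kerq.
have bs a : cont_fun X a -> bounded_op N Q (sigma a) by move=> ca; apply: qcstar_bounded; exact: sg.
have bB := qcstar_bounded qB; have bW := qcstar_bounded qW; have bS := qcstar_bounded qS.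
(* One computation for both orders: the cross terms cancel because [sigma a] and [sigma b] absorb
   [sigma e], and what remains is [sigma e x + (x - sigma e x)]. *)
have inv a b x : cont_fun X a -> cont_fun X b -> fun_mul a e = a -> fun_mul e b = b -> fun_mul a b = e -> Q x ->
    (sigma a + D) ((sigma b + D) x) = x.
  move=> ca cb ae eb ab Qx.
  have [Qe _ _ _] := bs _ ce; have [Qb _ _ _] := bs _ cb; have [Qa _ _ _] := bs _ ca.
  have compE p q r y : cont_fun X p -> cont_fun X q -> fun_mul p q = r -> sigma p (sigma q y) = sigma r y.
    by move=> cp cq <-; rewrite (star_homM hsig).
  have DE y : Q y -> D y = y - sigma e y by move=> Qy; rewrite -{2}(idE _ Qy).
  have Qex := Qe _ Qx; have Qbx := Qb _ Qx.
  have Qd : Q (x - sigma e x) by exact: subspaceB.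
  change (sigma a (sigma b x + D x) + D (sigma b x + D x) = x).
  rewrite DE // (DE (sigma b x + _)); last exact: subspaceD.
  rewrite (bopD (bs _ ca)) // (bopB hQ (bs _ ca)) // (bopD (bs _ ce)) // (bopB hQ (bs _ ce)) //.
  rewrite (compE _ _ _ _ ca cb ab) (compE _ _ _ _ ca ce ae) (compE _ _ _ _ ce cb eb) (compE _ _ _ _ ce ce ee).
  by rewrite !subrr !addr0 [sigma b x + _]addrC addrK addrC subrK.
have WB x : Q x -> W (B x) = x by exact: inv.
have BW x : Q x -> B (W x) = x by exact: inv.
have SE x : Q x -> S x = B x + K x.
  by move=> Qx; change (S x = B x + (S x - B x)); rewrite addrC subrK.
have Tspec x : Q x -> M ((fun y => (y.1 - l) * x y) - S x).
  move=> Qx; have [Ax _] := Qx.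
  have -> : S x = T x - l *: x by change (T x - l *: idop Q x = T x - l *: x); rewrite idE.
  have [b _ hb] := poly_mul_space hw hs (polyz R); have [Azx _] := hb _ Ax.
  have [_ h] := orthoproj_spec hA def hM MA cM Azx.
  rewrite -zmulE opprB addrA subrK; suff -> : T x = orthoproj N Q (peval (polyz R) \* x) by [].
  by rewrite /compression patch_in.
have inj x : Q x -> S x = 0 -> x = 0.
  move=> Qx Sx; have [Ax _] := Qx; have := Tspec x Qx; rewrite Sx subr0 => Mx.
  apply: (ortho_disjoint hA def _ Qx).
  exact: (shift_injective hw hs hd hc Ig g0 gmin l1 gl Ax Mx).
(* The target is the component of the constant 1 in the quotient module: a preimage [f] under [S]
   puts [1 - (z - l) f] into the closure of [I]. *)
have [m Mm Q1] := ortho_decomp hA hM MA cM (poly_fun_space hw hs 1).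
have [f Qf Sf] := fredholm_alternative hQ quotient_definite bS bB bW compK SE WB BW inj Q1.
have [Af _] := Qf.
apply: (shift_not_surjective hw hs l1 w1 (fun p Ip => Vx p Ip) Af).
have -> : poly_fun 1 - (fun x => (x.1 - l) * f x) = m - ((fun x => (x.1 - l) * f x) - S f).
  by rewrite Sf opprB addrA [m + _]addrC subrK.
exact: (subspaceB hM Mm (Tspec f Qf)).
Qed.

End Main.

Theorem theorem5p2 (R : realType) (I : set {poly {poly R[i]}}) (alpha : R) :
  distinguished I ->
  -1 <= alpha ->
  contracted alpha I ->
  essentially_normal alpha I ->
  forall quo : ((R[i] * R[i] -> R[i]) -> (R[i] * R[i] -> R[i])) ->
               (R[i] * R[i] -> R[i]),
    exact_sequence alpha I quo ->
    ~ splitting alpha I quo.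
Proof.
move=> hd ha hc _ quo; have [om hw hs] := sqnorm_repr ha.
exact: (no_splitting hw hs hd hc).
Qed.
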